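(* Let $\mathcal{M}$ be a graded manifold and let $X,Y$ be vector fields on $\mathcal{M}$ with $[X,X]=0$ and $[Y,Y]=0$. Let $\theta^X:\mathcal{D}_1\to\mathcal{M}$ and $\theta^Y:\mathcal{D}_2\to\mathcal{M}$ be the corresponding flows. Then the flows $\theta^X$ and $\theta^Y$ commute on the maximal commuting domain $\mathsf{D}$ of $X$ and $Y$ if and only if $[X,Y]=0$.
   Context: Graded manifolds: ''graded'' means $\mathbb{Z}$-graded and all elements are homogeneous. For a sequence $(n_j)_{j\in\mathbb{Z}}$ of non-negative integers with finite sum and $V\subseteq\mathbb{R}^{n_0}$ open, the graded domain $V^{(n_j)}$ is $V$ with the sheaf $\mathcal{C}^\infty_{(n_j)}$ assigning to an open $W\subseteq V$ the graded commutative algebra whose degree $k$ elements are formal power series in variables $\xi^\mu$ of non-zero degrees ($n_j$ of them of degree $j$ for each $j\neq0$; $\xi^\mu\xi^\nu=(-1)^{|\xi^\mu||\xi^\nu|}\xi^\nu\xi^\mu$), of total degree $k$, with coefficients in $C^\infty(W)$. A graded manifold $\mathcal{M}=(M,\mathcal{C}^\infty_{\mathcal{M}})$ is a Hausdorff second countable space $M$ with a sheaf of graded commutative associative unital algebras locally isomorphic (as locally ringed spaces) to graded domains; $M$ is then a smooth manifold. A graded smooth map $\phi=(\underline{\phi},\phi^* ):\mathcal{M}\to\mathcal{N}$ consists of a smooth map $\underline{\phi}:M\to N$ and a morphism of sheaves of graded algebras $\phi^*:\mathcal{C}^\infty_{\mathcal{N}}\to\underline{\phi}_*\mathcal{C}^\infty_{\mathcal{M}}$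 inducing local morphisms on stalks. $\mathcal{M}|_U$ is the restriction to an open $U\subseteq M$. Products are categorical products. A vector field of degree $|X|$ is a degree $|X|$ graded derivation of $\mathcal{C}^\infty_{\mathcal{M}}(M)$; $[X,Y]=X\circ Y-(-1)^{|X||Y|}Y\circ X$. $X\sim_\phi Y$ means $X\circ\phi^*=\phi^*\circ Y$. Flows: a flow domain on the manifold $M$ is an open $D\subseteq M\times\mathbb{R}$ such that each $\{t\mid(m,t)\in D\}$, $m\in M$, is an open interval containing $0$. $\mathbb{R}[-k]$ is the graded manifold with a single global coordinate $\mathbb{t}$ of degree $-k$ (it is $\mathbb{R}$ for $k=0$; its underlying manifold is a point $\{\ast\}$ for $k\ne0$), with addition $+$ given by $+^*(\mathbb{t})=\mathbb{t}_1+\mathbb{t}_2$ and zero $0:\{\ast\}\to\mathbb{R}[-k]$, $0^*(\mathbb{t})=0$. A flow domain of degree $k$ on $\mathcal{M}$ is $\mathcal{D}=(\mathcal{M}\times\mathbb{R})|_D$ with $D$ a flow domain on $M$ if $k=0$, and $\mathcal{D}=\mathcal{M}\times\mathbb{R}[-k]$ if $k\neq0$; $D$ is its underlying manifold. A flow of degree $k$ on $\mathcal{M}$ is a graded smooth map $\theta:\mathcal{D}\to\mathcal{M}$, $\mathcal{D}$ a flow domain of degree $k$, such that $\theta\circ(1_{\mathcal{M}},0_{\mathcal{M}})=1_{\mathcal{M}}$ (with $0_{\mathcal{M}}$ the composite $\mathcal{M}\to\{\ast\}\xrightarrow{0}\mathbb{R}[-k]$) and $\theta\circ(\theta\times1_{\mathbb{R}[-k]})=\theta\circ(1_{\mathcal{M}}\times+)\circ\mathsf{a}$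 on $\mathcal{D}^\bullet$, where $\mathsf{a}$ is the associator, $\mathcal{D}^\bullet=(\mathcal{M}\times\mathbb{R}[-k])\times\mathbb{R}[-k]$ for $k\ne0$, and for $k=0$, $\mathcal{D}^\bullet$ is the restriction of $(\mathcal{M}\times\mathbb{R})\times\mathbb{R}$ to the open set of all $((m,s),t)$ with $(m,s)\in D$, $(\underline{\theta}(m,s),t)\in D$ and $(m,s+t)\in D$. The infinitesimal generator of $\theta$ is the unique degree $k$ vector field $X$ with $1\otimes\partial_{\mathbb{t}}\sim_\theta X$, where $1\otimes\partial_{\mathbb{t}}$ is the lift to $\mathcal{D}$ of the coordinate vector field on $\mathbb{R}[-k]$. Every vector field $X$ of degree $k$ with $[X,X]=0$ (automatic for $k$ even) is the infinitesimal generator of a unique maximal flow of degree $k$; it is called the flow of $X$. For $k=0$ its underlying map is the maximal ordinary flow of the underlying vector field $X_0$ on $M$, defined by $\underline{X(f)}=X_0(\underline f)$ ($\underline f$ is the body of $f$, locally its coefficient with no graded variable). Commuting domains (ordinary case): let $X_0,Y_0$ be vector fields on a manifold $M$ with maximal flows $\theta_0^X:D_1\to M$ and $\theta_0^Y:D_2\to M$. Let $D_1'=\{((m,s),t)\in D_1\times\mathbb{R}\mid(\theta_0^X(m,s),t)\in D_2\}$, $D_2'=\{((m,t),s)\in D_2\times\mathbb{R}\mid(\theta_0^Y(m,t),s)\in D_1\}$ and $\sigma((m,s),t)=((m,t),s)$. A commuting domain of $X_0$ and $Y_0$ is an open $\mathbb{D}\subseteq(M\times\mathbb{R})\times\mathbb{R}$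 with $\mathbb{D}\subseteq D_1'\cap\sigma^{-1}(D_2')$ such that for every $m\in M$ and every $(s,t)$ with $((m,s),t)\in\mathbb{D}$, one has $((m,s'),t')\in\mathbb{D}$ for all $(s',t')$ in the closed rectangle with corners $(0,0)$ and $(s,t)$. There is a unique maximal commuting domain (containing all others). Graded case: let $k=|X|$, $\ell=|Y|$, and let $\sigma:(\mathcal{M}\times\mathbb{R}[-k])\times\mathbb{R}[-\ell]\to(\mathcal{M}\times\mathbb{R}[-\ell])\times\mathbb{R}[-k]$ be the canonical flip. The maximal commuting domain of $X$ and $Y$ is $\mathsf{D}=((\mathcal{M}\times\mathbb{R}[-k])\times\mathbb{R}[-\ell])|_{\mathbb{D}}$ where: if $k=\ell=0$, $\mathbb{D}$ is the maximal commuting domain of $X_0$ and $Y_0$; if $k=0$, $\ell\neq0$, $\mathbb{D}=D_1\times\{\ast\}$; if $k\ne0$, $\ell=0$, $\mathbb{D}=\underline{\sigma}^{-1}(D_2\times\{\ast\})$; if $k,\ell\neq0$, $\mathbb{D}=(M\times\{\ast\})\times\{\ast\}$. Here $D_1,D_2$ are the underlying manifolds of $\mathcal{D}_1,\mathcal{D}_2$. The flows commute on $\mathsf{D}$ if $$\theta^Y\circ(\theta^X\times1_{\mathbb{R}[-\ell]})=\theta^X\circ(\theta^Y\times1_{\mathbb{R}[-k]})\circ\sigma$$ as graded smooth maps $\mathsf{D}\to\mathcal{M}$ (all maps suitably restricted). *)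

(* Defs.v *)
From HB Require Import structures.
From mathcomp Require Import all_boot all_order all_algebra.
From mathcomp Require Import mathcomp_extra boolp classical_sets functions.
From mathcomp Require Import cardinality reals topology normedtype derive.
From mathcomp Require Import ring zify lra.
Set Implicit Arguments.
Unset Strict Implicit.
Unset Printing Implicit Defensive.
Import Order.TTheory GRing.Theory Num.Theory.
Import numFieldNormedType.Exports.
Local Open Scope classical_set_scope.
Local Open Scope ring_scope.

Record opens (T : topologicalType) := Opens {
  oset :> set T;
  opensP : open oset }.

Definition opensT (T : topologicalType) : opens T := Opens (@openT T).

Section Smooth.
Variables (R : realType) (n : nat).
Implicit Types (W : set 'rV[R]_n) (f g : 'rV[R]_n -> R).

Definition basis_vec (i : 'I_n) : 'rV[R]_n := delta_mx 0 i.

(* Of class C^r on [W], for [W] open: [f] is continuous on [W] and, when r > 0,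
   all its first partial derivatives exist on [W] and are of class C^(r-1). *)
Fixpoint Cr (r : nat) W f : Prop :=
  (forall x, W x -> {for x, continuous f}) /\
  if r is r'.+1 then
    forall i, (forall x, W x -> derivable f x (basis_vec i)) /\
              Cr r' W ('D_(basis_vec i) f)
  else True.

Definition smooth W f := forall r, Cr r W f.

Lemma Cr_sub r W W' f : W' `<=` W -> Cr r W f -> Cr r W' f.
Proof.
elim: r f => [|r IH] f sW /= [cf df]; split=> //; first by move=> x /sW/cf.
- by move=> x /sW/cf.
- by move=> i; have [dfi Cfi] := df i; split; [move=> x /sW/dfi | exact: IH].
Qed.

Lemma Cr_local r W f :
  (forall x, W x -> exists2 W', W' x & Cr r W' f) -> Cr r W f.
Proof.
elim: r f => [|r IH] f H /=.
  by split=> // x /H[W' W'x [+ _]]; apply.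
split; first by move=> x /H[W' W'x [+ _]]; apply.
move=> i; split; first by move=> x /H[W' W'x [_ /(_ i)[+ _]]]; apply.
by apply: IH => x /H[W' W'x [_ /(_ i)[_ ?]]]; exists W'.
Qed.

Lemma open_near W x : open W -> W x -> \forall y \near x, W y.
Proof. by move=> oW Wx; apply: open_nbhs_nbhs. Qed.

Lemma open_near_eq W x f g : open W -> W x -> (forall y, W y -> f y = g y) ->
  \forall y \near x, f y = g y.
Proof.
move=> oW Wx fg; near=> y; apply: fg.
by near: y; exact: open_near.
Unshelve. all: by end_near. Qed.

Lemma cont_near_eq x f g : (\forall y \near x, f y = g y) ->
  {for x, continuous f} -> {for x, continuous g}.
Proof.
move=> fg cf; have fgx : f x = g x := nbhs_singleton fg.
have cf' : f @ nbhs x --> g x by rewrite -fgx; exact: cf.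
have gf : g @ nbhs x `=>` f @ nbhs x.
  by apply: near_eq_cvg.
exact: cvg_trans gf cf'.
Qed.

Lemma Cr_eq r W f g : open W -> (forall x, W x -> f x = g x) ->
  Cr r W f -> Cr r W g.
Proof.
move=> oW; elim: r f g => [|r IH] f g fg.
  move=> [cf _]; split=> // x Wx.
  exact: cont_near_eq (open_near_eq oW Wx fg) (cf x Wx).
move=> [cf df]; split.
  move=> x Wx; exact: cont_near_eq (open_near_eq oW Wx fg) (cf x Wx).
move=> i; have [dfi Cfi] := df i.
have fgn x : W x -> \near x, f x = g x.
  by move=> Wx; exact: (open_near_eq oW Wx).
split; first by move=> x Wx; apply: near_eq_derivable (fgn _ Wx) (dfi _ Wx).
apply: IH Cfi => x Wx.
by apply: near_eq_derive; exact: fgn.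
Qed.

Lemma CrS r W f : Cr r.+1 W f -> Cr r W f.
Proof.
elim: r f => [|r IH] f [cf df]; split=> // i.
have [dfi Cfi] := df i; split=> //; exact: IH.
Qed.

Lemma CrC r W (c : R) : Cr r W (fun=> c).
Proof.
have cc : forall x : 'rV[R]_n, {for x, continuous (fun _ : 'rV[R]_n => c)}.
  by move=> x; exact: cst_continuous.
elim: r c cc => [|r IH] c cc /=; split=> //.
move=> i; split; first by move=> x _; exact: (derivable_cst c).
suff -> : 'D_(basis_vec i) (fun _ : 'rV[R]_n => c) = (fun=> 0) by apply: IH => x; exact: cst_continuous.
by apply/funext => x; exact: derive_cst.
Qed.

Lemma CrD r W f g : open W -> Cr r W f -> Cr r W g -> Cr r W (fun x => f x + g x).
Proof.
move=> oW; elim: r f g => [|r IH] f g [cf df] [cg dg]; split=> //.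
- by move=> x Wx; exact: (continuousD (cf _ Wx) (cg _ Wx)).
- by move=> x Wx; exact: (continuousD (cf _ Wx) (cg _ Wx)).
move=> i; have [dfi Cfi] := df i; have [dgi Cgi] := dg i; split.
  by move=> x Wx; apply: derivableD; [exact: dfi | exact: dgi].
apply: Cr_eq (IH _ _ Cfi Cgi) => // x Wx.
by rewrite deriveD //; [exact: dfi | exact: dgi].
Qed.

Lemma CrM r W f g : open W -> Cr r W f -> Cr r W g -> Cr r W (fun x => f x * g x).
Proof.
move=> oW; elim: r f g => [|r IH] f g Cf Cg.
  move: Cf Cg => [cf df] [cg dg]; split=> //.
  by move=> x Wx; exact: (continuousM (cf _ Wx) (cg _ Wx)).
have [cf df] := Cf; have [cg dg] := Cg; split=> //.
  by move=> x Wx; exact: (continuousM (cf _ Wx) (cg _ Wx)).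
move=> i; have [dfi Cfi] := df i; have [dgi Cgi] := dg i; split.
  by move=> x Wx; apply: derivableM; [exact: dfi | exact: dgi].
have := CrD oW (IH _ _ (CrS Cf) Cgi) (IH _ _ (CrS Cg) Cfi).
apply: Cr_eq => // x Wx.
by rewrite deriveM //; [exact: dfi | exact: dgi].
Qed.

Lemma Cr_sum r W (I : Type) (s : seq I) (F : I -> 'rV[R]_n -> R) :
  open W -> (forall i, Cr r W (F i)) -> Cr r W (fun x => \sum_(i <- s) F i x).
Proof.
move=> oW CF; elim: s => [|i s IH].
  by apply: Cr_eq (CrC r W 0) => // x _; rewrite big_nil.
by apply: Cr_eq (CrD oW (CF i) IH) => // x _; rewrite big_cons.
Qed.

Lemma Cr_coord r W (i : 'I_n) : open W -> Cr r W (fun x => x 0 i).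
Proof.
have cc : continuous (fun x : 'rV[R]_n => x 0 i) by exact: coord_continuous.
have dd x v : is_derive x v (fun x : 'rV[R]_n => x 0 i) (v 0 i).
  pose F (h : R) : R :=
    h^-1 *: (((fun y : 'rV[R]_n => y 0 i) \o shift x) (h *: v) - x 0 i).
  have key : F @ 0^' --> (v 0 i : R).
    have FE : F @ 0^' `=>` (fun _ : R => v 0 i : R) @ 0^'.
      apply: near_eq_cvg; near=> h.
      rewrite /F /= !mxE addrK /GRing.scale /= mulrA mulVf ?mul1r //.
      near: h; exact: nbhs_dnbhs_neq.
    by apply: cvg_trans FE _; exact: cvg_cst.
  have dc : derivable (fun y : 'rV[R]_n => y 0 i) x v by apply: (cvgP (v 0 i)).
  have <- : 'D_v (fun y : 'rV[R]_n => y 0 i) x = v 0 i.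
    by apply: cvg_lim => //; exact: norm_hausdorff.
  exact: derivableP.
move=> oW; case: r => [|r]; split=> //; try by move=> x _; exact: cc.
move=> j; split; first by move=> x _; case: (dd x (basis_vec j)).
apply: Cr_eq (CrC r W (basis_vec j 0 i)) => // x _.
by case: (dd x (basis_vec j)) => _ ->.
Unshelve. all: by end_near.
Qed.

End Smooth.

Section MultiIndex.
Variables (q : nat) (deg : 'I_q -> int).
Local Notation mindex := {ffun 'I_q -> nat}.
Implicit Types a b c : mindex.

Definition mzero : mindex := [ffun=> 0%N].
Definition madd a b : mindex := [ffun i => (a i + b i)%N].
Definition msub a b : mindex := [ffun i => (a i - b i)%N].
Definition mle a b := [forall i, (a i <= b i)%N].
(* A variable of odd degree squares to zero, so its exponent is at most 1. *)
Definition mvalid a := [forall i, odd (absz (deg i)) ==> (a i <= 1)%N].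
Definition mdegree a : int := \sum_i deg i *+ a i.

Definition mbelow c : seq mindex :=
  [seq a <- [seq [ffun i => nat_of_ord (u i)]
             | u : {ffun 'I_q -> 'I_(\sum_i c i).+1}] | mle a c].
Definition msplits c : seq (mindex * mindex) :=
  [seq (a, msub c a) | a <- mbelow c].

(* For ordered monomials, xi^a xi^b = (-1)^(mcross a b) xi^(a + b): each factor
   xi_j of xi^b moves to the left of the factors xi_i of xi^a with j < i. *)
Definition mcross a b : nat :=
  (\sum_(i < q) \sum_(j < q | j < i) (a i * absz (deg i)) * (b j * absz (deg j)))%N.

Definition cmul (R : comNzRingType) (f g : mindex -> R) c : R :=
  if mvalid c then
    \sum_(ab <- msplits c) (-1) ^+ mcross ab.1 ab.2 * (f ab.1 * g ab.2)
  else 0.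

Definition homog (R : nzRingType) (k : int) (f : mindex -> R) :=
  forall a, ~~ (mvalid a && (mdegree a == k)) -> f a = 0.

Lemma mbelowP c a : (a \in mbelow c) = mle a c.
Proof.
rewrite mem_filter andb_idr // => /forallP le_ac.
apply/mapP; exists [ffun i => inord (a i)]; first by rewrite mem_enum.
apply/ffunP => i; rewrite !ffunE inordK // ltnS.
by apply: leq_trans (le_ac i) _; rewrite (bigD1 i) //= leq_addr.
Qed.

Lemma mbelow_uniq c : uniq (mbelow c).
Proof.
rewrite filter_uniq // map_inj_uniq ?enum_uniq // => u v /ffunP uv.
by apply/ffunP => i; apply/val_inj; have := uv i; rewrite !ffunE.
Qed.

Lemma msplitsP c p : (p \in msplits c) = (madd p.1 p.2 == c).
Proof.
apply/mapP/eqP => [[a]|<-].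
  rewrite mbelowP => /forallP ac ->; apply/ffunP => i.
  by rewrite !ffunE /= subnKC.
exists p.1; first by rewrite mbelowP; apply/forallP => i; rewrite ffunE leq_addr.
case: p => a b /=; congr pair; apply/ffunP => i.
by rewrite !ffunE addKn.
Qed.

Lemma msplits_uniq c : uniq (msplits c).
Proof. by rewrite map_inj_uniq ?mbelow_uniq // => a b []. Qed.

Lemma maddA a b c : madd a (madd b c) = madd (madd a b) c.
Proof. by apply/ffunP => i; rewrite !ffunE addnA. Qed.

Lemma maddC a b : madd a b = madd b a.
Proof. by apply/ffunP => i; rewrite !ffunE addnC. Qed.

Lemma mvalid_addl a b : mvalid (madd a b) -> mvalid a.
Proof.
move=> /forallP v; apply/forallP => i; apply/implyP => o.
by move/implyP: (v i) => /(_ o); rewrite ffunE; apply: leq_trans; rewrite leq_addr.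
Qed.

Lemma mvalid_addr a b : mvalid (madd a b) -> mvalid b.
Proof. rewrite maddC; exact: mvalid_addl. Qed.

Lemma mdegreeD a b : mdegree (madd a b) = mdegree a + mdegree b.
Proof. by rewrite -big_split /=; apply: eq_bigr => i _; rewrite ffunE mulrnDr. Qed.

Lemma mcrossDl a a' b : mcross (madd a a') b = (mcross a b + mcross a' b)%N.
Proof.
rewrite /mcross -big_split; apply: eq_bigr => i _; rewrite -big_split.
by apply: eq_bigr => j _; rewrite /= ffunE !mulnDl.
Qed.

Lemma mcrossDr a b b' : mcross a (madd b b') = (mcross a b + mcross a b')%N.
Proof.
rewrite /mcross -big_split; apply: eq_bigr => i _; rewrite -big_split.
by apply: eq_bigr => j _; rewrite /= ffunE mulnDl mulnDr.
Qed.

Section CoefficientAlgebra.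
Variable R : comNzRingType.
Implicit Types f g h : mindex -> R.

Lemma cmulDl (x : R) f g h c :
  cmul (fun a => x * f a + g a) h c = x * cmul f h c + cmul g h c.
Proof.
rewrite /cmul; case: ifP => _; last by rewrite mulr0 addr0.
rewrite big_distrr -big_split /=; apply: eq_bigr => ab _.
by rewrite mulrDl mulrDr !mulrA; congr (_ * _ * _ + _); rewrite mulrC.
Qed.

Lemma cmulA f g h c : cmul f (cmul g h) c = cmul (cmul f g) h c.
Proof.
rewrite /cmul; case: ifP => // vc.
pose term (a b d : mindex) : R :=
  (-1) ^+ (mcross a b + mcross a d + mcross b d) * (f a * g b * h d).
transitivity (\sum_(p <- msplits c) \sum_(r <- msplits p.2) term p.1 r.1 r.2).
  rewrite !big_seq; apply: eq_bigr => -[a e]; rewrite msplitsP => /= /eqP ae.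
  rewrite ifT; last by move: vc; rewrite -ae => /mvalid_addr.
  rewrite 2!big_distrr /= !big_seq; apply: eq_bigr => -[b d].
  rewrite msplitsP => /= /eqP <-; rewrite /term mcrossDr !exprD.
  ring.
transitivity (\sum_(p <- msplits c) \sum_(r <- msplits p.1) term r.1 r.2 p.2);
  last first.
  rewrite !big_seq; apply: eq_bigr => -[e d]; rewrite msplitsP => /= /eqP ed.
  rewrite ifT; last by move: vc; rewrite -ed => /mvalid_addl.
  rewrite big_distrl big_distrr /= !big_seq; apply: eq_bigr => -[a b].
  rewrite msplitsP => /= /eqP <-; rewrite /term mcrossDl !exprD.
  ring.
pose L := [seq (p.1, r.1, r.2) | p <- msplits c, r <- msplits p.2].
pose L' := [seq (r.1, r.2, p.2) | p <- msplits c, r <- msplits p.1].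
have -> : \sum_(p <- msplits c) \sum_(r <- msplits p.2) term p.1 r.1 r.2 =
    \sum_(t <- L) term t.1.1 t.1.2 t.2 by rewrite big_allpairs_dep.
have -> : \sum_(p <- msplits c) \sum_(r <- msplits p.1) term r.1 r.2 p.2 =
    \sum_(t <- L') term t.1.1 t.1.2 t.2 by rewrite big_allpairs_dep.
apply: perm_big; apply: uniq_perm.
- apply: allpairs_uniq_dep; [exact: msplits_uniq|by move=> p _; exact: msplits_uniq|].
  move=> t t' /allpairsPdep[p [r [_ + Et]]] /allpairsPdep[p' [r' [_ + Et']]].
  rewrite {}Et {}Et' !msplitsP /=; case: p p' r r' => [a e] [a' e'] [b d] [b' d'] /=.
  by move=> /eqP <- /eqP <- [-> -> ->].
- apply: allpairs_uniq_dep; [exact: msplits_uniq|by move=> p _; exact: msplits_uniq|].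
  move=> t t' /allpairsPdep[p [r [_ + Et]]] /allpairsPdep[p' [r' [_ + Et']]].
  rewrite {}Et {}Et' !msplitsP /=; case: p p' r r' => [e d] [e' d'] [a b] [a' b'] /=.
  by move=> /eqP <- /eqP <- [-> -> ->].
move=> [[a b] d]; apply/allpairsPdep/allpairsPdep => -[[x y] [[z t]]] [];
  rewrite !msplitsP /= => /eqP <- /eqP <- [-> -> ->].
- by exists (madd x z, t), (x, z); rewrite !msplitsP /= maddA !eqxx.
- by exists (z, madd t y), (t, y); rewrite !msplitsP /= maddA !eqxx.
Qed.

End CoefficientAlgebra.

Lemma odd_absz_sum (I : Type) (s : seq I) (F : I -> int) :
  odd (absz (\sum_(i <- s) F i)) = odd (\sum_(i <- s) absz (F i))%N.
Proof.
elim: s => [|i s IH]; first by rewrite !big_nil.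
rewrite !big_cons oddD -IH; move: (F i) (\sum_(_ <- _) _) => u v.
by lia.
Qed.

Lemma odd_mdegree a : odd (absz (mdegree a)) = odd (\sum_i a i * absz (deg i))%N.
Proof.
rewrite odd_absz_sum; congr odd; apply: eq_bigr => i _.
by rewrite -mulr_natr abszM mulnC natz.
Qed.

Lemma mcross_comm a b : mvalid (madd a b) ->
  odd (mcross a b + mcross b a) = odd (absz (mdegree a * mdegree b)).
Proof.
move=> vab; rewrite abszM oddM !odd_mdegree -oddM.
pose A i := (a i * absz (deg i))%N; pose B i := (b i * absz (deg i))%N.
rewrite -[in RHS]/(\sum_i A i)%N -[in RHS]/(\sum_i B i)%N big_distrlr /=.
have -> : (mcross b a = \sum_(i < q) \sum_(j < q | i < j) A i * B j)%N.
  rewrite /mcross (exchange_big_dep predT) //=; apply: eq_bigr => i _.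
  by apply: eq_bigr => j _; rewrite mulnC.
have -> : (\sum_(i < q) \sum_(j < q) A i * B j =
   mcross a b + \sum_(i < q) \sum_(j < q | i < j) A i * B j + \sum_i A i * B i)%N.
  rewrite /mcross -!big_split /=; apply: eq_bigr => i _.
  rewrite (bigID (fun j : 'I_q => (j < i)%N)) /= -addnA; congr addn.
  rewrite (bigD1 i) /= ?ltnn // addnC; congr addn; apply: eq_bigl => j.
  by rewrite -leqNgt ltn_neqAle eq_sym andbC.
rewrite [in RHS]oddD; suff -> : odd (\sum_i A i * B i) = false by rewrite addbF.
elim/big_rec: _ => // i n _; rewrite oddD => ->; rewrite addbF /A /B !oddM.
have /forallP/(_ i)/implyP := vab; rewrite ffunE.
case: (odd (absz (deg i))) => [/(_ isT)|]; last by rewrite !andbF.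
by case: (a i) (b i) => [|[|?]] [|[|?]].
Qed.

Lemma sign_exprz (R : unitRingType) (z : int) : (-1 : R) ^ z = (-1) ^+ (absz z).
Proof.
case: z => n //; rewrite NegzE /= -exprnN.
by rewrite -exprVn invrN1.
Qed.

Lemma cmulC (R : comUnitRingType) (f g : mindex -> R) (k l : int) c :
  homog k f -> homog l g -> cmul f g c = (-1) ^ (k * l) * cmul g f c.
Proof.
move=> hf hg; rewrite /cmul; case: ifP => vc; last by rewrite mulr0.
rewrite big_distrr /= [RHS](perm_big [seq (p.2, p.1) | p <- msplits c]); last first.
  apply: uniq_perm; first exact: msplits_uniq.
    by rewrite map_inj_uniq ?msplits_uniq // => -[? ?] [? ?] [-> ->].
  move=> [a b]; rewrite msplitsP; apply/idP/mapP => [ab|[[x y]]].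
    by exists (b, a) => //; rewrite msplitsP maddC.
  by rewrite msplitsP /= maddC => + [-> ->].
rewrite [RHS]big_map big_seq [RHS]big_seq; apply: eq_bigr => -[a b]; rewrite msplitsP /= => /eqP ab.
have [/andP[_ /eqP da]|na] := boolP (mvalid a && (mdegree a == k)); last first.
  by rewrite hf // mul0r !mulr0.
have [/andP[_ /eqP db]|nb] := boolP (mvalid b && (mdegree b == l)); last first.
  by rewrite (hg b) // mul0r !mulr0.
have -> : (-1) ^ (k * l) = (-1) ^+ (mcross a b + mcross b a) :> R.
  by rewrite sign_exprz -da -db -signr_odd -mcross_comm ?signr_odd ?ab.
rewrite exprD -mulrA [X in _ = _ * X]mulrA -expr2 sqrr_sign mul1r.
by rewrite [g b * _]mulrC.
Qed.

Lemma homog_cmul (R : comUnitRingType) (f g : mindex -> R) (k l : int) :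
  homog k f -> homog l g -> homog (k + l) (cmul f g).
Proof.
move=> hf hg c; rewrite negb_and /cmul; case: ifP => //= vc dc.
rewrite big_seq big1 // => -[a b]; rewrite msplitsP /= => /eqP ab.
have [/andP[_ /eqP da]|na] := boolP (mvalid a && (mdegree a == k)); last first.
  by rewrite hf // mul0r !mulr0.
have [/andP[_ /eqP db]|nb] := boolP (mvalid b && (mdegree b == l)); last first.
  by rewrite (hg b) // mulr0 mulr0.
by move: dc; rewrite -ab mdegreeD da db eqxx.
Qed.

Lemma mvalid0 : mvalid mzero.
Proof. by apply/forallP => i; rewrite ffunE implybT. Qed.

Lemma mdegree0 : mdegree mzero = 0.
Proof. by rewrite /mdegree big1 // => i _; rewrite ffunE. Qed.

Lemma madd0 a : madd mzero a = a.
Proof. by apply/ffunP => i; rewrite !ffunE. Qed.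

Lemma cmul1 (R : comUnitRingType) (f : mindex -> R) (k : int) c :
  homog k f -> cmul (fun a => (a == mzero)%:R) f c = f c.
Proof.
move=> hf; rewrite /cmul; case: ifPn => vc; last by rewrite hf // negb_and vc.
rewrite (bigD1_seq (mzero, c)) ?msplits_uniq ?msplitsP /= ?madd0 //.
rewrite big1_seq => [|[a b] /= /andP[nab]]; last first.
  rewrite msplitsP /= => /eqP bc; case: eqP => [a0|_]; last by rewrite !mul0r mulr0.
  by move: nab bc; rewrite a0 madd0 => + bc; rewrite bc eqxx.
rewrite /mcross big1 ?expr0 ?eqxx ?addr0 ?mul1r // => i _.
by rewrite big1 // => j _; rewrite ffunE mul0n.
Qed.

End MultiIndex.

Section GradedSpaces.
Variable R : realType.

(* The data of a space with a sheaf of graded commutative R-algebras.  The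
   degree of a product is given by a proof of [i + j = k], which lets the
   algebra laws be stated without transports between degrees. *)
Record gspace := GSpace {
  gpoint :> topologicalType;
  sec : opens gpoint -> int -> lmodType R;
  res : forall U V : opens gpoint, V `<=` U -> forall k : int, sec U k -> sec V k;
  gone : forall U, sec U 0;
  gmul : forall U (i j k : int), i + j = k -> sec U i -> sec U j -> sec U k;
  resP : forall (U V : opens gpoint) (h : V `<=` U) k (a : R) (f g : sec U k),
    res h (a *: f + g) = a *: res h f + res h g;
  res_id : forall (U : opens gpoint) (h : U `<=` U) k (f : sec U k), res h f = f;
  res_comp : forall (U V W : opens gpoint) (h : V `<=` U) (h' : W `<=` V) (h'' : W `<=` U) k
    (f : sec U k), res h' (res h f) = res h'' f;
  res_one : forall (U V : opens gpoint) (h : V `<=` U), res h (gone U) = gone V;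
  res_mul : forall (U V : opens gpoint) (h : V `<=` U) i j k (e : i + j = k)
    (f : sec U i) (g : sec U j), res h (gmul e f g) = gmul e (res h f) (res h g);
  gmulP : forall U i j k (e : i + j = k) (a : R) (f f' : sec U i) (g : sec U j),
    gmul e (a *: f + f') g = a *: gmul e f g + gmul e f' g;
  gmulA : forall U i j k ij jk ijk (e1 : j + k = jk) (e2 : i + jk = ijk)
    (e3 : i + j = ij) (e4 : ij + k = ijk)
    (f : sec U i) (g : sec U j) (h : sec U k),
    gmul e2 f (gmul e1 g h) = gmul e4 (gmul e3 f g) h;
  gmulC : forall U i j k (e : i + j = k) (e' : j + i = k)
    (f : sec U i) (g : sec U j), gmul e f g = (-1) ^ (i * j) *: gmul e' g f;
  gmul1 : forall U k (e : 0 + k = k) (f : sec U k), gmul e (gone U) f = f;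
  sheaf_sep : forall (I : Type) (V : I -> opens gpoint) (U : opens gpoint)
    (h : forall i, V i `<=` U), U `<=` \bigcup_i V i ->
    forall k (f g : sec U k), (forall i, res (h i) f = res (h i) g) -> f = g;
  sheaf_glue : forall (I : Type) (V : I -> opens gpoint) (U : opens gpoint)
    (h : forall i, V i `<=` U), U `<=` \bigcup_i V i ->
    forall k (f : forall i, sec (V i) k),
    (forall i j (W : opens gpoint) (hi : W `<=` V i) (hj : W `<=` V j),
      res hi (f i) = res hj (f j)) ->
    exists g : sec U k, forall i, res (h i) g = f i }.

(* A sequence (n_j) of finite sum: [gdim0] is n_0 and [gdeg] lists the degrees of
   the graded variables, n_j of them being equal to j <> 0. *)
Record gdim := GDim {
  gdim0 : nat;
  gvars : nat;
  gdeg : 'I_gvars -> int;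
  gdeg_neq0 : forall i, gdeg i != 0 }.

Section GradedDomain.
Variable d : gdim.
Local Notation n := (gdim0 d).
Local Notation mindex := {ffun 'I_(gvars d) -> nat}.
Local Notation coefs := (mindex -> 'rV[R]_n -> R^o).

Section Sections.
Variables (W : opens 'rV[R]_n) (k : int).

(* A power series of degree [k] over [W] is given by its coefficients, smooth
   functions on [W] which are extended by 0 outside [W] so that sections over [W]
   are equal as soon as they agree on [W]. *)
Definition is_gsec (f : coefs) :=
  [/\ forall a, smooth W (f a), forall x, homog (@gdeg d) k (f^~ x)
    & forall a x, ~ oset W x -> f a x = 0].

Definition gsec_pred : {pred coefs} := fun f => `[< is_gsec f >].

Lemma gsec_pred_submod : submod_closed gsec_pred.
Proof.
split.
  apply/asboolP; split=> //; first by move=> a r; exact: CrC.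
move=> a f g /asboolP[sf hf of_] /asboolP[sg hg og]; apply/asboolP; split.
- move=> b r; apply: (CrD (opensP W) (CrM (opensP W) (CrC r W a) (sf b r)) (sg b r)).
- move=> x b nb; change (a * f b x + g b x = 0).
  by rewrite [f b x](hf x) // [g b x](hg x) // mulr0 addr0.
- move=> b x nx; change (a * f b x + g b x = 0).
  by rewrite of_ // og // mulr0 addr0.
Qed.

HB.instance Definition _ :=
  GRing.isSubmodClosed.Build R coefs gsec_pred gsec_pred_submod.

Record gsec := GSec { coef : coefs; _ : gsec_pred coef }.
HB.instance Definition _ := [isSub for coef].
HB.instance Definition _ := [Choice of gsec by <:].
HB.instance Definition _ := [SubChoice_isSubLmodule of gsec by <:].

Lemma gsecP (f : gsec) : is_gsec (coef f).
Proof. by case: f => f Hf; exact/asboolP. Qed.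

Definition mk_gsec (f : coefs) (Hf : is_gsec f) : gsec := GSec (asboolT Hf).
End Sections.

Lemma gsec_eqP W k (f g : gsec W k) :
  (forall a x, oset W x -> coef f a x = coef g a x) -> f = g.
Proof.
move=> fg; apply/val_inj/funext => a; apply/funext => x /=.
have [|Wx] := pselect (oset W x); first exact: fg.
by have [_ _ fo] := gsecP f; have [_ _ go] := gsecP g; rewrite fo // go.
Qed.

Definition zext (W : set 'rV[R]_n) (f : coefs) : coefs :=
  fun a x => if x \in W then f a x else 0.

Lemma zext_in (W : set 'rV[R]_n) f a x : W x -> zext W f a x = f a x.
Proof. by move=> Wx; rewrite /zext mem_set. Qed.

Lemma zext_is_gsec (W : opens 'rV[R]_n) k f :
  (forall a, smooth W (f a)) -> (forall x, oset W x -> homog (@gdeg d) k (f^~ x)) ->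
  is_gsec W k (zext W f).
Proof.
move=> sf hf; split.
- move=> a r; apply: Cr_eq (sf a r); first exact: opensP.
  by move=> x Wx; rewrite zext_in.
- move=> x a na; rewrite /zext; case: ifPn => // /set_mem Wx; exact: (hf x).
- by move=> a x nWx; rewrite /zext memNset.
Qed.

Lemma dres_subproof (U V : opens 'rV[R]_n) (h : V `<=` U) k (f : gsec U k) :
  is_gsec V k (zext V (coef f)).
Proof.
have [sf hf _] := gsecP f; apply: zext_is_gsec => // a r; exact: Cr_sub (sf a r).
Qed.
Definition dres U V h k f : gsec V k := mk_gsec (@dres_subproof U V h k f).

Lemma done_subproof (U : opens 'rV[R]_n) :
  is_gsec U 0 (zext U (fun a _ => (a == mzero _)%:R)).
Proof.
apply: zext_is_gsec; first by move=> a r; exact: CrC.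
move=> x _ a; case: (eqVneq a (mzero _)) => // ->.
by rewrite mvalid0 mdegree0 eqxx.
Qed.
Definition done U : gsec U 0 := mk_gsec (done_subproof U).

Lemma dmul_subproof (U : opens 'rV[R]_n) i j k (e : i + j = k)
    (f : gsec U i) (g : gsec U j) :
  is_gsec U k (fun c x => cmul (@gdeg d) ((coef f)^~ x) ((coef g)^~ x) c).
Proof.
have [sf hf of_] := gsecP f; have [sg hg _] := gsecP g; split.
- move=> c r; rewrite /cmul; case: (mvalid (@gdeg d) c); last exact: CrC.
  apply: Cr_sum; first exact: opensP.
  move=> p; apply: CrM; [exact: opensP|exact: CrC|].
  by apply: CrM; [exact: opensP|exact: sf|exact: sg].
- by move=> x; rewrite -e; exact: homog_cmul.
- move=> c x nx; rewrite /cmul; case: ifP => // _; rewrite big1 // => p _.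
  by rewrite of_ // mul0r mulr0.
Qed.
Definition dmul U i j k e f g : gsec U k := mk_gsec (@dmul_subproof U i j k e f g).

Lemma dsheaf_glue (I : Type) (V : I -> opens 'rV[R]_n) (U : opens 'rV[R]_n)
    (h : forall i, V i `<=` U) : U `<=` \bigcup_i V i ->
    forall k (f : forall i, gsec (V i) k),
    (forall i j (W : opens 'rV[R]_n) (hi : W `<=` V i) (hj : W `<=` V j),
      dres hi (f i) = dres hj (f j)) ->
    exists g : gsec U k, forall i, dres (h i) g = f i.
Proof.
move=> cov k f comp.
have agree i j x : oset (V i) x -> oset (V j) x -> (coef (f i))^~ x = (coef (f j))^~ x.
  move=> Vi Vj; pose W := Opens (openI (opensP (V i)) (opensP (V j))).
  have := comp i j W (@subIsetl _ _ _) (@subIsetr _ _ _).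
  move=> /(congr1 (@coef _ _)) E; apply/funext => a.
  by have := congr1 (fun F : coefs => F a x) E; rewrite /= !zext_in.
pose G : coefs := fun a x =>
  match pselect (exists i, oset (V i) x) with
  | left ex => coef (f (sval (cid ex))) a x
  | right _ => 0
  end.
have GE i a x : oset (V i) x -> G a x = coef (f i) a x.
  move=> Vi; rewrite /G; case: pselect => [ex|[]]; last by exists i.
  have E := agree _ _ _ (svalP (cid ex)) Vi.
  exact: (congr1 (fun F : mindex -> R^o => F a) E).
have HG : is_gsec U k G.
  split.
  - move=> a r; apply: Cr_local => x /cov[i _ Vi]; exists (oset (V i)) => //.
    have [sf _ _] := gsecP (f i); apply: Cr_eq (sf a r); first exact: opensP.
    by move=> y Vy; rewrite (GE i).
  - move=> x a na; rewrite /G; case: pselect => // ex.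
    by have [_ hf _] := gsecP (f (sval (cid ex))); exact: hf.
  - move=> a x nU; rewrite /G; case: pselect => // ex.
    by case: nU; exact: h (svalP (cid ex)).
exists (mk_gsec HG) => i; apply: gsec_eqP => a x Vx /=.
by rewrite zext_in // (GE i).
Qed.

Implicit Types U V W : opens 'rV[R]_n.

Lemma dresP U V (h : V `<=` U) k (a : R) (f g : gsec U k) :
  dres h (a *: f + g) = a *: dres h f + dres h g.
Proof. by apply: gsec_eqP => b x Vx /=; rewrite zext_in // !fctE !zext_in. Qed.

Lemma dres_id U (h : U `<=` U) k (f : gsec U k) : dres h f = f.
Proof. by apply: gsec_eqP => b x Vx /=; rewrite zext_in. Qed.

Lemma dres_comp U V W (h : V `<=` U) (h' : W `<=` V) (h'' : W `<=` U) k
  (f : gsec U k) : dres h' (dres h f) = dres h'' f.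
Proof. by apply: gsec_eqP => b x Wx /=; rewrite !zext_in //; exact: h'. Qed.

Lemma dres_one U V (h : V `<=` U) : dres h (done U) = done V.
Proof. by apply: gsec_eqP => b x Vx /=; rewrite !zext_in //; exact: h. Qed.

Lemma dres_mul U V (h : V `<=` U) i j k (e : i + j = k)
  (f : gsec U i) (g : gsec U j) :
  dres h (dmul e f g) = dmul e (dres h f) (dres h g).
Proof.
apply: gsec_eqP => b x Vx /=; rewrite zext_in //.
by congr cmul; apply/funext => a; rewrite zext_in.
Qed.

Lemma dmulP U i j k (e : i + j = k) (a : R) (f f' : gsec U i) (g : gsec U j) :
  dmul e (a *: f + f') g = a *: dmul e f g + dmul e f' g.
Proof. by apply: gsec_eqP => b x Ux /=; exact: cmulDl. Qed.

Lemma dmulA U i j k ij jk ijk (e1 : j + k = jk) (e2 : i + jk = ijk)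
  (e3 : i + j = ij) (e4 : ij + k = ijk)
  (f : gsec U i) (g : gsec U j) (h : gsec U k) :
  dmul e2 f (dmul e1 g h) = dmul e4 (dmul e3 f g) h.
Proof. by apply: gsec_eqP => b x Ux /=; exact: cmulA. Qed.

Lemma dmulC U i j k (e : i + j = k) (e' : j + i = k)
  (f : gsec U i) (g : gsec U j) : dmul e f g = (-1) ^ (i * j) *: dmul e' g f.
Proof.
apply: gsec_eqP => b x Ux /=.
by apply: cmulC; [case: (gsecP f)|case: (gsecP g)].
Qed.

Lemma dmul1 U k (e : 0 + k = k) (f : gsec U k) : dmul e (done U) f = f.
Proof.
apply: gsec_eqP => b x Ux /=.
have [_ hf _] := gsecP f; rewrite -[RHS](cmul1 _ (hf x)).
by congr cmul; apply/funext => a; rewrite zext_in.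
Qed.

Lemma dsheaf_sep (I : Type) (V : I -> opens 'rV[R]_n) U
  (h : forall i, V i `<=` U) : U `<=` \bigcup_i V i ->
  forall k (f g : gsec U k), (forall i, dres (h i) f = dres (h i) g) -> f = g.
Proof.
move=> cov k f g fg; apply: gsec_eqP => a x /cov[i _ Vx].
have /(congr1 (@coef _ _)) E := fg i.
by have := congr1 (fun F : coefs => F a x) E; rewrite /= !zext_in.
Qed.

Definition gdomain : gspace :=
  @GSpace 'rV[R]_n (fun U k => gsec U k : lmodType R) dres done dmul
    dresP dres_id dres_comp dres_one dres_mul dmulP dmulA dmulC dmul1
    dsheaf_sep dsheaf_glue.

End GradedDomain.

(* The germ of [f] at [x] is invertible in the stalk.  A morphism of stalks is
   local when only invertible germs have invertible images. *)
Definition gunit_at (X : gspace) (x : X) (U : opens X) k (f : sec U k) :=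
  exists (V : opens X) (h : V `<=` U), oset V x /\
    exists g : sec V (- k), gmul (subrr k) (res h f) g = gone V.

Lemma gunit_at_res (X : gspace) (x : X) (U V : opens X) (h : V `<=` U) k
  (f : sec U k) : oset V x -> gunit_at x (res h f) <-> gunit_at x f.
Proof.
move=> Vx; split=> -[W [hW [Wx [g fg]]]].
  have hWU := subset_trans hW h.
  by exists W, hWU; split=> //; exists g; rewrite -(res_comp h hW).
pose W' := Opens (openI (opensP W) (opensP V)).
have h1 : W' `<=` W by exact: subIsetl.
have h2 : W' `<=` V by exact: subIsetr.
exists W', h2; split; first by split.
exists (res h1 g); rewrite (res_comp _ _ (subset_trans h1 hW)).
by rewrite -(res_comp hW h1) -res_mul fg res_one.
Qed.

(* A morphism of locally ringed spaces from the open subspace [gdom] of [X] to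
   [Y].  The values of [gfun] outside [gdom] are irrelevant. *)
Record gmap (X Y : gspace) := GMap {
  gdom : opens X;
  gfun :> X -> Y;
  gcont : forall W : opens Y, open (gdom `&` gfun @^-1` W);
  gpull : forall (W : opens Y) k, sec W k -> sec (Opens (gcont W)) k;
  gpullP : forall (W : opens Y) k (a : R) (f g : sec W k),
    gpull (a *: f + g) = a *: gpull f + gpull g;
  gpull_one : forall W : opens Y, gpull (gone W) = gone (Opens (gcont W));
  gpull_mul : forall (W : opens Y) i j k (e : i + j = k)
    (f : sec W i) (g : sec W j),
    gpull (gmul e f g) = gmul e (gpull f) (gpull g);
  gpull_res : forall (W W' : opens Y) (h : W' `<=` W)
    (h' : Opens (gcont W') `<=` Opens (gcont W)) k (f : sec W k),
    gpull (res h f) = res h' (gpull f);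
  gpull_local : forall (W : opens Y) k (f : sec W k) x,
    oset gdom x -> oset W (gfun x) ->
    gunit_at x (gpull f) -> gunit_at (gfun x) f }.

Definition gpre (X Y : gspace) (phi : gmap X Y) (W : opens Y) : opens X :=
  Opens (gcont phi W).

(* [phi] and [psi] are defined on [U] and have the same restriction to [U]. *)
Definition geq_on (X Y : gspace) (U : set X) (phi psi : gmap X Y) :=
  [/\ U `<=` gdom phi, U `<=` gdom psi, {in U, phi =1 psi}
    & forall (W : opens Y) k (f : sec W k) (V : opens X)
        (h : V `<=` gpre phi W) (h' : V `<=` gpre psi W),
      V `<=` U -> res h (gpull phi f) = res h' (gpull psi f)].

Lemma gdom_gpreT (X Y : gspace) (phi : gmap X Y) (U : opens X) :
  U `<=` gdom phi -> U `<=` gpre phi (opensT Y).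
Proof. by move=> h x /h. Qed.

Definition gpull_on (X Y : gspace) (phi : gmap X Y) (U : opens X)
  (h : U `<=` gdom phi) k (f : sec (opensT Y) k) : sec U k :=
  res (gdom_gpreT h) (gpull phi f).

Section Identity.
Variable X : gspace.

Lemma gid_cont (W : opens X) : open (opensT X `&` id @^-1` W).
Proof. by rewrite setTI; exact: opensP. Qed.

Lemma gid_sub (W : opens X) : Opens (gid_cont W) `<=` W.
Proof. by move=> x []. Qed.

Definition gid : gmap X X.
Proof.
refine (@GMap X X (opensT X) id gid_cont (fun W k f => res (@gid_sub W) f)
  _ _ _ _ _).
- by move=> W k a f g; rewrite resP.
- by move=> W; rewrite res_one.
- by move=> W i j k e f g; rewrite res_mul.
- move=> W W' h h' k f.
  by rewrite !(res_comp _ _ (subset_trans h' (@gid_sub W))).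
- by move=> W k f x _ Wx /gunit_at_res; apply; split.
Defined.
End Identity.

Section Composition.
Variables (X Y Z : gspace) (psi : gmap Y Z) (phi : gmap X Y).

Let cdom : opens X := gpre phi (gdom psi).
Let cfun := psi \o phi.

Lemma gcomp_sub (W : opens Z) :
  cdom `&` cfun @^-1` W `<=` gpre phi (gpre psi W).
Proof. by move=> x [[? ?] ?]; do !split. Qed.

Lemma gcomp_cont (W : opens Z) : open (cdom `&` cfun @^-1` W).
Proof.
rewrite (_ : _ `&` _ = gpre phi (gpre psi W)); first exact: opensP.
by apply/seteqP; split=> [|x [? [? ?]]]; [exact: gcomp_sub|do !split].
Qed.

Definition gcomp : gmap X Z.
Proof.
refine (@GMap X Z cdom cfun gcomp_cont
  (fun W k f => res (@gcomp_sub W : Opens (gcomp_cont W) `<=` _)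
                    (gpull phi (gpull psi f))) _ _ _ _ _).
- by move=> W k a f g; rewrite !gpullP resP.
- by move=> W; rewrite !gpull_one res_one.
- by move=> W i j k e f g; rewrite !gpull_mul res_mul.
- move=> W W' h h' k f.
  have hY : gpre psi W' `<=` gpre psi W by move=> y [? ?]; split=> //; exact: h.
  have hX : gpre phi (gpre psi W') `<=` gpre phi (gpre psi W).
    by move=> x [? ?]; split=> //; exact: hY.
  rewrite (gpull_res h hY) (gpull_res hY hX).
  have hT : Opens (gcomp_cont W') `<=` gpre phi (gpre psi W).
    by move=> x /gcomp_sub/hX.
  by rewrite !(res_comp _ _ hT).
- move=> W k f x [dx px] Wx /gunit_at_res => /(_ (conj (conj dx px) Wx)).
  by move=> /gpull_local => /(_ dx (conj px Wx)) /gpull_local; apply.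
Defined.
End Composition.

(* A chart of degree type [chart_dim]: an isomorphism from the open subspace
   [gdom chart_map] of [X] onto the open subspace [gdom chart_inv] of a graded
   domain. *)
Record chart (X : gspace) := Chart {
  chart_dim : gdim;
  chart_map : gmap X (gdomain chart_dim);
  chart_inv : gmap (gdomain chart_dim) X;
  chart_mapK : geq_on (gdom chart_map) (gcomp chart_inv chart_map) (gid _);
  chart_invK : geq_on (gdom chart_inv) (gcomp chart_map chart_inv) (gid _) }.

Record gmanifold := GManifold {
  gman_space :> gspace;
  gman_hausdorff : hausdorff_space gman_space;
  gman_second_countable : @second_countable gman_space;
  gman_charts : forall x : gman_space,
    exists c : chart gman_space, oset (gdom (chart_map c)) x }.

(* [g] is a smooth function on the open subset [U] of the underlying manifold,
   whose atlas consists of the underlying maps of the graded charts. *)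
Definition smooth_on (X : gspace) (U : set X) (g : X -> R) :=
  forall c : chart X,
    smooth (gdom (chart_inv c) `&` chart_inv c @^-1` U) (g \o chart_inv c).

Definition smooth_underlying (X Y : gspace) (phi : gmap X Y) :=
  forall (W : opens Y) (g : Y -> R),
    smooth_on W g -> smooth_on (gpre phi W) (g \o phi).

(* A graded smooth map from the open submanifold [gdom smap_map] of [M] to [N]. *)
Record smap (M N : gmanifold) := SMap {
  smap_map :> gmap M N;
  smap_smooth : smooth_underlying smap_map }.

Lemma sid_smooth (M : gmanifold) : smooth_underlying (gid M).
Proof.
move=> W g sg c; suff -> : (gpre (gid M) W : set M) = W by exact: sg.
by apply/seteqP; split=> [x []|x].
Qed.
Definition sid (M : gmanifold) : smap M M := SMap (@sid_smooth M).

Lemma scomp_smooth (M N P : gmanifold) (psi : smap N P) (phi : smap M N) :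
  smooth_underlying (gcomp psi phi).
Proof.
move=> W g /(smap_smooth psi)/(smap_smooth phi).
suff -> : (gpre (gcomp psi phi) W : set M) = gpre phi (gpre psi W) by [].
by apply/seteqP; split=> [x [[? ?] ?]|x [? [? ?]]]; do !split.
Qed.
Definition scomp (M N P : gmanifold) (psi : smap N P) (phi : smap M N) : smap M P :=
  SMap (scomp_smooth psi phi).

Section DomainManifold.
Variable d : gdim.
Local Notation X := (gdomain d).

Lemma gid_chartK : geq_on (gdom (gid X)) (gcomp (gid X) (gid X)) (gid X).
Proof.
split=> // W k f V h h' _.
have h3 : V `<=` W by move=> x /h'[].
have h2 : V `<=` gpre (gid X) W by move=> x /h3.
have h1 : V `<=` gpre (gid X) (gpre (gid X) W) by move=> x /h3.
transitivity (res h3 f); last by rewrite -(res_comp (@gid_sub X W) h' h3).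
apply: etrans (res_comp _ h h1 _) _; apply: etrans (res_comp _ _ h2 _) _.
exact: res_comp.
Qed.

Definition gid_chart : chart X := Chart gid_chartK gid_chartK.

Lemma gdomain_charts (x : X) : exists c : chart X, oset (gdom (chart_map c)) x.
Proof. by exists gid_chart. Qed.

Lemma gdomain_hausdorff : hausdorff_space X.
Proof. exact: norm_hausdorff. Qed.
End DomainManifold.

Lemma gdomain_second_countable (d : gdim) : @second_countable (gdomain d).
Proof.
pose n := gdim0 d.
pose F (p : 'rV[rat]_n * nat) : set 'rV[R]_n :=
  ball (map_mx ratr p.1 : 'rV[R]_n) (p.2.+1%:R^-1 : R).
exists (range F).
  by apply: sub_countable (card_image_le _ _) _; exact: countableP.
split; first by move=> _ [p _ <-]; exact: ball_open.
move=> x A /nbhs_ballP[e /= e0 eA].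
have e20 : 0 < e / 2 by rewrite divr_gt0.
have [N] := ltr_add_invr e20; rewrite add0r => Ne.
pose r : R := N.+1%:R^-1; have r0 : 0 < r by rewrite invr_gt0.
have exq i : exists q : rat, ball (x 0 i) r (ratr q : R).
  have /rat_in_itvoo[q] : x 0 i - r < x 0 i + r by rewrite ltrBlDr -addrA ltrDl addr_gt0.
  rewrite in_itv /= => /andP[q1 q2]; exists q.
  by rewrite /ball /= ltr_norml ltrBrDl ltrBlDl; apply/andP; split; lra.
pose q : 'rV[rat]_n := \row_i sval (cid (exq i)).
have xq : ball x r (map_mx ratr q : 'rV[R]_n).
  split=> // i j; rewrite !mxE (ord1 i); exact: svalP (cid (exq j)).
exists (F (q, N)); first by split; [exists (q, N)|exact: ball_sym].
move=> y Fy; apply: eA; apply: (@ball_split _ _ (map_mx ratr q : 'rV[R]_n)).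
  by apply: le_ball xq; exact: ltW.
by apply: le_ball Fy; exact: ltW.
Qed.

Definition gdomain_manifold (d : gdim) : gmanifold :=
  GManifold (@gdomain_hausdorff d) (gdomain_second_countable d) (@gdomain_charts d).

(* The point, and the line with one global coordinate of degree [- k]. *)
Lemma point_deg_neq0 (i : 'I_0) : (0 : int) != 0. Proof. by case: i. Qed.
Definition gpt : gmanifold := gdomain_manifold (GDim 0 point_deg_neq0).

Lemma line_deg_neq0 (k : int) (i : 'I_(k != 0)) : - k != 0.
Proof. by case: eqVneq i => [_ []|k0 _] //; rewrite oppr_eq0. Qed.
Definition line_dim (k : int) : gdim := GDim (k == 0) (@line_deg_neq0 k).
Definition gline (k : int) : gmanifold := gdomain_manifold (line_dim k).

(* [gdim0] and [gvars] of the line are 1 and 0 for [k = 0], and 0 and 1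
   otherwise, so that the sums below have one or no term. *)
Definition line_val (k : int) (y : gline k) : R :=
  \sum_(i < gdim0 (line_dim k)) (y : 'rV[R]_(gdim0 (line_dim k))) 0 i.

Definition line_coord_coef (k : int) :
    {ffun 'I_(gvars (line_dim k)) -> nat} -> gline k -> R^o :=
  fun a y => if k == 0 then line_val y else (\sum_i a i == 1)%:R.

Lemma line_coord_subproof (k : int) :
  @is_gsec (line_dim k) (opensT _) (- k) (@line_coord_coef k).
Proof.
split; last by move=> a x [].
- move=> a r; rewrite /line_coord_coef; case: (k == 0); last exact: CrC.
  apply: Cr_sum; first exact: openT.
  by move=> i; apply: Cr_coord; exact: openT.
move=> x a; rewrite /line_coord_coef /mvalid /mdegree.
move: a; case: (eqVneq k 0) => k0 a.
  have no (i : 'I_(k != 0)) : False by move: i; rewrite k0 eqxx => -[].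
  case/negP; apply/andP; split; first by apply/forallP => i; case: (no i).
  by rewrite big1 ?k0 // => i; case: (no i).
case: (eqVneq (\sum_i a i)%N 1%N) => // a1; case/negP; apply/andP; split.
  by apply/forallP => i; apply/implyP => _; rewrite -a1 (bigD1 i) //= leq_addr.
by rewrite sumrMnr /= a1.
Qed.

Definition line_coord (k : int) : @sec (gline k) (opensT _) (- k) :=
  mk_gsec (line_coord_subproof k).

Section VectorFields.
Variables (M : gspace) (U : opens M).

(* Graded derivations of degree [k] of the algebra of sections over [U]. *)
Record gvf (k : int) := GVf {
  vapp : forall i j, k + i = j -> sec U i -> sec U j;
  vappP : forall i j (e : k + i = j) (a : R) (f g : sec U i),
    vapp e (a *: f + g) = a *: vapp e f + vapp e g;
  vapp_mul : forall i j m i' j' m' (e : i + j = m) (ei : k + i = i')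
    (ej : k + j = j') (em : k + m = m') (e1 : i' + j = m') (e2 : i + j' = m')
    (f : sec U i) (g : sec U j),
    vapp em (gmul e f g) =
      gmul e1 (vapp ei f) g + (-1) ^ (k * i) *: gmul e2 f (vapp ej g) }.

Lemma bracket_degl (k l i j : int) : k + l + i = j -> k + (l + i) = j.
Proof. by rewrite addrA. Qed.
Lemma bracket_degr (k l i j : int) : k + l + i = j -> l + (k + i) = j.
Proof. by rewrite addrCA addrA. Qed.

Definition gbracket k l (X : gvf k) (Y : gvf l) i j (e : k + l + i = j)
    (f : sec U i) : sec U j :=
  vapp X (bracket_degl e) (vapp Y erefl f)
  - (-1) ^ (k * l) *: vapp Y (bracket_degr e) (vapp X erefl f).

Definition gbracket_eq0 k l (X : gvf k) (Y : gvf l) :=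
  forall i j (e : k + l + i = j) (f : sec U i), gbracket X Y e f = 0.
End VectorFields.

Definition grelated (M N : gspace) (U : opens M) (phi : gmap M N) k
    (X : gvf U k) (Y : gvf (opensT N) k) :=
  exists h : U `<=` gdom phi, forall i j (e : k + i = j) (f : sec (opensT N) i),
    vapp X e (gpull_on h f) = gpull_on h (vapp Y e f).

Definition is_coord_vf k (dt : gvf (opensT (gline k)) k) :=
  vapp dt (subrr k) (line_coord k) = gone _.

Definition gtotal (X Y : gspace) (phi : gmap X Y) := setT `<=` gdom phi.

(* Categorical products.  A map from the open submanifold [U] of [T] is a
   [smap] with domain [U]. *)
Record gproduct (A B : gmanifold) := GProduct {
  gprod :> gmanifold;
  pfst : smap gprod A;
  psnd : smap gprod B;
  pfst_total : gtotal pfst;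
  psnd_total : gtotal psnd;
  ppair : forall T : gmanifold, smap T A -> smap T B -> smap T gprod;
  ppair_dom : forall (T : gmanifold) (f : smap T A) (g : smap T B),
    (gdom (ppair f g) : set T) = gdom f `&` gdom g;
  ppair_fst : forall (T : gmanifold) (f : smap T A) (g : smap T B),
    geq_on (gdom f `&` gdom g) (scomp pfst (ppair f g)) f;
  ppair_snd : forall (T : gmanifold) (f : smap T A) (g : smap T B),
    geq_on (gdom f `&` gdom g) (scomp psnd (ppair f g)) g;
  ppair_uniq : forall (T : gmanifold) (h h' : smap T gprod),
    (gdom h : set T) = gdom h' ->
    geq_on (gdom h) (scomp pfst h) (scomp pfst h') ->
    geq_on (gdom h) (scomp psnd h) (scomp psnd h') -> geq_on (gdom h) h h' }.

Section Flows.
Variable prd : forall A B : gmanifold, gproduct A B.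

Definition prodmap (A A' B B' : gmanifold) (f : smap A A') (g : smap B B') :
    smap (prd A B) (prd A' B') :=
  ppair (prd A' B') (scomp f (pfst (prd A B))) (scomp g (psnd (prd A B))).

Definition passoc (A B C : gmanifold) : smap (prd (prd A B) C) (prd A (prd B C)) :=
  let p := pfst (prd (prd A B) C) in
  ppair (prd A (prd B C)) (scomp (pfst (prd A B)) p)
    (ppair (prd B C) (scomp (psnd (prd A B)) p) (psnd (prd (prd A B) C))).

Definition pflip (A B C : gmanifold) : smap (prd (prd A B) C) (prd (prd A C) B) :=
  let p := pfst (prd (prd A B) C) in
  ppair (prd (prd A C) B)
    (ppair (prd A C) (scomp (pfst (prd A B)) p) (psnd (prd (prd A B) C)))
    (scomp (psnd (prd A B)) p).

Definition is_line_zero k (z : smap gpt (gline k)) :=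
  gtotal z /\ forall h : opensT gpt `<=` gdom z, gpull_on h (line_coord k) = 0.

Definition is_line_add k (p : smap (prd (gline k) (gline k)) (gline k)) :=
  gtotal p /\
  forall (h : opensT (prd (gline k) (gline k)) `<=` gdom p)
    (h1 : opensT _ `<=` gdom (pfst (prd (gline k) (gline k))))
    (h2 : opensT _ `<=` gdom (psnd (prd (gline k) (gline k)))),
    gpull_on h (line_coord k) =
      gpull_on h1 (line_coord k) + gpull_on h2 (line_coord k).

Section OneFlow.
Variables (M : gmanifold) (k : int).
Local Notation P := (prd M (gline k)).

Definition slice (D : set P) (m : M) : set R :=
  [set line_val (psnd P z) | z in [set z | D z /\ pfst P z = m]].

Definition is_flow_domain (D : set P) :=
  if k == 0 then
    forall m, [/\ open (slice D m), is_interval (slice D m) & slice D m 0]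
  else D = setT.

(* This is the whole space when [D = setT], hence when [k <> 0].  Composites of
   partial maps being restricted to where they are defined, [prodmap theta (sid _)]
   has domain D x R[-k]. *)
Definition flow_dom2 (D : set P) (theta : smap P M)
    (add : smap (prd (gline k) (gline k)) (gline k)) : set (prd P (gline k)) :=
  [set z | [/\ D (pfst (prd P (gline k)) z),
               D (prodmap theta (sid (gline k)) z)
             & D (scomp (prodmap (sid M) add) (passoc M (gline k) (gline k)) z)]].

Definition is_flow (theta : smap P M) :=
  [/\ is_flow_domain (gdom theta),
      exists (bang : smap M gpt) (zero : smap gpt (gline k)),
        [/\ gtotal bang, is_line_zero zero
          & geq_on setT (scomp theta (ppair P (sid M) (scomp zero bang)))
              (sid M)]
    & exists add : smap (prd (gline k) (gline k)) (gline k),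
        is_line_add add /\
        geq_on (flow_dom2 (gdom theta) theta add)
          (scomp theta (prodmap theta (sid (gline k))))
          (scomp theta (scomp (prodmap (sid M) add) (passoc M _ _)))].

(* [Z] is the vector field [1 (x) d/dt] on the open submanifold [D]. *)
Definition is_lift_dt (D : opens P) (Z : gvf D k) :=
  (exists h : D `<=` gdom (pfst P),
     forall i j (e : k + i = j) (f : sec (opensT M) i),
       vapp Z e (gpull_on h f) = 0) /\
  exists dt : gvf (opensT (gline k)) k,
    is_coord_vf dt /\ grelated (psnd P) Z dt.

Definition is_generator (theta : smap P M) (X : gvf (opensT M) k) :=
  exists Z : gvf (gdom theta) k, is_lift_dt Z /\ grelated theta Z X.

(* A flow with no proper extension. *)
Definition is_maximal_flow (theta : smap P M) :=
  is_flow theta /\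
  forall theta' : smap P M, is_flow theta' ->
    geq_on (gdom theta) theta' theta -> gdom theta' `<=` gdom theta.

Definition is_flow_of (X : gvf (opensT M) k) (theta : smap P M) :=
  is_maximal_flow theta /\ is_generator theta X.
End OneFlow.

Section UnderlyingManifold.
Variable M : gmanifold.

(* In every chart, [g] is the coefficient of [f] with no graded variable. *)
Definition is_body (f : sec (opensT M) 0) (g : M -> R) :=
  forall (c : chart M) y, oset (gdom (chart_inv c)) y ->
    g (chart_inv c y) = coef (gpull (chart_inv c) f) (mzero _) y.

Definition is_vf0 (X0 : (M -> R) -> M -> R) :=
  [/\ forall f, smooth_on setT f -> smooth_on setT (X0 f),
      forall (a : R) f g, smooth_on setT f -> smooth_on setT g ->
        X0 (fun m => a * f m + g m) = (fun m => a * X0 f m + X0 g m)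
    & forall f g, smooth_on setT f -> smooth_on setT g ->
        X0 (fun m => f m * g m) = (fun m => X0 f m * g m + f m * X0 g m)].

(* For [k = 0] only: without a proof of [k + 0 = 0] the second clause is void. *)
Definition is_underlying_vf k (X : gvf (opensT M) k) (X0 : (M -> R) -> M -> R) :=
  is_vf0 X0 /\
  forall (e : k + 0 = 0) f g h, is_body f g -> is_body (vapp X e f) h -> X0 g = h.

(* Smoothness on the open subset [D] of the product manifold M x R. *)
Definition smooth_on_prodR (D : set (M * R)) (h : M * R -> R) :=
  forall c : chart M,
    let pt (v : 'rV[R]_(gdim0 (chart_dim c) + 1)) : M * R :=
      (chart_inv c (lsubmx v), rsubmx v 0 0) in
    smooth [set v | oset (gdom (chart_inv c)) (lsubmx v) /\ D (pt v)] (h \o pt).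

Definition is_flow_domain0 (D : set (M * R)) :=
  open D /\ forall m, let I := [set t | D (m, t)] in
    [/\ open I, is_interval I & I 0].

Definition is_flow0 (D : set (M * R)) (th : M * R -> M) :=
  [/\ is_flow_domain0 D,
      forall W : opens M, open (D `&` th @^-1` W) /\
        forall g, smooth_on W g -> smooth_on_prodR (D `&` th @^-1` W) (g \o th),
      forall m, th (m, 0) = m
    & forall m s t, D (m, s) -> D (th (m, s), t) -> D (m, s + t) ->
        th (th (m, s), t) = th (m, s + t)].

Definition is_generator0 (D : set (M * R)) (th : M * R -> M)
    (X0 : (M -> R) -> M -> R) :=
  forall f, smooth_on setT f -> forall m t, D (m, t) ->
    is_derive t 1 (fun u => f (th (m, u))) (X0 f (th (m, t))).

Definition is_maximal_flow0 (X0 : (M -> R) -> M -> R) (D : set (M * R))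
    (th : M * R -> M) :=
  [/\ is_flow0 D th, is_generator0 D th X0
    & forall D' th', is_flow0 D' th' -> D `<=` D' -> {in D, th' =1 th} ->
        D' `<=` D].

Definition between0 (s s' : R) := Num.min 0 s <= s' <= Num.max 0 s.

Definition is_commuting_domain0 (D1 : set (M * R)) (th1 : M * R -> M)
    (D2 : set (M * R)) (th2 : M * R -> M) (E : set ((M * R) * R)) :=
  [/\ open E,
      forall m s t, E ((m, s), t) ->
        [/\ D1 (m, s), D2 (th1 (m, s), t), D2 (m, t) & D1 (th2 (m, t), s)]
    & forall m s t, E ((m, s), t) -> forall s' t', between0 s s' ->
        between0 t t' -> E ((m, s'), t')].

Definition is_max_commuting_domain0 (X0 Y0 : (M -> R) -> M -> R)
    (E : set ((M * R) * R)) :=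
  exists D1 th1 D2 th2,
    [/\ is_maximal_flow0 X0 D1 th1, is_maximal_flow0 Y0 D2 th2,
        is_commuting_domain0 D1 th1 D2 th2 E
      & forall E', is_commuting_domain0 D1 th1 D2 th2 E' -> E' `<=` E].
End UnderlyingManifold.

Section Commutation.
Variables (M : gmanifold) (k l : int).
Local Notation PX := (prd M (gline k)).
Local Notation PY := (prd M (gline l)).
Local Notation QX := (prd PX (gline l)).
Local Notation QY := (prd PY (gline k)).

Definition QX_point (z : QX) : (M * R) * R :=
  let w := pfst QX z in
  ((pfst PX w, line_val (psnd PX w)), line_val (psnd QX z)).

Definition is_max_commuting_domain (X : gvf (opensT M) k) (Y : gvf (opensT M) l)
    (thX : smap PX M) (thY : smap PY M) (D : opens QX) :=
  if k == 0 then
    if l == 0 then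
      exists X0 Y0 E, [/\ is_underlying_vf X X0, is_underlying_vf Y Y0,
        is_max_commuting_domain0 X0 Y0 E & (D : set QX) = QX_point @^-1` E]
    else (D : set QX) = pfst QX @^-1` gdom thX
  else
    if l == 0 then
      (D : set QX) = pflip M (gline k) (gline l) @^-1` (pfst QY @^-1` gdom thY)
    else (D : set QX) = setT.

Definition flows_commute_on (thX : smap PX M) (thY : smap PY M) (D : opens QX) :=
  geq_on D (scomp thY (prodmap thX (sid (gline l))))
    (scomp (scomp thX (prodmap thY (sid (gline k))))
           (pflip M (gline k) (gline l))).
End Commutation.
End Flows.
End GradedSpaces.

(* Main.v *)
(** Write F and G for the composites theta^Y o (theta^X x 1) and
    theta^X o (theta^Y x 1) o sigma.  Differentiating F^* f = G^* f in both line
    variables at zero gives [X,Y] = 0.  Conversely, if [X,Y] = 0, the defect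
    Delta f = d_t (G^* f) - G^* (Y f) satisfies d_s (Delta f) = +- Delta (X f)
    and vanishes for s = 0, so it vanishes identically by uniqueness for the
    associated differential equation: an ordinary linear one if s has degree 0,
    a recursion on power series coefficients otherwise.  Then F and G both solve
    the flow equation of Y with the same value at t = 0, hence agree.  For fields
    of degree 0 one also needs that the maximal graded flow is defined on the whole
    domain of the underlying classical flow; this follows by gluing time shifts of
    the flow near the first time at which it would stop being defined. *)
From HB Require Import structures.
From mathcomp Require Import all_boot all_order all_algebra.
From mathcomp Require Import mathcomp_extra boolp classical_sets functions.
From mathcomp Require Import cardinality reals ereal topology normedtype derive.
From mathcomp Require Import sequences realfun exp.
From mathcomp Require Import ftc measure lebesgue_measure lebesgue_integral.
From mathcomp Require Import ring zify lra.
Require Import Defs.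
Set Implicit Arguments.
Unset Strict Implicit.
Unset Printing Implicit Defensive.
Import Order.TTheory GRing.Theory Num.Theory.
Import numFieldNormedType.Exports.
Local Open Scope classical_set_scope.
Local Open Scope ring_scope.


(** * Integration over the unit interval *)

Section ParameterIntegral.
Variable R : realType.
Local Notation mu := (@lebesgue_measure R).
Local Notation I01 := (`[0, 1]%classic : set R).

(** Products are known only through their universal property and maps are partial, so equalities are
    tested on germs. The value of a section at a point is an element of [gser], a single ring
    holding all degrees, and a morphism of stalks becomes a [germ_hom] into such a ring. Hadamard's
    lemma with graded variables shows that such a homomorphism, or a derivation along it, is
    determined by its values on coordinates, modulo every power of the augmentation ideal.

    For a time of degree 0, the uniqueness arguments share one device. A difference of two
    pullbacks, or the defect of a relation, obeys a twisted Leibniz rule. Once it is known to lie in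
    the N-th power of the ideal, each of its coefficients of length N is an ordinary point
    derivation, hence is given near a point by finitely many numbers that solve a linear system with
    bounded coefficients. Gronwall's inequality applies layer after layer. Only the underlying
    curves are nonlinear, and they are matched beforehand by a Lipschitz estimate.

    Vector fields act on global sections only, while germs are local: bump functions carry one to
    the other. *)

Definition int01 (h : R -> R) : R := (\int[mu]_(u in I01) h u)%R.

Lemma int01_integrable (h : R -> R) : {within I01, continuous h} ->
  mu.-integrable I01 (EFin \o h).
Proof.
move=> ch; apply: continuous_compact_integrable => //.
exact: segment_compact.
Qed.

Lemma int01B (h h' : R -> R) : {within I01, continuous h} ->
  {within I01, continuous h'} -> int01 (fun u => h u - h' u) = int01 h - int01 h'.
Proof.
move=> ch ch'; rewrite /int01 RintegralB //; exact: int01_integrable.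
Qed.

Lemma within_continuousZ (A : set R) (c : R) (h : R -> R) : {within A, continuous h} ->
  {within A, continuous (fun u => c * h u)}.
Proof.
move=> ch u; apply: (@continuousM R (subspace A) (fun=> c) h u); first exact: cst_continuous.
exact: ch.
Qed.

Lemma within_continuousB (A : set R) (h h' : R -> R) : {within A, continuous h} ->
  {within A, continuous h'} -> {within A, continuous (fun u => h u - h' u)}.
Proof.
by move=> ch ch' u; apply: (@continuousB _ _ (subspace A) h h' u); [exact: ch|exact: ch'].
Qed.

Lemma int01Z (c : R) (h : R -> R) : {within I01, continuous h} ->
  int01 (fun u => c * h u) = c * int01 h.
Proof. move=> ch; rewrite /int01 RintegralZl //; exact: int01_integrable. Qed.

Lemma int01_bound (h : R -> R) (e : R) : {within I01, continuous h} ->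
  (forall u, I01 u -> `|h u| <= e) -> `|int01 h| <= e.
Proof.
move=> ch he; rewrite /int01.
apply: le_trans (le_normr_Rintegral _ (int01_integrable ch)) _ => //.
have -> : e = (\int[mu]_(u in I01) (fun=> e) u)%R.
  by rewrite Rintegral_cst //= lebesgue_measure_itv /= lte_fin ltr01 /= oppr0 addr0 mulr1.
apply: le_Rintegral => //.
- apply: int01_integrable => u; apply: continuous_comp; first exact: ch.
  exact: norm_continuous.
- apply: int01_integrable => u; exact: cst_continuous.
Qed.

Lemma derivable1_continuous (F : R -> R) x : derivable F x 1 -> {for x, continuous F}.
Proof. by move=> /derivable1_diffP/differentiable_continuous. Qed.

Lemma int01_FTC (F h : R -> R) : {within I01, continuous h} ->
  (forall u, I01 u -> is_derive u 1 F (h u)) -> int01 h = F 1 - F 0.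
Proof.
move=> ch dF; rewrite /int01 /Rintegral (@continuous_FTC2 _ h F) //.
- split.
  + move=> u; rewrite in_itv /= => /andP[u0 u1].
    by have [] := dF u ltac:(rewrite /= in_itv /=; lra).
  + apply: cvg_at_right_filter; have [d _] := dF 0 ltac:(rewrite /= in_itv /=; lra).
    exact: derivable1_continuous d.
  + apply: cvg_at_left_filter; have [d _] := dF 1 ltac:(rewrite /= in_itv /=; lra).
    exact: derivable1_continuous d.
- move=> u; rewrite in_itv /= => /andP[u0 u1]; rewrite derive1E.
  by have [_ ->] := dF u ltac:(rewrite /= in_itv /=; lra).
Qed.

End ParameterIntegral.

Section Hadamard.
Variables (R : realType) (n : nat).
Local Notation V := 'rV[R]_n.
Local Notation I01 := (`[0, 1]%classic : set R).
Implicit Types (W B : set V) (f g : V -> R).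

(** Compactness covers [K] by balls of half the radius given by continuity. Only [y] has to lie in
    [K], because [f] is continuous at the points of [K] as a function on the whole space. *)
Lemma unif_cont_compact (K : set V) f : compact K ->
  (forall y, K y -> {for y, continuous f}) -> forall e : R, 0 < e ->
  exists2 d : R, 0 < d & forall y y', K y -> ball y d y' -> `|f y' - f y| < e.
Proof.
move=> /compact_near_coveringP cK cf e e0.
pose P (d : R) (y : V) := forall y', ball y d y' -> `|f y' - f y| < e.
have /(cK _ (0^'+ : set_system R) P) H : forall y, K y ->
    \forall y' \near y & d \near 0^'+, P d y'.
  move=> y Ky; have e2 : 0 < e / 2 by lra.
  have /cvgrPdist_lt/(_ _ e2)/nbhs_ballP[r /= r0 Hr] := cf y Ky.
  exists (ball y (r / 2), [set d | 0 < d < r / 2]) => /=.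
    split; first by apply: nbhsx_ballx; lra.
    near=> d; rewrite /=; apply/andP; split; first by near: d; exact: nbhs_right_gt.
    by near: d; apply: nbhs_right_lt; lra.
  move=> [z d] /= [yz /andP[d0 dr]] y' zy'.
  have h1 : ball y r z by apply: le_ball yz; lra.
  have h2 : ball y r y'.
    rewrite (_ : r = r / 2 + r / 2); last by lra.
    by apply: ball_triangle yz _; apply: le_ball zy'; exact: ltW.
  have := Hr _ h1; have := Hr _ h2; rewrite /= !ltr_norml => /andP[? ?] /andP[? ?].
  by apply/andP; split; lra.
have [d /= [d0 Hd]] : exists d : R, 0 < d /\ (forall y, K y -> P d y).
  have [d [d0 Hd]] : exists d : R, 0 < d /\ K `<=` P d.
    near (0:R)^'+ => d; exists d; split; first by near: d; exact: nbhs_right_gt.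
    by near: d.
  by exists d.
by exists d => // y y' Ky; exact: Hd.
Unshelve. all: by end_near. Qed.

End Hadamard.

(** * Directional derivatives as derivatives of functions of one variable *)

Section LineDerivative.
Variable R : realType.

Lemma is_derive_line (V : normedModType R) (f : V -> R) x v (l : R) :
  is_derive x v f l <-> is_derive (0 : R) 1 (fun h : R => f (x + h *: v)) l.
Proof.
have E : (fun h : R => h^-1 *: ((f \o shift x) (h *: v) - f x)) =
   (fun h : R => h^-1 *: (((fun h : R => f (x + h *: v)) \o shift 0) (h *: 1) - f (x + 0 *: v))).
  apply/funext => h /=; congr (_ *: (f _ - f _)); last by rewrite scale0r addr0.
  by rewrite addr0 addrC [_ *: 1]mulr1.
split=> -[d <-].
- have d' : derivable (fun h : R => f (x + h *: v)) (0 : R) 1 by rewrite /derivable -E.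
  by apply: DeriveDef => //; rewrite /derive -E.
- have d' : derivable f x v by rewrite /derivable E.
  by apply: DeriveDef => //; rewrite /derive E.
Qed.

Lemma is_derive_along (V : normedModType R) (f : V -> R) (x v : V) (s l : R) :
  is_derive (x + s *: v) v f l -> is_derive s 1 (fun t : R => f (x + t *: v)) l.
Proof.
move=> /is_derive_line H; apply/is_derive_line.
rewrite (_ : (fun h => _) = (fun h : R => f (x + s *: v + h *: v))) //.
by apply/funext => h; rewrite [_ *: 1]mulr1 scalerDl addrA.
Qed.

Lemma is_derive_rescale (U V : normedModType R) (f : V -> R) (A : U -> V) x w v (c l : R) :
  (forall h : R, A (x + h *: w) = A x + (c * h) *: v) ->
  is_derive (A x) v f l -> is_derive x w (f \o A) (c * l).
Proof.
move=> AE /is_derive_line H; apply/is_derive_line.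
have -> : (fun h : R => (f \o A) (x + h *: w)) =
    (fun h : R => f (A x + h *: v)) \o (fun h : R => c * h).
  by apply/funext => h /=; rewrite AE.
have H' : is_derive (c * 0) 1 (fun h : R => f (A x + h *: v)) l by rewrite mulr0.
have dc : is_derive (0 : R) 1 (fun h : R => c * h) c.
  by have := is_deriveZ c (is_derive_id (0 : R^o) (1 : R^o)); rewrite [_ *: 1]mulr1.
by have := is_derive1_comp H' dc; rewrite mulrC.
Qed.

Lemma is_derive_cvg (V : normedModType R) (f : V -> R) (x v : V) (l : R) :
  (forall e : R, 0 < e -> \forall h \near (0 : R)^', `|h^-1 * (f (x + h *: v) - f x) - l| < e) ->
  is_derive x v f l.
Proof.
move=> H; pose F (h : R) : R^o := h^-1 *: ((f \o shift x) (h *: v) - f x).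
have key : F @ 0^' --> (l : R^o).
  apply/cvgrPdist_lt => e e0; near=> h.
  by rewrite distrC /F /= (addrC (h *: v)); near: h; exact: H.
have dc : derivable f x v by apply: (cvgP (l : R^o)).
by apply: DeriveDef => //; apply: cvg_lim.
Unshelve. all: by end_near. Qed.

End LineDerivative.

(** * Differentiation under the integral sign *)

Section ParameterIntegralSmooth.
Variables (R : realType) (n : nat).
Local Notation V := 'rV[R]_n.
Local Notation I01 := (`[0, 1]%classic : set R).
Local Notation bv i := (@basis_vec R n i).
Implicit Types (W B : set V) (f g : V -> R) (h : R -> V -> R).

(** The second clause is continuity in [x] uniformly in the parameter [u]. This is what an integral
    over [u] needs in order to inherit continuity, and the recursion asks the same of every partial
    derivative. *)
Fixpoint unif_Cr (r : nat) B h : Prop :=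
  [/\ forall x, B x -> {within I01, continuous (h^~ x)},
      forall x, B x -> forall e : R, 0 < e -> exists2 d : R, 0 < d &
        forall x', ball x d x' -> forall u, I01 u -> `|h u x' - h u x| < e
    & if r is r'.+1 then
        forall i, (forall u x, I01 u -> B x -> derivable (h u) x (bv i)) /\
          unif_Cr r' B (fun u => 'D_(bv i) (h u))
      else True].

Lemma open_ball_sub x (B : set V) : open B -> B x -> exists2 d, 0 < d & ball x d `<=` B.
Proof. by move=> oB Bx; have /nbhs_ballP[e /= e0 eB] := open_nbhs_nbhs (conj oB Bx); exists e. Qed.

Lemma norm_basis_le (i : 'I_n) : `|bv i : 'rV[R]_n| <= 1.
Proof.
rewrite [leLHS]mx_normrE; apply/bigmax_leP; split=> // -[a b] _ /=.
by rewrite mxE; case: (_ && _); rewrite ?normr1 ?normr0.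
Qed.

Lemma ball_basis (x : V) (i : 'I_n) (s d : R) : `|s| < d -> ball x d (x + s *: bv i).
Proof.
move=> sd; rewrite -ball_normE /= opprD addNKr normrN normrZ.
by apply: le_lt_trans sd; rewrite ler_piMr // norm_basis_le.
Qed.

Lemma continuous_int01 B h : open B ->
  (forall x, B x -> {within I01, continuous (h^~ x)}) ->
  (forall x, B x -> forall e : R, 0 < e -> exists2 d : R, 0 < d &
     forall x', ball x d x' -> forall u, I01 u -> `|h u x' - h u x| < e) ->
  forall x, B x -> {for x, continuous (fun x => int01 (h^~ x))}.
Proof.
move=> oB c1 c2 x Bx; apply/(@cvgrPdist_lt _ R^o _ (nbhs x) _) => e e0.
have [d d0 dB] := open_ball_sub oB Bx.
have e2 : 0 < e / 2 by lra.
have [d' d'0 Hd] := c2 x Bx _ e2.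
near=> x'; rewrite -int01B; last 2 first.
- by move=> u; apply: c1.
- move=> u; apply: c1; apply: dB; near: x'; exact: nbhsx_ballx.
apply: le_lt_trans (_ : e / 2 < e); last by lra.
apply: int01_bound.
  move=> u; apply: continuousB; apply: c1 => //.
  by apply: dB; near: x'; exact: nbhsx_ballx.
move=> u Iu; rewrite distrC; apply/ltW/Hd => //.
by near: x'; exact: nbhsx_ballx.
Unshelve. all: by end_near. Qed.

(** By the mean value theorem the difference quotient is the partial derivative at an intermediate
    point. That point depends on [u], but the uniform clause of [unif_Cr] bounds the error
    independently of it, so the bound survives integration. *)
Lemma Cr_int01 r B h : open B -> unif_Cr r B h -> Cr r B (fun x => int01 (h^~ x)).
Proof.
move=> oB; elim: r h => [|r IH] h [c1 c2 H]; have cH := continuous_int01 oB c1 c2.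
  by split.
have der i x : B x -> is_derive x (bv i) (fun x => int01 (h^~ x))
    (int01 (fun u => 'D_(bv i) (h u) x)).
  move=> Bx; have [Hd Hu] := H i.
  have [_ u2 _] : unif_Cr 0 B (fun u => 'D_(bv i) (h u)) by case: r Hu {IH H} => [|r] [].
  have u1 y : B y -> {within I01, continuous (fun u => 'D_(bv i) (h u) y)}.
    by move=> By; case: r Hu {IH H} => [|r] [u1 _ _]; exact: u1.
  have [d d0 dB] := open_ball_sub oB Bx.
  apply: is_derive_cvg => e e0; have e2 : 0 < e / 2 by lra.
  have [d' d'0 Hd'] := u2 x Bx _ e2.
  have dd0 : 0 < Num.min d d' by rewrite lt_min d0.
  near=> s.
  have s0 : s != 0 by near: s; exact: nbhs_dnbhs_neq.
  have sd : `|s| < Num.min d d' by near: s; exact: dnbhs0_lt.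
  have [sd1 sd2] : `|s| < d /\ `|s| < d' by apply/andP; rewrite -lt_min.
  have Bs (t : R) : `|t| <= `|s| -> B (x + t *: bv i).
    by move=> ts; apply/dB/ball_basis/(le_lt_trans ts).
  rewrite -int01B; [|exact/c1/Bs|exact: c1].
  have cq : {within I01, continuous (fun u => h u (x + s *: bv i) - h u x)}.
    by move=> u; apply: continuousB; apply: c1 => //; exact: Bs.
  rewrite -int01Z // -int01B; last exact: u1; last first.
    exact: within_continuousZ.
  apply: le_lt_trans (_ : e / 2 < e); last by lra.
  apply: int01_bound.
    by apply: within_continuousB; [exact: within_continuousZ|exact: u1].
  move=> u Iu.
  have dline (t : R) : `|t| <= `|s| ->
      is_derive t 1 (fun t : R => h u (x + t *: bv i)) ('D_(bv i) (h u) (x + t *: bv i)).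
    by move=> ts; apply/is_derive_along/derivableP/Hd/Bs.
  have [t ts ->] : exists2 t : R, `|t| <= `|s| & s^-1 * (h u (x + s *: bv i) - h u x) =
      'D_(bv i) (h u) (x + t *: bv i).
    have cont (a b : R) : (forall t : R, t \in `[a, b] -> `|t| <= `|s|) ->
        {within `[a, b], continuous (fun t : R => h u (x + t *: bv i))}.
      move=> ab; apply: derivable_within_continuous => t tab.
      by have [] := dline t (ab t tab).
    have [sp|sn] := ltP 0 s.
      have ab (t : R) : t \in `[0, s] -> `|t| <= `|s|.
        by rewrite in_itv /= => /andP[? ?]; rewrite !ger0_norm // ltW.
      have [||c cs E] := @MVT R (fun t : R => h u (x + t *: bv i))
        (fun t => 'D_(bv i) (h u) (x + t *: bv i)) 0 s sp.
      - by move=> t /subset_itv_oo_cc ts; exact/dline/ab.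
      - exact: cont.
      exists c; first exact/ab/subset_itv_oo_cc.
      by move: E; rewrite scale0r addr0 subr0 => ->; rewrite mulrC mulfK.
    have {}sn : s < 0 by rewrite lt_neqAle s0.
    have ab (t : R) : t \in `[s, 0] -> `|t| <= `|s|.
      by rewrite in_itv /= => /andP[? ?]; rewrite !ler0_norm ?lerN2 // ltW.
    have [||c cs E] := @MVT R (fun t : R => h u (x + t *: bv i))
      (fun t => 'D_(bv i) (h u) (x + t *: bv i)) s 0 sn.
    - by move=> t /subset_itv_oo_cc ts; exact/dline/ab.
    - exact: cont.
    exists c; first exact/ab/subset_itv_oo_cc.
    move: E; rewrite scale0r addr0 sub0r => E.
    have -> : h u (x + s *: bv i) - h u x = 'D_(bv i) (h u) (x + c *: bv i) * s.
      by rewrite -opprB E mulrN opprK.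
    by rewrite mulrC mulfK.
  by apply/ltW/Hd' => //; apply: ball_basis; exact: le_lt_trans ts _.
split=> // i; split; first by move=> x Bx; have [] := der i x Bx.
have [_ Hu] := H i; apply: Cr_eq (IH _ Hu) => // x Bx.
by have [_ ->] := der i x Bx.
Unshelve. all: by end_near. Qed.

End ParameterIntegralSmooth.

(** * Hadamard's lemma *)

Section Hadamard.
Variables (R : realType) (n : nat).
Local Notation V := 'rV[R]_n.
Local Notation I01 := (`[0, 1]%classic : set R).
Local Notation bv i := (@basis_vec R n i).
Implicit Types (W B : set V) (f g : V -> R) (h : R -> V -> R).

Lemma unif_Cr_eq r B h h' : open B -> (forall u x, I01 u -> B x -> h u x = h' u x) ->
  unif_Cr r B h -> unif_Cr r B h'.
Proof.
move=> oB; elim: r h h' => [|r IH] h h' E [c1 c2 H].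
all: have c1' x : B x -> {within I01, continuous (h'^~ x)}
  by move=> Bx; apply: subspace_eq_continuous (c1 x Bx) => u /set_mem Iu; exact: E.
all: have c2' x : B x -> forall e : R, 0 < e -> exists2 d : R, 0 < d &
    forall x', ball x d x' -> forall u, I01 u -> `|h' u x' - h' u x| < e
  by move=> Bx e e0; have [d d0 Hd] := c2 x Bx e e0; have [d' d'0 dB] := open_ball_sub oB Bx;
     exists (Num.min d d') => [|x' xx' u Iu]; [by rewrite lt_min d0|];
     rewrite -!E //; [apply: Hd => //; apply: le_ball xx'; rewrite ge_min lexx
                     |apply: dB; apply: le_ball xx'; rewrite ge_min lexx orbT].
  by split.
split=> // i; have [Hd Hu] := H i.
have near_E u x : I01 u -> B x -> \near x, h u x = h' u x.
  by move=> Iu Bx; apply: (open_near_eq oB Bx) => y; exact: E.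
split; first by move=> u x Iu Bx; apply: near_eq_derivable (near_E u x Iu Bx) (Hd u x Iu Bx).
apply: IH Hu => u x Iu Bx; exact: near_eq_derive (near_E u x Iu Bx).
Qed.

(* The coordinates before [i] are those of [x], the coordinates after [i] are those of [q],
   and the [i]-th one moves from [q] to [x]. *)
Definition hpath (q : V) (i : 'I_n) (u : R) (x : V) : V :=
  \row_j (if (j < i)%N then x 0 j else if j == i then q 0 j + u * (x 0 j - q 0 j) else q 0 j).

(** The rate at which the [j]-th coordinate of the path follows that of its end point. *)
Definition hslope (i j : 'I_n) (u : R) : R :=
  if (j < i)%N then 1 else if j == i then u else 0.

Lemma hpath_shift q i u x j (s : R) :
  hpath q i u (x + s *: bv j) = hpath q i u x + (hslope i j u * s) *: bv j.
Proof.
apply/rowP => l; rewrite /hslope !mxE eqxx /=.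
case: (eqVneq l j) => [->|lj]; last by rewrite /= !mulr0 !addr0.
rewrite /= !mulr1; case: ifP => _; first by rewrite mul1r.
by case: ifP => _; [ring|rewrite mul0r addr0].
Qed.

Lemma hpath_time q i u x (s : R) :
  hpath q i (u + s) x = hpath q i u x + ((x 0 i - q 0 i) * s) *: bv i.
Proof.
apply/rowP => l; rewrite !mxE eqxx /=.
case: (eqVneq l i) => [->|li]; last by rewrite /= !mulr0 addr0.
by rewrite /= ltnn; ring.
Qed.

Lemma hpath_lip q i u x x' (d : R) : I01 u -> ball x d x' ->
  ball (hpath q i u x) d (hpath q i u x').
Proof.
rewrite /= in_itv /= => /andP[u0 u1] [d0 xx']; split=> // a j; rewrite !mxE.
have := xx' 0 j; rewrite /ball /=; case: ifP => // _; case: ifP => _; last first.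
  by rewrite subrr normr0.
move=> H; have -> : q 0 j + u * (x 0 j - q 0 j) - (q 0 j + u * (x' 0 j - q 0 j)) =
  u * (x 0 j - x' 0 j) by ring.
by rewrite normrM ger0_norm //; apply: le_lt_trans H; rewrite ler_piMl.
Qed.

Lemma hpath_ball q i u x (d : R) : I01 u -> ball q d x -> ball q d (hpath q i u x).
Proof.
move=> Iu qx; have := hpath_lip q i Iu qx.
rewrite (_ : hpath q i u q = q) //; apply/rowP => j; rewrite mxE.
by case: ifP => // _; case: ifP => // _; rewrite subrr mulr0 addr0.
Qed.

Lemma hpath_continuous q i x : continuous (fun u : R => hpath q i u x).
Proof.
move=> u; have -> : (fun u : R => hpath q i u x) =
    (fun u : R => hpath q i 0 x + u *: ((x 0 i - q 0 i) *: bv i)).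
  by apply/funext => v; rewrite -{1}[v]add0r hpath_time scalerA mulrC.
apply: (@continuousD _ _ _ (fun=> hpath q i 0 x) (fun u : R => u *: _) u).
  exact: cst_continuous.
exact: scalel_continuous.
Qed.

Lemma closed_ball_compact (q : V) (d : R) : 0 < d -> compact (closed_ball q d).
Proof.
move=> d0; apply: bounded_closed_compact; last exact: closed_ball_closed.
rewrite closed_ballE //; exists (`|q| + d); split; first by rewrite num_real.
move=> M HM x /= qx; apply: le_trans (ltW HM).
by rewrite -[x](subrKC q) (le_trans (ler_normD _ _)) // lerD2l distrC.
Qed.

Lemma sub_closed_ball (q : V) (d : R) : ball q d `<=` closed_ball q d.
Proof. exact: subset_closed_ball. Qed.

(** The prefactor [a * u ^+ m] makes the family stable under partial derivatives: deriving in the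
    moving coordinate brings out a factor [u], in an earlier one a factor 1, in a later one a factor
    0, as recorded by [a'] and [m']. *)
Lemma unif_Cr_hpath W (q : V) (d : R) i r (a : R) (m : nat) f : 0 < d -> closed_ball q d `<=` W ->
  open W -> smooth W f ->
  unif_Cr r (ball q d) (fun u x => a * u ^+ m * f (hpath q i u x)).
Proof.
move=> d0 KW oW; have oB : open (ball q d) := ball_open _ _.
have BW u x : I01 u -> ball q d x -> W (hpath q i u x).
  by move=> Iu qx; apply/KW/sub_closed_ball/hpath_ball.
have c0 f' m' a' : smooth W f' -> unif_Cr 0 (ball q d) (fun u x => a' * u ^+ m' * f' (hpath q i u x)).
  move=> sf; have [cf _] := sf 0%N; split=> // x qx.
    apply: continuous_in_subspaceT => u /set_mem Iu.
    apply: (@continuousM R R (fun u => a' * u ^+ m') (fun u => f' (hpath q i u x))).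
      apply: (@continuousM R R (fun=> a') (fun u => u ^+ m')); first exact: cst_continuous.
      exact: exprn_continuous.
    by apply: (@continuous_comp _ _ _ (fun u => hpath q i u x) f');
      [exact: hpath_continuous|exact/cf/BW].
  move=> e e0; have e1 : 0 < e / (`|a'| + 1) by rewrite divr_gt0 // ltr_wpDl.
  have [|d' d'0 Hd] := @unif_cont_compact _ _ _ f' (closed_ball_compact (q := q) d0) _ _ e1.
    by move=> y /KW; exact: cf.
  exists d' => // x' xx' u Iu; rewrite -mulrBr normrM.
  have H1 : `|f' (hpath q i u x') - f' (hpath q i u x)| < e / (`|a'| + 1).
    by apply: Hd; [exact/sub_closed_ball/hpath_ball|exact: hpath_lip].
  have H2 : `|a' * u ^+ m'| <= `|a'|.
    move: Iu; rewrite /= in_itv /= => /andP[u0 u1].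
    by rewrite normrM normrX (ger0_norm u0) ler_piMr // exprn_ile1.
  have a1 : 0 < `|a'| + 1 by rewrite ltr_wpDl.
  move: H1; rewrite ltr_pdivlMr // => H1; apply: le_lt_trans H1.
  by rewrite mulrC ler_wpM2l // (le_trans H2) // lerDl.
elim: r a m f => [|r IH] a m f sf; first exact: c0.
have [c1 c2 _] := c0 f m a sf.
have der u x j : I01 u -> ball q d x -> is_derive x (bv j) (fun x => a * u ^+ m * f (hpath q i u x))
    (a * u ^+ m * (hslope i j u * 'D_(bv j) f (hpath q i u x))).
  move=> Iu qx; have [_ /(_ j)[df _]] := sf 1%N.
  have H := is_derive_rescale (hpath_shift q i u x j) (derivableP (df _ (BW _ _ Iu qx))).
  exact: (is_deriveZ (a * u ^+ m) H).
split=> // j; split; first by move=> u x Iu qx; have [] := der u x j Iu qx.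
have sfj : smooth W ('D_(bv j) f) by move=> r'; have [_ /(_ j)[_ +]] := sf r'.+1.
pose a' : R := if (j < i)%N || (j == i) then a else 0.
pose m' : nat := if (j < i)%N then m else m.+1.
apply: unif_Cr_eq (IH a' m' _ sfj) => // u x Iu qx.
have [_ ->] := der u x j Iu qx; rewrite /hslope /a' /m'.
case: ltnP => _ /=; first by ring.
by case: eqP => _; rewrite ?exprS; ring.
Qed.

(** The segment from [q] to [x] is replaced by a path that moves one coordinate at a time, so that
    each increment of [f] is the integral of a single partial derivative. The chain rule in several
    variables is thereby avoided; it is deduced from this lemma afterwards. *)
Lemma hadamard W (q : V) (d : R) f : 0 < d -> closed_ball q d `<=` W -> open W -> smooth W f ->
  exists2 g : 'I_n -> V -> R, forall i, smooth (ball q d) (g i) &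
    forall x, ball q d x -> f x = f q + \sum_i (x 0 i - q 0 i) * g i x.
Proof.
move=> d0 KW oW sf.
have sfj j : smooth W ('D_(bv j) f) by move=> r'; have [_ /(_ j)[_ +]] := sf r'.+1.
pose h i (u : R) x := 1 * u ^+ 0 * 'D_(bv i) f (hpath q i u x).
have Hh i r := unif_Cr_hpath i r 1 0 d0 KW oW (sfj i).
exists (fun i x => int01 ((h i)^~ x)).
  by move=> i r; apply: Cr_int01; [exact: ball_open|exact: Hh].
(* Corners of the path from [q] to [x]: at [P k] the first [k] coordinates have already moved. *)
move=> x qx; pose P (k : nat) : V := \row_j (if (j < k)%N then x 0 j else q 0 j).
have -> : f x = f (P n) by congr f; apply/rowP => j; rewrite mxE ltn_ord.
have -> : f q = f (P 0%N) by congr f; apply/rowP => j; rewrite mxE.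
rewrite -[LHS](subrKC (f (P 0%N))); congr (_ + _).
rewrite -(@telescope_sumr _ 0 n (fun k => f (P k))) // big_mkord; apply: eq_bigr => i _.
have [c1 _ _] := Hh i 0%N; rewrite -int01Z; last exact: c1.
have -> : f (P i.+1) = f (hpath q i 1 x).
  congr f; apply/rowP => j; rewrite !mxE ltnS leq_eqVlt.
  by case: ltngtP => //= ji; rewrite ?orbT // -val_eqE /= ?ji ?eqxx ?mul1r ?subrKC // gtn_eqF.
have -> : f (P i) = f (hpath q i 0 x).
  congr f; apply/rowP => j; rewrite !mxE; case: ifP => // _.
  by case: ifP => // _; rewrite mul0r addr0.
symmetry; apply: (@int01_FTC _ (fun u => f (hpath q i u x))).
  exact/within_continuousZ/c1.
move=> u Iu; rewrite /h expr0 !mul1r.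
have [_ /(_ i)[df _]] := sf 1%N.
have BW : W (hpath q i u x) by apply/KW/sub_closed_ball/hpath_ball.
apply: (is_derive_rescale (A := fun u => hpath q i u x) _ (derivableP (df _ BW))) => s.
by rewrite [s *: _]mulr1; exact: hpath_time.
Qed.

End Hadamard.

(** * The chain rule in several variables and smoothness of composites *)

Section ChainRule.
Variable R : realType.

(** As [u x = 0], the difference quotient of the product is that of [u] times a value of [g], so
    continuity of [g] suffices. *)
Lemma is_derive_mul_vanish (V : normedModType R) (u g : V -> R) (x v : V) (l : R) :
  is_derive x v u l -> u x = 0 -> {for x, continuous g} ->
  is_derive x v (fun y => u y * g y) (l * g x).
Proof.
move=> /is_derive_line[du Du] ux cg; apply/is_derive_line.
pose G (h : R) : R := u (x + h *: v).
have GE : (fun h : R => h^-1 *: ((G \o shift 0) (h *: (1 : R)) - G 0)) = (fun h => h^-1 * G h).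
  by apply/funext => h; rewrite /G /= [_ *: 1]mulr1 scale0r !addr0 ux subr0.
have cU : (fun h => h^-1 * G h) @ 0^' --> (l : R) by rewrite -Du -GE; exact: du.
have cG : (fun h : R => g (x + h *: v)) @ 0^' --> (g x : R).
  have cl : {for (0 : R), continuous (fun h : R => x + h *: v)}.
    apply: (@continuousD _ _ _ (fun=> x) (fun h : R => h *: v)).
      exact: cst_continuous.
    exact: scalel_continuous.
  have : {for (0 : R), continuous (fun h : R => g (x + h *: v))}.
    by apply: (continuous_comp cl); rewrite scale0r addr0.
  rewrite /prop_for /continuous_at scale0r addr0 => H.
  by apply: cvg_trans H; apply: cvg_app; exact: cvg_within.
pose H (h : R) : R := u (x + h *: v) * g (x + h *: v).
have key : (fun h : R => h^-1 *: ((H \o shift 0) (h *: (1 : R)) - H 0)) @ 0^' --> (l * g x : R).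
  rewrite (_ : (fun h => _) = (fun h : R => (h^-1 * G h) * g (x + h *: v))); last first.
    apply/funext => h; rewrite /H /G /= [_ *: 1]mulr1 scale0r !addr0 ux mul0r subr0.
    by rewrite [LHS]mulrA.
  exact: cvgM cU cG.
have dd : derivable H 0 1 := cvgP _ key.
by apply: DeriveDef; [exact: dd|apply: cvg_lim key].
Qed.

Lemma continuous_rV (T : topologicalType) n (b : T -> 'rV[R]_n) x :
  (forall j, {for x, continuous (fun y => b y 0 j)}) -> {for x, continuous b}.
Proof.
move=> cb; apply/cvg_ballP => e e0; near=> y; split=> // i j; rewrite (ord1 i).
move: i j => _; near: y; apply: filter_forall => j.
by have /cvg_ballP/(_ e e0) := cb j.
Unshelve. all: by end_near. Qed.

Variable n : nat.
Local Notation V := 'rV[R]_n.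
Local Notation bv i := (@basis_vec R n i).

Lemma smooth_D (W : set V) f i : smooth W f -> smooth W ('D_(bv i) f).
Proof. by move=> sf r; have [_ /(_ i)[_ +]] := sf r.+1. Qed.

Lemma smooth_derivable (W : set V) f i x : smooth W f -> W x -> derivable f x (bv i).
Proof. by move=> sf Wx; have [_ /(_ i)[+ _]] := sf 1%N; exact. Qed.

Lemma smooth_continuous (W : set V) f x : smooth W f -> W x -> {for x, continuous f}.
Proof. by move=> sf Wx; have [+ _] := sf 0%N; exact. Qed.

Lemma sub_closed_ball_open (W : set V) q : open W -> W q ->
  exists2 d : R, 0 < d & closed_ball q d `<=` W.
Proof.
move=> oW Wq; have [d d0 dW] := open_ball_sub oW Wq.
have d2 : 0 < d / 2 by lra.
exists (d / 2) => //; apply: subset_trans dW => y; rewrite closed_ballE //= => qy.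
by rewrite -ball_normE /=; apply: le_lt_trans qy _; lra.
Qed.

Lemma is_derive_near_eq (U : normedModType R) (f g : U -> R) (x v : U) (l : R) :
  (\forall y \near x, f y = g y) -> is_derive x v f l -> is_derive x v g l.
Proof.
move=> fg [df Df]; apply: DeriveDef; first exact: near_eq_derivable fg df.
by rewrite -Df; symmetry; exact: near_eq_derive.
Qed.

Lemma coord_is_derive (x v : V) i : is_derive x v (fun y : V => y 0 i) (v 0 i).
Proof.
apply: is_derive_cvg => e e0; near=> h.
have h0 : h != 0 by near: h; exact: nbhs_dnbhs_neq.
by rewrite !mxE addrAC subrr add0r mulrA mulVf // mul1r subrr normr0.
Unshelve. all: by end_near. Qed.

(** Hadamard's lemma at [b x] writes [f \o b] as a constant plus products whose first factor
    vanishes at [x]; [is_derive_mul_vanish] differentiates these. *)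
Lemma is_derive_chain (U : normedModType R) (W : set V) f (b : U -> V) x v (l : 'I_n -> R) :
  open W -> smooth W f -> W (b x) -> {for x, continuous b} ->
  (forall j, is_derive x v (fun y => b y 0 j) (l j)) ->
  is_derive x v (f \o b) (\sum_j l j * 'D_(bv j) f (b x)).
Proof.
move=> oW sf Wx cb db; have [d d0 KW] := sub_closed_ball_open oW Wx.
have [g sg gE] := hadamard d0 KW oW sf; set q := b x in Wx KW sg gE *.
have qq : ball q d q := ballxx q d0.
have cg j : {for q, continuous (g j)} := smooth_continuous (sg j) qq.
have key (U' : normedModType R) (b' : U' -> V) (x' v' : U') (l' : 'I_n -> R) :
    b' x' = q -> {for x', continuous b'} ->
    (forall j, is_derive x' v' (fun y => b' y 0 j) (l' j)) ->
    is_derive x' v' (f \o b') (\sum_j l' j * g j q).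
  move=> bq cb' db'.
  have H : is_derive x' v' (fun y => f q + \sum_j (b' y 0 j - q 0 j) * g j (b' y))
      (\sum_j l' j * g j q).
    have Hj j : is_derive x' v' (fun y => (b' y 0 j - q 0 j) * g j (b' y)) (l' j * g j q).
      rewrite -[in g j q]bq; apply: (is_derive_mul_vanish (u := fun y => b' y 0 j - q 0 j)).
      - have := is_deriveB (db' j) (is_derive_cst (q 0 j : R^o) x' v').
        by rewrite subr0.
      - by rewrite bq subrr.
      - by apply: continuous_comp; rewrite ?bq.
    have := is_deriveD (is_derive_cst (f q : R^o) x' v') (is_derive_sum Hj).
    rewrite add0r; rewrite (_ : cst _ + _ = (fun y => f q + \sum_j (b' y 0 j - q 0 j) * g j (b' y))) //.
    by apply/funext => y; rewrite !fctE fct_sumE.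
  apply: is_derive_near_eq H.
  have : \forall y \near x', ball q d (b' y) by rewrite -bq in cb' *; apply: cb'; exact: nbhsx_ballx.
  by apply: filterS => y qy; rewrite /= -gE.
(* The same formula applied to the identity map identifies the cofactors at [q] as the partial
   derivatives. *)
have gD j : g j q = 'D_(bv j) f q.
  have := key V id q (bv j) _ erefl _ (fun i => coord_is_derive q (bv j) i).
  move=> /(_ cvg_id)[_ E]; rewrite -[RHS]/('D_(bv j) (f \o id) q) E.
  rewrite (bigD1 j) //= mxE !eqxx mul1r big1 ?addr0 // => i ij.
  by rewrite mxE eqxx (negbTE ij) mul0r.
by under eq_bigr do rewrite -gD; exact: key.
Qed.

Lemma Cr_comp m (U : set 'rV[R]_m) (W : set V) r f (b : 'rV[R]_m -> V) :
  open U -> open W -> smooth W f -> (forall x, U x -> W (b x)) ->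
  (forall j, Cr r U (fun x => b x 0 j)) -> Cr r U (f \o b).
Proof.
move=> oU oW + UW; elim: r f => [|r IH] f sf Cb.
all: have cb x : U x -> {for x, continuous b}
  by move=> Ux; apply: continuous_rV => j; have [+ _] := Cb j; exact.
all: have cfb x : U x -> {for x, continuous (f \o b)}
  by move=> Ux; apply: continuous_comp; [exact: cb|exact: (smooth_continuous sf (UW x Ux))].
  by split.
split=> // i.
have der x : U x -> is_derive x (basis_vec R i) (f \o b)
    (\sum_j 'D_(basis_vec R i) (fun x => b x 0 j) x * 'D_(bv j) f (b x)).
  move=> Ux; apply: is_derive_chain oW sf (UW x Ux) (cb x Ux) _ => j.
  by apply: derivableP; have [_ /(_ i)[+ _]] := Cb j; exact.
split; first by move=> x Ux; have [] := der x Ux.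
have CS : Cr r U (fun x => \sum_j 'D_(basis_vec R i) (fun x => b x 0 j) x * 'D_(bv j) f (b x)).
  apply: Cr_sum => // j; apply: CrM => //; first by have [_ /(_ i)[_ +]] := Cb j.
  by apply: (IH _ (smooth_D j sf)) => j'; exact: CrS.
by apply: Cr_eq CS => // x Ux; have [_ ->] := der x Ux.
Qed.

Lemma CrV r (U : set V) f : open U -> (forall x, U x -> f x != 0) -> Cr r U f ->
  Cr r U (fun x => (f x)^-1).
Proof.
move=> oU nf; elim: r => [|r IH] Cf; have [cf df] := Cf.
all: have cV x : U x -> {for x, continuous (fun x => (f x)^-1)}
  by move=> Ux; apply: (@continuousV _ _ f x); [exact: nf|exact: cf].
  by split.
split=> // i; have [dfi Cfi] := df i; split.
  by move=> x Ux; apply: derivableV; [exact: nf|exact: dfi].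
have := CrM oU (CrC r U (-1)) (CrM oU (CrM oU (IH (CrS Cf)) (IH (CrS Cf))) Cfi).
apply: Cr_eq => // x Ux; rewrite deriveV; [|exact: nf|exact: dfi].
by rewrite -exprVn expr2 mulN1r scaleNr.
Qed.

Lemma smoothV (U : set V) f : open U -> (forall x, U x -> f x != 0) -> smooth U f ->
  smooth U (fun x => (f x)^-1).
Proof. by move=> oU nf sf r; exact: CrV. Qed.

Lemma Cr_prod r (U : set V) (I : Type) (s : seq I) (F : I -> V -> R) :
  open U -> (forall i, Cr r U (F i)) -> Cr r U (fun x => \prod_(i <- s) F i x).
Proof.
move=> oW CF; elim: s => [|i s IH].
  by apply: Cr_eq (CrC r U 1) => // x _; rewrite big_nil.
by apply: Cr_eq (CrM oW (CF i) IH) => // x _; rewrite big_cons.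
Qed.

End ChainRule.

(** * Bump functions and Gronwall's inequality *)

Section Bump.
Variable R : realType.

(** The function [x^-k exp(-1/x)] extended by 0. The exponent [k] is kept general because the
    derivative of one member of the family is a combination of two others, so all are proved smooth
    together. *)
Definition flat (k : nat) (x : R) : R := if 0 < x then x^-1 ^+ k * expR (- x^-1) else 0.

Lemma flat_ge0 k x : 0 <= flat k x.
Proof. by rewrite /flat; case: ltP => // x0; rewrite mulr_ge0 ?expR_ge0 // exprn_ge0 // invr_ge0 ltW. Qed.

Lemma flat_gt0 x : 0 < x -> 0 < flat 0 x.
Proof. by move=> x0; rewrite /flat x0 mul1r expR_gt0. Qed.

(** The exponential at [x^-1] dominates the term of degree [k.+1] of its series. Applied with
    [k.+1], the bound gives the derivative 0 at the origin. *)
Lemma flat_bound k x : flat k x <= (k.+1)`!%:R * `|x|.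
Proof.
rewrite /flat; case: ltP => x0; last by rewrite mulr_ge0.
have xi : 0 <= x^-1 by rewrite invr_ge0 ltW.
have := expR_ge1Dxn k xi; rewrite expRN gtr0_norm // => H.
have f0 : 0 < (k.+1)`!%:R :> R by rewrite ltr0n fact_gt0.
have H2 : x^-1 ^+ k.+1 / (k.+1)`!%:R <= expR x^-1 by apply: le_trans H; rewrite lerDr.
rewrite ler_pdivrMr ?expR_gt0 //.
move: H2; rewrite ler_pdivrMr // => H2.
have -> : x^-1 ^+ k = x * x^-1 ^+ k.+1 by rewrite exprS mulrA mulfV ?mul1r // gt_eqF.
by rewrite [_ * x]mulrC -mulrA ler_wpM2l ?(ltW x0) // mulrC.
Qed.

Lemma flat_is_derive k (x : R) : is_derive x 1 (flat k) (flat k.+2 x - k%:R * flat k.+1 x).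
Proof.
have [x0|x0|->] := ltrgtP x 0.
- have -> : flat k.+2 x - k%:R * flat k.+1 x = 0.
    by rewrite /flat ltNge (ltW x0) /= mulr0 subr0.
  apply: is_derive_near_eq (is_derive_cst (0 : R^o) x 1).
  have : \forall y \near x, y < 0 by exact: lt_nbhsl.
  by apply: filterS => y y0; rewrite /flat ltNge (ltW y0).
- have xn : x != 0 by rewrite gt_eqF.
  have dV : is_derive x 1 (fun y : R => y^-1) (- x^-1 ^+ 2).
    have := is_deriveV xn (is_derive_id x (1 : R)).
    by rewrite [_ *: 1]mulr1 exprVn.
  have dE : is_derive x 1 (fun y : R => expR (- y^-1)) (expR (- x^-1) * x^-1 ^+ 2).
    have := is_derive1_comp (is_derive_expR _) (is_deriveN dV).
    by rewrite opprK.
  have := is_deriveM (is_deriveX k dV) dE.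
  set l := (_ *: _ + _ *: _) => H.
  have <- : l = flat k.+2 x - k%:R * flat k.+1 x.
    rewrite /l /flat x0 /GRing.scale /= !fctE.
    by case: k {H l} => [|k]; rewrite /= ?expr0 ?exprS; ring.
  apply: is_derive_near_eq H.
  have : \forall y \near x, 0 < y by exact: lt_nbhsr.
  by apply: filterS => y y0; rewrite /flat y0 !fctE.
have -> : flat k.+2 0 - k%:R * flat k.+1 0 = 0 by rewrite /flat ltxx mulr0 subr0.
apply: is_derive_cvg => e e0; pose C : R := (k.+2)`!%:R.
have C0 : 0 < C by rewrite ltr0n fact_gt0.
near=> h; have h0 : h != 0 by near: h; exact: nbhs_dnbhs_neq.
have hd : `|h| < e / C by near: h; apply: dnbhs0_lt; rewrite divr_gt0.
have -> : h^-1 * (flat k (0 + h *: 1) - flat k 0) - 0 = flat k.+1 h.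
  rewrite subr0 add0r [_ *: 1]mulr1 /flat ltxx subr0.
  by case: ifP => _; [rewrite exprS mulrA|rewrite mulr0].
rewrite ger0_norm ?flat_ge0 //; apply: le_lt_trans (flat_bound _ _) _.
by rewrite mulrC -ltr_pdivlMr.
Unshelve. all: by end_near. Qed.

Lemma flat_continuous k : continuous (flat k).
Proof. by move=> x; apply: derivable1_continuous; have [] := flat_is_derive k x. Qed.

Variable n : nat.
Local Notation V := 'rV[R]_n.

Lemma is_derive_comp_flat k (f : V -> R) (x v : V) (l : R) : is_derive x v f l ->
  is_derive x v (flat k \o f) ((flat k.+2 (f x) - k%:R * flat k.+1 (f x)) * l).
Proof.
move=> /is_derive_line H; apply/is_derive_line.
apply: (@is_derive1_comp _ (flat k) (fun h : R => f (x + h *: v))) => //.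
by rewrite scale0r addr0; exact: flat_is_derive.
Qed.

Lemma Cr_flat r k (U : set V) (f : V -> R) : open U -> Cr r U f -> Cr r U (flat k \o f).
Proof.
move=> oU; elim: r k => [|r IH] k Cf; have [cf df] := Cf.
all: have cV x : U x -> {for x, continuous (flat k \o f)}
  by move=> Ux; apply: continuous_comp; [exact: cf|exact: flat_continuous].
  by split.
split=> // i; have [dfi Cfi] := df i.
have der x (Ux : U x) := is_derive_comp_flat k (derivableP (dfi x Ux)).
split; first by move=> x Ux; have [] := der x Ux.
have H := CrM oU (CrD oU (IH k.+2 (CrS Cf)) (CrM oU (CrC r U (- k%:R)) (IH k.+1 (CrS Cf)))) Cfi.
by apply: Cr_eq H => // x Ux; have [_ ->] := der x Ux; rewrite mulNr.
Qed.

(** Balls are cubes here, so a product of one-variable cutoffs [a / (a + b)] works: [b] vanishes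
    when the distance in that coordinate is at most [d], [a] when it is at least [2 * d], and they
    never vanish together. Squared distances keep everything smooth. *)
Lemma bump (q : V) (d : R) : 0 < d -> exists rho : V -> R,
  [/\ smooth setT rho, forall x, ball q d x -> rho x = 1
    & forall x, ~ closed_ball q (2 * d) x -> rho x = 0].
Proof.
move=> d0; pose s (i : 'I_n) (x : V) := (x 0 i - q 0 i) ^+ 2.
pose a i x := flat 0 (4 * d ^+ 2 - s i x).
pose b i x := flat 0 (s i x - d ^+ 2).
pose phi i x := a i x * (a i x + b i x)^-1.
have ab0 i x : a i x + b i x != 0.
  rewrite gt_eqF // /a /b; have dd : 0 < d ^+ 2 by rewrite exprn_gt0.
  have [sd|sd] := ltP (s i x) (4 * d ^+ 2).
    by apply: ltr_wpDr (flat_ge0 _ _) (flat_gt0 _); rewrite subr_gt0.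
  by apply: ltr_wpDl (flat_ge0 _ _) (flat_gt0 _); rewrite subr_gt0; lra.
have sE i : smooth setT (s i).
  move=> r; have H := CrD openT (Cr_coord r i openT) (CrC r setT (- q 0 i)).
  exact: (CrM openT H H).
have sa i : smooth setT (a i).
  move=> r; apply: (Cr_flat (f := fun x => 4 * d ^+ 2 - s i x) _ openT).
  apply: Cr_eq (CrD openT (CrC r setT (4 * d ^+ 2)) (CrM openT (CrC r setT (-1)) (sE i r))) => //.
    exact: openT.
  by move=> x _; rewrite mulN1r.
have sb i : smooth setT (b i).
  move=> r; apply: (Cr_flat (f := fun x => s i x - d ^+ 2) _ openT).
  exact: CrD openT (sE i r) (CrC r setT _).
exists (fun x => \prod_i phi i x); split.
- move=> r; apply: Cr_prod => [|i]; first exact: openT.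
  apply: CrM; [exact: openT|exact: sa|]; apply: CrV => //; first exact: openT.
  by apply: CrD; [exact: openT|exact: sa|exact: sb].
- move=> x [_ qx]; apply: big1 => i _; rewrite /phi.
  have bi0 : b i x = 0.
    rewrite /b /flat ifF //; apply/negbTE; rewrite -leNgt subr_le0 /s.
    rewrite -real_normK ?num_real // lerXn2r ?nnegrE ?(ltW d0) //.
    by rewrite distrC; apply/ltW/(qx 0 i).
  by have := ab0 i x; rewrite bi0 addr0 => ai; rewrite mulfV.
- move=> x; rewrite closed_ballE ?mulr_gt0 //= => nq.
  have [i Hi] : exists i, 2 * d < `|q 0 i - x 0 i|.
    apply: contrapT => H; apply: nq; rewrite /closed_ball_ /= [leLHS]mx_normrE.
    apply/bigmax_leP; split; first by lra.
    move=> [u j] _ /=; rewrite (ord1 u) !mxE leNgt; apply/negP => h; apply: H; by exists j.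
  rewrite (bigD1 i) //= /phi; have -> : a i x = 0; last by rewrite !mul0r.
  rewrite /a /flat ifF //; apply/negbTE; rewrite -leNgt subr_le0 /s.
  rewrite -[leRHS]real_normK ?num_real // distrC.
  have -> : 4 * d ^+ 2 = (2 * d) ^+ 2 by ring.
  by rewrite lerXn2r ?nnegrE ?mulr_ge0 ?(ltW d0) // ltW.
Qed.

(** With the integrating factor [exp(- K t)], the function [E] becomes nonincreasing. *)
Lemma gronwall (E E' : R -> R) (K a b : R) : a <= b ->
  (forall t, a <= t <= b -> is_derive t 1 E (E' t)) ->
  (forall t, a <= t <= b -> E' t <= K * E t) -> E a = 0 -> E b <= 0.
Proof.
move=> ab dE HE E0.
pose F t := E t * expR (- (K * t)).
have dF t : a <= t <= b -> is_derive t 1 F ((E' t - K * E t) * expR (- (K * t))).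
  move=> tab.
  have dl : is_derive t 1 (fun t : R => - (K * t)) (- K).
    have := is_deriveN (is_deriveZ K (is_derive_id t (1 : R^o))).
    by rewrite [_ *: 1]mulr1.
  have := is_deriveM (dE t tab) (is_derive1_comp (is_derive_expR _) dl).
  by rewrite /GRing.scale /= => H; apply: is_derive_eq; rewrite /comp; ring.
suff : F b <= F a.
  by rewrite /F E0 mul0r pmulr_lle0 // expR_gt0.
have I t : t \in `[a, b] -> a <= t <= b by rewrite in_itv.
apply: (@ler0_derive1_le_cc _ F a b) => //.
- by move=> t /subset_itv_oo_cc/I tab; have [] := dF t tab.
- move=> t /subset_itv_oo_cc/I tab; rewrite derive1E; have [_ ->] := dF t tab.
  by rewrite pmulr_lle0 ?expR_gt0 // subr_le0 HE.
- by apply: derivable_within_continuous => t /I tab; have [] := dF t tab.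
- by rewrite in_itv /= ?lexx ?ab ?andbT.
- by rewrite in_itv /= ?lexx ?ab ?andbT.
Qed.

End Bump.

(** * Signs and splittings of multi-indices *)

Section SignedSplits.
Variables (q : nat) (deg : 'I_q -> int).
Local Notation mindex := {ffun 'I_q -> nat}.
Implicit Types a b c : mindex.

Definition mlen a : nat := (\sum_i a i)%N.
Definition munit (j : 'I_q) : mindex := [ffun i => (i == j : nat)].

Lemma mlen0 : mlen (mzero q) = 0%N.
Proof. by rewrite /mlen big1 // => i _; rewrite ffunE. Qed.

Lemma mlenD a b : mlen (madd a b) = (mlen a + mlen b)%N.
Proof. by rewrite /mlen -big_split; apply: eq_bigr => i _; rewrite ffunE. Qed.

Lemma mlen_unit j : mlen (munit j) = 1%N.
Proof.
rewrite /mlen (bigD1 j) //= ffunE eqxx big1 // => i ij.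
by rewrite ffunE (negbTE ij).
Qed.

Lemma mlen_eq0 a : (mlen a == 0%N) = (a == mzero q).
Proof.
apply/eqP/eqP => [a0|->]; last exact: mlen0.
apply/ffunP => i; rewrite ffunE; apply/eqP; rewrite -leqn0 -a0.
by rewrite /mlen (bigD1 i) //= leq_addr.
Qed.

Lemma madd0r a : madd a (mzero q) = a.
Proof. by rewrite maddC madd0. Qed.

Lemma mvalid_unit j : mvalid deg (munit j).
Proof. by apply/forallP => i; apply/implyP => _; rewrite ffunE; case: (i == j). Qed.

Lemma mdegree_unit j : mdegree deg (munit j) = deg j.
Proof.
rewrite /mdegree (bigD1 j) //= ffunE eqxx big1 ?addr0 // => i ij.
by rewrite ffunE (negbTE ij).
Qed.

(** Reindexing for the graded Leibniz rule: taking one factor of index [j] off the left part is a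
    bijection onto the splittings of [c]. *)
Lemma msplits_shift_l (c : mindex) j :
  perm_eq (seq.filter (fun p : mindex * mindex => (0 < p.1 j)%N) (msplits (madd c (munit j))))
          [seq (madd p.1 (munit j), p.2) | p <- msplits c].
Proof.
have inj : injective (fun p : mindex * mindex => (madd p.1 (munit j), p.2)).
  move=> [a b] [a' b'] /= [/ffunP E ->]; congr pair; apply/ffunP => i.
  by have := E i; rewrite !ffunE => /addIn.
apply: uniq_perm; [by rewrite filter_uniq ?msplits_uniq|by rewrite map_inj_uniq ?msplits_uniq|].
move=> [a b]; rewrite mem_filter msplitsP /=; apply/andP/mapP.
  move=> [aj /eqP/ffunP E]; exists (msub a (munit j), b) => /=.
    rewrite msplitsP; apply/eqP/ffunP => i; have := E i; rewrite !ffunE.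
    by case: eqVneq => [->|_] /=; lia.
  congr pair; apply/ffunP => i; rewrite !ffunE.
  by case: eqVneq => [->|_] /=; lia.
move=> [[a' b']]; rewrite msplitsP /= => /eqP <- [-> ->]; split.
  by rewrite !ffunE eqxx addn1.
by rewrite -!maddA [madd b' _]maddC.
Qed.

Lemma msplits_shift_r (c : mindex) j :
  perm_eq (seq.filter (fun p : mindex * mindex => (0 < p.2 j)%N) (msplits (madd c (munit j))))
          [seq (p.1, madd p.2 (munit j)) | p <- msplits c].
Proof.
have inj : injective (fun p : mindex * mindex => (p.1, madd p.2 (munit j))).
  move=> [a b] [a' b'] /= [-> /ffunP E]; congr pair; apply/ffunP => i.
  by have := E i; rewrite !ffunE => /addIn.
apply: uniq_perm; [by rewrite filter_uniq ?msplits_uniq|by rewrite map_inj_uniq ?msplits_uniq|].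
move=> [a b]; rewrite mem_filter msplitsP /=; apply/andP/mapP.
  move=> [aj /eqP/ffunP E]; exists (a, msub b (munit j)) => /=.
    rewrite msplitsP; apply/eqP/ffunP => i; have := E i; rewrite !ffunE.
    by case: eqVneq => [->|_] /=; lia.
  congr pair; apply/ffunP => i; rewrite !ffunE.
  by case: eqVneq => [->|_] /=; lia.
move=> [[a' b']]; rewrite msplitsP /= => /eqP <- [-> ->]; split.
  by rewrite !ffunE eqxx addn1.
by rewrite -!maddA.
Qed.

(** Only the parities of [mlow] and [mhigh] matter: they decide the sign picked up when a variable
    of odd degree at position [j] moves past the variables before it, or after it. *)
Definition mlow (j : 'I_q) a : nat := (\sum_(i < q | i < j) a i * absz (deg i))%N.
Definition mhigh (j : 'I_q) a : nat := (\sum_(i < q | j < i) a i * absz (deg i))%N.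

Lemma mlowD j a b : mlow j (madd a b) = (mlow j a + mlow j b)%N.
Proof. by rewrite /mlow -big_split; apply: eq_bigr => i _; rewrite ffunE mulnDl. Qed.

Lemma mlow_unit j : mlow j (munit j) = 0%N.
Proof. by rewrite /mlow big1 // => i ij; rewrite ffunE -val_eqE /= ltn_eqF. Qed.

Lemma mcross_unitl j a : mcross deg (munit j) a = (absz (deg j) * mlow j a)%N.
Proof.
rewrite /mcross (bigD1 j) //= [X in (_ + X)%N]big1 ?addn0 => [|i ij]; last first.
  by rewrite big1 // => l _; rewrite ffunE (negbTE ij) !mul0n.
by rewrite /mlow big_distrr; apply: eq_bigr => i _; rewrite ffunE eqxx mul1n.
Qed.

Lemma mcross_unitr j a : mcross deg a (munit j) = (absz (deg j) * mhigh j a)%N.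
Proof.
rewrite /mcross (exchange_big_dep predT) //= (bigD1 j) //= [X in (_ + X)%N]big1 ?addn0 => [|i ij]; last first.
  by rewrite big1 // => l _; rewrite ffunE (negbTE ij) !mul0n muln0.
rewrite /mhigh big_distrr; apply: eq_bigr => i _.
by rewrite ffunE eqxx mul1n mulnC.
Qed.

Lemma odd_mdegree_split j a : odd (absz (mdegree deg a)) =
  odd (mlow j a + a j * absz (deg j) + mhigh j a)%N.
Proof.
rewrite odd_mdegree; congr odd; rewrite (bigID (fun i : 'I_q => (i < j)%N)) /= -addnA.
congr addn; rewrite (bigD1 j) ?ltnn //=; congr addn; apply: eq_bigl => i.
by rewrite -leqNgt ltn_neqAle eq_sym andbC.
Qed.

End SignedSplits.

(** * The ring of graded power series and its left derivatives *)

Section GradedSeries.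
Variables (R : realType) (q : nat) (deg : 'I_q -> int).
Local Notation mindex := {ffun 'I_q -> nat}.
Local Notation raw := (mindex -> R^o).
Implicit Types a b c : mindex.

(** Repeated odd variables are excluded but the total degree is left free: series of all degrees
    form one ring, in which values of sections of different degrees are added and compared without
    transport. *)
Definition gser_pred : {pred raw} := fun f => `[< forall a, ~~ mvalid deg a -> f a = 0 >].

Lemma gser_pred_submod : submod_closed gser_pred.
Proof.
split; first exact/asboolP.
move=> x f g /asboolP vf /asboolP vg; apply/asboolP => a na.
by rewrite -[LHS]/(x * f a + g a) vf // vg // mulr0 addr0.
Qed.

HB.instance Definition _ := GRing.isSubmodClosed.Build R raw gser_pred gser_pred_submod.

Record gser := GSer { gc : raw; _ : gser_pred gc }.
HB.instance Definition _ := [isSub for gc].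
HB.instance Definition _ := [Choice of gser by <:].
HB.instance Definition _ := [SubChoice_isSubLmodule of gser by <:].
Implicit Types f g h : gser.

Lemma gserP f a : ~~ mvalid deg a -> gc f a = 0.
Proof. by case: f => F /= HF na; have /asboolP := HF; apply. Qed.

Definition mk_gser (f : raw) (H : forall a, ~~ mvalid deg a -> f a = 0) : gser :=
  GSer (asboolT H).

Lemma gser_eqP f g : (forall a, gc f a = gc g a) -> f = g.
Proof. by move=> E; apply/val_inj/funext. Qed.

Lemma gcD f g a : gc (f + g) a = gc f a + gc g a. Proof. by []. Qed.
Lemma gcN f a : gc (- f) a = - gc f a. Proof. by []. Qed.
Lemma gcB f g a : gc (f - g) a = gc f a - gc g a. Proof. by []. Qed.
Lemma gcZ (x : R) f a : gc (x *: f) a = x * gc f a. Proof. by []. Qed.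
Lemma gc0 a : gc 0 a = 0. Proof. by []. Qed.

Lemma gc_sum (I : Type) (s : seq I) (P : pred I) (F : I -> gser) a :
  gc (\sum_(i <- s | P i) F i) a = \sum_(i <- s | P i) gc (F i) a.
Proof. by elim/big_ind2: _ => // x y f g <- <-. Qed.

Lemma cmul_valid f g a : ~~ mvalid deg a -> cmul deg (gc f) (gc g) a = 0.
Proof. by rewrite /cmul => /negbTE ->. Qed.

Definition gsmul f g : gser := mk_gser (@cmul_valid f g).

Lemma gsone_valid a : ~~ mvalid deg a -> (a == mzero q)%:R = 0 :> R.
Proof. by case: eqP => // ->; rewrite mvalid0. Qed.

Definition gsone : gser := mk_gser gsone_valid.

Lemma gsmulA : associative gsmul.
Proof. by move=> f g h; apply: gser_eqP => a; exact: cmulA. Qed.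

Lemma gsmul1 : left_id gsone gsmul.
Proof.
move=> f; apply: gser_eqP => c /=; rewrite /cmul; case: ifPn => vc; last by rewrite gserP.
rewrite (bigD1_seq (mzero q, c)) ?msplits_uniq ?msplitsP /= ?madd0 //.
rewrite big1_seq => [|[a b] /= /andP[nab]]; last first.
  rewrite msplitsP /= => /eqP bc; case: eqP => [a0|_]; last by rewrite !mul0r mulr0.
  by move: nab bc; rewrite a0 madd0 => + bc; rewrite bc eqxx.
rewrite /mcross big1 ?expr0 ?eqxx ?addr0 ?mul1r // => i _.
by rewrite big1 // => j _; rewrite ffunE mul0n.
Qed.

Lemma gsmulr1 : right_id gsone gsmul.
Proof.
move=> f; apply: gser_eqP => c /=; rewrite /cmul; case: ifPn => vc; last by rewrite gserP.
rewrite (bigD1_seq (c, mzero q)) ?msplits_uniq ?msplitsP /= ?madd0r //.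
rewrite big1_seq => [|[a b] /= /andP[nab]]; last first.
  rewrite msplitsP /= => /eqP bc; case: eqP => [a0|_]; last by rewrite !mulr0.
  by move: nab bc; rewrite a0 madd0r => + bc; rewrite bc eqxx.
rewrite /mcross big1 ?expr0 ?eqxx ?addr0 ?mul1r ?mulr1 // => i _.
by rewrite big1 // => j _; rewrite ffunE mul0n muln0.
Qed.

Lemma gsmulPl (x : R) f g h : gsmul (x *: f + g) h = x *: gsmul f h + gsmul g h.
Proof. by apply: gser_eqP => c; exact: cmulDl. Qed.

Lemma gsmulPr (x : R) f g h : gsmul h (x *: f + g) = x *: gsmul h f + gsmul h g.
Proof.
apply: gser_eqP => c; rewrite gcD gcZ /= /cmul; case: ifP => _; last by rewrite mulr0 addr0.
rewrite big_distrr -big_split /=; apply: eq_bigr => ab _.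
rewrite -[(x *: gc f + gc g) ab.2]/(x * gc f ab.2 + gc g ab.2) !mulrDr; congr (_ + _); ring.
Qed.

Lemma gsmulDl : left_distributive gsmul +%R.
Proof. by move=> f g h; have := gsmulPl 1 f g h; rewrite !scale1r. Qed.

Lemma gsmulDr : right_distributive gsmul +%R.
Proof. by move=> f g h; have := gsmulPr 1 g h f; rewrite !scale1r. Qed.

Lemma gsone_neq0 : gsone != 0.
Proof.
apply/eqP => /(congr1 (fun f => gc f (mzero q))) /=.
by rewrite eqxx; apply/eqP; rewrite oner_eq0.
Qed.

HB.instance Definition _ := GRing.Zmodule_isNzRing.Build gser
  gsmulA gsmul1 gsmulr1 gsmulDl gsmulDr gsone_neq0.

Lemma gsmulZl (x : R) f g : x *: (f * g) = (x *: f) * g.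
Proof. by have : (x *: f + 0) * g = x *: (f * g) + 0 * g := gsmulPl x f 0 g; rewrite !addr0 mul0r addr0 => ->. Qed.

HB.instance Definition _ := GRing.Lmodule_isLalgebra.Build R gser gsmulZl.

Lemma gsmulZr (x : R) f g : x *: (f * g) = f * (x *: g).
Proof. by have : f * (x *: g + 0) = x *: (f * g) + f * 0 := gsmulPr x g 0 f; rewrite !addr0 mulr0 addr0 => ->. Qed.

HB.instance Definition _ := GRing.Lalgebra_isAlgebra.Build R gser gsmulZr.

Lemma gcM f g a : gc (f * g) a = cmul deg (gc f) (gc g) a. Proof. by []. Qed.

Lemma gc1 a : gc 1 a = (a == mzero q)%:R. Proof. by []. Qed.

Lemma cmul_mzero (f g : mindex -> R) : cmul deg f g (mzero q) = f (mzero q) * g (mzero q).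
Proof.
rewrite /cmul mvalid0 (bigD1_seq (mzero q, mzero q)) ?msplits_uniq ?msplitsP /= ?madd0 //.
rewrite big1_seq ?addr0 => [|[a b] /= /andP[nab]].
  rewrite /mcross big1 ?expr0 ?mul1r // => i _.
  by rewrite big1 // => j _; rewrite ffunE mul0n.
rewrite msplitsP /= => /eqP ab; case/negP: nab.
have : (mlen a + mlen b)%N = 0%N by rewrite -mlenD ab mlen0.
by move/eqP; rewrite addn_eq0 !mlen_eq0 => /andP[/eqP -> /eqP ->].
Qed.

Definition gbody f : R := gc f (mzero q).

Lemma gbodyM f g : gbody (f * g) = gbody f * gbody g.
Proof. exact: cmul_mzero. Qed.

Lemma gbody1 : gbody 1 = 1. Proof. by rewrite /gbody gc1 eqxx. Qed.

Definition gsh (k : int) f := homog deg k (gc f).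

Lemma gshM k l f g : gsh k f -> gsh l g -> gsh (k + l) (f * g).
Proof. exact: homog_cmul. Qed.

Lemma gsh0 k : gsh k 0. Proof. by []. Qed.

Lemma gshD k f g : gsh k f -> gsh k g -> gsh k (f + g).
Proof. by move=> hf hg a na; rewrite gcD hf // hg // addr0. Qed.

Lemma gshZ k x f : gsh k f -> gsh k (x *: f).
Proof. by move=> hf a na; rewrite gcZ hf // mulr0. Qed.

Lemma gsh_sum (I : Type) (s : seq I) (P : pred I) (F : I -> gser) k :
  (forall i, P i -> gsh k (F i)) -> gsh k (\sum_(i <- s | P i) F i).
Proof. by move=> HF; elim/big_ind: _ => //; exact: gshD. Qed.

Lemma gsh1 : gsh 0 1.
Proof.
move=> a na; rewrite gc1; case: eqP => // a0; move: na.
by rewrite a0 mvalid0 mdegree0 eqxx.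
Qed.

Lemma gsh_body k f : gsh k f -> k != 0 -> gbody f = 0.
Proof. by move=> hf k0; apply: hf; rewrite mvalid0 mdegree0 eq_sym. Qed.

Lemma gscomm k l f g : gsh k f -> gsh l g -> f * g = (-1) ^ (k * l) *: (g * f).
Proof. by move=> hf hg; apply: gser_eqP => a; rewrite gcZ !gcM; exact: cmulC. Qed.

(* Powers of the ideal of series without constant term. *)
Definition gfil (N : nat) f := forall a, (mlen a < N)%N -> gc f a = 0.

Lemma gfil_eq0 f : (forall N, gfil N f) -> f = 0.
Proof. by move=> H; apply: gser_eqP => a; exact: (H (mlen a).+1). Qed.

Lemma gfilW N M f : (N <= M)%N -> gfil M f -> gfil N f.
Proof. by move=> NM H a aN; apply: H; exact: leq_trans NM. Qed.

Lemma gfilD N f g : gfil N f -> gfil N g -> gfil N (f + g).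
Proof. by move=> hf hg a na; rewrite gcD hf // hg // addr0. Qed.

Lemma gfilZ N x f : gfil N f -> gfil N (x *: f).
Proof. by move=> hf a na; rewrite gcZ hf // mulr0. Qed.

Lemma gfil_sum (I : Type) (s : seq I) (P : pred I) (F : I -> gser) N :
  (forall i, P i -> gfil N (F i)) -> gfil N (\sum_(i <- s | P i) F i).
Proof. by move=> HF; elim/big_ind: _ => //; exact: gfilD. Qed.

Lemma gfilM N M f g : gfil N f -> gfil M g -> gfil (N + M) (f * g).
Proof.
move=> hf hg c cNM; rewrite gcM /cmul; case: ifP => // _.
rewrite big_seq big1 // => -[a b]; rewrite msplitsP /= => /eqP ab.
have [aN|aN] := ltnP (mlen a) N; first by rewrite hf // mul0r mulr0.
rewrite hg ?mulr0 //; move: cNM; rewrite -ab mlenD => H.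
by rewrite ltnNge; apply/negP => bM; move: H; rewrite ltnNge leq_add.
Qed.

Lemma gfil1 f : gbody f = 0 -> gfil 1 f.
Proof. by move=> f0 a; rewrite ltnS leqn0 mlen_eq0 => /eqP ->. Qed.

(** In the lowest layer that can be non-zero, a factor acts through its constant term. This is what
    turns a derivation along a homomorphism into a real point derivation, coefficient by
    coefficient. *)
Lemma gfilM_top N f g c : gfil N f -> mlen c = N ->
  gc (f * g) c = gc f c * gbody g /\ gc (g * f) c = gbody g * gc f c.
Proof.
move=> hf cN.
have -> : g = gbody g *: 1 + (g - gbody g *: 1) by rewrite addrC subrK.
set g1 := g - _; have g1f : gfil 1 g1.
  by apply: gfil1; rewrite /gbody gcB gcZ gc1 eqxx mulr1 subrr.
have -> : gbody (gbody g *: 1 + g1) = gbody g by rewrite /g1 addrC subrK.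
rewrite mulrDr mulrDl !gcD -gsmulZr -gsmulZl mulr1 mul1r !gcZ.
rewrite (gfilM hf g1f) ?cN ?addn1 // (gfilM g1f hf) ?cN ?add1n //.
by rewrite !addr0 mulrC.
Qed.

(** The left derivative: it passes the variables before [j], whence the sign, and meets the exponent
    [(b j).+1]. *)
Definition gder_raw (j : 'I_q) (f : mindex -> R) (b : mindex) : R :=
  (-1) ^+ (absz (deg j) * mlow deg j b) * ((b j).+1%:R * f (madd b (munit j))).

Lemma mvalid_leq1 (a : mindex) j : mvalid deg a -> odd (absz (deg j)) -> (a j <= 1)%N.
Proof. by move=> /forallP/(_ j)/implyP. Qed.

Lemma mvalid_addunit b j : mvalid deg b ->
  mvalid deg (madd b (munit j)) = (odd (absz (deg j)) ==> (b j == 0%N)).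
Proof.
move=> vb; apply/forallP/implyP.
  by move=> /(_ j)/implyP H /H; rewrite !ffunE eqxx addn1 ltnS leqn0.
move=> H i; apply/implyP => oi; rewrite !ffunE; case: (eqVneq i j) => [ij|_].
  by move: oi; rewrite ij addn1 ltnS leqn0 => /H.
by rewrite addn0; exact: mvalid_leq1.
Qed.

(** Both sums on the right are reindexed over the splittings of [madd b (munit j)], those that give
    no factor [j] to the derived side contributing 0. The identity is then checked splitting by
    splitting. *)
Lemma gder_rawM j (k : int) f g b : gsh k f ->
  gder_raw j (gc (f * g)) b =
  (if mvalid deg b then
    \sum_(p <- msplits b) (-1) ^+ mcross deg p.1 p.2 * (gder_raw j (gc f) p.1 * gc g p.2)
    + (-1) ^ (deg j * k) *
      \sum_(p <- msplits b) (-1) ^+ mcross deg p.1 p.2 * (gc f p.1 * gder_raw j (gc g) p.2)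
  else 0).
Proof.
move=> hf; case: ifPn => vb; last first.
  rewrite /gder_raw gserP ?mulr0 //; apply: contra vb; exact: mvalid_addl.
pose p := absz (deg j); set c := madd b (munit j).
pose T1 (x : mindex * mindex) : R := (-1) ^+ (mcross deg x.1 x.2 + p * mlow deg j x.2 + p * mlow deg j x.1)
  * (x.1 j)%:R * (gc f x.1 * gc g x.2).
pose T2 (x : mindex * mindex) : R := (-1) ^ (deg j * k) * (-1) ^+ (mcross deg x.1 x.2 + p * mhigh deg j x.1 + p * mlow deg j x.2)
  * (x.2 j)%:R * (gc f x.1 * gc g x.2).
have -> : \sum_(x <- msplits b) (-1) ^+ mcross deg x.1 x.2 * (gder_raw j (gc f) x.1 * gc g x.2) =
   \sum_(x <- msplits c) T1 x.
  rewrite [RHS](bigID (fun x : mindex * mindex => (0 < x.1 j)%N)) /= [X in _ = _ + X]big1 => [|x]; last first.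
    by rewrite -eqn0Ngt => /eqP; rewrite /T1 => ->; rewrite mulr0 mul0r.
  rewrite addr0 -[RHS]big_filter [RHS](perm_big _ (msplits_shift_l b j)) [RHS]big_map.
  apply: eq_bigr => -[a a'] _; rewrite /T1 /gder_raw /= mcrossDl mcross_unitl mlowD mlow_unit.
  rewrite !ffunE eqxx addn1 addn0 -/p !exprD.
  have s1 : (-1) ^+ (p * mlow deg j a') * (-1) ^+ (p * mlow deg j a') = 1 :> R.
    by rewrite -expr2 sqrr_sign.
  by rewrite -[LHS]mul1r -[X in X * _ = _]s1; ring.
have -> : (-1) ^ (deg j * k) * \sum_(x <- msplits b) (-1) ^+ mcross deg x.1 x.2 * (gc f x.1 * gder_raw j (gc g) x.2) =
   \sum_(x <- msplits c) T2 x.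
  rewrite [RHS](bigID (fun x : mindex * mindex => (0 < x.2 j)%N)) /= [X in _ = _ + X]big1 => [|x]; last first.
    by rewrite -eqn0Ngt => /eqP; rewrite /T2 => ->; rewrite mulr0 mul0r.
  rewrite addr0 -[RHS]big_filter [RHS](perm_big _ (msplits_shift_r b j)) [RHS]big_map big_distrr.
  apply: eq_bigr => -[a a'] _; rewrite /T2 /gder_raw /= mcrossDr mcross_unitr mlowD mlow_unit.
  rewrite !ffunE eqxx addn1 addn0 -/p !exprD.
  have s1 : (-1) ^+ (p * mhigh deg j a) * (-1) ^+ (p * mhigh deg j a) = 1 :> R.
    by rewrite -expr2 sqrr_sign.
  by rewrite -[LHS]mul1r -[X in X * _ = _]s1; ring.
rewrite -big_split /gder_raw gcM /cmul -/c.
pose S := (-1) ^+ (p * mlow deg j b) * (b j).+1%:R : R.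
have -> : (-1) ^+ (`|deg j| * mlow deg j b) * ((b j).+1%:R *
    (if mvalid deg c then \sum_(ab <- msplits c) (-1) ^+ mcross deg ab.1 ab.2 * (gc f ab.1 * gc g ab.2) else 0)) =
  \sum_(x <- msplits c) (mvalid deg c)%:R * S * (-1) ^+ mcross deg x.1 x.2 * (gc f x.1 * gc g x.2).
  case: ifP => _; last by rewrite !mulr0 big1 // => x _; rewrite !mul0r.
  by rewrite mulrA big_distrr; apply: eq_bigr => x _; rewrite /= /S /p; ring.
rewrite [LHS]big_seq [RHS]big_seq; apply: eq_bigr => -[a a']; rewrite msplitsP /= => /eqP ac.
rewrite /T1 /T2 /= -mulrDl.
have [va|na] := boolP (mvalid deg a); last by rewrite (gserP f) // mul0r !mulr0.
have [va'|na'] := boolP (mvalid deg a'); last by rewrite (gserP g) // !mulr0.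
have [/eqP da|nda] := boolP (mdegree deg a == k); last by rewrite hf ?va // mul0r !mulr0.
congr (_ * _); have lb : mlow deg j b = (mlow deg j a + mlow deg j a')%N.
  by have := congr1 (mlow deg j) ac; rewrite /c !mlowD mlow_unit addn0.
have bj : (b j).+1 = (a j + a' j)%N.
  by have := congr1 (fun z : mindex => z j) ac; rewrite /c !ffunE eqxx addn1.
(* Here [k] is the degree of the left monomial [a]; its parity is separated into the contributions
   before, at and after the position [j]. *)
have sk : (-1) ^ (deg j * k) = (-1) ^+ (p * (mlow deg j a + a j * p + mhigh deg j a)) :> R.
  rewrite sign_exprz abszM -signr_odd oddM -[in RHS]signr_odd oddM; congr (_ ^+ _).
  by rewrite -(odd_mdegree_split deg) da.
rewrite sk /S lb !mulnDr !exprD (mvalid_addunit j vb).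
have -> : (-1) ^+ (p * (a j * p)) = (-1) ^+ (p * a j) :> R.
  by rewrite -signr_odd -[in RHS]signr_odd !oddM; case: (odd p); case: (odd (a j)).
set A := (-1) ^+ (p * mlow deg j a); set A' := (-1) ^+ (p * mlow deg j a').
set X := (-1) ^+ mcross _ _ _; set H := (-1) ^+ (p * mhigh _ _ _).
have HH : H * H = 1 by rewrite -expr2 sqrr_sign.
(* The identity of multiplicities. For an even variable it is additivity of exponents; for an odd
   one, either exactly one of [a j], [a' j] equals 1, or both do and the sign cancels them. *)
suff E : (odd p ==> (b j == 0%N))%:R * (b j).+1%:R = (a j)%:R + (-1) ^+ (p * a j) * (a' j)%:R :> R.
  transitivity ((odd p ==> (b j == 0%N))%:R * (b j).+1%:R * (A * A' * X)); first by rewrite /p; ring.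
  rewrite E; transitivity ((a j)%:R * (A * A' * X) + (-1) ^+ (p * a j) * (a' j)%:R * (A * A' * X) * (H * H)).
    by rewrite HH; ring.
  by ring.
rewrite bj -signr_odd oddM; case: (boolP (odd p)) => op /=; last by rewrite mul1r expr0 mul1r natrD.
have := mvalid_leq1 va op; have := mvalid_leq1 va' op.
move: bj; case: (a j) => [|[|?]] //; case: (a' j) => [|[|?]] //= [->] _ _; rewrite ?expr0 ?expr1 /=; ring.
Qed.

Lemma gder_valid j f a : ~~ mvalid deg a -> gder_raw j (gc f) a = 0.
Proof.
move=> va; rewrite /gder_raw gserP ?mulr0 //; apply: contra va; exact: mvalid_addl.
Qed.

Definition gder j f : gser := mk_gser (@gder_valid j f).

Lemma gderM j k f g : gsh k f ->
  gder j (f * g) = gder j f * g + (-1) ^ (deg j * k) *: (f * gder j g).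
Proof.
move=> hf; apply: gser_eqP => b; rewrite gcD gcZ -[LHS]/(gder_raw j (gc (f * g)) b).
rewrite (gder_rawM _ _ _ hf) !gcM /cmul; case: ifP => _ //.
by rewrite mulr0 addr0.
Qed.

Lemma gderP j x f g : gder j (x *: f + g) = x *: gder j f + gder j g.
Proof.
apply: gser_eqP => a; rewrite gcD gcZ -[LHS]/(gder_raw j (gc (x *: f + g)) a).
rewrite /gder_raw gcD gcZ -[gc (gder j f) a]/(gder_raw j (gc f) a).
by rewrite -[gc (gder j g) a]/(gder_raw j (gc g) a) /gder_raw; ring.
Qed.

Lemma gsh_gder j k l f : l + deg j = k -> gsh k f -> gsh l (gder j f).
Proof.
move=> lk hf b; rewrite negb_and /= /gder_raw => nb.
rewrite (_ : gc f _ = 0) ?mulr0 //.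
have [vb|vb] := boolP (mvalid deg (madd b (munit j))); last by rewrite gserP.
apply: hf; rewrite vb /= mdegreeD mdegree_unit -lk.
by move: nb; rewrite (mvalid_addl vb) /=; apply: contra => /eqP/addIr ->.
Qed.

End GradedSeries.

(** * Smooth families of series and their infinite sums *)

Section SmoothFamilies.
Variables (R : realType) (n q : nat) (deg : 'I_q -> int).
Local Notation V := 'rV[R]_n.
Local Notation L := (gser R deg).
Implicit Types (U : set V) (F G : V -> L).

Definition smooth_fam U F := forall a, smooth U (fun p => gc (F p) a).

Lemma smooth_eq U (f g : V -> R) : open U -> (forall x, U x -> f x = g x) -> smooth U f -> smooth U g.
Proof. by move=> oU E sf r; exact: Cr_eq E (sf r). Qed.

Lemma smooth_sub U U' (f : V -> R) : U' `<=` U -> smooth U f -> smooth U' f.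
Proof. by move=> h sf r; exact: Cr_sub h (sf r). Qed.

Lemma smooth_famD U F G : open U -> smooth_fam U F -> smooth_fam U G -> smooth_fam U (fun p => F p + G p).
Proof.
by move=> oU sF sG a r; apply: Cr_eq oU _ (CrD oU (sF a r) (sG a r)) => x _; rewrite gcD.
Qed.

Lemma smooth_famM U F G : open U -> smooth_fam U F -> smooth_fam U G -> smooth_fam U (fun p => F p * G p).
Proof.
move=> oU sF sG a r; apply: (@Cr_eq _ _ r U (fun p => cmul deg (gc (F p)) (gc (G p)) a)) => //.
rewrite /cmul; case: (mvalid deg a); last exact: CrC.
apply: Cr_sum => // p; exact: CrM oU (CrC r U _) (CrM oU (sF _ r) (sG _ r)).
Qed.

Lemma smooth_famZ U (f : V -> R) F : open U -> smooth U f -> smooth_fam U F ->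
  smooth_fam U (fun p => f p *: F p).
Proof. by move=> oU sf sF a r; apply: Cr_eq oU _ (CrM oU (sf r) (sF a r)) => x _; rewrite gcZ. Qed.

Lemma smooth_famC U (F : L) : smooth_fam U (fun=> F).
Proof. by move=> a r; exact: CrC. Qed.

Lemma smooth_fam_sum U (I : Type) (s : seq I) (F : I -> V -> L) : open U ->
  (forall i, smooth_fam U (F i)) -> smooth_fam U (fun p => \sum_(i <- s) F i p).
Proof.
move=> oU sF a; elim: s => [|i s IH].
  by apply: smooth_eq (fun r => CrC r U 0) => // x _; rewrite big_nil.
apply: smooth_eq (_ : smooth U (fun p => gc (F i p) a + gc (\sum_(j <- s) F j p) a)) => //.
  by move=> x _; rewrite big_cons gcD.
by move=> r; apply: CrD oU (sF i a r) (IH r).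
Qed.

(* The sum of a series whose [r]-th term lies in the [r]-th power of the augmentation ideal. *)
Definition gsum_raw (F : nat -> L) (a : {ffun 'I_q -> nat}) : R := \sum_(r < (mlen a).+1) gc (F r) a.

Lemma gsum_valid (F : nat -> L) a : ~~ mvalid deg a -> gsum_raw F a = 0.
Proof. by move=> va; apply: big1 => r _; exact: gserP. Qed.

Definition gsum (F : nat -> L) : L := mk_gser (@gsum_valid F).

Lemma gsumE (F : nat -> L) a N : (forall r, gfil r (F r)) -> (mlen a < N)%N ->
  gc (gsum F) a = \sum_(r < N) gc (F r) a.
Proof.
move=> fF aN; rewrite -[LHS]/(gsum_raw F a) /gsum_raw.
rewrite (big_ord_widen N (fun r => gc (F r) a) aN) [RHS](bigID (fun r : 'I_N => (r < (mlen a).+1)%N)) /=.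
rewrite [X in _ + X]big1 ?addr0 // => r; rewrite ltnS -ltnNge; exact: fF.
Qed.

Lemma gsum_fil (F : nat -> L) N : (forall r, gfil r (F r)) -> gfil N (gsum F - \sum_(r < N) F r).
Proof. by move=> fF a aN; rewrite gcB (gsumE fF aN) gc_sum subrr. Qed.

Lemma gsum_body (F : nat -> L) : gbody (gsum F) = gbody (F 0%N).
Proof. by rewrite /gbody -[LHS]/(gsum_raw F _) /gsum_raw mlen0 big_ord1. Qed.

Lemma gsh_gsum k (F : nat -> L) : (forall r, gsh k (F r)) -> gsh k (gsum F).
Proof. by move=> hF a na; apply: big1 => r _; exact: hF. Qed.

Lemma smooth_fam_gsum U (F : nat -> V -> L) : open U -> (forall r, smooth_fam U (F r)) ->
  smooth_fam U (fun p => gsum (fun r => F r p)).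
Proof.
move=> oU sF a r.
by apply: (@Cr_sum _ _ r U _ _ (fun (i : 'I_(mlen a).+1) p => gc (F i p) a)) => // i; exact: sF.
Qed.

End SmoothFamilies.

(** * Coordinates and partial derivatives on graded domains *)

Section DomainCalculus.
Variables (R : realType) (d : gdim).
Local Notation n := (gdim0 d).
Local Notation q := (gvars d).
Local Notation deg := (@gdeg d).
Local Notation V := 'rV[R]_n.
Local Notation L := (gser R deg).
Local Notation C := (gdomain R d).
Local Notation bv i := (@basis_vec R n i).
Implicit Types (W : opens C) (k : int).

Lemma ev_valid W k (f : @sec R C W k) (p : V) a : ~~ mvalid deg a -> coef (f : gsec W k) a p = 0.
Proof. by move=> va; have [_ hf _] := gsecP f; apply: (hf p); rewrite negb_and va. Qed.

Definition ev W k (p : V) (f : @sec R C W k) : L := mk_gser (@ev_valid W k f p).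

Lemma gc_ev W k (p : V) (f : @sec R C W k) a : gc (ev p f) a = coef (f : gsec W k) a p.
Proof. by []. Qed.

Lemma ev_gsh W k p (f : @sec R C W k) : gsh k (ev p f).
Proof. by have [_ hf _] := gsecP f; exact: hf. Qed.

Lemma ev_smooth W k (f : @sec R C W k) : smooth_fam W (fun p => ev p f).
Proof. by have [sf _ _] := gsecP f; exact: sf. Qed.

Lemma evP W k p (a : R) (f g : @sec R C W k) : ev p (a *: f + g) = a *: ev p f + ev p g.
Proof. by apply: gser_eqP. Qed.

Lemma evD W k p (f g : @sec R C W k) : ev p (f + g) = ev p f + ev p g.
Proof. by apply: gser_eqP. Qed.

Lemma evZ W k p a (f : @sec R C W k) : ev p (a *: f) = a *: ev p f.
Proof. by apply: gser_eqP. Qed.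

Lemma ev0 W k p : ev p (0 : @sec R C W k) = 0.
Proof. by apply: gser_eqP. Qed.

Lemma ev_mul W i j k (e : i + j = k) p (f : @sec R C W i) (g : @sec R C W j) :
  ev p (gmul e f g) = ev p f * ev p g.
Proof. by apply: gser_eqP. Qed.

Lemma ev_res W W' (h : W' `<=` W) k p (f : @sec R C W k) : oset W' p -> ev p (res h f) = ev p f.
Proof. by move=> Wp; apply: gser_eqP => a; rewrite !gc_ev /= zext_in. Qed.

Lemma ev_one W p : oset W p -> ev p (gone W : @sec R C W 0) = 1.
Proof. by move=> Wp; apply: gser_eqP => a; rewrite gc_ev gc1 /= zext_in. Qed.

Lemma sec_ev_eq W k (f g : @sec R C W k) : (forall p, oset W p -> ev p f = ev p g) -> f = g.
Proof.
by move=> E; apply: gsec_eqP => a x Wx; have := E x Wx => /(congr1 (fun F : L => gc F a)).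
Qed.

Lemma fsec_subproof W k (F : V -> L) : smooth_fam W F -> (forall p, oset W p -> gsh k (F p)) ->
  is_gsec W k (zext W (fun a p => gc (F p) a)).
Proof. by move=> sF hF; exact: zext_is_gsec. Qed.

Definition fsec W k (F : V -> L) (sF : smooth_fam W F) (hF : forall p, oset W p -> gsh k (F p)) :
  @sec R C W k := mk_gsec (fsec_subproof sF hF).

Lemma ev_fsec W k F sF hF p : oset W p -> ev p (@fsec W k F sF hF) = F p.
Proof. by move=> Wp; apply: gser_eqP => a; rewrite gc_ev /= zext_in. Qed.

Definition cvar := ('I_n + 'I_q)%type.
Definition cdeg (v : cvar) : int := match v with inl _ => 0 | inr j => deg j end.
Definition cval (p : V) (v : cvar) : R := match v with inl i => p 0 i | inr _ => 0 end.

Lemma gvar_valid j (a : {ffun 'I_q -> nat}) : ~~ mvalid deg a -> (a == munit j)%:R = 0 :> R.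
Proof. by case: eqP => // ->; rewrite mvalid_unit. Qed.
Definition gvar j : L := mk_gser (@gvar_valid j).

Definition cgen (p : V) (v : cvar) : L := match v with inl i => (p 0 i)%:A | inr j => gvar j end.

Lemma gsh_gvar j : gsh (deg j) (gvar j).
Proof.
move=> a na; rewrite /=; case: eqP => // a0; move: na.
by rewrite a0 mvalid_unit mdegree_unit eqxx.
Qed.

Lemma gsh_scalar (x : R) : gsh 0 (x%:A : L).
Proof. by apply: gshZ; exact: gsh1. Qed.

Lemma gsh_cgen p v : gsh (cdeg v) (cgen p v).
Proof. by case: v => [i|j]; [exact: gsh_scalar|exact: gsh_gvar]. Qed.

Lemma cgen_smooth W v : smooth_fam W (fun p => cgen p v).
Proof.
case: v => [i|j]; last exact: smooth_famC.
apply: smooth_famZ (smooth_famC _ _); first exact: opensP.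
by move=> r; apply: Cr_coord; exact: opensP.
Qed.

Definition xc W (v : cvar) : @sec R C W (cdeg v) :=
  fsec (@cgen_smooth W v) (fun p _ => @gsh_cgen p v).

Lemma ev_xc W v p : oset W p -> ev p (xc W v) = cgen p v.
Proof. exact: ev_fsec. Qed.

Lemma gbody_gvar j : gbody (gvar j) = 0.
Proof.
rewrite /gbody /=; case: eqP => // /(congr1 (@mlen _)).
by rewrite mlen0 mlen_unit.
Qed.

Lemma gbody_scalar (x : R) : gbody (x%:A : L) = x.
Proof. by rewrite /gbody gcZ gc1 eqxx mulr1. Qed.

Lemma gbody_cgen p v : gbody (cgen p v) = cval p v.
Proof. by case: v => [i|j]; [exact: gbody_scalar|exact: gbody_gvar]. Qed.

Definition pder_fam (v : cvar) W k (f : @sec R C W k) (p : V) : L :=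
  match v with
  | inl i => mk_gser (f := fun a => if mvalid deg a then 'D_(bv i) (coef (f : gsec W k) a) p else 0)
       (fun a va => ifN _ _ va)
  | inr j => gder j (ev p f)
  end.

Lemma pder_smooth v W k (f : @sec R C W k) : smooth_fam W (pder_fam v f).
Proof.
have sf := ev_smooth f.
case: v => [i|j] a; rewrite /=.
  case: (mvalid deg a); last by move=> r; exact: CrC.
  exact: smooth_D (sf a).
by move=> r; apply: CrM (CrC r _ _) (CrM _ (CrC r _ _) (sf _ r)); exact: opensP.
Qed.

Lemma pder_gsh v W k (f : @sec R C W k) p : oset W p -> gsh (k - cdeg v) (pder_fam v f p).
Proof.
case: v => [i|j] Wp; last by apply: gsh_gder (ev_gsh p f); rewrite subrK.
rewrite subr0 => a na /=; case: ifP => // va.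
rewrite (_ : coef _ a = fun=> 0); first exact: derive_cst.
by apply/funext => x; have [_ hf _] := gsecP f; exact: (hf x).
Qed.

Definition pder v W k (f : @sec R C W k) : @sec R C W (k - cdeg v) :=
  fsec (@pder_smooth v W k f) (@pder_gsh v W k f).

Lemma ev_pder v W k (f : @sec R C W k) p : oset W p -> ev p (pder v f) = pder_fam v f p.
Proof. exact: ev_fsec. Qed.

Lemma sec_derivable W k (f : @sec R C W k) a i p : oset W p -> derivable (coef (f : gsec W k) a) p (bv i).
Proof. by move=> Wp; apply: smooth_derivable Wp; exact: (ev_smooth f a). Qed.

Arguments sec_derivable [W k] f a i [p] _.

Lemma pder_fam_lin v W k (x : R) (f g : @sec R C W k) p : oset W p ->
  pder_fam v (x *: f + g) p = x *: pder_fam v f p + pder_fam v g p.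
Proof.
move=> Wp; case: v => [i|j]; last by rewrite /pder_fam evP gderP.
apply: gser_eqP => a; rewrite gcD gcZ /=.
case: ifP => _; last by rewrite mulr0 addr0.
have df := sec_derivable f a i Wp; have dg := sec_derivable g a i Wp.
rewrite -[LHS]/('D_(bv i) ((x \*: coef (f : gsec W k) a) + coef (g : gsec W k) a) p).
by rewrite deriveD ?deriveZ //; exact: derivableZ.
Qed.

Lemma pder_famM v W i j k (e : i + j = k) (f : @sec R C W i) (g : @sec R C W j) p : oset W p ->
  pder_fam v (gmul e f g) p =
  pder_fam v f p * ev p g + (-1) ^ (cdeg v * i) *: (ev p f * pder_fam v g p).
Proof.
move=> Wp; case: v => [m|m]; last by rewrite /= ev_mul (gderM _ _ (ev_gsh p f)).
rewrite mul0r expr0z scale1r; apply: gser_eqP => c; rewrite gcD !gcM /= /cmul.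
case: ifPn => vc; last by rewrite addr0.
rewrite -big_split /=.
pose F (ab : {ffun 'I_q -> nat} * {ffun 'I_q -> nat}) (x : V) : R^o :=
  (-1) ^+ mcross deg ab.1 ab.2 * (coef (f : gsec W i) ab.1 x * coef (g : gsec W j) ab.2 x).
have dF ab : is_derive p (bv m) (F ab) ((-1) ^+ mcross deg ab.1 ab.2 *
   ('D_(bv m) (coef (f : gsec W i) ab.1) p * coef (g : gsec W j) ab.2 p +
    coef (f : gsec W i) ab.1 p * 'D_(bv m) (coef (g : gsec W j) ab.2) p)).
  have df := derivableP (sec_derivable f ab.1 m Wp); have dg := derivableP (sec_derivable g ab.2 m Wp).
  have := is_deriveZ ((-1) ^+ mcross deg ab.1 ab.2) (is_deriveM df dg).
  by move=> H; apply: is_derive_eq; rewrite /GRing.scale /=; ring.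
have -> : (fun x : V => if mvalid deg c then
   \sum_(ab <- msplits c) (-1) ^+ mcross deg ab.1 ab.2 *
     (coef (f : gsec W i) ab.1 x * coef (g : gsec W j) ab.2 x) else 0) = \sum_(ab <- msplits c) F ab.
  by apply/funext => x; rewrite vc fct_sumE.
have : is_derive p (bv m) (\sum_(ab <- msplits c) F ab)
   (\sum_(ab <- msplits c) ((-1) ^+ mcross deg ab.1 ab.2 *
   ('D_(bv m) (coef (f : gsec W i) ab.1) p * coef (g : gsec W j) ab.2 p +
    coef (f : gsec W i) ab.1 p * 'D_(bv m) (coef (g : gsec W j) ab.2) p))).
  elim: (msplits c) => [|ab s IH]; first by rewrite !big_nil; exact: is_derive_cst.
  by rewrite !big_cons; exact: is_deriveD.
move=> [_ ->]; rewrite !big_seq; apply: eq_bigr => -[a b]; rewrite msplitsP /= => /eqP ab.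
have -> : mvalid deg a by apply: mvalid_addl (b : {ffun 'I_q -> nat}) _; rewrite ab.
have -> : mvalid deg b by apply: (@mvalid_addr _ deg a b); rewrite ab.
by rewrite mulrDr.
Qed.

Lemma pder_lin v W k (x : R) (f g : @sec R C W k) :
  pder v (x *: f + g) = x *: pder v f + pder v g.
Proof. by apply: sec_ev_eq => p Wp; rewrite evP !ev_pder // pder_fam_lin. Qed.

Lemma pder_res v W W' (h : W' `<=` W) k (f : @sec R C W k) : pder v (res h f) = res h (pder v f).
Proof.
apply: sec_ev_eq => p Wp; rewrite ev_res // !ev_pder //; last exact: h.
case: v => [i|j] /=; last by rewrite ev_res.
apply: gser_eqP => a /=; case: ifP => // _.
apply: near_eq_derive; apply: open_near_eq Wp _; first exact: opensP.
by move=> x Wx; rewrite zext_in.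
Qed.

Lemma pder_mul v W (i j k k' : int) (e : i + j = k) (e1 : i - cdeg v + j = k') (e2 : i + (j - cdeg v) = k')
  (ek : k - cdeg v = k') (f : @sec R C W i) (g : @sec R C W j) p : oset W p ->
  ev p (pder v (gmul e f g)) = ev p (gmul e1 (pder v f) g) + (-1) ^ (cdeg v * i) *: ev p (gmul e2 f (pder v g)).
Proof. by move=> Wp; rewrite ev_pder // !ev_mul !ev_pder // pder_famM. Qed.

Lemma pder_xc W v w p : oset W p -> ev p (pder v (xc W w)) = (v == w)%:R%:A.
Proof.
move=> Wp; rewrite ev_pder //; apply: gser_eqP => a; rewrite gcZ gc1.
case: v => [i|j]; last rewrite -[LHS]/(gder_raw deg j (gc (ev p (xc W w))) a) ev_xc //.
  rewrite /=; case: ifP => [va|va]; last first.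
    case: (eqVneq a (mzero q)) => [a0|_]; last by rewrite /= ?mulr0n ?mul0r ?mulr0 ?mul0r ?mulr0.
    by move: va; rewrite a0 mvalid0.
  have -> : 'D_(bv i) (zext W (fun a p => gc (cgen p w) a) a) p = 'D_(bv i) (fun p => gc (cgen p w) a : R^o) p.
    apply: near_eq_derive; apply: open_near_eq Wp _; first exact: opensP.
    by move=> x Wx; rewrite zext_in.
  case: w => [i'|j'] /=; last by rewrite /= ?mulr0n ?mul0r ?mulr0 ?mul0r ?mulr0 derive_cst.
  rewrite (_ : (fun p : V => _) = (a == mzero q)%:R \*: (fun p : V => p 0 i' : R^o)); last first.
    by apply/funext => x; rewrite -[LHS]/(x 0 i' * (a == mzero q)%:R) mulrC.
  have [dx Dx] := coord_is_derive p (bv i) i'.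
  rewrite deriveZ // Dx mxE eqxx /= -[LHS]/(_ * _) mulrC eq_sym.
  by rewrite -[inl i == inl i']/(i == i').
rewrite /gder_raw; case: w => [i'|j'] /=.
  rewrite -[(_ *: _) _]/(p 0 i' * (_ == _)%:R) mulr0n mul0r; case: (madd a (munit j) =P mzero q) => [/(congr1 (@mlen _))|_]; last by rewrite /= ?mulr0n ?mul0r ?mulr0 ?mul0r ?mulr0.
  by rewrite mlen0 mlenD mlen_unit addn1.
rewrite -[inr j == inr j']/(j == j') /=.
have [->|jj] := eqVneq j j'.
  rewrite mul1r; have [->|a0] := eqVneq a (mzero q).
    by rewrite madd0 eqxx ffunE /mlow big1 ?muln0 ?mul1r // => i _; rewrite ffunE.
  case: (madd a (munit j') =P munit j') => [E|_]; last by rewrite /= ?mulr0n ?mul0r ?mulr0 ?mul0r ?mulr0.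
  have := congr1 (@mlen _) E; rewrite mlenD mlen_unit => /eqP; rewrite -[X in _ == X]add0n eqn_add2r mlen_eq0.
  by rewrite (negbTE a0).
case: (madd a (munit j) =P munit j') => [E|_]; last by rewrite /= ?mulr0n ?mul0r ?mulr0 ?mul0r ?mulr0.
have := congr1 (fun z : {ffun 'I_q -> nat} => z j) E.
by rewrite !ffunE eqxx (negbTE jj) addn1.
Qed.

End DomainCalculus.

(** * Hadamard's lemma with graded variables *)

Section GradedHadamard.
Variables (R : realType) (d : gdim).
Local Notation n := (gdim0 d).
Local Notation q := (gvars d).
Local Notation deg := (@gdeg d).
Local Notation V := 'rV[R]_n.
Local Notation L := (gser R deg).
Local Notation C := (gdomain R d).
Local Notation cvar := (cvar d).
Implicit Types (W : opens C) (k : int).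

Lemma gc_gvarM j (g : L) c : gc (gvar R j * g) c =
  if mvalid deg c && (0 < c j)%N then
    (-1) ^+ (absz (deg j) * mlow deg j (msub c (munit j))) * gc g (msub c (munit j)) else 0.
Proof.
rewrite gcM /cmul; case: (boolP (mvalid deg c)) => //= vc.
have [cj|cj] := ltnP 0 (c j); last first.
  rewrite big_seq big1 // => -[a b]; rewrite msplitsP /= => /eqP ab.
  case: eqP => [aj|_]; last by rewrite /= mulr0n mul0r mulr0.
  by move: cj; rewrite -ab aj !ffunE eqxx.
rewrite (bigD1_seq (munit j, msub c (munit j))) ?msplits_uniq ?msplitsP //=; last first.
  apply/eqP/ffunP => i; rewrite !ffunE; case: eqVneq => [->|_] /=; lia.
rewrite eqxx mul1r mcross_unitl big1_seq ?addr0 // => -[a b] /= /andP[nab].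
rewrite msplitsP /= => /eqP ab; case: eqP => [aj|_]; last by rewrite /= mulr0n mul0r mulr0.
case/negP: nab; rewrite -ab aj; apply/eqP; congr pair.
by apply/ffunP => i; rewrite !ffunE addKn.
Qed.

Lemma cst_fam_smooth W k (c : R) :
  smooth_fam W (fun _ : V => if k == 0 then c%:A else 0 : L).
Proof. exact: smooth_famC. Qed.

Lemma cst_fam_gsh k (c : R) : gsh k (if k == 0 then c%:A else 0 : L).
Proof. by case: eqP => [->|_]; [exact: gsh_scalar|exact: gsh0]. Qed.

(** Being 0 in non-zero degree, it gives the expansion of a section around a point the same shape in
    every degree. *)
Definition cst_sec W k (c : R) : @sec R C W k :=
  fsec (@cst_fam_smooth W k c) (fun p _ => @cst_fam_gsh k c).

Lemma cst_sec0 W c : cst_sec W 0 c = c *: gone W.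
Proof. by apply: sec_ev_eq => p Wp; rewrite ev_fsec // eqxx evZ ev_one. Qed.

Lemma cst_sec_neq0 W k c : k != 0 -> cst_sec W k c = 0.
Proof. by move=> /negbTE k0; apply: sec_ev_eq => p Wp; rewrite ev_fsec // k0 ev0. Qed.

Definition xgen (x p : V) (v : cvar) : L := cgen p v - (cval x v)%:A.

Lemma xgen_inl x p (i : 'I_n) : xgen x p (inl i) = (p 0 i - x 0 i)%:A.
Proof. by rewrite /xgen -scalerBl. Qed.

Lemma xgen_smooth W x v : smooth_fam W (fun p => xgen x p v).
Proof.
exact: (smooth_famD (opensP W) (@cgen_smooth _ _ W v) (smooth_famC W (- (cval x v)%:A))).
Qed.

Lemma gsh_xgen x p v : gsh (cdeg v) (xgen x p v).
Proof.
case: v => [i|j]; rewrite /xgen /= ?scale0r ?subr0; last exact: gsh_gvar.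
by rewrite -scaleN1r; apply: gshD; [exact: gsh_scalar|apply/gshZ/gsh_scalar].
Qed.

Definition xcc W (x : V) (v : cvar) : @sec R C W (cdeg v) :=
  fsec (@xgen_smooth W x v) (fun p _ => @gsh_xgen x p v).

Lemma xcc_inl W x (i : 'I_n) : xcc W x (inl i) = xc W (inl i) - x 0 i *: gone W.
Proof.
apply: sec_ev_eq => p Wp; rewrite ev_fsec // -scaleN1r addrC evP evZ ev_one // ev_xc //.
by rewrite /xgen scaleN1r addrC.
Qed.

Lemma xcc_inr W x (j : 'I_q) : xcc W x (inr j) = xc W (inr j).
Proof. by apply: sec_ev_eq => p Wp; rewrite ev_fsec // ev_xc // /xgen scale0r subr0. Qed.

(** A non-constant monomial is divided by its first variable only, which counts it once and makes
    the sign in [gc_gvarM] trivial. *)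
Definition leads (j : 'I_q) (c : {ffun 'I_q -> nat}) : bool :=
  (0 < c j)%N && [forall i : 'I_q, (i < j)%N ==> (c i == 0%N)].

Lemma sum_leads (c : {ffun 'I_q -> nat}) (x : R) :
  \sum_j (if leads j c then x else 0) = if c == mzero q then 0 else x.
Proof.
case: eqVneq => [->|c0].
  by apply: big1 => j _; rewrite /leads ffunE.
have [j0 cj0] : exists j, (0 < c j)%N.
  apply: contrapT => H; case/eqP: c0; apply/ffunP => i; rewrite ffunE.
  by apply/eqP; rewrite -leqn0 leqNgt; apply/negP => ci; apply: H; exists i.
case: (@arg_minnP _ j0 (fun j => (0 < c j)%N) (fun j => val j) cj0) => j cj jmin.
have lj : leads j c.
  rewrite /leads cj; apply/forallP => i; apply/implyP => ij; rewrite -leqn0 leqNgt.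
  by apply/negP => /jmin; rewrite leqNgt ij.
rewrite (bigD1 j) //= lj big1 ?addr0 // => i ij; case: ifP => // /andP[ci /forallP H].
case: (ltngtP i j) => [lij|lji|/val_inj E]; last by rewrite E eqxx in ij.
  by have := jmin i ci; rewrite leqNgt lij.
by have /implyP/(_ lji)/eqP cj0' := H j; move: cj; rewrite cj0'.
Qed.

(** The coefficient without graded variable is expanded by the classical lemma, which provides the
    cofactors of the coordinates of degree 0. Every other monomial is divided by its first graded
    variable. *)
Lemma graded_hadamard W k (f : @sec R C W k) (x : V) : oset W x ->
  exists (B : opens C) (h : B `<=` W) (G : forall v, @sec R C B (k - cdeg v)),
    oset B x /\ res h f = cst_sec B k (coef (f : gsec W k) (mzero q) x)
      + \sum_v gmul (subrKC (cdeg v) k) (xcc B x v) (G v).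
Proof.
move=> Wx; have [e e0 KW] := sub_closed_ball_open (opensP W) Wx.
pose B : opens C := Opens (ball_open x e : open (ball x e)).
have hB : B `<=` W by apply: subset_trans KW; exact: subset_closed_ball.
have sf0 := ev_smooth f (mzero q).
have [g sg gE] := hadamard e0 KW (opensP W) sf0.
pose G0 (i : 'I_n) (p : V) : L := if k == 0 then (g i p)%:A else 0.
have sG0 i : smooth_fam B (G0 i).
  rewrite /G0; case: (k == 0); last exact: smooth_famC.
  by apply: smooth_famZ (smooth_famC _ _); [exact: opensP|exact: sg].
have hG0 i p : gsh (k - 0) (G0 i p).
  by rewrite subr0 /G0; case: eqP => [->|_]; [exact: gsh_scalar|exact: gsh0].
pose G1r (j : 'I_q) (p : V) (b : {ffun 'I_q -> nat}) : R :=
  if leads j (madd b (munit j)) then gc (ev p f) (madd b (munit j)) else 0.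
have vG1 j p b : ~~ mvalid deg b -> G1r j p b = 0.
  move=> vb; rewrite /G1r; case: ifP => // _; rewrite gserP //.
  by apply: contra vb; exact: mvalid_addl.
pose G1 j p : L := mk_gser (@vG1 j p).
have sG1 j : smooth_fam B (G1 j).
  move=> b; rewrite /G1 /= /G1r; case: (leads _ _); last by move=> r; exact: CrC.
  by apply: smooth_sub hB _; exact: (ev_smooth f).
have hG1 j p : gsh (k - deg j) (G1 j p).
  move=> b nb; rewrite /= /G1r; case: ifP => // _.
  have [vb|vb] := boolP (mvalid deg (madd b (munit j))); last by rewrite gserP.
  apply: (ev_gsh p f); rewrite vb /= mdegreeD mdegree_unit.
  by move: nb; rewrite (mvalid_addl vb) /=; apply: contra => /eqP <-; rewrite addrK.
pose G v : @sec R C B (k - cdeg v) := match v return @sec R C B (k - cdeg v) with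
  | inl i => fsec (sG0 i) (fun p _ => hG0 i p) | inr j => fsec (sG1 j) (fun p _ => hG1 j p) end.
exists B, hB, G; split; first exact: ballxx.
apply: sec_ev_eq => p Bp; rewrite ev_res // evD ev_fsec //.
have -> : ev p (\sum_v gmul (subrKC (cdeg v) k) (xcc B x v) (G v)) =
    \sum_v xgen x p v * ev p (G v).
  rewrite (big_morph (fun f : @sec R C B k => ev p f) (fun f g => evD p f g) (@ev0 R d B k p)).
  by apply: eq_bigr => v _; rewrite ev_mul ev_fsec.
rewrite big_sumType /=; apply: gser_eqP => c; rewrite !gcD !gc_sum.
under [X in _ + (X + _)]eq_bigr => i _ do rewrite ev_fsec //.
have E1 j : gc (xgen x p (inr j) * ev p (fsec (sG1 j) (fun p _ => hG1 j p))) c =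
    if leads j c then gc (ev p f) c else 0.
  rewrite ev_fsec // /xgen scale0r subr0 gc_gvarM /leads.
  have [vc|vc] := boolP (mvalid deg c); last by rewrite (gserP (ev p f) vc) if_same.
  rewrite /=.
  have [cj|cj] := ltnP 0 (c j) => //=.
  have cE : madd (msub c (munit j)) (munit j) = c.
    by apply/ffunP => i; rewrite !ffunE; case: eqVneq => [->|_] /=; lia.
  rewrite /G1r cE /leads cj /=; case: ifP => [/forallP H|_]; last by rewrite mulr0.
  rewrite /mlow big1 ?muln0 ?mul1r // => i ij.
  by rewrite ffunE; have /implyP/(_ ij)/eqP -> := H i.
under [X in _ + (_ + X)]eq_bigr => j _ do rewrite E1.
rewrite sum_leads; have [->|c0] := eqVneq c (mzero q).
  rewrite addr0; have [k0|k0] := eqVneq k 0; last first.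
    rewrite gc0 add0r big1 => [|i _]; last by rewrite /G0 (negbTE k0) mulr0.
    by have := gsh_body (ev_gsh p f) k0.
  rewrite gcZ gc1 eqxx mulr1 gE //; congr (_ + _).
  apply: eq_bigr => i _; rewrite /G0 k0 eqxx xgen_inl mulr_algl !gcZ.
  by rewrite gc1 eqxx mulr1.
rewrite (_ : gc (if _ then _ else _) c = 0) ?add0r; last first.
  by case: (k == 0); rewrite ?gcZ ?gc1 ?(negbTE c0) ?mulr0.
rewrite big1 ?add0r // => i _; rewrite /G0 xgen_inl mulr_algl gcZ.
by case: (k == 0); rewrite ?gcZ ?gc1 ?(negbTE c0) ?mulr0.
Qed.

End GradedHadamard.

(** * Homomorphisms and derivations of stalks with values in series *)

Section Germs.
Variables (R : realType) (q' : nat) (deg' : 'I_q' -> int).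
Local Notation L' := (gser R deg').

(* [A] is the effect on sections of a morphism into [X] that sends a point to [x], followed by
   the evaluation of all coefficients at that point. *)
Record germ_hom (X : gspace R) (x : X) (A : forall (W : opens X) k, sec W k -> L') : Prop := GermHom {
  gh_lin : forall (W : opens X) k (a : R) (f g : sec W k), oset W x ->
    A W k (a *: f + g) = a *: A W k f + A W k g;
  gh_one : forall W : opens X, oset W x -> A W 0 (gone W) = 1;
  gh_mul : forall (W : opens X) (i j k : int) (e : i + j = k) (f : sec W i) (g : sec W j),
    oset W x -> A W k (gmul e f g) = A W i f * A W j g;
  gh_res : forall (W W' : opens X) (h : W' `<=` W) k (f : sec W k), oset W' x ->
    A W' k (res h f) = A W k f;
  gh_gsh : forall (W : opens X) k (f : sec W k), oset W x -> gsh k (A W k f);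
  gh_body : forall (W : opens X) (f : sec W 0), oset W x -> ~ gunit_at x f -> gbody (A W 0 f) = 0 }.

Record germ_der (s : int) (X : gspace R) (x : X) (A D : forall (W : opens X) k, sec W k -> L') : Prop := GermDer {
  gd_lin : forall (W : opens X) k (a : R) (f g : sec W k), oset W x ->
    D W k (a *: f + g) = a *: D W k f + D W k g;
  gd_mul : forall (W : opens X) (i j k : int) (e : i + j = k) (f : sec W i) (g : sec W j), oset W x ->
    D W k (gmul e f g) = D W i f * A W j g + (-1) ^ (s * i) *: (A W i f * D W j g);
  gd_res : forall (W W' : opens X) (h : W' `<=` W) k (f : sec W k), oset W' x ->
    D W' k (res h f) = D W k f }.

Section Facts.
Variables (X : gspace R) (x : X) (W : opens X).
Hypothesis Wx : oset W x.

Lemma gh0 A k : germ_hom x A -> A W k 0 = 0.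
Proof. by move=> hA; have := gh_lin hA (-1) 0 (0 : sec W k) Wx; rewrite scaler0 addr0 scaleN1r addNr. Qed.

Lemma ghD A k (f g : sec W k) : germ_hom x A -> A W k (f + g) = A W k f + A W k g.
Proof. by move=> hA; have := gh_lin hA 1 f g Wx; rewrite !scale1r. Qed.

Lemma ghZ A k a (f : sec W k) : germ_hom x A -> A W k (a *: f) = a *: A W k f.
Proof. by move=> hA; have := gh_lin hA a f 0 Wx; rewrite (gh0 _ hA) !addr0. Qed.

Lemma gh_sum A k (I : Type) (s : seq I) (F : I -> sec W k) : germ_hom x A ->
  A W k (\sum_(i <- s) F i) = \sum_(i <- s) A W k (F i).
Proof. by move=> hA; apply: big_morph => [f g|]; [exact: ghD|exact: gh0]. Qed.

Lemma gd0 s A D k : germ_der s x A D -> D W k 0 = 0.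
Proof. by move=> hA; have := gd_lin hA (-1) 0 (0 : sec W k) Wx; rewrite scaler0 addr0 scaleN1r addNr. Qed.

Lemma gdD s A D k (f g : sec W k) : germ_der s x A D -> D W k (f + g) = D W k f + D W k g.
Proof. by move=> hA; have := gd_lin hA 1 f g Wx; rewrite !scale1r. Qed.

Lemma gdZ s A D k a (f : sec W k) : germ_der s x A D -> D W k (a *: f) = a *: D W k f.
Proof. by move=> hA; have := gd_lin hA a f 0 Wx; rewrite (gd0 _ hA) !addr0. Qed.

Lemma gd_sum s A D k (I : Type) (r : seq I) (F : I -> sec W k) : germ_der s x A D ->
  D W k (\sum_(i <- r) F i) = \sum_(i <- r) D W k (F i).
Proof. by move=> hA; apply: big_morph => [f g|]; [exact: gdD hA|exact: gd0 hA]. Qed.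

Lemma gd_one s A D : germ_hom x A -> germ_der s x A D -> D W 0 (gone W) = 0.
Proof.
move=> hA hD; have := gd_mul hD (addr0 0) (gone W) (gone W) Wx.
rewrite gmul1 (gh_one hA Wx) mulr1 mul1r mulr0 expr0z scale1r.
by move=> /eqP; rewrite -[X in X == _]addr0 (inj_eq (addrI _)) eq_sym => /eqP.
Qed.
End Facts.
End Germs.

Section GermUniqueness.
Variables (R : realType) (q' : nat) (deg' : 'I_q' -> int) (d : gdim).
Local Notation L' := (gser R deg').
Local Notation C := (gdomain R d).
Local Notation V := 'rV[R]_(gdim0 d).
Variable x : V.
Implicit Types (A D : forall (W : opens C) k, @sec R C W k -> L').

Lemma gunit_ev_body W k (f : @sec R C W k) (p : C) : gunit_at p f -> gbody (ev p f) != 0.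
Proof.
move=> [W' [h [Wp [g /(congr1 (fun s => gbody (ev p s)))]]]].
rewrite ev_mul gbodyM ev_res // ev_one // gbody1 => E; apply/eqP => f0.
by move: E; rewrite f0 mul0r => /eqP; rewrite eq_sym oner_eq0.
Qed.

(** Minus its value at [x], the section [f] is no longer invertible at [x], and [gh_body] kills the
    constant term of its image. *)
Lemma gh_body_eq A (W : opens C) (f : @sec R C W 0) : oset W x -> @germ_hom R q' deg' C x A ->
  gbody (A W 0 f) = gbody (ev x f).
Proof.
move=> Wx hA; set c := gbody (ev x f).
have : gbody (A W 0 ((- c) *: gone W + f)) = 0.
  apply: (gh_body hA Wx) => /gunit_ev_body; rewrite evP ev_one // /gbody gcD gcZ gc1 eqxx mulr1.
  by rewrite -[gc (ev x f) _]/c addNr eqxx.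
rewrite (gh_lin hA _ _ _ Wx) (gh_one hA Wx) /gbody gcD gcZ gc1 eqxx mulr1 => /eqP.
by rewrite addrC subr_eq0 => /eqP.
Qed.

Lemma gh_cst A (W : opens C) k c : oset W x -> @germ_hom R q' deg' C x A ->
  A W k (cst_sec W k c) = if k == 0 then c%:A else 0.
Proof.
move=> Wx hA; case: eqP => [->|/eqP k0]; first by rewrite cst_sec0 (ghZ Wx _ _ hA) (gh_one hA Wx).
by rewrite cst_sec_neq0 // (gh0 Wx _ hA).
Qed.

Lemma gh_xcc A (W : opens C) v : oset W x -> @germ_hom R q' deg' C x A ->
  A W (cdeg v) (xcc W x v) = A W (cdeg v) (xc W v) - (cval x v)%:A.
Proof.
move=> Wx hA; case: v => [i|j]; last by rewrite xcc_inr scale0r subr0.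
by rewrite xcc_inl (ghD Wx _ _ hA) -scaleN1r !(ghZ Wx _ _ hA) (gh_one hA Wx) scaleN1r.
Qed.

Lemma gh_xcc_fil A (W : opens C) v : oset W x -> @germ_hom R q' deg' C x A ->
  gfil 1 (A W (cdeg v) (xcc W x v)).
Proof.
move=> Wx hA; apply: gfil1; case: v => [i|j]; last first.
  exact: gsh_body (gh_gsh hA _ Wx) (gdeg_neq0 j).
rewrite (gh_body_eq _ Wx hA) ev_fsec // /xgen -scaleN1r.
by rewrite /gbody gcD !gcZ gc1 eqxx !mulr1 mulN1r subrr.
Qed.

(** Induction on the power of the augmentation ideal that contains the difference. In the Hadamard
    expansion the constants cancel, the centred coordinates have equal images lying in the first
    power, and the cofactors are covered by induction. *)
Lemma germ_hom_uniq A A' : @germ_hom R q' deg' C x A -> @germ_hom R q' deg' C x A' ->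
  (forall (W : opens C) v, oset W x -> A W _ (xc W v) = A' W _ (xc W v)) ->
  forall (W : opens C) k (f : @sec R C W k), oset W x -> A W k f = A' W k f.
Proof.
move=> hA hA' E; suff H N W k (f : @sec R C W k) : oset W x -> gfil N (A W k f - A' W k f).
  move=> W k f Wx; apply/eqP; rewrite -subr_eq0; apply/eqP/gfil_eq0 => N; exact: H.
elim: N W k f => // N IH W k f Wx; have [B [h [G [Bx Gf]]]] := graded_hadamard f Wx.
rewrite -(gh_res hA h f Bx) -(gh_res hA' h f Bx) Gf.
rewrite (ghD Bx _ _ hA) (ghD Bx _ _ hA') !gh_cst // opprD addrACA subrr add0r.
rewrite (gh_sum Bx _ _ hA) (gh_sum Bx _ _ hA') -sumrB; apply: gfil_sum => v _.
rewrite (gh_mul hA _ _ _ Bx) (gh_mul hA' _ _ _ Bx).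
have -> : A' B _ (xcc B x v) = A B _ (xcc B x v) by rewrite !gh_xcc // E.
by rewrite -mulrBr -[N.+1]add1n; apply: gfilM; [exact: gh_xcc_fil|exact: IH].
Qed.

(** The same induction: [D] kills constants and centred coordinates, so the Leibniz rule leaves only
    images of centred coordinates times values of [D] on the cofactors. *)
Lemma germ_der_uniq s A D : @germ_hom R q' deg' C x A -> @germ_der R q' deg' s C x A D ->
  (forall (W : opens C) v, oset W x -> D W _ (xc W v) = 0) ->
  forall (W : opens C) k (f : @sec R C W k), oset W x -> D W k f = 0.
Proof.
move=> hA hD E; suff H N W k (f : @sec R C W k) : oset W x -> gfil N (D W k f).
  by move=> W k f Wx; apply/gfil_eq0 => N; exact: H.
elim: N W k f => // N IH W k f Wx; have [B [h [G [Bx Gf]]]] := graded_hadamard f Wx.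
rewrite -(gd_res hD h f Bx) Gf (gdD Bx _ _ hD) (gd_sum Bx _ _ hD).
have -> : D B k (cst_sec B k (coef (f : gsec W k) (mzero (gvars d)) x)) = 0.
  case: (eqVneq k 0) => [k0|k0]; last by rewrite cst_sec_neq0 // (gd0 Bx _ hD).
  move: (coef _ _ _) => c; rewrite k0 cst_sec0 (gdZ Bx _ _ hD) (gd_one Bx hA hD).
  by rewrite scaler0.
rewrite add0r; apply: gfil_sum => v _; rewrite (gd_mul hD _ _ _ Bx).
have -> : D B _ (xcc B x v) = 0.
  case: v => [i|j]; last by rewrite xcc_inr E.
  by rewrite xcc_inl (gdD Bx _ _ hD) -scaleN1r !(gdZ Bx _ _ hD) (gd_one Bx hA hD) E // !scaler0 addr0.
rewrite mul0r add0r; apply: gfilZ; rewrite -[N.+1]add1n.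
by apply: gfilM; [exact: gh_xcc_fil|exact: IH].
Qed.

End GermUniqueness.

(** * Invertible germs on graded domains *)

Section Units.
Variables (R : realType) (d : gdim).
Local Notation V := 'rV[R]_(gdim0 d).
Local Notation C := (gdomain R d).
Local Notation L := (gser R (@gdeg d)).

Lemma open_cap_preimage (T S : topologicalType) (U : set T) (W : set S) (f : T -> S) :
  open U -> open W -> (forall x, U x -> {for x, continuous f}) -> open (U `&` f @^-1` W).
Proof.
move=> oU oW cf; rewrite openE => x [Ux Wx]; apply: filterI; first exact: open_nbhs_nbhs.
by apply: (cf x Ux); exact: open_nbhs_nbhs.
Qed.

Lemma gfilX (q : nat) (deg : 'I_q -> int) (t : gser R deg) r : gfil 1 t -> gfil r (t ^+ r).
Proof. by move=> ft; elim: r => [|r IH] //; rewrite exprS -add1n; exact: gfilM. Qed.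

Lemma gsh0X (q : nat) (deg : 'I_q -> int) (t : gser R deg) r : gsh 0 t -> gsh 0 (t ^+ r).
Proof. by move=> ht; elim: r => [|r IH]; [exact: gsh1|rewrite exprS -[0]addr0; exact: gshM]. Qed.

Lemma smooth_famX n (q : nat) (deg : 'I_q -> int) (U : set 'rV[R]_n) (F : 'rV[R]_n -> gser R deg) r :
  open U -> smooth_fam U F -> smooth_fam U (fun p => F p ^+ r).
Proof.
move=> oU sF; elim: r => [|r IH]; first exact: smooth_famC.
by under [fun p => _]funext do rewrite exprS; exact: smooth_famM.
Qed.

(** Geometric series: near [p] one has [f = b (1 - t)] with [t] free of constant term, so the sum of
    the [b^-1 t^r] is finite in each coefficient. The degree is 0 because the body of any other
    degree vanishes. *)
Lemma gunit_of_body (W : opens C) k (f : @sec R C W k) (p : C) : oset W p ->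
  gbody (ev p f) != 0 -> gunit_at p f.
Proof.
move=> Wp fp; have k0 : k = 0.
  by apply/eqP; apply: contraNT fp => k0; apply/eqP; exact: gsh_body (ev_gsh p f) k0.
move: f fp; rewrite {}k0 => f fp.
pose b (x : V) : R := gbody (ev x f).
have sb : smooth W b := ev_smooth f (mzero (gvars d)).
have oW' : open (W `&` b @^-1` [set x | x != 0]).
  apply: open_cap_preimage; [exact: opensP|exact: open_neq|].
  by move=> x; exact: smooth_continuous.
pose W' : opens C := Opens oW'.
have hW : W' `<=` W by move=> x [].
have W'p : oset W' p by [].
exists W', hW; split=> //.
pose t (x : V) : L := 1 - (b x)^-1 *: ev x f.
pose F (r : nat) (x : V) : L := (b x)^-1 *: t x ^+ r.
have sbi : smooth W' (fun x => (b x)^-1).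
  by apply: (smoothV (opensP W') _ (smooth_sub hW sb)) => x [].
have st : smooth_fam W' t.
  apply: smooth_famD; [exact: opensP|exact: smooth_famC|].
  under [fun p => _]funext do rewrite -scaleNr.
  apply: smooth_famZ; [exact: opensP| |].
    by move=> r; apply: smooth_eq (_ : smooth W' (fun x => -1 * (b x)^-1)) r;
       [exact: opensP|by move=> x _; rewrite mulN1r|
        move=> r; apply: CrM; [exact: opensP|exact: CrC|exact: sbi]].
  by move=> a; apply: smooth_sub hW _; exact: ev_smooth.
have sF r : smooth_fam W' (F r).
  exact: (smooth_famZ (opensP W') sbi (smooth_famX r (opensP W') st)).
have t1 x : b x != 0 -> gfil 1 (t x).
  move=> bx; apply: gfil1; rewrite /t /gbody gcB gc1 eqxx gcZ.
  by rewrite -[gc (ev x f) _]/(b x) mulVf // subrr.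
have ht x : gsh 0 (t x).
  rewrite /t -scaleNr; apply: gshD; first exact: gsh1.
  by apply: gshZ; exact: ev_gsh.
have hF x : gsh (- 0) (gsum (fun r => F r x)).
  by rewrite oppr0; apply: gsh_gsum => r; apply: gshZ; exact: gsh0X.
exists (fsec (smooth_fam_gsum (opensP W') sF) (fun x _ => hF x)).
apply: sec_ev_eq => x W'x; rewrite ev_mul ev_res // ev_fsec // ev_one //.
have bx : b x != 0 by case: W'x.
have fF r : gfil r (F r x) by apply: gfilZ; apply: gfilX; exact: t1.
apply/eqP; rewrite -subr_eq0; apply/eqP/gfil_eq0 => N.
set G := gsum _; pose SN := \sum_(r < N) F r x.
have -> : ev x f * G - 1 = ev x f * (G - SN) + (ev x f * SN - 1) by rewrite mulrBr addrA subrK.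
apply: gfilD; first by rewrite -[N]add0n; apply: gfilM => //; exact: gsum_fil.
have -> : ev x f * SN - 1 = - t x ^+ N.
  have -> : ev x f = b x *: (1 - t x).
    by rewrite /t opprB addrC subrK scalerA mulfV // scale1r.
  have -> : SN = (b x)^-1 *: \sum_(r < N) t x ^+ r by rewrite scaler_sumr.
  rewrite -gsmulZl -gsmulZr scalerA mulfV // scale1r.
  by rewrite -(opprB (t x) 1) mulNr -subrX1 opprB addrAC subrr sub0r.
by rewrite -scaleN1r; apply/gfilZ/gfilX/t1.
Qed.

End Units.

Lemma signz_sqr (R : unitRingType) (z : int) : (-1 : R) ^ z * (-1) ^ z = 1.
Proof. by rewrite sign_exprz -expr2 sqrr_sign. Qed.

Lemma subr_trans4 (V : zmodType) (a b u w : V) : a - b = a - u + (u - w) + (w - b).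
Proof. by rewrite [a - u + _]addrA subrK addrA subrK. Qed.

Section DerivativeRules.
Variables (R : realType) (d : gdim).
Local Notation C := (gdomain R d).
Local Notation L := (gser R (@gdeg d)).
Implicit Types (W : opens C) (k : int).

Lemma pder0 v W k : pder v (0 : @sec R C W k) = 0.
Proof. by have := pder_lin v (-1) (0 : @sec R C W k) 0; rewrite scaler0 addr0 scaleN1r addNr. Qed.

Lemma pder_one v W : pder v (gone W : @sec R C W 0) = 0.
Proof.
apply: sec_ev_eq => p Wp; rewrite ev0 ev_pder //.
have := pder_famM v (addr0 0) (gone W) (gone W : @sec R C W 0) Wp.
rewrite gmul1 ev_one // mulr1 mul1r mulr0 expr0z scale1r => /eqP.
by rewrite -[X in X == _]addr0 (inj_eq (addrI _)) eq_sym => /eqP.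
Qed.

Lemma pder_cst v W k c : pder v (cst_sec W k c : @sec R C W k) = 0.
Proof.
have [->|k0] := eqVneq k 0; last by rewrite cst_sec_neq0 // pder0.
rewrite cst_sec0 -[_ *: _]addr0 pder_lin pder0 addr0.
by rewrite pder_one scaler0.
Qed.

Lemma sec_cst W k (f : @sec R C W k) c : (forall p, oset W p -> ev p f = c%:A) -> f = cst_sec W k c.
Proof.
move=> E; apply: sec_ev_eq => p Wp; rewrite ev_fsec // E //.
case: (eqVneq k 0) => // k0; have := gsh_body (ev_gsh p f) k0.
by rewrite E // gbody_scalar => ->; rewrite scale0r.
Qed.

Lemma pder_pder_xc u v w W : pder u (pder v (xc W w : @sec R C W _)) = 0.
Proof.
rewrite (@sec_cst W _ (pder v (xc W w)) (v == w)%:R); first exact: pder_cst.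
by move=> p Wp; rewrite pder_xc.
Qed.

End DerivativeRules.

(** * Morphisms out of a graded domain, and morphisms with prescribed coordinates *)

Section GermOfMap.
Variables (R : realType) (e : gdim) (X : gspace R) (phi : gmap (gdomain R e) X).

(** The clause on bodies is locality on stalks, read backwards: a pullback with non-zero body is
    invertible, so the original germ is. *)
Lemma gmap_germ (p : gdomain R e) : oset (gdom phi) p ->
  germ_hom (phi p) (fun W k f => ev p (gpull phi f) : gser R (@gdeg e)).
Proof.
move=> dp; split.
- by move=> W k a f g Wx; rewrite gpullP evP.
- by move=> W Wx; rewrite gpull_one ev_one.
- by move=> W i j k ee f g Wx; rewrite gpull_mul ev_mul.
- move=> W W' h k f Wx; have h' : gpre phi W' `<=` gpre phi W by move=> x [? ?]; split=> //; exact: h.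
  by rewrite (gpull_res h h') ev_res.
- by move=> W k f Wx; exact: ev_gsh.
- move=> W f Wx nu; apply: contrapT => /eqP b0; apply: nu; apply: gpull_local => //.
  exact: gunit_of_body b0.
Qed.

End GermOfMap.

(* The Taylor expansion of [f] at the body of the prescribed coordinates [y], evaluated on their
   nilpotent parts [nu]: the exponential of the derivation [sum_v nu_v d/dx_v]. *)
Section MapFromCoordinates.
Variables (R : realType) (e d : gdim).
Local Notation E := (gdomain R e).
Local Notation D := (gdomain R d).
Local Notation L := (gser R (@gdeg e)).
Variables (U : opens E) (y : forall v : cvar d, @sec R E U (cdeg v)).
Implicit Types (W : opens D) (k : int).

Definition gt_fun (p : E) : D := \row_i gbody (ev p (y (inl i))).

Lemma gt_fun_smooth j : smooth U (fun p => (gt_fun p : 'rV[R]_(gdim0 d)) 0 j).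
Proof.
apply: smooth_eq (_ : smooth U (fun p => gbody (ev p (y (inl j))))); first exact: opensP.
  by move=> x _; rewrite mxE.
exact: (ev_smooth (y (inl j))).
Qed.

Lemma gt_cont W : open (U `&` gt_fun @^-1` W).
Proof.
apply: open_cap_preimage; [exact: opensP|exact: opensP|].
move=> p Up; apply: continuous_rV => j.
exact: smooth_continuous (gt_fun_smooth j) Up.
Qed.
Local Notation gpre W := (Opens (@gt_cont W)).

Lemma gt_comp_smooth W (f : 'rV[R]_(gdim0 d) -> R) : smooth W f ->
  smooth (gpre W) (f \o gt_fun).
Proof.
move=> sf r; apply: (Cr_comp (opensP (gpre W)) (opensP W) sf); first by move=> p [].
move=> j; apply: Cr_sub (gt_fun_smooth j r).
by move=> p [].
Qed.

Definition nu (v : cvar d) (p : E) : L := ev p (y v) - (cval (gt_fun p) v)%:A.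

Lemma nu_fil v p : gfil 1 (nu v p).
Proof.
apply: gfil1; rewrite /nu /gbody gcB gcZ gc1 eqxx mulr1.
case: v => [i|j]; first by rewrite /= mxE subrr.
by rewrite subr0; exact: (gsh_body (ev_gsh p (y (inr j))) (gdeg_neq0 j)).
Qed.

Lemma nu_gsh v p : gsh (cdeg v) (nu v p).
Proof.
have H := ev_gsh p (y v).
case: v H => [i|j] H; rewrite /nu /= ?scale0r ?subr0 // -scaleNr.
by apply: gshD => //; exact: gsh_scalar.
Qed.

Lemma nu_smooth v : smooth_fam U (nu v).
Proof.
have oU := opensP U.
case: v => [i|j]; last first.
  rewrite (_ : nu _ = fun p => ev p (y (inr j))); first exact: ev_smooth.
  by apply/funext => p; rewrite /nu scale0r subr0.
rewrite (_ : nu _ = fun p => ev p (y (inl i)) + (-1 * (gt_fun p : 'rV[R]_(gdim0 d)) 0 i) *: 1); last first.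
  by apply/funext => p; rewrite /nu mulN1r scaleNr.
apply: (smooth_famD oU (ev_smooth (y (inl i)))).
apply: (smooth_famZ oU _ (smooth_famC U 1)) => r.
by apply: (CrM oU (CrC r U (-1)) (gt_fun_smooth i r)).
Qed.

(** The [r]-th Taylor term: dividing by [r'.+1] at each level builds up the factorial, and at order
    0 only the body at the underlying point is left. *)
Fixpoint UU (r : nat) W k (f : @sec R D W k) (p : E) : L :=
  if r is r'.+1 then (r'.+1%:R^-1) *: \sum_v nu v p * UU r' (pder v f) p
  else (gbody (ev (gt_fun p) f))%:A.

Lemma UU_lin r W k (a : R) (f g : @sec R D W k) p :
  UU r (a *: f + g) p = a *: UU r f p + UU r g p.
Proof.
elim: r k f g => [|r IH] k f g.
  rewrite -[LHS]/((gbody (ev (gt_fun p) (a *: f + g)))%:A) evP.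
  by rewrite /gbody gcD gcZ scalerDl -scalerA.
rewrite /= scalerA mulrC -scalerA -scalerDr; congr (_ *: _).
rewrite scaler_sumr -big_split; apply: eq_bigr => v _ /=.
by rewrite pder_lin IH mulrDr gsmulZr.
Qed.

Lemma UU0 r W k p : UU r (0 : @sec R D W k) p = 0.
Proof. by have := UU_lin r (-1) (0 : @sec R D W k) 0 p; rewrite scaler0 addr0 scaleN1r addNr. Qed.

Lemma UUD r W k (f g : @sec R D W k) p : UU r (f + g) p = UU r f p + UU r g p.
Proof. by have := UU_lin r 1 f g p; rewrite !scale1r. Qed.

Lemma UUZ r W k a (f : @sec R D W k) p : UU r (a *: f) p = a *: UU r f p.
Proof. by have := UU_lin r a f 0 p; rewrite UU0 !addr0. Qed.

Lemma UU_gsh r W k (f : @sec R D W k) p : gsh k (UU r f p).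
Proof.
elim: r k f => [|r IH] k f.
  rewrite -[UU 0 f p]/((gbody (ev (gt_fun p) f))%:A).
  have [k0|k0] := eqVneq k 0; first by move: (gbody _) => c; rewrite k0; exact: gsh_scalar.
  by rewrite (gsh_body (ev_gsh _ f) k0) scale0r.
rewrite /=; apply/gshZ/gsh_sum => v _; have := gshM (@nu_gsh v p) (IH _ (pder v f)).
by rewrite subrKC.
Qed.

Lemma UU_fil r W k (f : @sec R D W k) p : gfil r (UU r f p).
Proof.
elim: r k f => [|r IH] k f //=; apply/gfilZ/gfil_sum => v _.
by rewrite -[r.+1]add1n; apply: gfilM; [exact: nu_fil|exact: IH].
Qed.

Lemma UU_smooth r W k (f : @sec R D W k) : smooth_fam (gpre W) (UU r f).
Proof.
elim: r k f => [|r IH] k f /=.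
  apply: (smooth_famZ (opensP (gpre W)) _ (smooth_famC _ 1)).
  by apply: gt_comp_smooth; exact: (ev_smooth f).
apply: (smooth_famZ (opensP (gpre W)) (fun r' => CrC r' _ _)).
apply: (@smooth_fam_sum _ _ _ _ (gpre W) _ (index_enum _)
  (fun v p => nu v p * UU r (pder v f) p) (opensP (gpre W))) => v.
apply: (smooth_famM (opensP (gpre W)) _ (IH _ (pder v f))).
by move=> a; apply: smooth_sub (@nu_smooth v a) => p [].
Qed.

Lemma UU_res r W W' (h : W' `<=` W) k (f : @sec R D W k) p : oset W' (gt_fun p) ->
  UU r (res h f) p = UU r f p.
Proof.
move=> Wp; elim: r k f => [|r IH] k f; first by rewrite -[LHS]/((gbody (ev (gt_fun p) (res h f)))%:A) ev_res.
rewrite /=.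
by congr (_ *: _); apply: eq_bigr => v _; rewrite pder_res IH.
Qed.

Lemma UU0E W k (f : @sec R D W k) p : UU 0 f p = (gbody (ev (gt_fun p) f))%:A.
Proof. by []. Qed.

Lemma UUS r W k (f : @sec R D W k) p :
  UU r.+1 f p = r.+1%:R^-1 *: \sum_v nu v p * UU r (pder v f) p.
Proof. by []. Qed.
Arguments UU : simpl never.

(** The exponential of a derivation is multiplicative, order by order. After multiplication by
    [r.+1], the Leibniz rule yields each product of orders [s] and [r.+1 - s] with multiplicity
    [s + (r.+1 - s)]. *)
Lemma UU_mul r W i j k (ee : i + j = k) (f : @sec R D W i) (g : @sec R D W j) p :
  oset W (gt_fun p) ->
  UU r (gmul ee f g) p = \sum_(s < r.+1) UU s f p * UU (r - s) g p.
Proof.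
move=> Wp; elim: r i j k ee f g => [|r IH] i j k ee f g.
  rewrite big_ord1 -[LHS]/((gbody (ev (gt_fun p) (gmul ee f g)))%:A) ev_mul gbodyM.
  by rewrite /UU mulr_algl scalerA.
have E1 (v : cvar d) : i - cdeg v + j = k - cdeg v by rewrite -ee addrAC.
have E2 (v : cvar d) : i + (j - cdeg v) = k - cdeg v by rewrite -ee addrA.
have Dm (v : cvar d) : pder v (gmul ee f g) = gmul (E1 v) (pder v f) g + (-1) ^ (cdeg v * i) *: gmul (E2 v) f (pder v g).
  by apply: sec_ev_eq => x Wx; rewrite evD evZ; exact: pder_mul.
have r0 : r.+1%:R != 0 :> R by rewrite pnatr_eq0.
apply: (scalerI r0); rewrite UUS scalerA mulfV // scale1r.
have -> : \sum_v nu v p * UU r (pder v (gmul ee f g)) p =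
    \sum_(s < r.+1) ((\sum_v nu v p * UU s (pder v f) p) * UU (r - s) g p +
                     UU s f p * (\sum_v nu v p * UU (r - s) (pder v g) p)).
  under eq_bigr => v _.
    rewrite Dm UUD UUZ !IH mulrDr -gsmulZr.
    (* The sign of the Leibniz rule is absorbed by moving [nu v p] past [UU s f p], which has degree
       [i]. *)
    have -> : (-1) ^ (cdeg v * i) *: (nu v p * \sum_(s < r.+1) UU s f p * UU (r - s) (pder v g) p) =
        \sum_(s < r.+1) UU s f p * (nu v p * UU (r - s) (pder v g) p).
      rewrite mulr_sumr scaler_sumr; apply: eq_bigr => s _.
      rewrite !mulrA (gscomm (@nu_gsh v p) (UU_gsh s f p)) -gsmulZl scalerA.
      by rewrite signz_sqr scale1r.
    rewrite mulr_sumr -big_split /=; over.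
  rewrite exchange_big; apply: eq_bigr => s _ /=.
  rewrite big_split /= mulr_suml mulr_sumr; congr (_ + _).
  by apply: eq_bigr => v _; rewrite mulrA.
have S s k' (h : @sec R D W k') : \sum_v nu v p * UU s (pder v h) p = s.+1%:R *: UU s.+1 h p.
  by rewrite UUS scalerA mulfV ?scale1r // pnatr_eq0.
under eq_bigr => s _ do rewrite !S.
rewrite big_split /=.
rewrite scaler_sumr.
transitivity (\sum_(s < r.+2) (s%:R *: (UU s f p * UU (r.+1 - s) g p) +
                               (r.+1 - s)%:R *: (UU s f p * UU (r.+1 - s) g p))); last first.
  apply: eq_bigr => s _; rewrite -scalerDl -natrD subnKC //.
  by have := ltn_ord s; rewrite ltnS.
rewrite [RHS]big_split /=; congr (_ + _).
  rewrite [RHS]big_ord_recl (_ : (ord0 : 'I_r.+2)%:R = 0 :> R) // scale0r add0r.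
  by apply: eq_bigr => s _; rewrite lift0 subSS -gsmulZl.
rewrite [RHS]big_ord_recr /= subnn scale0r addr0; apply: eq_bigr => s _.
by rewrite -gsmulZr subSn // -ltnS.
Qed.

Lemma UU_one r W p : oset W (gt_fun p) -> UU r (gone W : @sec R D W 0) p = (r == 0%N)%:R.
Proof.
move=> Wp; case: r => [|r]; first by rewrite /UU ev_one // gbody1 scale1r.
by rewrite UUS big1 ?scaler0 // => v _; rewrite pder_one UU0 mulr0.
Qed.

Definition SS W k (f : @sec R D W k) (p : E) : L := gsum (fun r => UU r f p).

Lemma SS_lin W k (a : R) (f g : @sec R D W k) p : SS (a *: f + g) p = a *: SS f p + SS g p.
Proof.
apply: gser_eqP => c; rewrite gcD gcZ /= /gsum_raw big_distrr -big_split.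
by apply: eq_bigr => r _ /=; rewrite UU_lin gcD gcZ.
Qed.

(** Modulo the [N]-th power of the ideal all three series may be truncated at order [N]; the
    products of terms whose orders add up to at least [N] lie in that power. *)
Lemma SS_mul W i j k (ee : i + j = k) (f : @sec R D W i) (g : @sec R D W j) p :
  oset W (gt_fun p) -> SS (gmul ee f g) p = SS f p * SS g p.
Proof.
move=> Wp; apply/eqP; rewrite -subr_eq0; apply/eqP/gfil_eq0 => N.
pose P k (f : @sec R D W k) := \sum_(r < N) UU r f p.
have HP k' (h : @sec R D W k') : gfil N (SS h p - P _ h).
  by apply: gsum_fil => r; exact: UU_fil.
have H1 : SS f p * SS g p - P _ f * P _ g = (SS f p - P _ f) * SS g p + P _ f * (SS g p - P _ g).
  by rewrite mulrBl mulrBr addrA subrK.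
have -> : SS (gmul ee f g) p - SS f p * SS g p = (SS (gmul ee f g) p - P _ (gmul ee f g))
   + (P _ (gmul ee f g) - P _ f * P _ g) + (P _ f * P _ g - SS f p * SS g p).
  exact: subr_trans4.
apply: gfilD; last first.
  rewrite -opprB H1 -scaleN1r; apply/gfilZ/gfilD.
    by rewrite -[N]addn0; exact: gfilM.
  by rewrite -[N]add0n; exact: gfilM.
apply: gfilD; first exact: HP.
have -> : P _ (gmul ee f g) = \sum_(s < N) \sum_(t < N | (t < N - s)%N) UU s f p * UU t g p.
  rewrite /P; under eq_bigr => r _.
    rewrite UU_mul // (big_ord_widen N (fun s => UU s f p * UU (r - s) g p)) //; over.
  rewrite (exchange_big_dep predT) //=; apply: eq_bigr => s _.
  rewrite -(big_ord_widen N (fun t => UU s f p * UU t g p)) ?leq_subr // -(big_mkord xpredT (fun t => UU s f p * UU t g p)).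
  rewrite -[in RHS](addnK s (N - s)%N) subnK ?(ltnW (ltn_ord s)) //.
  have -> : \sum_(r < N | (s < r.+1)%N) UU s f p * UU (r - s) g p =
     \sum_(s <= r < N) UU s f p * UU (r - s) g p by rewrite big_geq_mkord.
  rewrite -{1}[s : nat]add0n big_addn; apply: eq_bigr => r _.
  by rewrite addnK.
rewrite mulr_suml -sumrB; apply: gfil_sum => s _; rewrite mulr_sumr.
rewrite [X in _ - X](bigID (fun t : 'I_N => (t < N - s)%N)) /= opprD addNKr.
rewrite -scaleN1r; apply/gfilZ/gfil_sum => t; rewrite -leqNgt leq_subLR => H.
by apply: (gfilW H); apply: gfilM; exact: UU_fil.
Qed.

Lemma SS_one W p : oset W (gt_fun p) -> SS (gone W : @sec R D W 0) p = 1.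
Proof.
move=> Wp; apply/eqP; rewrite -subr_eq0; apply/eqP/gfil_eq0 => N.
apply: (gfilW (leqnSn N)).
have := @gsum_fil _ _ _ (fun r => UU r (gone W : @sec R D W 0) p) N.+1 (fun r => @UU_fil r _ _ _ p).
by rewrite big_ord_recl UU_one // big1 ?addr0 // => r _; rewrite UU_one.
Qed.

Lemma SS_res W W' (h : W' `<=` W) k (f : @sec R D W k) p : oset W' (gt_fun p) ->
  SS (res h f) p = SS f p.
Proof.
move=> Wp; apply: gser_eqP => c; rewrite /= /gsum_raw.
by apply: eq_bigr => r _; rewrite UU_res.
Qed.

Lemma SS_xc W v p : oset W (gt_fun p) -> oset U p -> SS (xc W v : @sec R D W _) p = ev p (y v).
Proof.
move=> Wp Up; apply/eqP; rewrite -subr_eq0; apply/eqP/gfil_eq0 => N.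
(* Two more orders than required, so that the terms of orders 0 and 1, the only ones that survive on
   a coordinate, are always present in the truncated sum. *)
apply: (gfilW (leq_addl 2 N)).
have := @gsum_fil _ _ _ (fun r => UU r (xc W v : @sec R D W _) p) N.+2 (fun r => @UU_fil r _ _ _ p).
rewrite -(big_mkord xpredT (fun r => UU r (xc W v : @sec R D W _) p)) 2?big_ltn //.
rewrite big_nat_cond big1 ?addr0 => [|[|[|r]] // _].
  rewrite UU0E ev_xc // gbody_cgen UUS invr1 scale1r (bigD1 v) //= UU0E pder_xc //.
  rewrite eqxx gbody_scalar !scale1r mulr1 big1 ?addr0 => [|w wv].
    by rewrite /nu subrKC.
  by rewrite UU0E pder_xc // (negbTE wv) gbody_scalar scale0r mulr0.
rewrite UUS big1 ?scaler0 // => w _; rewrite UUS big1 ?scaler0 ?mulr0 // => u _.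
by rewrite pder_pder_xc UU0 mulr0.
Qed.

Lemma SS_body W k (f : @sec R D W k) p : gbody (SS f p) = gbody (ev (gt_fun p) f).
Proof. by rewrite gsum_body /UU gbody_scalar. Qed.

Lemma SS_smooth W k (f : @sec R D W k) : smooth_fam (gpre W) (SS f).
Proof. by apply: smooth_fam_gsum => [|r]; [exact: opensP|exact: UU_smooth]. Qed.

Definition gt_pull W k (f : @sec R D W k) : @sec R E (gpre W) k :=
  fsec (@SS_smooth W k f) (fun p _ => gsh_gsum (fun r => @UU_gsh r W k f p)).

Lemma ev_gt_pull W k (f : @sec R D W k) p : oset (gpre W) p -> ev p (gt_pull f) = SS f p.
Proof. exact: ev_fsec. Qed.

Definition gt_map : gmap E D.
Proof.
refine (@GMap R E D U gt_fun gt_cont gt_pull _ _ _ _ _).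
- by move=> W k a f g; apply: sec_ev_eq => p Wp; rewrite evP !ev_gt_pull // SS_lin.
- by move=> W; apply: sec_ev_eq => p Wp; rewrite ev_one // ev_gt_pull // SS_one //; case: Wp.
- by move=> W i j k ee f g; apply: sec_ev_eq => p Wp; rewrite ev_mul !ev_gt_pull // SS_mul //; case: Wp.
- move=> W W' h h' k f; apply: sec_ev_eq => p Wp; rewrite ev_res // !ev_gt_pull //; last exact: h'.
  by rewrite SS_res //; case: Wp.
- move=> W k f p Up Wp /gunit_ev_body; rewrite ev_gt_pull // SS_body.
  exact: gunit_of_body.
Defined.

Lemma gt_map_xc W v p : oset (gpre W) p -> ev p (gpull gt_map (xc W v : @sec R D W _)) = ev p (y v).
Proof. by move=> Wp; rewrite ev_gt_pull // SS_xc //; case: Wp. Qed.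

End MapFromCoordinates.

(** * Germs of sections and of maps; restriction and gluing of maps *)

Section GermEquality.
Variable R : realType.
Implicit Types X Y Z : gspace R.

(** Equality of germs for sections over different open sets, which frees later statements from the
    inclusion proofs carried by [res]. The relation [meq] does the same for maps. *)
Definition agree X (z : X) (U V : opens X) k (s : sec U k) (t : sec V k) :=
  exists (N : opens X) (h : N `<=` U) (h' : N `<=` V), oset N z /\ res h s = res h' t.

Definition meq X Y (z : X) (phi psi : gmap X Y) := exists2 N : opens X, oset N z & geq_on N phi psi.

Definition ocap X (U V : opens X) : opens X := Opens (openI (opensP U) (opensP V)).

Lemma ocapl X (U V : opens X) : ocap U V `<=` U. Proof. by move=> x []. Qed.
Lemma ocapr X (U V : opens X) : ocap U V `<=` V. Proof. by move=> x []. Qed.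

Lemma agree_refl X (z : X) (U : opens X) k (s : sec U k) : oset U z -> agree z s s.
Proof. by move=> Uz; exists U, (@subset_refl _ U), (@subset_refl _ U). Qed.

Lemma agree_sym X (z : X) (U V : opens X) k (s : sec U k) (t : sec V k) : agree z s t -> agree z t s.
Proof. by move=> [N [h [h' [Nz E]]]]; exists N, h', h. Qed.

Lemma agree_trans X (z : X) (U V W : opens X) k (s : sec U k) (t : sec V k) (u : sec W k) :
  agree z s t -> agree z t u -> agree z s u.
Proof.
move=> [N [h [h' [Nz E]]]] [N' [g [g' [N'z E']]]].
exists (ocap N N'), (subset_trans (@ocapl _ N N') h), (subset_trans (@ocapr _ N N') g').
split=> //; rewrite -(res_comp h (@ocapl _ N N')) E (res_comp _ _ (subset_trans (@ocapr _ N N') g)).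
by rewrite -(res_comp g (@ocapr _ N N')) E' (res_comp _ _ (subset_trans (@ocapr _ N N') g')).
Qed.

Lemma agree_res X (z : X) (U V : opens X) (h : V `<=` U) k (s : sec U k) : oset V z ->
  agree z (res h s) s.
Proof. by move=> Vz; exists V, (@subset_refl _ V), h; split=> //; rewrite res_id. Qed.

Lemma germ_agree q (deg : 'I_q -> int) X (z : X) (A : forall (W : opens X) k, sec W k -> gser R deg)
    (U V : opens X) k (s : sec U k) (t : sec V k) :
  (forall (W W' : opens X) (h : W' `<=` W) k (f : sec W k), oset W' z -> A W' k (res h f) = A W k f) ->
  agree z s t -> A U k s = A V k t.
Proof. by move=> HA [N [h [h' [Nz E]]]]; rewrite -(HA _ _ h _ s Nz) E HA. Qed.

Lemma agree_ev (d : gdim) (p : gdomain R d) (U V : opens (gdomain R d)) k (s : @sec R (gdomain R d) U k)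
  (t : @sec R (gdomain R d) V k) : agree p s t -> ev p s = ev p t.
Proof.
by move=> H; apply: (germ_agree (A := fun W k f => ev p f) _ H) => W W' h j f Wp; exact: ev_res.
Qed.

Lemma gpre_mono X Y (phi : gmap X Y) (W W' : opens Y) : W' `<=` W -> gpre phi W' `<=` gpre phi W.
Proof. by move=> h x [? ?]; split=> //; exact: h. Qed.

Lemma agree_pull X Y (phi : gmap X Y) (z : X) (U V : opens Y) k (s : sec U k) (t : sec V k) :
  oset (gdom phi) z -> agree (phi z) s t -> agree z (gpull phi s) (gpull phi t).
Proof.
move=> dz [N [h [h' [Nz E]]]]; exists (gpre phi N), (gpre_mono h), (gpre_mono h').
by split=> //; rewrite -(gpull_res h (gpre_mono h)) E (gpull_res h' (gpre_mono h')).
Qed.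

Lemma agree_comp X Y Z (psi : gmap Y Z) (phi : gmap X Y) (z : X) (W : opens Z) k (f : sec W k) :
  oset (gpre (gcomp psi phi) W) z -> agree z (gpull (gcomp psi phi) f) (gpull phi (gpull psi f)).
Proof. by move=> Wz; exact: agree_res. Qed.

Lemma meq_pull X Y (z : X) (phi psi : gmap X Y) (W : opens Y) k (f : sec W k) :
  meq z phi psi -> oset W (phi z) -> agree z (gpull phi f) (gpull psi f).
Proof.
move=> [N Nz [h1 h2 E1 E2]] Wz; have Ez := E1 z (mem_set Nz).
pose N' := ocap N (ocap (gpre phi W) (gpre psi W)).
have g1 : N' `<=` gpre phi W by move=> x [_ []].
have g2 : N' `<=` gpre psi W by move=> x [_ []].
exists N', g1, g2; split; last by apply: E2 => x [].
split=> //; split; split=> //=; [exact: h1|exact: h2|].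
by rewrite -Ez.
Qed.

Lemma meq_pt X Y (z : X) (phi psi : gmap X Y) : meq z phi psi -> phi z = psi z.
Proof. by move=> [N Nz [_ _ E _]]; apply: E; exact: mem_set. Qed.

Lemma meq_doml X Y (z : X) (phi psi : gmap X Y) : meq z phi psi -> oset (gdom phi) z.
Proof. by move=> [N Nz [h _ _ _]]; exact: h. Qed.

Lemma meq_near X Y (z : X) (phi psi : gmap X Y) : meq z phi psi ->
  exists2 N : opens X, oset N z & forall x, oset N x -> meq x phi psi.
Proof. by move=> [N Nz H]; exists N => // x Nx; exists N. Qed.

(** Each point of [V] has a neighbourhood on which the two pullbacks coincide, and separation of the
    sheaf assembles these local equalities. *)
Lemma geq_of_agree X Y (U : set X) (phi psi : gmap X Y) :
  U `<=` gdom phi -> U `<=` gdom psi -> {in U, phi =1 psi} ->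
  (forall z, U z -> forall (W : opens Y) k (f : sec W k), oset W (phi z) ->
     agree z (gpull phi f) (gpull psi f)) -> geq_on U phi psi.
Proof.
move=> h1 h2 E H; split=> // W k f V h h' VU.
pose I := {z : X | oset V z}.
have HI (i : I) : exists N : opens X, [/\ oset N (sval i), N `<=` V &
    forall (g : N `<=` gpre phi W) (g' : N `<=` gpre psi W), res g (gpull phi f) = res g' (gpull psi f)].
  case: i => z Vz /=; have Wz : oset W (phi z) by have [] := h z Vz.
  have [N [g [g' [Nz EN]]]] := H z (VU z Vz) W k f Wz.
  exists (ocap N V); split=> //; first exact: ocapr.
  move=> l l'; rewrite -(res_comp g (@ocapl _ N V)) EN; exact: res_comp.
pose NN i := sval (cid (HI i)).
have hN i : NN i `<=` V by have [] := svalP (cid (HI i)).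
apply: (@sheaf_sep R X I NN V hN).
  by move=> z Vz; exists (exist _ z Vz) => //; have [] := svalP (cid (HI (exist _ z Vz))).
move=> i; have [_ _ Ei] := svalP (cid (HI i)).
rewrite (res_comp _ _ (subset_trans (hN i) h)) (res_comp _ _ (subset_trans (hN i) h')).
exact: Ei.
Qed.

Lemma geq_meq X Y (U : opens X) (phi psi : gmap X Y) (z : X) : oset U z -> geq_on U phi psi -> meq z phi psi.
Proof. by move=> Uz H; exists U. Qed.

Lemma geq_of_meq X Y (U : set X) (phi psi : gmap X Y) :
  (forall z, U z -> meq z phi psi) -> geq_on U phi psi.
Proof.
move=> H; apply: geq_of_agree.
- by move=> z /H/meq_doml.
- by move=> z /H[N Nz [_ h _ _]]; exact: h.
- by move=> z /set_mem/H/meq_pt.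
- by move=> z /H Hz W k f Wz; exact: meq_pull.
Qed.

Lemma geq_refl X Y (U : set X) (phi : gmap X Y) : U `<=` gdom phi -> geq_on U phi phi.
Proof.
move=> h; apply: geq_of_agree => // z Uz W k f Wz; apply: agree_refl.
by split=> //; exact: h.
Qed.

Lemma meq_refl X Y (z : X) (phi : gmap X Y) : oset (gdom phi) z -> meq z phi phi.
Proof. by move=> dz; exists (gdom phi) => //; exact: geq_refl. Qed.

Lemma meq_sym X Y (z : X) (phi psi : gmap X Y) : meq z phi psi -> meq z psi phi.
Proof.
move=> [N Nz [h1 h2 E H]]; exists N => //; split=> //; first by move=> x /E.
by move=> W k f V h h' VN; rewrite (H W k f V h' h).
Qed.

Lemma meq_domr X Y (z : X) (phi psi : gmap X Y) : meq z phi psi -> oset (gdom psi) z.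
Proof. by move/meq_sym/meq_doml. Qed.

(* Germs of maps are compared through the germs of their effect on sections. *)
Lemma meq_of_agree X Y (N : opens X) (phi psi : gmap X Y) (z : X) : oset N z ->
  N `<=` gdom phi -> N `<=` gdom psi -> {in N : set X, phi =1 psi} ->
  (forall x, oset N x -> forall (W : opens Y) k (f : sec W k), oset W (phi x) ->
     agree x (gpull phi f) (gpull psi f)) -> meq z phi psi.
Proof. by move=> Nz h1 h2 E H; exists N => //; exact: geq_of_agree. Qed.

Lemma meq_trans X Y (z : X) (phi psi chi : gmap X Y) : meq z phi psi -> meq z psi chi -> meq z phi chi.
Proof.
move=> /meq_near[N Nz H] /meq_near[N' N'z H'].
apply: (@meq_of_agree _ _ (ocap N N')) => //.
- by move=> x [/H/meq_doml].
- by move=> x [_ /H'/meq_domr].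
- by move=> x /set_mem[/H/meq_pt -> /H'/meq_pt].
move=> x [/H Hx /H' H'x] W k f Wx; apply: agree_trans (meq_pull f Hx Wx) _.
by apply: meq_pull H'x _; rewrite -(meq_pt Hx).
Qed.

Lemma meq_comp X Y Z (z : X) (phi phi' : gmap X Y) (psi psi' : gmap Y Z) :
  meq z phi phi' -> meq (phi z) psi psi' -> meq z (gcomp psi phi) (gcomp psi' phi').
Proof.
move=> /meq_near[N Nz H] /meq_near[N' N'z H'].
have dz := meq_doml (H z Nz).
have Hx x : oset N x -> oset N' (phi x) -> oset (gdom phi') x /\ oset (gdom psi') (phi' x).
  move=> Nx N'x; split; first exact: meq_domr (H x Nx).
  by rewrite -(meq_pt (H x Nx)); exact: meq_domr (H' _ N'x).
apply: (@meq_of_agree _ _ (ocap N (gpre phi N'))) => //.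
- by move=> x [Nx [dx N'x]]; split=> //=; exact: meq_doml (H' _ N'x).
- by move=> x [Nx [dx N'x]]; exact: (Hx x).
- move=> x /set_mem[Nx [dx N'x]] /=.
  by rewrite -(meq_pt (H x Nx)) (meq_pt (H' _ N'x)).
move=> x [Nx [dx N'x]] W k f Wx.
have E1 := meq_pt (H x Nx); have E2 := meq_pt (H' _ N'x).
have d1 := meq_doml (H' _ N'x); have d2 := meq_domr (H' _ N'x).
have [d3 d4] := Hx x Nx N'x.
have Wx' : oset W (psi' (phi' x)) by rewrite -E1 -E2.
apply: agree_trans (agree_comp f _) _; first by split=> //; split.
apply: agree_trans (agree_pull dx (meq_pull f (H' _ N'x) Wx)) _.
apply: agree_trans (meq_pull (gpull psi' f) (H x Nx) _) _; first by split=> //=; rewrite -E2.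
by apply/agree_sym/agree_comp; split=> //; split.
Qed.

Lemma meq_compl X Y Z (z : X) (phi phi' : gmap X Y) (psi : gmap Y Z) :
  meq z phi phi' -> oset (gdom psi) (phi z) -> meq z (gcomp psi phi) (gcomp psi phi').
Proof. by move=> H dz; apply: meq_comp H (meq_refl dz). Qed.

Lemma meq_compr X Y Z (z : X) (phi : gmap X Y) (psi psi' : gmap Y Z) : oset (gdom phi) z ->
  meq (phi z) psi psi' -> meq z (gcomp psi phi) (gcomp psi' phi).
Proof. by move=> dz; apply: meq_comp (meq_refl dz). Qed.

Lemma meq_assoc X Y Z T (z : X) (phi : gmap X Y) (psi : gmap Y Z) (chi : gmap Z T) :
  oset (gdom phi) z -> oset (gdom psi) (phi z) -> oset (gdom chi) (psi (phi z)) ->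
  meq z (gcomp (gcomp chi psi) phi) (gcomp chi (gcomp psi phi)).
Proof.
move=> d1 d2 d3; apply: (@meq_of_agree _ _ (gdom (gcomp (gcomp chi psi) phi))) => //.
  by move=> x [dx [ex fx]].
move=> x [dx [ex fx]] W k f Wx.
apply: agree_trans (agree_comp f _) _; first by split.
apply: agree_trans (agree_pull dx (agree_comp f _)) _; first by split.
apply: agree_trans (agree_sym (agree_comp (gpull chi f) _)) _; first by split.
by apply/agree_sym/agree_comp; split.
Qed.

Lemma agree_id X (z : X) (W : opens X) k (f : sec W k) : oset W z -> agree z (gpull (gid X) f) f.
Proof. by move=> Wz; apply: agree_res; split. Qed.

Lemma meq_idl X Y (z : X) (phi : gmap X Y) : oset (gdom phi) z -> meq z (gcomp (gid Y) phi) phi.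
Proof.
move=> dz; apply: (@meq_of_agree _ _ (gdom phi)) => //.
move=> x dx W k f Wx; apply: agree_trans (agree_comp f _) _; first by split.
by apply: agree_pull => //; exact: agree_id.
Qed.

Lemma meq_idr X Y (z : X) (phi : gmap X Y) : oset (gdom phi) z -> meq z (gcomp phi (gid X)) phi.
Proof.
move=> dz; apply: (@meq_of_agree _ _ (gdom phi)) => //.
move=> x dx W k f Wx; apply: agree_trans (agree_comp f _) _; first by split.
by apply: agree_id; split.
Qed.

Lemma chart_meq_map X (c : chart X) (z : X) : oset (gdom (chart_map c)) z ->
  meq z (gcomp (chart_inv c) (chart_map c)) (gid X).
Proof. by move=> dz; apply: geq_meq dz (chart_mapK c). Qed.

Lemma chart_meq_inv X (c : chart X) y : oset (gdom (chart_inv c)) y ->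
  meq y (gcomp (chart_map c) (chart_inv c)) (gid _).
Proof. by move=> dz; apply: geq_meq dz (chart_invK c). Qed.

Lemma chart_pt X (c : chart X) (z : X) : oset (gdom (chart_map c)) z ->
  oset (gdom (chart_inv c)) (chart_map c z) /\ chart_inv c (chart_map c z) = z.
Proof. by move=> /chart_meq_map H; split; [have [] := meq_doml H|exact: (meq_pt H)]. Qed.

(* A map from the open subspace [N] of [gdom phi]. *)
Section Restriction.
Variables (X Y : gspace R) (phi : gmap X Y) (N : opens X).

Lemma grestr_cont (W : opens Y) : open (ocap (gdom phi) N `&` phi @^-1` W).
Proof.
rewrite (_ : _ `&` _ = ocap (gpre phi W) N); first exact: opensP.
by apply/seteqP; split=> x [[? ?] ?]; do !split.
Qed.

Lemma grestr_sub (W : opens Y) : Opens (grestr_cont W) `<=` gpre phi W.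
Proof. by move=> x [[? ?] ?]; split. Qed.

Definition grestr : gmap X Y.
Proof.
refine (@GMap R X Y (ocap (gdom phi) N) phi grestr_cont (fun W k f => res (@grestr_sub W) (gpull phi f)) _ _ _ _ _).
- by move=> W k a f g; rewrite gpullP resP.
- by move=> W; rewrite gpull_one res_one.
- by move=> W i j k e f g; rewrite gpull_mul res_mul.
- move=> W W' h h' k f; rewrite (gpull_res h (gpre_mono h)).
  by rewrite !(res_comp _ _ (subset_trans h' (@grestr_sub W))).
- move=> W k f x [dx Nx] Wx /gunit_at_res => /(_ (conj (conj dx Nx) Wx)).
  exact: gpull_local.
Defined.

Lemma grestr_meq z : oset (gdom phi) z -> oset N z -> meq z grestr phi.
Proof.
move=> dz Nz; apply: (@meq_of_agree _ _ (ocap (gdom phi) N)) => //; first exact: ocapl.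
by move=> x [dx Nx] W k f Wx; apply: agree_res; split.
Qed.
End Restriction.

Lemma gunit_pull X Y (phi : gmap X Y) (z : X) (W : opens Y) k (f : sec W k) :
  oset (gdom phi) z -> gunit_at (phi z) f -> gunit_at z (gpull phi f).
Proof.
move=> dz [V [h [Vz [g E]]]]; exists (gpre phi V), (gpre_mono h); split=> //.
by exists (gpull phi g); rewrite -(gpull_res h (gpre_mono h)) -gpull_mul E gpull_one.
Qed.

Section Glue.
Variables (X Y : gspace R) (phi psi : gmap X Y).
Hypothesis compat : forall z, oset (gdom phi) z -> oset (gdom psi) z -> meq z phi psi.

Definition gglue_fun (z : X) : Y := if z \in (gdom phi : set X) then phi z else psi z.

Lemma gglue_funl z : oset (gdom phi) z -> gglue_fun z = phi z.
Proof. by move=> dz; rewrite /gglue_fun mem_set. Qed.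

Lemma gglue_funr z : oset (gdom psi) z -> gglue_fun z = psi z.
Proof.
move=> dz; rewrite /gglue_fun; case: ifPn => // /set_mem dz'.
exact: meq_pt (compat dz' dz).
Qed.

Lemma gglue_preE (W : opens Y) : (gdom phi `|` gdom psi) `&` gglue_fun @^-1` W =
  gpre phi W `|` gpre psi W.
Proof.
apply/seteqP; split=> z.
  by move=> [[dz|dz]] /=; [rewrite gglue_funl|rewrite gglue_funr] => //= ?; [left|right].
by move=> [[dz Wz]|[dz Wz]]; split; [left| |right|] => //=; [rewrite gglue_funl|rewrite gglue_funr].
Qed.

Lemma gglue_cont (W : opens Y) :
  open (Opens (openU (opensP (gdom phi)) (opensP (gdom psi))) `&` gglue_fun @^-1` W).
Proof.
rewrite [X in open X](gglue_preE W); apply: openU; exact: opensP.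
Qed.
Local Notation gp W := (Opens (gglue_cont W)).

Definition gglue_part (W : opens Y) (b : bool) : opens X := if b then gpre phi W else gpre psi W.
Lemma gglue_part_sub W b : gglue_part W b `<=` gp W.
Proof.
move=> z H; have : (gpre phi W `|` gpre psi W) z by case: b H; [left|right].
by rewrite -gglue_preE.
Qed.
Definition gglue_subl W : gpre phi W `<=` gp W := @gglue_part_sub W true.
Definition gglue_subr W : gpre psi W `<=` gp W := @gglue_part_sub W false.
Lemma gglue_cover W : gp W `<=` \bigcup_b gglue_part W b.
Proof.
move=> z; rewrite [X in X z](gglue_preE W) => -[H|H]; [exists true|exists false] => //.
Qed.

Lemma gglue_ex (W : opens Y) k (f : sec W k) : exists g : sec (gp W) k,
  res (@gglue_subl W) g = gpull phi f /\ res (@gglue_subr W) g = gpull psi f.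
Proof.
pose F (b : bool) : sec (gglue_part W b) k := match b return sec (gglue_part W b) k with
  | true => gpull phi f | false => gpull psi f end.
have key (V : opens X) (h1 : V `<=` gpre phi W) (h2 : V `<=` gpre psi W) :
    res h1 (gpull phi f) = res h2 (gpull psi f).
  have [||||_ _ _ H] := @geq_of_agree _ _ V phi psi.
  - by move=> z /h1[].
  - by move=> z /h2[].
  - by move=> z /set_mem Vz; apply/meq_pt/compat; [have [] := h1 z Vz|have [] := h2 z Vz].
  - move=> z Vz W' j g Wz; apply: meq_pull => //.
    by apply: compat; [have [] := h1 z Vz|have [] := h2 z Vz].
  exact: H.
have [|g Hg] := @sheaf_glue R X bool (gglue_part W) (gp W) (@gglue_part_sub W) (@gglue_cover W) k F.
  move=> [] [] V h1 h2 /=; [by rewrite (Prop_irrelevance h1 h2)|exact: key| |by rewrite (Prop_irrelevance h1 h2)].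
  by symmetry; exact: key.
by exists g; split; [exact: (Hg true)|exact: (Hg false)].
Qed.

Definition gglue_pull W k (f : sec W k) : sec (gp W) k := sval (cid (gglue_ex f)).

Lemma gglue_agreel W k (f : sec W k) z : oset (gpre phi W) z -> agree z (gglue_pull f) (gpull phi f).
Proof.
move=> dz; have [E _] := svalP (cid (gglue_ex f)); rewrite -E.
by apply: agree_sym; exact: agree_res.
Qed.

Lemma gglue_agreer W k (f : sec W k) z : oset (gpre psi W) z -> agree z (gglue_pull f) (gpull psi f).
Proof.
move=> dz; have [_ E] := svalP (cid (gglue_ex f)); rewrite -E.
by apply: agree_sym; exact: agree_res.
Qed.

Lemma gglue_eq W k (f g : sec (gp W) k) : res (@gglue_subl W) f = res (@gglue_subl W) g ->
  res (@gglue_subr W) f = res (@gglue_subr W) g -> f = g.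
Proof.
move=> E1 E2; apply: (@sheaf_sep R X bool (gglue_part W) (gp W) (@gglue_part_sub W) (@gglue_cover W)).
by case; [exact: E1|exact: E2].
Qed.

Lemma gglue_resl W k (f : sec W k) : res (@gglue_subl W) (gglue_pull f) = gpull phi f.
Proof. by have [] := svalP (cid (gglue_ex f)). Qed.
Lemma gglue_resr W k (f : sec W k) : res (@gglue_subr W) (gglue_pull f) = gpull psi f.
Proof. by have [] := svalP (cid (gglue_ex f)). Qed.

Definition gglue : gmap X Y.
Proof.
refine (@GMap R X Y _ gglue_fun gglue_cont gglue_pull _ _ _ _ _).
- by move=> W k a f g; apply: gglue_eq; rewrite resP ?gglue_resl ?gglue_resr gpullP.
- by move=> W; apply: gglue_eq; rewrite ?gglue_resl ?gglue_resr gpull_one res_one.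
- by move=> W i j k e f g; apply: gglue_eq; rewrite res_mul ?gglue_resl ?gglue_resr gpull_mul.
- move=> W W' h h' k f; apply: gglue_eq; rewrite ?gglue_resl ?gglue_resr.
    rewrite (gpull_res h (gpre_mono h)) -gglue_resl (res_comp _ _ (subset_trans (gpre_mono h) (@gglue_subl W))).
    by rewrite (res_comp _ _ (subset_trans (gpre_mono h) (@gglue_subl W))).
  rewrite (gpull_res h (gpre_mono h)) -gglue_resr (res_comp _ _ (subset_trans (gpre_mono h) (@gglue_subr W))).
  by rewrite (res_comp _ _ (subset_trans (gpre_mono h) (@gglue_subr W))).
- move=> W k f z dz Wz; have : (gpre phi W `|` gpre psi W) z by rewrite -gglue_preE.
  case=> Hz.
    rewrite gglue_funl; last by case: Hz.
    move=> /(gunit_at_res (@gglue_subl W) _ Hz); rewrite gglue_resl.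
    by case: Hz; exact: gpull_local.
  rewrite gglue_funr; last by case: Hz.
  move=> /(gunit_at_res (@gglue_subr W) _ Hz); rewrite gglue_resr.
  by case: Hz; exact: gpull_local.
Defined.

Lemma gglue_meql z : oset (gdom phi) z -> meq z gglue phi.
Proof.
move=> dz; apply: (@meq_of_agree _ _ (gdom phi)) => //; first by move=> x; left.
  by move=> x /set_mem dx; exact: gglue_funl.
move=> x dx W k f; rewrite [gglue x]gglue_funl // => Wx.
by apply: gglue_agreel.
Qed.

Lemma gglue_meqr z : oset (gdom psi) z -> meq z gglue psi.
Proof.
move=> dz; apply: (@meq_of_agree _ _ (gdom psi)) => //; first by move=> x; right.
  by move=> x /set_mem dx; exact: gglue_funr.
move=> x dx W k f; rewrite [gglue x]gglue_funr // => Wx.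
by apply: gglue_agreer.
Qed.

End Glue.
End GermEquality.

Section AgreeAlgebra.
Variables (R : realType) (X : gspace R) (z : X).

Lemma res_eq_sub (U V N W : opens X) (h : N `<=` U) (h' : N `<=` V) k (s : sec U k) (t : sec V k)
  (l : W `<=` N) (a : W `<=` U) (b : W `<=` V) : res h s = res h' t -> res a s = res b t.
Proof. by move=> E; rewrite -(res_comp h l) E (res_comp h' l). Qed.

Lemma agree_lin (U V : opens X) k (a : R) (s s' : sec U k) (t t' : sec V k) :
  agree z s t -> agree z s' t' -> agree z (a *: s + s') (a *: t + t').
Proof.
move=> [N [h [h' [Nz E]]]] [N' [g [g' [N'z E']]]].
pose l := @ocapl _ X N N'; pose r := @ocapr _ X N N'.
exists (ocap N N'), (subset_trans l h), (subset_trans l h'); split=> //.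
by rewrite !resP (res_eq_sub l _ (subset_trans l h') E) (res_eq_sub r _ (subset_trans l h') E').
Qed.

Lemma agree_mul (U V : opens X) i j k (e : i + j = k) (s : sec U i) (s' : sec U j)
  (t : sec V i) (t' : sec V j) :
  agree z s t -> agree z s' t' -> agree z (gmul e s s') (gmul e t t').
Proof.
move=> [N [h [h' [Nz E]]]] [N' [g [g' [N'z E']]]].
pose l := @ocapl _ X N N'; pose r := @ocapr _ X N N'.
exists (ocap N N'), (subset_trans l h), (subset_trans l h'); split=> //.
by rewrite !res_mul (res_eq_sub l _ (subset_trans l h') E) (res_eq_sub r _ (subset_trans l h') E').
Qed.

Lemma res0 (U V : opens X) (h : V `<=` U) k : res h (0 : sec U k) = 0.
Proof. by have := resP h (-1) (0 : sec U k) 0; rewrite scaler0 addr0 scaleN1r addNr. Qed.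

Lemma resB (U V : opens X) (h : V `<=` U) k (f g : sec U k) : res h (f - g) = res h f - res h g.
Proof. by rewrite addrC -scaleN1r resP scaleN1r addrC. Qed.

Lemma gmul0l (U : opens X) i j k (e : i + j = k) (g : sec U j) : gmul e (0 : sec U i) g = 0.
Proof. by have := gmulP e (-1) (0 : sec U i) 0 g; rewrite scaler0 addr0 scaleN1r addNr. Qed.

Lemma gmul0r (U : opens X) i j k (e : i + j = k) (g : sec U i) : gmul e g (0 : sec U j) = 0.
Proof. by rewrite (gmulC e (etrans (addrC j i) e)) gmul0l scaler0. Qed.

End AgreeAlgebra.

Lemma gpull0 (R : realType) (X Y : gspace R) (phi : gmap X Y) (W : opens Y) k :
  gpull phi (0 : sec W k) = 0.
Proof. by have := gpullP phi (-1) (0 : sec W k) 0; rewrite scaler0 addr0 scaleN1r addNr. Qed.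

Lemma gmap_continuous (R : realType) (X Y : gspace R) (phi : gmap X Y) (z : X) :
  oset (gdom phi) z -> {for z, continuous phi}.
Proof.
move=> dz W; rewrite nbhsE => -[W' [oW' W'z] WW'].
apply: (@filterS _ _ _ (gpre phi (Opens oW'))); first by move=> x [_ /WW'].
by apply: open_nbhs_nbhs; split; [exact: opensP|split].
Qed.

Section GermPull.
Variables (R : realType) (q : nat) (deg : 'I_q -> int) (X Y : gspace R) (phi : gmap X Y) (z : X).
Hypothesis dz : oset (gdom phi) z.

Lemma germ_hom_pull (A : forall (W : opens X) k, sec W k -> gser R deg) : germ_hom z A ->
  germ_hom (phi z) (fun W k f => A (gpre phi W) k (gpull phi f)).
Proof.
move=> hA; split.
- by move=> W k a f g Wz; rewrite gpullP (gh_lin hA).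
- by move=> W Wz; rewrite gpull_one (gh_one hA).
- by move=> W i j k e f g Wz; rewrite gpull_mul (gh_mul hA).
- by move=> W W' h k f Wz; rewrite (gpull_res h (gpre_mono h)) (gh_res hA).
- by move=> W k f Wz; apply: (gh_gsh hA).
- move=> W f Wz nu; apply: (gh_body hA) => // /gpull_local H; exact/nu/H.
Qed.

Lemma germ_der_pull s (A D : forall (W : opens X) k, sec W k -> gser R deg) : germ_der s z A D ->
  germ_der s (phi z) (fun W k f => A (gpre phi W) k (gpull phi f))
                     (fun W k f => D (gpre phi W) k (gpull phi f)).
Proof.
move=> hD; split.
- by move=> W k a f g Wz; rewrite gpullP (gd_lin hD).
- by move=> W i j k e f g Wz; rewrite gpull_mul (gd_mul hD).
- by move=> W W' h k f Wz; rewrite (gpull_res h (gpre_mono h)) (gd_res hD).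
Qed.
End GermPull.

(** * Extension of sections and of derivations by bump functions *)

Section Extension.
Variables (R : realType) (M : gmanifold R).

(** [g] is multiplied by a bump function taken from a chart and continued by 0. The support lies in
    the image of a closed ball, which is compact, hence closed as [M] is Hausdorff, and this is what
    permits the gluing. The second clause makes derivations local, the third one separates
    points. *)
Lemma section_extend (U V : opens M) (VU : V `<=` U) (z : M) k (g : sec V k) : oset V z ->
  exists g' : sec U k, [/\ agree z g' g,
    forall j m (e : k + j = m) (f : sec U j), res VU f = 0 -> gmul e g' f = 0
    & forall (W : opens M) (h : W `<=` U), W `&` V `<=` set0 -> res h g' = 0].
Proof.
move=> Vz; have [c cz] := gman_charts z; set d := chart_dim c.
have [iz izE] := chart_pt cz; set y := chart_map c z in iz izE.
pose O : opens (gdomain R d) := gpre (chart_inv c) (ocap V (gdom (chart_map c))).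
have Oy : oset O y by split=> //; rewrite /= izE.
have [r0 r00 KO] := sub_closed_ball_open (opensP O) Oy.
(* [bump] is supported in the ball of twice its radius, which has to be [r0]. *)
pose r := r0 / 2; have r_gt0 : 0 < r by rewrite divr_gt0.
have r2 : 2 * r = r0 by rewrite /r mulrC divfK.
have [rho [srho rho1 rho0]] := bump y r_gt0; rewrite r2 in rho0.
pose Kb := closed_ball (y : 'rV[R]_(gdim0 d)) r0.
pose K : set M := chart_inv c @` Kb.
have cK : compact K.
  apply: continuous_compact; last exact: closed_ball_compact.
  apply: continuous_in_subspaceT => x /set_mem/KO[dx _]; exact: gmap_continuous.
have clK : closed K := compact_closed (@gman_hausdorff _ M) cK.
pose B' : opens (gdomain R d) := Opens (closed_openC (@closed_ball_closed _ _ (y : 'rV[R]_(gdim0 d)) r0)).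
have srf : smooth_fam (opensT (gdomain R d)) (fun p => (rho p)%:A : gser R (@gdeg d)).
  by apply: (smooth_famZ openT srho); exact: smooth_famC.
pose rhoS : @sec R (gdomain R d) (opensT _) 0 := fsec srf (fun p _ => @gsh_scalar R d (rho p)).
pose cr := gpull (chart_map c) rhoS.
pose A1 := ocap V (gdom (chart_map c)).
have h1 : A1 `<=` gpre (chart_map c) (opensT _) by move=> x [].
have hV : A1 `<=` V by move=> x [].
pose h := gmul (add0r k) (res h1 cr) (res hV g).
pose A2 : opens M := ocap U (Opens (closed_openC clK)).
have key (W : opens M) (w1 : W `<=` A1) (w2 : W `<=` A2) : res w1 h = 0.
  have wB : W `<=` gpre (chart_map c) B'.
    move=> x Wx; have [_ dx] := w1 x Wx; split=> // Kx; have [_ nK] := w2 x Wx; apply: nK.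
    by exists (chart_map c x) => //; have [] := chart_pt dx.
  have sT : B' `<=` opensT (gdomain R d) by [].
  have r0B : res sT rhoS = 0.
    apply: sec_ev_eq => p Bp; rewrite ev_res // ev_fsec // ev0.
    by rewrite rho0 ?scale0r.
  rewrite res_mul (res_comp h1 w1 (subset_trans w1 h1)).
  have -> : res (subset_trans w1 h1) cr = 0.
    rewrite -(res_comp (gpre_mono sT) wB) /cr -(gpull_res sT (gpre_mono sT)) r0B.
    by rewrite gpull0 res0.
  by rewrite gmul0l.
pose A (b : bool) : opens M := if b then A1 else A2.
have sA b : A b `<=` U by case: b => x []; [move=> /VU|].
have cA : U `<=` \bigcup_b A b.
  move=> x Ux; have [Kx|nK] := pselect (K x); last by exists false.
  by exists true => //; case: Kx => x' /KO[dx' H] <-.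
pose F (b : bool) : sec (A b) k := match b return sec (A b) k with true => h | false => 0 end.
have [|g' Hg'] := @sheaf_glue R M bool A U sA cA k F.
  move=> [] [] W w1 w2; rewrite /F ?res0.
  - by rewrite (Prop_irrelevance w1 w2).
  - exact: key.
  - by symmetry; exact: key.
  - by [].
have g'1 := Hg' true; have g'2 := Hg' false.
exists g'; split.
- pose BB : opens (gdomain R d) := Opens (ball_open (y : 'rV[R]_(gdim0 d)) r).
  pose N := ocap A1 (gpre (chart_map c) BB).
  have NA : N `<=` A1 by exact: ocapl.
  have NB : N `<=` gpre (chart_map c) BB by exact: ocapr.
  exists N, (subset_trans NA (sA true)), (subset_trans NA hV); split.
    by split; split=> //; exact: ballxx.
  rewrite -(res_comp (sA true) NA) g'1 res_mul (res_comp h1 NA (subset_trans NA h1)).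
  have sT : BB `<=` opensT (gdomain R d) by [].
  have -> : res (subset_trans NA h1) cr = gone N.
    rewrite -(res_comp (gpre_mono sT) NB) /cr -(gpull_res sT (gpre_mono sT)).
    have -> : res sT rhoS = gone _.
      apply: sec_ev_eq => p Bp; rewrite ev_res // ev_fsec // ev_one //.
      by rewrite rho1 ?scale1r.
    by rewrite gpull_one res_one.
  by rewrite gmul1 (res_comp hV NA (subset_trans NA hV)).
- move=> j m e f f0; apply: (@sheaf_sep R M bool A U sA cA) => -[]; rewrite res_mul res0.
    by rewrite -(res_comp VU hV (sA true) f) f0 res0 gmul0r.
  by rewrite g'2 gmul0l.
- move=> W hW WV; have WA2 : W `<=` A2.
    move=> x Wx; split; first exact: hW.
    move=> [x' /KO[dx' [Vx _]] xx']; have : set0 x by apply: WV; split=> //; rewrite -xx'.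
    by [].
  by rewrite -(res_comp (sA false) WA2) g'2 res0.
Qed.

(** The chart is an arbitrary choice; [gh_bodyE] shows that the value in degree 0 is forced by any
    germ homomorphism at the point, hence does not depend on it. *)
Definition body (U : opens M) k (f : sec U k) (z : M) : R :=
  let c := sval (cid (gman_charts z)) in gbody (ev (chart_map c z) (gpull (chart_inv c) f)).

Lemma gh_bodyE q (deg : 'I_q -> int) (z : M) (A : forall (W : opens M) k, sec W k -> gser R deg)
  (U : opens M) (f : sec U 0) : oset U z -> germ_hom z A -> gbody (A U 0 f) = body f z.
Proof.
move=> Uz hA; set l := body f z.
have nu : ~ gunit_at z ((- l) *: gone U + f).
  rewrite /l /body; case: (cid _) => c /= cz; have [dy yE] := chart_pt cz.
  set y := chart_map c z in dy yE *; rewrite -{1}yE => /(gunit_pull dy)/gunit_ev_body.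
  rewrite gpullP gpull_one evP ev_one ?yE //; last by split=> //=; rewrite yE.
  by rewrite /gbody gcD gcZ gc1 eqxx mulr1 addNr eqxx.
have := gh_body hA Uz nu; rewrite (gh_lin hA) // (gh_one hA) // /gbody gcD gcZ gc1 eqxx mulr1.
by move=> /eqP; rewrite addrC subr_eq0 => /eqP.
Qed.

Lemma ev_body (d : gdim) (phi : gmap (gdomain R d) M) p (U : opens M) (f : sec U 0) :
  oset (gdom phi) p -> oset U (phi p) -> gbody (ev p (gpull phi f)) = body f (phi p).
Proof. by move=> dp Up; exact: (gh_bodyE f Up (gmap_germ dp)). Qed.

(** Disjoint neighbourhoods and [section_extend] give a global section equal to 1 near one point and
    to 0 near the other. *)
Lemma separate_points (m m' : M) : (forall f : sec (opensT M) 0, body f m = body f m') -> m = m'.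
Proof.
move=> H; apply: contrapT => mm'.
have := @gman_hausdorff _ M; rewrite open_hausdorff => /(_ m m' (introN eqP mm')).
move=> [[A B] /= [/set_mem Am /set_mem Bm'] [oA oB AB]].
pose VA := Opens oA; pose VB := Opens oB.
have AT : VA `<=` opensT M by [].
have BT : VB `<=` opensT M by [].
have [f [f1 _ f0]] := @section_extend (opensT M) VA AT m 0 (gone VA) Am.
have {}f0 : res BT f = 0 by apply: f0; rewrite setIC (eqP AB).
have body_at z (c : chart M) : oset (gdom (chart_map c)) z ->
    body f z = gbody (ev (chart_map c z) (gpull (chart_inv c) f)).
  by move=> cz; have [dy yE] := chart_pt cz; rewrite ev_body ?yE.
have E1 : body f m = 1.
  have [c cm] := gman_charts m; have [dy yE] := chart_pt cm; rewrite (body_at _ _ cm).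
  rewrite -yE in f1; rewrite (agree_ev (agree_pull dy f1)) gpull_one ev_one ?gbody1 //.
  by split=> //=; rewrite yE.
have E2 : body f m' = 0.
  have [c cm] := gman_charts m'; have [dy yE] := chart_pt cm; rewrite (body_at _ _ cm).
  have ag : agree (chart_inv c (chart_map c m')) f (0 : sec VB 0).
    by rewrite yE; exists VB, BT, (@subset_refl _ VB); split=> //; rewrite res0 f0.
  by rewrite (agree_ev (agree_pull dy ag)) gpull0 ev0.
by have := H f; rewrite E1 E2 => /eqP; rewrite oner_eq0.
Qed.

Section ExtendDerivation.
Variables (q : nat) (deg : 'I_q -> int) (s : int) (z : M) (U : opens M).
Local Notation L := (gser R deg).
Variables (A : forall (W : opens M) k, sec W k -> L) (D0 : forall k, sec U k -> L).
Arguments D0 {k}.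
Hypotheses (Uz : oset U z) (hA : germ_hom z A).
Hypothesis D0lin : forall k (a : R) (f g : sec U k), D0 (a *: f + g) = a *: D0 f + D0 g.
Hypothesis D0mul : forall (i j k : int) (e : i + j = k) (f : sec U i) (g : sec U j),
  D0 (gmul e f g) = D0 f * A g + (-1) ^ (s * i) *: (A f * D0 g).

Lemma D00 k : D0 (0 : sec U k) = 0.
Proof. by have := D0lin (-1) (0 : sec U k) 0; rewrite scaler0 addr0 scaleN1r addNr. Qed.

(** If [u] vanishes near [z] and [rho] is 1 near [z] with support where [u] vanishes, then the
    Leibniz rule applied to [rho u = 0] gives [D0 u = 0]. *)
Lemma der_local k (f g : sec U k) : agree z f g -> D0 f = D0 g.
Proof.
move=> [N [h [h' [Nz E]]]].
suff H (u : sec U k) : res h u = 0 -> D0 u = 0.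
  apply/eqP; rewrite -subr_eq0 -scaleN1r addrC -D0lin scaleN1r addrC; apply/eqP/H.
  by rewrite resB E (Prop_irrelevance h h') subrr.
move=> u0; have [rho [r1 r0 _]] := section_extend h (gone N) Nz.
have A0 : A u = 0.
  by rewrite -(gh_res hA h u Nz) u0; exact: (gh0 Nz k hA).
have A1 : A rho = 1.
  rewrite (germ_agree (A := A) _ r1) ?(gh_one hA) // => W W' hh j v; exact: (gh_res hA).
have := D0mul (add0r k) rho u; rewrite r0 // D00 A0 mulr0 add0r A1 mul1r mulr0 expr0z scale1r.
by move=> <-.
Qed.

(** Every germ at [z] is represented by a section over [U], by [section_extend], and [der_local]
    makes the choice of the representative immaterial. *)
Lemma extend_der : exists D : forall (W : opens M) k, sec W k -> L,
  germ_der s z A D /\ forall k (f : sec U k), D U k f = D0 f.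
Proof.
pose D (W : opens M) k (f : sec W k) : L :=
  match pselect (exists g : sec U k, agree z g f) with
  | left ex => D0 (sval (cid ex)) | right _ => 0 end.
have DE (W : opens M) k (f : sec W k) (g : sec U k) : agree z g f -> D W k f = D0 g.
  move=> gf; rewrite /D; case: pselect => [ex|[]]; last by exists g.
  by apply: der_local; apply: agree_trans (svalP (cid ex)) (agree_sym gf).
have ex (W : opens M) k (f : sec W k) : oset W z -> exists g : sec U k, agree z g f.
  move=> Wz; have Vz : oset (ocap U W) z by [].
  have [g [gf _ _]] := section_extend (@ocapl _ _ U W) (res (@ocapr _ _ U W) f) Vz.
  by exists g; apply: agree_trans gf (agree_res _ _ Vz).
have Aag (W : opens M) k (f : sec W k) (g : sec U k) : agree z g f -> A g = A f.
  by move=> gf; apply: germ_agree gf => W' W'' h j v; exact: (gh_res hA).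
exists D; split; last by move=> k f; apply: DE; exact: agree_refl.
split.
- move=> W k a f g Wz; have [f' ff'] := ex W k f Wz; have [g' gg'] := ex W k g Wz.
  by rewrite (DE _ _ _ _ ff') (DE _ _ _ _ gg') (DE _ _ _ _ (agree_lin a ff' gg')) D0lin.
- move=> W i j k e f g Wz; have [f' ff'] := ex W i f Wz; have [g' gg'] := ex W j g Wz.
  rewrite (DE _ _ _ _ ff') (DE _ _ _ _ gg') (DE _ _ _ _ (agree_mul e ff' gg')) D0mul.
  by rewrite (Aag _ _ _ _ ff') (Aag _ _ _ _ gg').
- move=> W W' h k f Wz; have [f' ff'] := ex W' k (res h f) Wz.
  by rewrite (DE _ _ _ _ ff') (DE _ _ _ _ (agree_trans ff' (agree_res h f Wz))).
Qed.
End ExtendDerivation.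
End Extension.

(** * Smoothness of underlying maps and of bodies *)

Section SmoothUnderlying.
Variable R : realType.

Lemma gd_coord_smooth (e d : gdim) (phi : gmap (gdomain R e) (gdomain R d)) i :
  smooth (gdom phi) (fun p => (phi p : 'rV[R]_(gdim0 d)) 0 i).
Proof.
have dT : gdom phi `<=` gpre phi (opensT _) by move=> x.
apply: smooth_eq (smooth_sub dT (ev_smooth (gpull phi (xc (opensT _) (inl i))) (mzero _))).
  exact: opensP.
move=> p dp; have E : gbody (ev p (gpull phi (xc (opensT (gdomain R d)) (inl i)))) =
    gbody (ev (phi p) (xc (opensT (gdomain R d)) (inl i))).
  by apply: (gh_body_eq (x := phi p) _ _ (gmap_germ dp)).
by rewrite -[LHS]/(gbody (ev p (gpull phi (xc (opensT (gdomain R d)) (inl i))))) E ev_xc // gbody_scalar.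
Qed.

(** In charts the components of the underlying map are bodies of pulled back coordinates, hence
    smooth. This packs every [gmap] built by hand into an [smap], as the universal property of
    products demands. *)
Lemma gmap_smooth (X Y : gmanifold R) (phi : gmap X Y) : smooth_underlying phi.
Proof.
move=> W g sg c r; apply: Cr_local => y [dy [dz Wz]].
have [b bz] := gman_charts (phi (chart_inv c y)).
pose psi := gcomp (chart_map b) (gcomp phi (chart_inv c)).
pose N := gpre (gcomp phi (chart_inv c)) (ocap (gdom (chart_map b)) W).
have Ny : oset N y by [].
exists (oset N) => //.
pose O := gdom (chart_inv b) `&` chart_inv b @^-1` W.
have oO : open O := gcont (chart_inv b) W.
have NO p : oset N p -> O (psi p).
  by move=> [[dp dp'] [bp Wp]]; have [H1 H2] := chart_pt bp; split=> //=; rewrite H2.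
have H : Cr r N ((g \o chart_inv b) \o psi).
  apply: Cr_comp (opensP N) oO (sg b) NO _ => j.
  by apply: Cr_sub (gd_coord_smooth psi j r) => p [[dp dp'] [bp Wp]].
apply: Cr_eq (opensP N) _ H => p [[dp dp'] [bp Wp]] /=.
by have [_ ->] := chart_pt bp.
Qed.

Definition mk_smap (X Y : gmanifold R) (phi : gmap X Y) : smap X Y := SMap (@gmap_smooth X Y phi).

Lemma body_smooth (M : gmanifold R) (f : sec (opensT M) 0) : smooth_on setT (body f).
Proof.
move=> c; have h : gdom (chart_inv c) `&` chart_inv c @^-1` setT `<=` gpre (chart_inv c) (opensT M) by [].
apply: smooth_eq (smooth_sub h (ev_smooth (gpull (chart_inv c) f) (mzero _))).
  exact: (gcont (chart_inv c) (opensT M)).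
by move=> p [dp _]; rewrite -[LHS]/(gbody (ev p (gpull (chart_inv c) f))) ev_body.
Qed.

Lemma body_is_body (M : gmanifold R) (f : sec (opensT M) 0) : is_body f (body f).
Proof. by move=> c y dy; rewrite -ev_body. Qed.
End SmoothUnderlying.

Section Casts.
Variables (R : realType) (X : gspace R).

Definition scast (U : opens X) k k' (e : k = k') (s : sec U k) : sec U k' := ecast j (sec U j) e s.

(** An operation defined in all degrees at once does not see the transport; taking for [A] an
    evaluation or a derivative removes every [scast]. *)
Lemma scast_nat T (A : forall (W : opens X) k, sec W k -> T) (U : opens X) k k' (e : k = k') (s : sec U k) :
  A U k' (scast e s) = A U k s.
Proof. by case: k' / e. Qed.

End Casts.

Lemma ev_agree (R : realType) (d : gdim) (x : gdomain R d) (N U V : opens (gdomain R d)) k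
  (s : @sec R (gdomain R d) U k) (t : @sec R (gdomain R d) V k) : N `<=` U -> N `<=` V -> oset N x ->
  (forall y, oset N y -> ev y s = ev y t) -> agree x s t.
Proof.
by move=> h h' Nx E; exists N, h, h'; split=> //; apply: sec_ev_eq => y Ny; rewrite !ev_res // E.
Qed.

Lemma agree_pder (R : realType) (d : gdim) v (p : gdomain R d) (U V : opens (gdomain R d)) k
  (s : @sec R (gdomain R d) U k) (t : @sec R (gdomain R d) V k) :
  agree p s t -> pder_fam v s p = pder_fam v t p.
Proof.
move=> [N [h [h' [Np E]]]].
rewrite -(ev_pder v s (h p Np)) -(ev_pder v t (h' p Np)) -(ev_res h _ Np) -(ev_res h' _ Np).
by rewrite -!pder_res E.
Qed.

(** * Maps into graded domains and products of graded domains *)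

Section MapsToDomains.
Variables (R : realType).

Lemma gd_pt (e d : gdim) (phi : gmap (gdomain R e) (gdomain R d)) x i : oset (gdom phi) x ->
  (phi x : 'rV[R]_(gdim0 d)) 0 i = gbody (ev x (gpull phi (xc (opensT _) (inl i)))).
Proof.
move=> dx; have E : gbody (ev x (gpull phi (xc (opensT (gdomain R d)) (inl i)))) =
    gbody (ev (phi x) (xc (opensT (gdomain R d)) (inl i))).
  by apply: (gh_body_eq (x := phi x) _ _ (gmap_germ dx)).
by rewrite E ev_xc // gbody_scalar.
Qed.

Lemma xc_res (d : gdim) (W W' : opens (gdomain R d)) (h : W' `<=` W) v : res h (xc W v) = xc W' v.
Proof. by apply: sec_ev_eq => p Wp; rewrite ev_res // !ev_xc //; exact: h. Qed.

Lemma xc_agree (d : gdim) (W W' : opens (gdomain R d)) v (x : gdomain R d) :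
  oset W x -> oset W' x -> agree x (xc W v) (xc W' v).
Proof.
move=> Wx W'x; exists (ocap W W'), (@ocapl _ _ W W'), (@ocapr _ _ W W').
by split=> //; rewrite !xc_res.
Qed.

(** The underlying points agree because their coordinates are bodies of the pulled back coordinates;
    the pullbacks then agree by [germ_hom_uniq]. *)
Lemma gd_meq (e d : gdim) (phi psi : gmap (gdomain R e) (gdomain R d)) (N : opens (gdomain R e)) p :
  oset N p -> N `<=` gdom phi -> N `<=` gdom psi ->
  (forall x v, oset N x -> ev x (gpull phi (xc (opensT _) v)) = ev x (gpull psi (xc (opensT _) v))) ->
  meq p phi psi.
Proof.
move=> Np h1 h2 E.
have Ept x : oset N x -> phi x = psi x.
  by move=> Nx; apply/rowP => i; rewrite !gd_pt ?E //; [exact: h2|exact: h1].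
apply: (@meq_of_agree _ _ _ N) => //; first by move=> x /set_mem; exact: Ept.
move=> x Nx W k f Wx; pose N' := ocap N (gpre phi W).
have N'h x' : oset N' x' -> oset (gdom phi) x' /\ oset W (psi x').
  by move=> [Nx' [dx Wx']]; rewrite -Ept.
apply: (@ev_agree _ _ x N') => //.
- by move=> x' [].
- by move=> x' H; split; [exact/h2/(proj1 H)|exact: (proj2 (N'h x' H))].
- by split=> //; split=> //; exact: h1.
move=> y N'y; have [dy Wy] := N'h y N'y; have [Ny _] := N'y.
have hA := gmap_germ dy; have hA' := gmap_germ (h2 y Ny).
rewrite -Ept // in hA'.
apply: (germ_hom_uniq (x := phi y) hA hA'); last by rewrite Ept.
move=> W' v W'y; have xa := xc_agree v W'y (I : oset (opensT (gdomain R d)) (phi y)).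
rewrite (agree_ev (agree_pull dy xa)) E //; symmetry.
by apply: agree_ev; apply: agree_pull (h2 y Ny) _; rewrite -Ept.
Qed.

Variables (d1 d2 : gdim).
Local Notation n1 := (gdim0 d1).
Local Notation n2 := (gdim0 d2).
Local Notation q1 := (gvars d1).
Local Notation q2 := (gvars d2).

Definition gsd_deg (i : 'I_(q1 + q2)) : int :=
  match fintype.split i with inl j => gdeg j | inr j => gdeg j end.
Lemma gsd_neq0 i : gsd_deg i != 0.
Proof. by rewrite /gsd_deg; case: (fintype.split i) => j; exact: gdeg_neq0. Qed.
Definition gsumd : gdim := GDim (n1 + n2) gsd_neq0.

Definition cinl (v : cvar d1) : cvar gsumd :=
  match v with inl i => inl (lshift n2 i) | inr j => inr (lshift q2 j) end.
Definition cinr (v : cvar d2) : cvar gsumd :=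
  match v with inl i => inl (rshift n1 i) | inr j => inr (rshift q1 j) end.

Lemma cdeg_cinl v : cdeg (cinl v) = cdeg v.
Proof. by case: v => [i|j] //=; rewrite /gsd_deg (unsplitK (inl j)). Qed.
Lemma cdeg_cinr v : cdeg (cinr v) = cdeg v.
Proof. by case: v => [i|j] //=; rewrite /gsd_deg (unsplitK (inr j)). Qed.

Lemma cvar_split (v : cvar gsumd) : (exists w, v = cinl w) \/ (exists w, v = cinr w).
Proof.
case: v => [i|j].
  by case: (splitP i) => j ij; [left; exists (inl j)|right; exists (inl j)]; congr inl; apply/val_inj.
by case: (splitP j) => i ij; [left; exists (inr i)|right; exists (inr i)]; congr inr; apply/val_inj.
Qed.

Lemma cinl_inj : injective cinl.
Proof. by move=> [i|j] [i'|j'] //= [] /val_inj ->. Qed.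
Lemma cinlr v w : cinl v != cinr w.
Proof.
apply/eqP; case: v w => [i|j] [i'|j'] //= [] E; [have := ltn_ord i|have := ltn_ord j].
  by rewrite E ltnNge leq_addr.
by rewrite E ltnNge leq_addr.
Qed.

Definition csplit T (F : cvar d1 -> T) (G : cvar d2 -> T) (v : cvar gsumd) : T :=
  match v with
  | inl i => match fintype.split i with inl j => F (inl j) | inr j => G (inl j) end
  | inr i => match fintype.split i with inl j => F (inr j) | inr j => G (inr j) end
  end.
Lemma csplitl T F G v : @csplit T F G (cinl v) = F v.
Proof. by case: v => [i|j] /=; rewrite (unsplitK (inl _)). Qed.
Lemma csplitr T F G v : @csplit T F G (cinr v) = G v.
Proof. by case: v => [i|j] /=; rewrite (unsplitK (inr _)). Qed.

Lemma fst_gsh p v : gsh (cdeg v) (cgen p (cinl v) : gser R _).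
Proof. by rewrite -cdeg_cinl; exact: gsh_cgen. Qed.
Lemma snd_gsh p v : gsh (cdeg v) (cgen p (cinr v) : gser R _).
Proof. by rewrite -cdeg_cinr; exact: gsh_cgen. Qed.

Definition gfst : gmap (gdomain R gsumd) (gdomain R d1) :=
  gt_map (U := opensT _) (fun v => fsec (@cgen_smooth R gsumd (opensT _) (cinl v)) (fun p _ => @fst_gsh p v)).
Definition gsnd : gmap (gdomain R gsumd) (gdomain R d2) :=
  gt_map (U := opensT _) (fun v => fsec (@cgen_smooth R gsumd (opensT _) (cinr v)) (fun p _ => @snd_gsh p v)).

Lemma ev_gfst W v p : oset (gpre gfst W) p -> ev p (gpull gfst (xc W v)) = cgen p (cinl v).
Proof. by move=> Wp; rewrite gt_map_xc // ev_fsec. Qed.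
Lemma ev_gsnd W v p : oset (gpre gsnd W) p -> ev p (gpull gsnd (xc W v)) = cgen p (cinr v).
Proof. by move=> Wp; rewrite gt_map_xc // ev_fsec. Qed.

Lemma agree_gfst W v p : oset (gpre gfst W) p ->
  agree p (gpull gfst (xc W v)) (scast (cdeg_cinl v) (xc (opensT _) (cinl v))).
Proof.
move=> Wp; apply: (@ev_agree _ _ p (gpre gfst W)) => // y Wy.
by rewrite ev_gfst // (scast_nat (fun W k f => ev y f)) ev_xc.
Qed.
Lemma agree_gsnd W v p : oset (gpre gsnd W) p ->
  agree p (gpull gsnd (xc W v)) (scast (cdeg_cinr v) (xc (opensT _) (cinr v))).
Proof.
move=> Wp; apply: (@ev_agree _ _ p (gpre gsnd W)) => // y Wy.
by rewrite ev_gsnd // (scast_nat (fun W k f => ev y f)) ev_xc.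
Qed.

Lemma gfst_pt p i : (gfst p : 'rV[R]_n1) 0 i = (p : 'rV[R]_(n1 + n2)) 0 (lshift n2 i).
Proof. by rewrite gd_pt // ev_gfst // gbody_cgen. Qed.
Lemma gsnd_pt p i : (gsnd p : 'rV[R]_n2) 0 i = (p : 'rV[R]_(n1 + n2)) 0 (rshift n1 i).
Proof. by rewrite gd_pt // ev_gsnd // gbody_cgen. Qed.

Section Pairing.
Variables (e : gdim) (phi1 : gmap (gdomain R e) (gdomain R d1)) (phi2 : gmap (gdomain R e) (gdomain R d2)).
Local Notation U := (ocap (gdom phi1) (gdom phi2)).

Definition gpair_fam (v : cvar gsumd) (p : gdomain R e) : gser R (@gdeg e) :=
  csplit (fun w => ev p (gpull phi1 (xc (opensT _) w))) (fun w => ev p (gpull phi2 (xc (opensT _) w))) v.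

Lemma gpair_smooth v : smooth_fam U (gpair_fam v).
Proof.
have [[w ->]|[w ->]] := cvar_split v => a.
  rewrite (_ : (fun p => _) = (fun p => gc (ev p (gpull phi1 (xc (opensT _) w))) a)).
    by apply: smooth_sub (ev_smooth _ a) => p [d1p _].
  by apply/funext => p; rewrite /gpair_fam csplitl.
rewrite (_ : (fun p => _) = (fun p => gc (ev p (gpull phi2 (xc (opensT _) w))) a)).
  by apply: smooth_sub (ev_smooth _ a) => p [_ d2p].
by apply/funext => p; rewrite /gpair_fam csplitr.
Qed.

Lemma gpair_gsh v p : gsh (cdeg v) (gpair_fam v p).
Proof.
have [[w ->]|[w ->]] := cvar_split v.
  by rewrite /gpair_fam csplitl cdeg_cinl; exact: ev_gsh.
by rewrite /gpair_fam csplitr cdeg_cinr; exact: ev_gsh.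
Qed.

Definition gpair : gmap (gdomain R e) (gdomain R gsumd) :=
  gt_map (U := U) (fun v => fsec (@gpair_smooth v) (fun p _ => @gpair_gsh v p)).

Lemma ev_gpair W v p : oset (gpre gpair W) p -> ev p (gpull gpair (xc W v)) = gpair_fam v p.
Proof. by move=> Wp; rewrite gt_map_xc // ev_fsec //; case: Wp. Qed.

Lemma gfst_gpair p : oset U p -> meq p (gcomp gfst gpair) phi1.
Proof.
move=> Up; apply: (@gd_meq _ _ _ _ U) ; [by []|by move=> x []|by move=> x []|].
move=> x v Ux; rewrite (agree_ev (agree_comp _ _)) //.
rewrite (agree_ev (agree_pull _ (agree_gfst v _))) //.
rewrite (scast_nat (fun W k f => ev x (gpull gpair f))) ev_gpair //.
by rewrite /gpair_fam csplitl.
Qed.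

Lemma gsnd_gpair p : oset U p -> meq p (gcomp gsnd gpair) phi2.
Proof.
move=> Up; apply: (@gd_meq _ _ _ _ U) ; [by []|by move=> x []|by move=> x []|].
move=> x v Ux; rewrite (agree_ev (agree_comp _ _)) //.
rewrite (agree_ev (agree_pull _ (agree_gsnd v _))) //.
rewrite (scast_nat (fun W k f => ev x (gpull gpair f))) ev_gpair //.
by rewrite /gpair_fam csplitr.
Qed.
End Pairing.
End MapsToDomains.

(** One of the two identities of a local isomorphism. It suffices to carry sections and derivations
    into coordinates, and it is the one that the universal property yields on a product. *)
Definition local_retract (R : realType) (X : gspace R) d (Phi : gmap X (gdomain R d))
  (Psi : gmap (gdomain R d) X) (z : X) := meq z (gcomp Psi Phi) (gid X).

Lemma retract_agree (R : realType) (X : gspace R) d (Phi : gmap X (gdomain R d))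
  (Psi : gmap (gdomain R d) X) (z : X) (U : opens X) k (f : sec U k) :
  local_retract Phi Psi z -> oset U z -> agree z (gpull Phi (gpull Psi f)) f.
Proof.
move=> H Uz; have Hp : Psi (Phi z) = z := meq_pt H.
have [dz dz'] := meq_doml H.
have UP : oset (gpre (gcomp Psi Phi) U) z by split=> //=; rewrite Hp.
apply: agree_trans (agree_sym (agree_comp f UP)) _.
by apply: agree_trans (meq_pull f H (proj2 UP)) _; exact: agree_id.
Qed.

Lemma chart_retract (R : realType) (X : gspace R) (c : chart X) z : oset (gdom (chart_map c)) z ->
  local_retract (chart_map c) (chart_inv c) z.
Proof. exact: chart_meq_map. Qed.

(** * Coordinates on categorical products *)

Section Products.
Variable R : realType.

(** [ppair_uniq] compares maps with the same domain, so both are first restricted to a common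
    neighbourhood of [z]. *)
Lemma prod_meq (A B : gmanifold R) (P : gproduct A B) (T : gmanifold R) (h h' : gmap T P) z :
  oset (gdom h) z -> oset (gdom h') z ->
  meq z (gcomp (pfst P) h) (gcomp (pfst P) h') -> meq z (gcomp (psnd P) h) (gcomp (psnd P) h') ->
  meq z h h'.
Proof.
move=> dz dz' /meq_near[N1 N1z H1] /meq_near[N2 N2z H2].
pose N := ocap (ocap (gdom h) (gdom h')) (ocap N1 N2).
have Nz : oset N z by [].
have r1 x : oset N x -> meq x (grestr h N) h by move=> Nx; apply: grestr_meq => //; case: Nx => -[].
have r2 x : oset N x -> meq x (grestr h' N) h' by move=> Nx; apply: grestr_meq => //; case: Nx => -[].
have dT C (phi : smap P C) x : gtotal phi -> oset (gdom phi) x by apply.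
apply: meq_trans (meq_sym (r1 z Nz)) (meq_trans _ (r2 z Nz)).
have E : (gdom (grestr h N) : set T) = gdom (grestr h' N).
  apply/seteqP; split=> x [? Nx]; (split; last by []).
    by case: Nx => -[].
  by case: Nx => -[].
have U := @ppair_uniq _ _ _ P T (mk_smap (grestr h N)) (mk_smap (grestr h' N)) E.
have dNz : oset (gdom (grestr h N)) z by split; [exact: dz|exact: Nz].
apply: (geq_meq dNz); apply: U.
- apply: geq_of_meq => x [dx Nx]; have [_ [N1x _]] := Nx.
  apply: meq_trans (meq_compl (r1 x Nx) _) (meq_trans (H1 x N1x) (meq_sym (meq_compl (r2 x Nx) _))).
    exact: (@pfst_total _ _ _ P _ I).
  exact: (@pfst_total _ _ _ P _ I).
- apply: geq_of_meq => x [dx Nx]; have [_ [_ N2x]] := Nx.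
  apply: meq_trans (meq_compl (r1 x Nx) _) (meq_trans (H2 x N2x) (meq_sym (meq_compl (r2 x Nx) _))).
    exact: (@psnd_total _ _ _ P _ I).
  exact: (@psnd_total _ _ _ P _ I).
Qed.

Variables (A : gmanifold R) (dB : gdim).
Local Notation B := (gdomain_manifold R dB).
Variables (P : gproduct A B) (dA : gdim).
Local Notation S := (gsumd dA dB).
Variable PsiA : gmap (gdomain R dA) A.

(** The inverse of a product chart, obtained from the universal property alone: no description of
    the sheaf of [P] enters. *)
Definition pchart_inv : gmap (gdomain R S) P :=
  ppair P (mk_smap (X := gdomain_manifold R S) (gcomp PsiA (gfst R dA dB)))
          (mk_smap (X := gdomain_manifold R S) (Y := B) (gsnd R dA dB)).

Lemma pchart_dom p : oset (gdom pchart_inv) p <-> oset (gdom PsiA) (gfst R dA dB p).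
Proof.
have E := ppair_dom P (mk_smap (X := gdomain_manifold R S) (gcomp PsiA (gfst R dA dB)))
          (mk_smap (X := gdomain_manifold R S) (Y := B) (gsnd R dA dB)).
split=> H.
  have : (gdom pchart_inv : set (gdomain_manifold R S)) p by [].
  by rewrite [X in X p]E => -[[]].
suff : (gdom pchart_inv : set (gdomain_manifold R S)) p by [].
by rewrite [X in X p]E; split.
Qed.

Lemma pchart_fst p : oset (gdom PsiA) (gfst R dA dB p) ->
  meq p (gcomp (pfst P) pchart_inv) (gcomp PsiA (gfst R dA dB)).
Proof.
move=> dp; have := ppair_fst P (mk_smap (X := gdomain_manifold R S) (gcomp PsiA (gfst R dA dB)))
          (mk_smap (X := gdomain_manifold R S) (Y := B) (gsnd R dA dB)).
move=> /(geq_meq (U := ocap (gdom (gcomp PsiA (gfst R dA dB))) (gdom (gsnd R dA dB)))); apply.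
by split.
Qed.

Lemma pchart_snd p : oset (gdom PsiA) (gfst R dA dB p) ->
  meq p (gcomp (psnd P) pchart_inv) (gsnd R dA dB).
Proof.
move=> dp; have := ppair_snd P (mk_smap (X := gdomain_manifold R S) (gcomp PsiA (gfst R dA dB)))
          (mk_smap (X := gdomain_manifold R S) (Y := B) (gsnd R dA dB)).
move=> /(geq_meq (U := ocap (gdom (gcomp PsiA (gfst R dA dB))) (gdom (gsnd R dA dB)))); apply.
by split.
Qed.

Variable PhiA : gmap A (gdomain R dA).

(** In an arbitrary chart [c] of [P], the coordinates of the two projections are paired into [R'].
    The composite of [R'] with [pchart_inv] has the same projections as [chart_inv c], hence equals
    it, and composing with [chart_map c] gives the retraction. *)
Lemma product_retract (z : P) : local_retract PhiA PsiA (pfst P z) ->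
  exists Phi : gmap P (gdomain R S),
    [/\ local_retract Phi pchart_inv z, meq z (gcomp (gfst R dA dB) Phi) (gcomp PhiA (pfst P))
      & meq z (gcomp (gsnd R dA dB) Phi) (psnd P)].
Proof.
move=> Hr; have [c cz] := gman_charts z; have [iz izE] := chart_pt cz.
set y := chart_map c z in iz izE.
have dF x : oset (gdom (pfst P)) x by exact: (@pfst_total _ _ _ P _ I).
have dS x : oset (gdom (psnd P)) x by exact: (@psnd_total _ _ _ P _ I).
have [dPhi dPsi] := meq_doml Hr.
pose f1 := gcomp PhiA (gcomp (pfst P) (chart_inv c)).
pose f2 := gcomp (psnd P) (chart_inv c) : gmap _ (gdomain R dB).
pose R' := gpair f1 f2.
have U1 : oset (ocap (gdom f1) (gdom f2)) y.
  by split; split=> //=; rewrite izE.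
have m1 := gfst_gpair U1; have m2 := gsnd_gpair U1.
have dR : oset (gdom R') y by [].
have gz : oset (gdom PsiA) (gfst R dA dB (R' y)).
  by rewrite (meq_pt m1 : gfst R dA dB (R' y) = f1 y) /= izE.
have cmz : oset (gdom (gcomp (chart_inv c) (chart_map c))) z by [].
have H1 : meq y (gcomp pchart_inv R') (chart_inv c).
  have dJ : oset (gdom pchart_inv) (R' y) by apply/pchart_dom.
  apply: (prod_meq (P := P) (T := gdomain_manifold R (chart_dim c)) (h := gcomp pchart_inv R')) => //.
  - apply: meq_trans (meq_sym (meq_assoc dR dJ (dF _))) _.
    apply: meq_trans (meq_compr dR (pchart_fst gz)) _.
    have dG : oset (gdom (gfst R dA dB)) (R' y) by [].
    apply: meq_trans (meq_assoc dR dG gz) _.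
    apply: meq_trans (meq_compl m1 _) _ => //=.
    apply: meq_trans (meq_sym (meq_assoc _ _ _)) _ => //=; rewrite ?izE //.
    apply: meq_trans (meq_compr _ _) (meq_idl _) => //=.
    by rewrite izE.
  - apply: meq_trans (meq_sym (meq_assoc dR dJ (dS _))) _.
    apply: meq_trans (meq_compr dR (pchart_snd gz)) _.
    exact: m2.
exists (gcomp R' (chart_map c)); split.
- rewrite /local_retract.
  apply: meq_trans (meq_sym (meq_assoc _ _ _)) _ => //=; first by apply/pchart_dom.
  exact: meq_trans (meq_compr cz H1) (chart_meq_map cz).
- apply: meq_trans (meq_sym (meq_assoc _ _ _)) _ => //.
  apply: meq_trans (meq_compr cz m1) _.
  apply: meq_trans (meq_assoc _ _ _) _ => //=; rewrite ?izE //.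
  apply: meq_compl => //=; last by rewrite izE.
  apply: meq_trans (meq_assoc _ _ _) _ => //=.
  by apply: meq_trans (meq_compl (chart_meq_map cz) _) (meq_idr _) => //=.
- apply: meq_trans (meq_sym (meq_assoc _ _ _)) _ => //.
  apply: meq_trans (meq_compr cz m2) _.
  apply: meq_trans (meq_assoc _ _ _) _ => //=.
  by apply: meq_trans (meq_compl (chart_meq_map cz) _) (meq_idr _) => //=.
Qed.

(** Through the retraction every section near [w] becomes a section of the product domain, whose
    coordinates are pullbacks from the two factors, where [D] vanishes. *)
Lemma product_der q (deg : 'I_q -> int) s (w : P)
    (G D : forall (W : opens P) k, sec W k -> gser R deg) :
  local_retract PhiA PsiA (pfst P w) -> germ_hom w G -> germ_der s w G D ->
  (forall (W : opens A) k (f : sec W k), oset W (pfst P w) -> D _ _ (gpull (pfst P) f) = 0) ->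
  (forall v, D _ _ (gpull (psnd P) (xc (opensT (gdomain R dB)) v : @sec R B (opensT B) _)) = 0) ->
  forall (W : opens P) k (f : sec W k), oset W w -> D W k f = 0.
Proof.
move=> Hr hG hD H1 H2 W k f Ww; have [Phi [rP m1 m2]] := product_retract Hr.
have [dPhi dPsi] := meq_doml rP.
have Dag (U V : opens P) j (s1 : sec U j) (s2 : sec V j) : agree w s1 s2 -> D U j s1 = D V j s2.
  by apply: germ_agree => U' V' h j' f'; exact: (gd_res hD).
rewrite -(Dag _ _ _ _ _ (retract_agree f rP Ww)).
have hG' := germ_hom_pull dPhi hG; have hD' := germ_der_pull dPhi hD.
have Pw : pchart_inv (Phi w) = w := meq_pt rP.
apply: (germ_der_uniq (x := Phi w) hG' hD'); last by split=> //=; rewrite Pw.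
move=> W' v W'w; have [[u ->]|[u ->]] := cvar_split v.
- have ag1 := agree_gfst (R := R) (W := opensT _) (d2 := dB) u (conj I I : oset (gpre (gfst R dA dB) (opensT _)) (Phi w)).
  have xa := xc_agree (cinl dB u) W'w (I : oset (opensT (gdomain R S)) (Phi w)).
  rewrite (Dag _ _ _ _ _ (agree_pull dPhi xa)).
  rewrite -(scast_nat (fun W k f => D _ _ (gpull Phi f)) (cdeg_cinl dB u)).
  rewrite -(Dag _ _ _ _ _ (agree_pull dPhi ag1)).
  have [d1w _] := meq_doml m1; have dc : oset (gpre (gcomp (gfst R dA dB) Phi) (opensT _)) w by [].
  rewrite -(Dag _ _ _ _ _ (agree_comp _ dc)) (Dag _ _ _ _ _ (meq_pull _ m1 _)) //.
  have dc' : oset (gpre (gcomp PhiA (pfst P)) (opensT _)) w by split=> //; exact: meq_domr m1.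
  by rewrite (Dag _ _ _ _ _ (agree_comp _ dc')) H1 //; have [_] := meq_domr m1.
- have ag1 := agree_gsnd (R := R) (W := opensT _) (d1 := dA) u (conj I I : oset (gpre (gsnd R dA dB) (opensT _)) (Phi w)).
  have xa := xc_agree (cinr dA u) W'w (I : oset (opensT (gdomain R S)) (Phi w)).
  rewrite (Dag _ _ _ _ _ (agree_pull dPhi xa)).
  rewrite -(scast_nat (fun W k f => D _ _ (gpull Phi f)) (cdeg_cinr dA u)).
  rewrite -(Dag _ _ _ _ _ (agree_pull dPhi ag1)).
  have dc : oset (gpre (gcomp (gsnd R dA dB) Phi) (opensT _)) w by [].
  by rewrite -(Dag _ _ _ _ _ (agree_comp _ dc)) (Dag _ _ _ _ _ (meq_pull _ m2 _)).
Qed.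

Lemma product_hom q (deg : 'I_q -> int) (w : P)
    (F G : forall (W : opens P) k, sec W k -> gser R deg) :
  local_retract PhiA PsiA (pfst P w) -> germ_hom w F -> germ_hom w G ->
  (forall (W : opens A) k (f : sec W k), oset W (pfst P w) -> F _ _ (gpull (pfst P) f) = G _ _ (gpull (pfst P) f)) ->
  (forall v, F _ _ (gpull (psnd P) (xc (opensT (gdomain R dB)) v : @sec R B (opensT B) _)) =
     G _ _ (gpull (psnd P) (xc (opensT (gdomain R dB)) v : @sec R B (opensT B) _))) ->
  forall (W : opens P) k (f : sec W k), oset W w -> F W k f = G W k f.
Proof.
move=> Hr hF hG H1 H2 W k f Ww; have [Phi [rP m1 m2]] := product_retract Hr.
have [dPhi dPsi] := meq_doml rP.
have Pw : pchart_inv (Phi w) = w := meq_pt rP.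
have ag D (hD : germ_hom w D) := fun U V j (s1 : sec U j) (s2 : sec V j) =>
  @germ_agree R q deg P w D U V j s1 s2 (gh_res hD).
rewrite -(ag _ hF _ _ _ _ _ (retract_agree f rP Ww)) -(ag _ hG _ _ _ _ _ (retract_agree f rP Ww)).
have E (D : forall (W : opens P) k, sec W k -> gser R deg) (hD : germ_hom w D) v (W' : opens (gdomain R S)) :
  oset W' (Phi w) -> D _ _ (gpull Phi (xc W' v)) =
    csplit (fun u => D _ _ (gpull (pfst P) (gpull PhiA (xc (opensT _) u))))
           (fun u => D _ _ (gpull (psnd P) (xc (opensT (gdomain R dB)) u : @sec R B (opensT B) _))) v.
  move=> W'w; have {}ag := ag D hD; have [[u ->]|[u ->]] := cvar_split v.
  - have ag1 := agree_gfst (R := R) (W := opensT _) (d2 := dB) u (conj I I : oset (gpre (gfst R dA dB) (opensT _)) (Phi w)).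
    have xa := xc_agree (cinl dB u) W'w (I : oset (opensT (gdomain R S)) (Phi w)).
    rewrite csplitl (ag _ _ _ _ _ (agree_pull dPhi xa)).
    rewrite -(scast_nat (fun W k f => D _ _ (gpull Phi f)) (cdeg_cinl dB u)).
    rewrite -(ag _ _ _ _ _ (agree_pull dPhi ag1)).
    have dc : oset (gpre (gcomp (gfst R dA dB) Phi) (opensT _)) w by [].
    rewrite -(ag _ _ _ _ _ (agree_comp _ dc)) (ag _ _ _ _ _ (meq_pull _ m1 _)) //.
    have dc' : oset (gpre (gcomp PhiA (pfst P)) (opensT _)) w by split=> //; exact: meq_domr m1.
    exact: (ag _ _ _ _ _ (agree_comp _ dc')).
  - have ag1 := agree_gsnd (R := R) (W := opensT _) (d1 := dA) u (conj I I : oset (gpre (gsnd R dA dB) (opensT _)) (Phi w)).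
    have xa := xc_agree (cinr dA u) W'w (I : oset (opensT (gdomain R S)) (Phi w)).
    rewrite csplitr (ag _ _ _ _ _ (agree_pull dPhi xa)).
    rewrite -(scast_nat (fun W k f => D _ _ (gpull Phi f)) (cdeg_cinr dA u)).
    rewrite -(ag _ _ _ _ _ (agree_pull dPhi ag1)).
    have dc : oset (gpre (gcomp (gsnd R dA dB) Phi) (opensT _)) w by [].
    by rewrite -(ag _ _ _ _ _ (agree_comp _ dc)) (ag _ _ _ _ _ (meq_pull _ m2 _)).
have hF' := germ_hom_pull dPhi hF; have hG' := germ_hom_pull dPhi hG.
apply: (germ_hom_uniq (x := Phi w) hF' hG'); last by split=> //=; rewrite Pw.
move=> W' v W'w; rewrite /= !E //.
have [[u ->]|[u ->]] := cvar_split v; rewrite ?csplitl ?csplitr; last exact: H2.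
by apply: H1; have [_] := meq_domr m1.
Qed.

End Products.

(** * The line, products with a line, and generators at a point *)

Section LineCoordinate.
Variables (R : realType) (k : int).

(** The only coordinate of the line, an ordinary one for [k = 0] and a graded one otherwise. Passing
    to it spares a distinction on [k] in what follows. *)
Lemma line_var : exists v : cvar (line_dim k),
  [/\ forall w, w = v, cdeg v = - k,
      forall p : gline R k, ev p (line_coord R k) = cgen p v
    & forall p : gline R k, line_val p = cval p v].
Proof.
pose C := cvar (line_dim k).
have [v vP] : exists v : C, forall w, w = v.
  rewrite /C /cvar /=; case: (k == 0) => /=.
    exists (inl ord0) => -[i|[]//]; by rewrite (ord1 i).
  by exists (inr ord0) => -[[]//|i]; rewrite (ord1 i).
exists v; have dv : cdeg v = - k.
  case: v vP => [[i ik]|j] //= _; move: ik => /=; case: eqVneq => [->|] //.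
have lv (p : gline R k) : line_val p = cval p v.
  rewrite /line_val; case: v vP {dv} => [i|j] vP /=.
    rewrite (bigD1 i) //= big1 ?addr0 // => i' /negP[].
    by have [->] := vP (inl i').
  by rewrite big1 // => i _; have := vP (inl i).
split=> // p; apply: gser_eqP => a; rewrite gc_ev /= /line_coord_coef.
case: v vP dv lv => [i|j] vP dv lv.
  have k0 : k = 0 by apply/eqP; rewrite -oppr_eq0 -dv.
  have no (j : 'I_(gvars (line_dim k))) : False by have := vP (inr j).
  rewrite ifT; last exact/eqP. rewrite lv.
  have -> : gc (cgen p (inl i)) a = cval p (inl i) * gc (1 : gser R (@gdeg (line_dim k))) a by [].
  rewrite gc1.
  have -> : a = mzero _ by apply/ffunP => j; case: (no j).
  by rewrite eqxx mulr1.
have kn0 : k != 0 by rewrite -oppr_eq0 -dv; exact: (@gdeg_neq0 (line_dim k) j).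
rewrite ifF; last exact: negbTE.
have -> : gc (cgen p (inr j)) a = (a == munit j)%:R by [].
congr (_ %:R); congr nat_of_bool.
have all j' : j' = j by have [] := vP (inr j').
have -> : (\sum_i a i)%N = a j by rewrite (bigD1 j) //= big1 ?addn0 // => i /negP[]; apply/eqP/all.
apply/eqP/eqP => [aj|->]; last by rewrite !ffunE eqxx.
by apply/ffunP => i; rewrite (all i) aj !ffunE eqxx.
Qed.
End LineCoordinate.

Section LineProducts.
Variables (R : realType) (M : gmanifold R) (k : int) (P : gproduct M (gline R k)).

Lemma pder_agree_line q (deg : 'I_q -> int) (w : P)
    (D : forall (W : opens P) j, sec W j -> gser R deg) v :
  (forall (W W' : opens P) (h : W' `<=` W) j (f : sec W j), oset W' w -> D W' j (res h f) = D W j f) ->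
  D _ _ (gpull (psnd P) (xc (opensT (gdomain R (line_dim k))) v : @sec R (gline R k) (opensT (gline R k)) _)) =
  D _ _ (gpull (psnd P) (line_coord R k)).
Proof.
move=> Dres; have [u [uP du eu _]] := line_var R k.
rewrite (uP v) -(scast_nat (fun W j f => D _ _ (gpull (psnd P) f)) du).
have dw : oset (gdom (psnd P)) w by exact: (@psnd_total _ _ _ P _ I).
apply: (germ_agree Dres); apply: agree_pull dw _.
apply: (@ev_agree R (line_dim k) _ (opensT _)) => // y _.
by rewrite (scast_nat (fun W j f => ev y f)) ev_xc ?eu.
Qed.

Lemma line_der_uniq q (deg : 'I_q -> int) s (w : P)
    (G D : forall (W : opens P) j, sec W j -> gser R deg) :
  germ_hom w G -> germ_der s w G D ->
  (forall (W : opens M) j (f : sec W j), oset W (pfst P w) -> D _ _ (gpull (pfst P) f) = 0) ->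
  D _ _ (gpull (psnd P) (line_coord R k)) = 0 ->
  forall (W : opens P) j (f : sec W j), oset W w -> D W j f = 0.
Proof.
move=> hG hD H1 H2; have [c cz] := gman_charts (pfst P w).
apply: (product_der (chart_retract cz) hG hD H1) => v.
by rewrite (pder_agree_line v (gd_res hD)).
Qed.

Lemma line_hom_uniq q (deg : 'I_q -> int) (w : P)
    (A B : forall (W : opens P) j, sec W j -> gser R deg) :
  germ_hom w A -> germ_hom w B ->
  (forall (W : opens M) j (f : sec W j), oset W (pfst P w) ->
     A _ _ (gpull (pfst P) f) = B _ _ (gpull (pfst P) f)) ->
  A _ _ (gpull (psnd P) (line_coord R k)) = B _ _ (gpull (psnd P) (line_coord R k)) ->
  forall (W : opens P) j (f : sec W j), oset W w -> A W j f = B W j f.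
Proof.
move=> hA hB H1 H2; have [c cz] := gman_charts (pfst P w).
apply: (product_hom (chart_retract cz) hA hB H1) => v.
by rewrite (pder_agree_line v (gh_res hA)) (pder_agree_line v (gh_res hB)).
Qed.

Variables (M' : gmanifold R) (X : gvf (opensT M') k).

(* The germ of [Phi] at [p] runs along the line direction of the product. *)
Definition along (w : P) (e : gdim) (Phi : gmap (gdomain R e) P) (v : cvar e) (p : gdomain R e) :=
  [/\ oset (gdom Phi) p, Phi p = w, cdeg v = - k,
  forall (W : opens M) i (f : sec W i), oset W (pfst P w) ->
     pder_fam v (gpull Phi (gpull (pfst P) f)) p = 0
  & pder_fam v (gpull Phi (gpull (psnd P) (line_coord R k))) p = 1].

(** The relation of [d/dt] with [X] at the single point [w], tested on every parametrisation that
    runs along the line direction. In this form it passes to germs of maps and to composites. *)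
Definition gen_at (theta : gmap P M') (w : P) :=
  forall (e : gdim) (Phi : gmap (gdomain R e) P) (v : cvar e) (p : gdomain R e), along w Phi v p ->
  forall i j (ee : k + i = j) (f : sec (opensT M') i),
  pder_fam v (gpull Phi (gpull theta f)) p = ev p (gpull Phi (gpull theta (vapp X ee f))).

Lemma signzN (s i : int) : (-1 : R) ^ (- s * i) = (-1) ^ (s * i).
Proof.
by rewrite mulNr -exprz_inv invrN1.
Qed.

End LineProducts.

(** The derivative in [v] of a pullback by [Phi], minus the pullback of the derivative by [Z], is a
    derivation along [Phi]. It kills sections coming from [M] and the line coordinate, hence
    vanishes, in particular on pullbacks by [theta]. *)
Lemma generator_gen_at (R : realType) (prd : forall A B : gmanifold R, gproduct A B) (M : gmanifold R) (k : int)
    (X : gvf (opensT M) k) (theta : smap (prd M (gline R k)) M) w : oset (gdom theta) w -> is_generator theta X -> gen_at X theta w.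
Proof.
set P := prd M (gline R k) in theta w *.
move=> dw [Z [[[h1 Z1] [dt [dtP [h2 Z2]]]] [h3 Z3]]] e Phi v p [dp Ew dv H1 H2] i j ee f.
have hA := gmap_germ dp; rewrite Ew in hA.
pose A (W : opens P) m (g : sec W m) := ev p (gpull Phi g) : gser R (@gdeg e).
have pW (W : opens P) : oset W w -> oset (gpre Phi W) p by move=> Ww; split=> //=; rewrite Ew.
(* [Z] acts only on sections over the whole domain of [theta], so the difference starts there and is
   then extended to germs. *)
pose D0 m (g : sec (gdom theta) m) := pder_fam v (gpull Phi g) p - A _ _ (vapp Z erefl g) : gser R (@gdeg e).
have D0E m m' (em : k + m = m') (g : sec (gdom theta) m) :
    D0 m g = pder_fam v (gpull Phi g) p - A _ _ (vapp Z em g).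
  by rewrite /D0; case: m' / em.
have D0lin m (a : R) (g g' : sec (gdom theta) m) : D0 m (a *: g + g') = a *: D0 m g + D0 m g'.
  rewrite /D0 gpullP pder_fam_lin ?vappP; last exact: pW.
  by rewrite /A gpullP evP scalerBr opprD addrACA.
have D0mul m m' m'' (em : m + m' = m'') (g : sec (gdom theta) m) (g' : sec (gdom theta) m') :
    D0 m'' (gmul em g g') = D0 m g * A _ _ g' + (-1) ^ (k * m) *: (A _ _ g * D0 m' g').
  have e1 : k + m + m' = k + m'' by rewrite -em addrA.
  have e2 : m + (k + m') = k + m'' by rewrite -em addrCA.
  rewrite /D0 gpull_mul pder_famM ?dv; last exact: pW.
  rewrite (vapp_mul Z em erefl erefl erefl e1 e2) signzN /A [gmul _ _ _ + _]addrC gpullP !gpull_mul evP !ev_mul.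
  rewrite mulrBl mulrBr scalerBr opprD; set a1 := pder_fam _ _ _ * _; set a2 := _ *: (_ * pder_fam _ _ _).
  by rewrite [- _ - _]addrC addrACA.
have [D [hD DE]] := extend_der dw hA D0lin D0mul.
have Dag (U V : opens P) m (s1 : sec U m) (s2 : sec V m) : agree w s1 s2 -> D U m s1 = D V m s2.
  by apply: germ_agree => U' V' h m' f'; exact: (gd_res hD).
have D0f m (g : sec (opensT M) m) (h : gdom theta `<=` gdom theta) : D0 m (gpull_on h g) = 0.
  rewrite -DE; apply: (line_der_uniq hA hD) => //.
    move=> W m' g' Wz; have [g'' [ag _ _]] := @section_extend _ _ (opensT M) W (fun _ _ => I) _ _ g' Wz.
    rewrite -(Dag _ _ _ _ _ (agree_pull _ ag)); last exact: (@pfst_total _ _ _ P _ I).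
    rewrite -(Dag _ _ _ _ _ (agree_res (gdom_gpreT h1) (gpull (pfst P) g'') dw)).
    rewrite DE /D0 Z1 /A gpull0 ev0 subr0 -[RHS](H1 _ _ g''); last by [].
    apply: agree_pder; apply: agree_pull dp _; apply: agree_res.
    by rewrite Ew.
  rewrite -(Dag _ _ _ _ _ (agree_res (gdom_gpreT h2) (gpull (psnd P) (line_coord R k)) dw)).
  rewrite DE (D0E _ _ (subrr k)) -/(gpull_on h2 (line_coord R k)) Z2 dtP /A.
  rewrite /gpull_on gpull_one res_one gpull_one ev_one; last exact: pW.
  rewrite (agree_pder v (agree_pull dp (agree_res _ _ _))) ?H2 ?subrr //.
  by rewrite Ew.
have /eqP := D0f i f h3; rewrite (D0E _ _ ee) Z3 subr_eq0 => /eqP E.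
have ag m (g : sec (opensT M) m) : agree p (gpull Phi (gpull_on h3 g)) (gpull Phi (gpull theta g)).
  by apply: agree_pull dp _; apply: agree_res; rewrite Ew.
by rewrite -(agree_pder v (ag _ _)) -(agree_ev (ag _ _)) E.
Qed.

(** * Restriction to the zero locus of a coordinate *)

Section Kill.
Variables (R : realType) (e : gdim).
Local Notation L := (gser R (@gdeg e)).
Local Notation C := (gdomain R e).

Lemma gkill_valid (j : 'I_(gvars e)) (f : L) a : ~~ mvalid (@gdeg e) a -> (if a j == 0%N then gc f a else 0) = 0.
Proof. by move=> va; rewrite gserP // if_same. Qed.
Definition gkill j (f : L) : L := mk_gser (@gkill_valid j f).
Lemma gc_gkill j f a : gc (gkill j f) a = if a j == 0%N then gc f a else 0. Proof. by []. Qed.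

(* Setting to zero the variable [v]; for [v] of degree 0 this is only done on
   points where [v] vanishes already. *)
Definition kap (v : cvar e) (f : L) : L := match v with inl _ => f | inr j => gkill j f end.

Lemma kapP v (x : R) f g : kap v (x *: f + g) = x *: kap v f + kap v g.
Proof.
case: v => [i|j] //; apply: gser_eqP => a; rewrite gcD gcZ !gc_gkill gcD gcZ.
by case: ifP => // _; rewrite mulr0 addr0.
Qed.
Lemma kapB v f g : kap v (f - g) = kap v f - kap v g.
Proof. by rewrite addrC -scaleN1r kapP scaleN1r addrC. Qed.
Lemma kap1 v : kap v 1 = 1.
Proof.
case: v => [i|j] //; apply: gser_eqP => a; rewrite gc_gkill !gc1.
by case: (eqVneq a (mzero _)) => [->|_]; [rewrite ffunE eqxx|rewrite if_same].
Qed.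

Lemma kapM v f g : kap v (f * g) = kap v f * kap v g.
Proof.
case: v => [i|j] //; apply: gser_eqP => a; rewrite gc_gkill !gcM /cmul.
case: (mvalid _ a); last by rewrite if_same.
case: eqP => aj.
  rewrite !big_seq; apply: eq_bigr => -[b c]; rewrite msplitsP => /= /eqP bc.
  rewrite ?gc_gkill; move: aj; rewrite -bc ffunE => /eqP; rewrite addn_eq0 => /andP[-> ->].
  by [].
rewrite big_seq big1 // => -[b c]; rewrite msplitsP => /= /eqP bc; rewrite ?gc_gkill.
case: eqP => bj; last by rewrite mul0r mulr0.
case: eqP => cj; last by rewrite mulr0 mulr0.
by case: aj; rewrite -bc ffunE bj cj.
Qed.

Lemma kap_gsh v m f : gsh m f -> gsh m (kap v f).
Proof. by case: v => [i|j] // h a /h E; rewrite gc_gkill E if_same. Qed.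

Lemma kap_body v f : gbody (kap v f) = gbody f.
Proof. by case: v => [i|j] //; rewrite /gbody gc_gkill ffunE. Qed.

Lemma kap_germ_hom (X : gspace R) (x : X) v (A : forall (W : opens X) m, sec W m -> L) :
  germ_hom x A -> germ_hom x (fun W m f => kap v (A W m f)).
Proof.
move=> hA; split.
- by move=> W m a f g Wx; rewrite (gh_lin hA) // kapP.
- by move=> W Wx; rewrite (gh_one hA) // kap1.
- by move=> W i j m ee f g Wx; rewrite (gh_mul hA) // kapM.
- by move=> W W' h m f Wx; rewrite (gh_res hA).
- by move=> W m f Wx; apply: kap_gsh; exact: (gh_gsh hA).
- by move=> W f Wx nf; rewrite kap_body; exact: (gh_body hA).
Qed.

Lemma gder_gkill i j f : i != j -> gder i (gkill j f) = gkill j (gder i f).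
Proof.
move=> ij; apply: gser_eqP => a; rewrite gc_gkill.
rewrite -[LHS]/(gder_raw (@gdeg e) i (gc (gkill j f)) a) -[gc (gder i f) a]/(gder_raw (@gdeg e) i (gc f) a).
rewrite /gder_raw gc_gkill.
rewrite !ffunE [j == i]eq_sym (negbTE ij) addn0; case: ifP => // _; by rewrite !mulr0.
Qed.

Lemma kap_pder v w W k (f g : @sec R C W k) (N : opens C) (p : C) :
  v != w -> oset N p -> N `<=` W -> cval p v = 0 ->
  (forall y, oset N y -> cval y v = 0 -> kap v (ev y f) = kap v (ev y g)) ->
  kap v (pder_fam w f p) = kap v (pder_fam w g p).
Proof.
move=> vw Np NW p0 E; case: w vw => [i|j] vw; last first.
  case: v vw p0 E => [i' /= _ p0 E|j' jj p0 E]; first by rewrite E.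
  have j'j : j != j' by apply: contraNneq jj => ->.
  by rewrite /= -!(gder_gkill _ j'j); congr gder; exact: E p Np erefl.
have line (h : R) : cval (p + h *: basis_vec R i) v = 0.
  case: v vw p0 {E} => [i' /= ii' p0|//]; rewrite !mxE p0.
  have -> : (i' == i) = false by apply/negbTE; apply: contraNneq ii' => ->.
  by rewrite andbF mulr0 addr0.
have Nn : \forall h \near (0 : R), oset N (p + h *: basis_vec R i).
  have [d d0 dN] := open_ball_sub (opensP N) Np.
  near=> h; apply: dN; apply: ball_basis; near: h.
  by apply/nbhs_ballP; exists d => // h; rewrite /ball /= sub0r normrN.
have key a : gc (pder_fam (inl i) f p) a - gc (pder_fam (inl i) g p) a =
    if mvalid (@gdeg e) a then
    'D_(basis_vec R i) (fun y => gc (ev y f) a - gc (ev y g) a) p else 0.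
  rewrite /=; case: (mvalid _ a); last by rewrite subrr.
  by rewrite -deriveB //; apply: sec_derivable; exact: NW.
apply/eqP; rewrite -subr_eq0 -kapB; apply/eqP; apply: gser_eqP => a.
suff D0 : (match v with inl _ => true | inr j => a j == 0%N end) ->
  'D_(basis_vec R i) (fun y => gc (ev y f) a - gc (ev y g) a) p = 0.
  case: v {vw p0 E line} D0 => [i'|j'] D0.
    by rewrite [gc _ _]key D0 // if_same.
  rewrite gc_gkill gc0; case: ifP => // aj.
  by rewrite [gc _ _]key D0 // if_same.
move=> va; apply: derive_val; apply/is_derive_line.
apply: is_derive_near_eq (is_derive_cst (0 : R^o) (0 : R) 1).
near=> h; have Nh : oset N (p + h *: basis_vec R i) by near: h.
have := congr1 (fun F => gc F a) (E _ Nh (line h)).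
by case: v {vw p0 E line} va => [i'|j'] va; rewrite ?gc_gkill ?va => /= ->; rewrite subrr.
Unshelve. all: by end_near.
Qed.
End Kill.

(** * Points of products and values of the line coordinate *)

Section ProductPoints.
Variables (R : realType).

(** The coordinates of a point in a product chart are those of its projections, and the chart
    recovers the point from them. *)
Lemma prod_point_eq (A : gmanifold R) (dB : gdim) (P : gproduct A (gdomain_manifold R dB)) (w w' : P) :
  pfst P w = pfst P w' -> psnd P w = psnd P w' -> w = w'.
Proof.
move=> E1 E2; have [c cz] := gman_charts (pfst P w); have Hr := chart_retract cz.
have [Phi [r1 m1 m2]] := product_retract Hr.
rewrite E1 in Hr; have [Phi' [r1' m1' m2']] := product_retract Hr.
have <- : pchart_inv P (chart_inv c) (Phi w) = w := meq_pt r1.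
have <- : pchart_inv P (chart_inv c) (Phi' w') = w' := meq_pt r1'.
have e1 : gfst R (chart_dim c) dB (Phi w) = chart_map c (pfst P w) := meq_pt m1.
have e1' : gfst R (chart_dim c) dB (Phi' w') = chart_map c (pfst P w') := meq_pt m1'.
have e2 : gsnd R (chart_dim c) dB (Phi w) = psnd P w := meq_pt m2.
have e2' : gsnd R (chart_dim c) dB (Phi' w') = psnd P w' := meq_pt m2'.
suff -> : Phi w = Phi' w' by [].
apply/rowP => i; case: (splitP i) => j ij.
  have -> : i = lshift _ j by exact/val_inj.
  by rewrite -2!gfst_pt e1 e1' E1.
have -> : i = rshift _ j by exact/val_inj.
by rewrite -2!gsnd_pt e2 e2' E2.
Qed.

Variable k : int.
Lemma line_val_inj (y y' : gline R k) : line_val y = line_val y' -> y = y'.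
Proof.
have [v [vP _ _ lv]] := line_var R k; rewrite !lv => E; apply/rowP => i.
by have := vP (inl i); case: v {vP lv} E => //= i' E [->].
Qed.

Lemma line_val_germ (y : gline R k) q (deg : 'I_q -> int) (A : forall (W : opens (gline R k)) j, sec W j -> gser R deg) :
  germ_hom y A -> gbody (A _ _ (line_coord R k)) = line_val y.
Proof.
move=> hA; have [v [vP dv ev_ lv]] := line_var R k.
have [k0|k0] := eqVneq k 0; last first.
  rewrite (gsh_body (gh_gsh hA _ _)) ?oppr_eq0 //.
  by rewrite lv; case: v dv {vP ev_ lv} => //= i dv; case/eqP: k0; apply: oppr_inj; rewrite -dv oppr0.
rewrite lv -(gbody_cgen y v) -ev_.
suff H m (f : @sec R (gdomain R (line_dim k)) (opensT _) m) : m = 0 -> gbody (A _ _ f) = gbody (ev y f).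
  by apply: H; rewrite k0 oppr0.
move=> m0; case: _ / (esym m0) f => f.
exact: (gh_body_eq (x := y) f I hA).
Qed.
End ProductPoints.

(** * The initial condition of a flow *)

Section Start.
Variables (R : realType) (M : gmanifold R) (k : int) (P : gproduct M (gline R k)).

(** The initial condition in dual form: a germ homomorphism that kills the line coordinate does not
    distinguish [theta] from the projection. Setting a time variable to 0 is such a homomorphism,
    whatever its degree. *)
Definition start_at (theta : gmap P M) (w : P) :=
  forall (q : nat) (deg : 'I_q -> int) (A : forall (W : opens P) j, sec W j -> gser R deg),
  germ_hom w A -> A _ _ (gpull (psnd P) (line_coord R k)) = 0 ->
  [/\ oset (gdom theta) w, theta w = pfst P w &
  forall (W : opens M) i (f : sec W i), oset W (pfst P w) ->
    A _ _ (gpull theta f) = A _ _ (gpull (pfst P) f)].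

End Start.

(** A homomorphism that kills the line coordinate coincides with its composite with the projection
    followed by [c = (1, 0)], as both agree on the two factors; then [theta] after [c] is the
    identity. *)
Lemma flow_start_at (R : realType) (prd : forall A B : gmanifold R, gproduct A B) (M : gmanifold R) (k : int)
  (theta : smap (prd M (gline R k)) M) w : is_flow theta -> start_at theta w.
Proof.
set P := prd M (gline R k) in theta w * => -[_ [bang [z [bT [zT z0] H]]] _].
pose c : gmap M P := ppair P (sid M) (scomp z bang).
have cd m : oset (gdom c) m.
  have E := ppair_dom P (sid M) (scomp z bang).
  rewrite -[oset _]/(gdom (ppair P (sid M) (scomp z bang)) : set M) E; split=> //.
  by split; [exact: bT|exact: zT].
have c1 m : meq m (gcomp (pfst P) c) (gid M).
  have := @ppair_fst _ _ _ P _ (sid M) (scomp z bang).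
  move=> /(geq_meq (U := ocap (gdom (gid M)) (gdom (gcomp z bang)))); apply.
  by split=> //; split; [exact: bT|exact: zT].
have c2 m : meq m (gcomp (psnd P) c) (gcomp z bang).
  have := @ppair_snd _ _ _ P _ (sid M) (scomp z bang).
  move=> /(geq_meq (U := ocap (gdom (gid M)) (gdom (gcomp z bang)))); apply.
  by split=> //; split; [exact: bT|exact: zT].
have c3 m : meq m (gcomp theta c) (gid M) by exact: (geq_meq (U := opensT M) I H).
have lc0 m : agree m (gpull c (gpull (psnd P) (line_coord R k))) (0 : sec (opensT M) (- k)).
  have dcS : oset (gpre (gcomp (psnd P) c) (opensT _)) m by split=> //; exact: meq_doml (c2 m).
  apply: agree_trans (agree_sym (agree_comp (line_coord R k) dcS)) _.
  apply: agree_trans (meq_pull (line_coord R k) (c2 m) I) _.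
  have dm : oset (gpre (gcomp z bang) (opensT _)) m.
    by split=> //; split; [exact: bT|exact: zT].
  apply: agree_trans (agree_comp _ dm) _.
  have dz : oset (gdom z) (bang m) by exact: zT.
  pose zT' : opensT (gpt R) `<=` gdom z := zT.
  have ag := agree_pull (bT m I) (agree_sym (agree_res (gdom_gpreT zT') (gpull z (line_coord R k)) (I : oset (opensT (gpt R)) (bang m)))).
  apply: agree_trans ag _.
  have -> : res (gdom_gpreT zT') (gpull z (line_coord R k)) = 0 by exact: (z0 zT').
  rewrite gpull0; exists (gpre bang (opensT _)), (fun _ H => H), (fun _ _ => I).
  by rewrite !res0; do !split => //; exact: bT.
move=> q deg A hA kt.
have dF : oset (gdom (pfst P)) w by exact: (@pfst_total _ _ _ P _ I).
have dS : oset (gdom (psnd P)) w by exact: (@psnd_total _ _ _ P _ I).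
have hF := germ_hom_pull dF hA.
have agF (U V : opens M) m (s1 : sec U m) (s2 : sec V m) : agree (pfst P w) s1 s2 ->
    A _ _ (gpull (pfst P) s1) = A _ _ (gpull (pfst P) s2).
  exact: (germ_agree (gh_res hF)).
have A0 (W : opens P) m : oset W w -> A W m 0 = 0 by move=> Ww; exact: (gh0 Ww _ hA).
have wE : c (pfst P w) = w.
  apply: prod_point_eq; first by rewrite (meq_pt (c1 (pfst P w)) : pfst P (c _) = _).
  apply: line_val_inj; rewrite -(line_val_germ (germ_hom_pull dS hA)) kt.
  have dc : oset (gdom c) (pfst P w) by [].
  have hc := germ_hom_pull dc hF.
  have dS' : oset (gdom (psnd P)) (c (pfst P w)) by exact: (@psnd_total _ _ _ P _ I).
  rewrite -(line_val_germ (germ_hom_pull dS' hc)).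
  congr gbody; apply: etrans (agF _ _ _ _ _ (lc0 (pfst P w))) _.
  by rewrite gpull0 A0 //; split=> //; exact: dF.
have dc : oset (gdom c) (pfst P w) by [].
have hc := germ_hom_pull dc hF; rewrite wE in hc.
have dT : oset (gdom theta) w by rewrite -wE; have [] := meq_doml (c3 (pfst P w)).
have tw : theta w = pfst P w by rewrite -{1}wE; exact: (meq_pt (c3 (pfst P w))).
split=> // W i f Wz.
have := line_hom_uniq hA hc.
move=> /(_ _ _ (gpre theta W) _ (gpull theta f)) /= ->.
- apply: agF.
  have dcW : oset (gpre (gcomp theta c) W) (pfst P w).
    by split; [exact: (meq_doml (c3 _))|rewrite /= wE tw].
  apply: agree_trans (agree_sym (agree_comp f dcW)) _.
  by apply: agree_trans (meq_pull f (c3 _) _) (agree_id f _) => //=; rewrite wE tw.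
- move=> W' j f' W'z; apply: agF; apply: agree_sym.
  have dcW : oset (gpre (gcomp (pfst P) c) W') (pfst P w).
    by split; [exact: (meq_doml (c1 _))|rewrite /= wE].
  apply: agree_trans (agree_sym (agree_comp f' dcW)) _.
  by apply: agree_trans (meq_pull f' (c1 _) _) (agree_id f' _) => //=; rewrite wE.
- by rewrite kt (agF _ _ _ _ _ (lc0 _)) gpull0 A0 //; split=> //; exact: dF.
- by split=> //=; rewrite tw.
Qed.

(** * Real induction and estimates for differential equations *)

Section RealLine.
Variable R : realType.

(** Take the supremum of the [u] up to which [P] holds: the first hypothesis reaches it, the second
    one goes beyond it unless it is 1. *)
Lemma real_induction (P : R -> Prop) :
  (forall u : R, 0 <= u <= 1 -> (forall t, 0 <= t < u -> P t) -> P u) ->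
  (forall u : R, 0 <= u < 1 -> (forall t, 0 <= t <= u -> P t) ->
     exists2 e : R, 0 < e & forall t, u < t <= u + e -> t <= 1 -> P t) ->
  forall u : R, 0 <= u <= 1 -> P u.
Proof.
move=> cl st; pose T : set R := [set u | 0 <= u <= 1 /\ forall t, 0 <= t <= u -> P t].
have P0 : P 0 by apply: cl => [|t /andP[t0 /(le_lt_trans t0)]]; rewrite ?lexx ?ler01 ?ltxx.
have T0 : T 0.
  by split; [rewrite lexx ler01|move=> t t0; have -> : t = 0 by apply/eqP; rewrite eq_le andbC].
have supT : has_sup T by split; [exists 0|exists 1 => x [/andP[_ ?] _]].
set s := sup T; have s0 : 0 <= s by exact: ub_le_sup supT.2 _ T0.
have s1 : s <= 1 by apply: sup_le_ub => //; [exists 0|move=> x [/andP[_ ?] _]].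
have Plt t : 0 <= t < s -> P t.
  move=> /andP[t0 ts]; have [x Tx tx] := @sup_adherent _ T (s - t) (etrans (subr_gt0 _ _) ts) supT.
  rewrite -/s opprB addrCA subrr addr0 in tx.
  by case: Tx => _; apply; rewrite t0 ltW.
have Ps : P s by apply: cl; [rewrite s0 s1|exact: Plt].
have Ple t : 0 <= t <= s -> P t.
  by move=> /andP[t0]; rewrite le_eqVlt => /orP[/eqP-> //|ts]; apply: Plt; rewrite t0.
suff s1E : s = 1 by move=> u; rewrite -s1E; exact: Ple.
apply/eqP; rewrite eq_le s1 leNgt; apply/negP => sl1.
have [e e0 He] := st s (introT andP (conj s0 sl1)) Ple.
pose s' := Num.min (s + e) 1.
have ss' : s < s' by rewrite /s' lt_min sl1 ltrDl e0.
have : s' <= s.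
  apply: (ub_le_sup supT.2); split; first by rewrite (le_trans s0 (ltW ss')) /= /s' ge_min lexx orbT.
  move=> t /andP[t0]; have [ts _|st'] := leP t s; first by apply: Ple; rewrite t0.
  by rewrite /s' le_min => /andP[te t1]; apply: He; rewrite ?st'.
by rewrite leNgt ss'.
Qed.

(** From [2 x y <= x^2 + y^2]. It bounds the growth of a sum of squares under a linear system whose
    coefficients are at most [K]. *)
Lemma quad_bound (I : finType) (a : I -> R) (B : I -> I -> R) (K : R) : 0 <= K ->
  (forall v w, `|B v w| <= K) ->
  \sum_v (a v * \sum_w B v w * a w) <= K * #|I|%:R * \sum_v a v ^+ 2.
Proof.
move=> K0 HB.
have -> : K * #|I|%:R * \sum_v a v ^+ 2 = \sum_v \sum_w K * (2^-1 * (a v ^+ 2 + a w ^+ 2)).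
  transitivity (K * 2^-1 * (\sum_v \sum_(w : I) a v ^+ 2 + \sum_(v : I) \sum_w a w ^+ 2)).
    under [X in _ = _ * (X + _)]eq_bigr do rewrite sumr_const.
    by rewrite sumr_const sumrMnl -mulr_natl; field.
  rewrite -big_split mulr_sumr; apply: eq_bigr => v _; rewrite -big_split mulr_sumr /=.
  by apply: eq_bigr => w _; rewrite mulrA.
apply: ler_sum => v _; rewrite mulr_sumr; apply: ler_sum => w _.
apply: le_trans (ler_norm _) _; rewrite !normrM mulrCA.
apply: ler_pM => //; try by rewrite mulr_ge0.
rewrite -subr_ge0 -(real_normK (num_real (a v))) -(real_normK (num_real (a w))).
have -> : 2^-1 * (`|a v| ^+ 2 + `|a w| ^+ 2) - `|a v| * `|a w| = 2^-1 * (`|a v| - `|a w|) ^+ 2 by field.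
by rewrite mulr_ge0 ?invr_ge0 ?ler0n ?sqr_ge0.
Qed.

(** Mean value theorem along segments of a ball on which every partial derivative stays below [K],
    the sum of their absolute values at [y0] plus a margin of 1. *)
Lemma smooth_lipschitz n (W : set 'rV[R]_n) (f : 'rV[R]_n -> R) y0 : open W -> W y0 -> smooth W f ->
  exists d K : R, [/\ 0 < d, 0 <= K & forall y y', ball y0 d y -> ball y0 d y' ->
    `|f y - f y'| <= K * \sum_i `|y 0 i - y' 0 i| ].
Proof.
move=> oW Wy sf.
pose K : R := \sum_i `|'D_(basis_vec R i) f y0| + 1.
have KP i : `|'D_(basis_vec R i) f y0| < K.
  rewrite /K (bigD1 i) //= -addrA ltrDl; apply: ltr_wpDl; last exact: ltr01.
  by apply: sumr_ge0 => j _.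
have K0 : 0 <= K by rewrite /K addr_ge0 // sumr_ge0.
have nK : \forall y \near y0, W y /\ forall i, `|'D_(basis_vec R i) f y| < K.
  apply: filterI; first exact: open_near.
  apply: (@filter_forall _ _ (fun i y => (`|'D_(basis_vec R i) f y| < K)%R) _ (nbhs_filter y0)) => i.
  have c : {for y0, continuous (fun y => `|'D_(basis_vec R i) f y|)}.
    apply: (@continuous_comp _ _ _ ('D_(basis_vec R i) f) (fun x : R => `|x|)); last exact: norm_continuous.
    exact: smooth_continuous (smooth_D i sf) Wy.
  have oK : nbhs (`|'D_(basis_vec R i) f y0|) [set x : R | x < K].
    by apply: open_nbhs_nbhs; split; [exact: open_lt|exact: KP].
  exact: c _ oK.
have /nbhs_ballP[d d0 dP] := nK; exists d, K; split=> // y y' by_ by'.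
pose g (t : R) := f (y' + t *: (y - y')).
have inb (t : R) : 0 <= t <= 1 -> ball y0 d (y' + t *: (y - y')).
  move=> /andP[t0 t1]; move: by_ by'; rewrite -!ball_normE /= => by_ by'.
  have -> : y0 - (y' + t *: (y - y')) = t *: (y0 - y) + (1 - t) *: (y0 - y').
    by rewrite !scalerBr !scalerBl !scale1r opprD opprB; apply/rowP => i; rewrite !mxE; ring.
  apply: le_lt_trans (ler_normD _ _) _; rewrite !normrZ (ger0_norm t0) ger0_norm ?subr_ge0 //.
  have [->|tn0] := eqVneq t 0; first by rewrite mul0r add0r subr0 mul1r.
  have -> : d = t * d + (1 - t) * d by ring.
  apply: ltr_leD; first by rewrite ltr_pM2l // lt_def tn0.
  by apply: ler_wpM2l; rewrite ?subr_ge0 // ltW.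
pose g' (t : R) := \sum_j (y - y') 0 j * 'D_(basis_vec R j) f (y' + t *: (y - y')).
have dg (t : R) : 0 <= t <= 1 -> is_derive t 1 g (g' t).
  move=> t01; have [Wt _] := dP _ (inb t t01).
  apply: (is_derive_chain (b := fun t : R => y' + t *: (y - y')) oW sf Wt).
    by apply: continuousD; [exact: cst_continuous|exact: scalel_continuous].
  move=> j; have := is_derive_along (f := fun y : 'rV[R]_n => y 0 j) (coord_is_derive (y' + t *: (y - y')) (y - y') j).
  by [].
have gc : {within `[0, 1]%classic, continuous g}.
  apply: continuous_in_subspaceT => t /set_mem; rewrite /= in_itv /= => t01.
  by apply: derivable1_continuous; have [] := dg t t01.
have [|t /[!in_itv]/= t01 E] := @MVT R g g' 0 1 ltr01 _ gc.
  by move=> t; rewrite in_itv /= => /andP[/ltW t0 /ltW t1]; apply: dg; rewrite t0.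
have t01' : 0 <= t <= 1 by case/andP: t01 => /ltW -> /ltW.
have -> : f y - f y' = g' t.
  by move: E; rewrite /g scale1r scale0r addr0 [y' + (y - y')]addrC subrK subr0 mulr1.
have [_ Dt] := dP _ (inb t t01').
apply: le_trans (ler_norm_sum _ _ _) _; rewrite mulr_sumr; apply: ler_sum => i _.
by rewrite !mxE normrM mulrC; apply: ler_wpM2r => //; apply: ltW.
Qed.

End RealLine.

(** * Bodies and point derivations *)

Section BodyFacts.
Variables (R : realType) (M : gmanifold R).

Lemma gbody_ev (d : gdim) (phi : gmap (gdomain R d) M) p (U : opens M) k (f : sec U k) :
  oset (gdom phi) p -> oset U (phi p) -> gbody (ev p (gpull phi f)) = body f (phi p).
Proof.
move=> dp Up; have [k0|k0] := eqVneq k 0; first by case: _ / (esym k0) f => f; exact: ev_body.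
by rewrite /body !(gsh_body (@ev_gsh _ _ _ _ _ _) k0).
Qed.

(** The body, seen as a scalar series, lets real point derivations be handled by the results on
    [germ_der]. *)
Lemma scalar_germ_hom (q : nat) (deg : 'I_q -> int) (z : M) (A : forall (W : opens M) j, sec W j -> gser R deg) :
  germ_hom z A -> germ_hom z (fun W j f => (gbody (A W j f))%:A : gser R deg).
Proof.
move=> hA; split.
- by move=> W k a f g Wz; rewrite (gh_lin hA) // /gbody gcD gcZ scalerDl -scalerA.
- by move=> W Wz; rewrite (gh_one hA) // gbody1 scale1r.
- by move=> W i j k e f g Wz; rewrite (gh_mul hA) // gbodyM -gsmulZl mul1r scalerA.
- by move=> W W' h k f Wz; rewrite (gh_res hA).
- move=> W k f Wz; have [k0|k0] := eqVneq k 0; first by rewrite {1}k0; apply: gshZ; exact: gsh1.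
  by rewrite (gsh_body (gh_gsh hA _ Wz) k0) scale0r.
- by move=> W f Wz nf; rewrite {1}/gbody gcZ (gh_body hA) ?mul0r.
Qed.

Lemma agree_near (X : gspace R) (z : X) (U V : opens X) k (s : sec U k) (t : sec V k) : agree z s t ->
  \forall x \near z, agree x s t.
Proof.
move=> [N [h [h' [Nz E]]]]; apply: (@filterS _ _ _ (oset N)) (open_nbhs_nbhs _); last by split=> //; exact: opensP.
by move=> x Nx; exists N, h, h'.
Qed.

End BodyFacts.

Section PointDerivations.
Variables (R : realType) (M : gmanifold R).
Implicit Types (q : M) (D : forall j, sec (opensT M) j -> R).

(** No sign appears in the Leibniz rule because a body can be non-zero in degree 0 only. *)
Record point_der q D : Prop := PointDer {
  pd_lin : forall j (a : R) (f g : sec (opensT M) j), D j (a *: f + g) = a * D j f + D j g;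
  pd_mul : forall i j m (e : i + j = m) (f : sec (opensT M) i) (g : sec (opensT M) j),
    D m (gmul e f g) = D i f * body g q + body f q * D j g }.

Lemma point_der_coords (z0 : M) : exists (c : chart M) (N : opens M) (Xv : forall v : cvar (chart_dim c), sec (opensT M) (cdeg v)),
  [/\ oset N z0, N `<=` gdom (chart_map c),
    forall q v, oset N q -> agree q (Xv v) (gpull (chart_map c) (xc (opensT _) v))
  & forall q D, oset N q -> point_der q D -> forall j (f : sec (opensT M) j),
      D j f = \sum_v gbody (pder_fam v (gpull (chart_inv c) f) (chart_map c q)) * D _ (Xv v)].
Proof.
have [c cz] := gman_charts z0; exists c.
have ex v : exists Xv : sec (opensT M) (cdeg v), agree z0 Xv (gpull (chart_map c) (xc (opensT _) v)).
  have zz : oset (gpre (chart_map c) (opensT _)) z0 by split.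
  have [g [ag _ _]] := @section_extend _ _ (opensT M) _ (fun _ _ => I) z0 _ (gpull (chart_map c) (xc (opensT _) v)) zz.
  by exists g.
pose Xv v := sval (cid (ex v)).
have nX : \forall q \near z0, oset (gdom (chart_map c)) q /\
    forall v, agree q (Xv v) (gpull (chart_map c) (xc (opensT _) v)).
  apply: filterI; first by apply: open_nbhs_nbhs; split=> //; exact: opensP.
  apply: (@filter_forall _ _ (fun v q => agree q (Xv v) (gpull (chart_map c) (xc (opensT _) v))) _ (nbhs_filter z0)) => v.
  by apply: agree_near; exact: svalP (cid (ex v)).
pose S : set M := [set q | oset (gdom (chart_map c)) q /\
    forall v, agree q (Xv v) (gpull (chart_map c) (xc (opensT _) v))].
exists (Opens (@open_interior _ S)), Xv; split; [exact: nX|by move=> q /interior_subset[]|by move=> q v /interior_subset[]|].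
move=> q D /interior_subset[cq aX] hD j f.
set y := chart_map c q; have [dy yE] := chart_pt cq; rewrite -/y in dy yE.
have hA0 := gmap_germ dy; rewrite yE in hA0.
have hA := scalar_germ_hom hA0; move: hA.
set A := fun W j f => _; move=> hA.
have AE i (g : sec (opensT M) i) : A _ _ g = (body g q)%:A by rewrite /A gbody_ev // yE.
pose D0 i (g : sec (opensT M) i) : gser R (@gdeg (chart_dim c)) := (D i g)%:A.
have D0lin i (a : R) (g g' : sec (opensT M) i) : D0 i (a *: g + g') = a *: D0 i g + D0 i g'.
  by rewrite /D0 (pd_lin hD) scalerDl scalerA.
have D0mul i i' m (e : i + i' = m) (g : sec (opensT M) i) (g' : sec (opensT M) i') :
    D0 m (gmul e g g') = D0 i g * A _ _ g' + (-1) ^ (0 * i) *: (A _ _ g * D0 i' g').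
  rewrite /D0 (pd_mul hD) !AE mul0r expr0z scale1r -!gsmulZl !mul1r !scalerA -scalerDl.
  by [].
have [D1 [hD1 D1E]] := @extend_der R M _ _ 0 q (opensT M) A D0 I hA D0lin D0mul.
have hA' := germ_hom_pull cq hA; have hD' := germ_der_pull cq hD1.
have D1ag (U V : opens M) i (s : sec U i) (t : sec V i) : agree q s t -> D1 U i s = D1 V i t.
  by apply: germ_agree => *; exact: (gd_res hD1).
set A' := (fun W k f => _) in hA'; set D' := (fun W k f => D1 _ _ _) in hD'.
have A'E (W : opens (gdomain R (chart_dim c))) i (g : @sec R (gdomain R (chart_dim c)) W i) : oset W y ->
    A' W i g = (gbody (ev y g))%:A.
  move=> Wy; rewrite /A' /A; congr (gbody _)%:A.
  have Wy' : oset (gpre (gcomp (chart_map c) (chart_inv c)) W) y by split; [split=> //=; rewrite yE|rewrite /= yE].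
  rewrite -(agree_ev (agree_comp g Wy')).
  rewrite (agree_ev (meq_pull g (chart_meq_inv dy) _)) /=; last by rewrite yE.
  by apply: agree_ev; exact: agree_id.
pose b v := D' _ _ (xc (opensT (gdomain R (chart_dim c))) v).
pose D'' (W : opens (gdomain R (chart_dim c))) i (g : @sec R (gdomain R (chart_dim c)) W i) :=
  D' W i g - \sum_v gbody (pder_fam v g y) *: b v.
have hD'' : @germ_der R _ (@gdeg (chart_dim c)) 0 (gdomain R (chart_dim c)) y A' D''.
  split.
  - move=> W i a g g' Wy; rewrite /D'' (gd_lin hD') // scalerBr [RHS]addrACA -opprD; congr (_ - _).
    rewrite scaler_sumr -big_split /=; apply: eq_bigr => v _.
    by rewrite pder_fam_lin // /gbody gcD gcZ scalerDl scalerA.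
  - move=> W i i' m e g g' Wy; rewrite /D'' (gd_mul hD') // mul0r expr0z !scale1r mulrBl mulrBr.
    rewrite [RHS]addrACA -opprD; congr (_ - _).
    rewrite mulr_suml mulr_sumr -big_split /=; apply: eq_bigr => v _.
    rewrite (pder_famM v e g g') // !A'E // -!gsmulZr !mulr1.
    rewrite -(gsmulZl (gbody (ev y g))) mul1r scalerA scalerA -scalerDl; congr (_ *: _).
    rewrite [LHS]/gbody gcD gcZ -/(gbody (_ * _)) -/(gbody (_ * _)) !gbodyM.
    rewrite [gbody (ev y g') * _]mulrC; congr (_ + _).
    have [i0|i0] := eqVneq i 0; first by rewrite {1}i0 mulr0 expr0z mul1r mulrC.
    by rewrite (gsh_body (@ev_gsh _ _ _ _ _ _) i0) mul0r !mulr0.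
  - move=> W W' h i g Wy; rewrite /D'' (gd_res hD') //; congr (_ - _).
    apply: eq_bigr => v _; congr (gbody _ *: _); apply: agree_pder.
    exact: agree_res.
have D''0 i (g : @sec R (gdomain R (chart_dim c)) (gpre (chart_inv c) (opensT M)) i) :
    D'' _ _ g = 0.
  apply: (germ_der_uniq hA' hD''); last by split=> //; exact: dy.
  move=> W v Wy; rewrite /D'' (bigD1 v) //= big1 ?addr0 => [|w /negbTE wv].
    rewrite -ev_pder // pder_xc // eqxx scale1r gbody1 scale1r /b.
    apply/eqP; rewrite subr_eq0; apply/eqP; apply: D1ag; apply: agree_pull cq _.
    exact: xc_agree.
  by rewrite -ev_pder // pder_xc // wv mulr0n scale0r /gbody gc0 scale0r.
have ag := retract_agree f (chart_retract cq) (I : oset (opensT M) q).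
have := D''0 _ (gpull (chart_inv c) f); rewrite /D'' /D' (D1ag _ _ _ _ _ ag) D1E => /eqP.
rewrite subr_eq0 => /eqP /(congr1 (@gbody _ _ _)); rewrite gbody_scalar => ->.
rewrite {1}/gbody gc_sum; apply: eq_bigr => v _; rewrite gcZ; congr (_ * _).
by rewrite /b /D' -(D1ag _ _ _ _ _ (aX v)) D1E -/(gbody _) gbody_scalar.
Qed.
End PointDerivations.

(** * Uniqueness for differential equations along curves *)

Section CurveODE.
Variables (R : realType) (M : gmanifold R).

Lemma zero_of_left (g : R -> R) (u : R) : 0 < u -> {for u, continuous g} ->
  (forall t, 0 <= t < u -> g t = 0) -> g u = 0.
Proof.
move=> u0 cg g0; apply/eqP/negPn/negP => gu.
have pos : 0 < `|g u| by rewrite normr_gt0.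
have /nbhs_ballP[d d0 dP] : \forall t \near u, `|g u - g t| < `|g u|.
  by have /cvgrPdist_lt := cg; apply.
pose t := Num.max 0 (u - d / 2).
have tu : t < u by rewrite /t gt_max u0 ltrBlDr ltrDl divr_gt0.
have t0 : 0 <= t by rewrite /t le_max lexx.
have : `|g u - g t| < `|g u|.
  apply: dP; rewrite /ball /= ger0_norm ?subr_ge0; last exact: ltW.
  have : u - d / 2 <= t by rewrite /t le_max lexx orbT.
  have d2 : d / 2 < d by rewrite ltr_pdivrMr // ltr_pMr // ltr1n.
  by lra.
by rewrite (g0 t) ?t0 // subr0 ltxx.
Qed.

Lemma near_right (S : set R) (u : R) : (\forall t \near u, S t) ->
  exists2 e : R, 0 < e & forall t, u <= t <= u + e -> S t.
Proof.
move=> /nbhs_ballP[d d0 dP]; exists (d / 2); first by rewrite divr_gt0.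
move=> t /andP[ut te]; apply: dP; rewrite /ball /= distrC ger0_norm ?subr_ge0 //.
have d2 : d / 2 < d by rewrite ltr_pdivrMr // ltr_pMr // ltr1n.
by lra.
Qed.

Lemma near_lt_bound (T : topologicalType) (I : finType) (g : I -> T -> R) (x : T) :
  (forall i, {for x, continuous (g i)}) ->
  exists2 K : R, 0 <= K & \forall y \near x, forall i, `|g i y| <= K.
Proof.
move=> cg; pose K := \sum_i `|g i x| + 1; exists K.
  by rewrite addr_ge0 // sumr_ge0.
apply: (@filter_forall _ _ (fun i y => (`|g i y| <= K)%R) _ (nbhs_filter x)) => i.
have lt : `|g i x| < K.
  rewrite /K (bigD1 i) //= -addrA ltrDl; apply: ltr_wpDl; last exact: ltr01.
  by apply: sumr_ge0 => j _.
have /cvgrPdist_lt /(_ (K - `|g i x|)) := cg i; rewrite subr_gt0 => /(_ lt).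
apply: filterS => y h; have := ler_normB (g i x) (g i x - g i y).
by rewrite opprB addrC subrK; lra.
Qed.

Lemma is_derive_sqr_sum (I : finType) (a : I -> R -> R) (a' : I -> R) (s : R) :
  (forall i, is_derive s 1 (a i) (a' i)) ->
  is_derive s 1 (fun t => \sum_i a i t ^+ 2) (\sum_i 2 * (a i s * a' i)).
Proof.
move=> da; elim: (index_enum I) => [|i r IH].
  rewrite big_nil (_ : (fun t => _) = cst (0 : R^o)); first exact: is_derive_cst.
  by apply/funext => t; rewrite big_nil.
rewrite big_cons (_ : (fun t => _) = (fun t => a i t * a i t) + (fun t => \sum_(i <- r) a i t ^+ 2)); last first.
  by apply/funext => t; rewrite big_cons expr2.
apply: is_deriveD; apply: is_derive_eq (is_deriveM (da i) (da i)) _.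
by rewrite /GRing.scale /=; ring.
Qed.

Variables (k : int) (X : gvf (opensT M) k) (c : R).

(** Near [q u] the derivation is given by its values on the finitely many [Xv], which solve a linear
    system with bounded coefficients; Gronwall's inequality for their sum of squares carries the
    vanishing to the right of [u]. The constant [c] rescales time so that every curve is run over
    the unit interval. *)
Lemma point_der_ode (q : R -> M) (D : R -> forall j, sec (opensT M) j -> R) :
  (forall u : R, 0 <= u <= 1 -> {for u, continuous q}) ->
  (forall u : R, 0 <= u <= 1 -> point_der (q u) (D u)) ->
  (forall u : R, 0 <= u <= 1 -> forall i (f : sec (opensT M) i),
     is_derive u 1 (fun u => D u i f) (c * D u (k + i) (vapp X erefl f))) ->
  (forall i (f : sec (opensT M) i), D 0 i f = 0) ->
  forall u : R, 0 <= u <= 1 -> forall i (f : sec (opensT M) i), D u i f = 0.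
Proof.
move=> cq pD dD D0; apply: real_induction => u u01 Hu.
  have [->|un0] := eqVneq u 0; first exact: D0.
  move=> i f; apply: (@zero_of_left (fun u => D u i f)).
  - by rewrite lt_def un0; case/andP: u01.
  - by apply: derivable1_continuous; have [] := dD u u01 i f.
  - by move=> t tu; exact: Hu.
have u01' : 0 <= u <= 1 by case/andP: u01 => -> /ltW.
have [ch [N [Xv [Nz Nc _ Dc]]]] := point_der_coords (q u).
pose b (vw : cvar (chart_dim ch) * cvar (chart_dim ch)) (x : M) : R :=
  gbody (pder_fam vw.2 (gpull (chart_inv ch) (vapp X erefl (Xv vw.1))) (chart_map ch x)).
have cb vw : {for u, continuous (b vw \o q)}.
  have cqu := Nc _ Nz; have [dy yE] := chart_pt cqu.
  apply: continuous_comp; first exact: cq.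
  apply: (@continuous_comp _ _ _ (chart_map ch) (fun y => gbody (pder_fam vw.2 (gpull (chart_inv ch) (vapp X erefl (Xv vw.1))) y))).
    exact: gmap_continuous.
  apply: smooth_continuous (pder_smooth _ _ _) _; by split.
have [K K0 nK] := near_lt_bound cb.
have nN : \forall t \near u, oset N (q t).
  by apply: (cq u u01'); apply: open_nbhs_nbhs; split; [exact: opensP|].
have [e e0 He] := near_right (filterI nK nN); exists e => // t /andP[ut te] t1.
pose E s := \sum_v D s _ (Xv v) ^+ 2.
pose E' s := \sum_v 2 * (D s _ (Xv v) * (c * D s _ (vapp X erefl (Xv v)))).
have sin s : u <= s <= t -> (0 <= s <= 1) /\ (u <= s <= u + e).
  by move=> /andP[us st]; case/andP: u01 => u0 u1; split; lra.
have Et : E t <= 0.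
  (* The factor 2 comes from differentiating squares, the number of coordinates from
     [quad_bound]. *)
  apply: (@gronwall R E E' (2 * `|c| * (K * #|{: cvar (chart_dim ch)}|%:R)) u t (ltW ut)).
  - move=> s us; have [s01 _] := sin s us.
    exact: (is_derive_sqr_sum (a := fun v s => D s _ (Xv v)) (fun v => dD s s01 _ (Xv v))).
  - move=> s us; have [s01 se] := sin s us; have [bK Ns] := He s se.
    have -> : E' s = 2 * \sum_v (D s _ (Xv v) * \sum_w (c * b (v, w) (q s)) * D s _ (Xv w)).
      rewrite /E' mulr_sumr; apply: eq_bigr => v _; congr (2 * (_ * _)).
      by rewrite (Dc _ _ Ns (pD s s01)) mulr_sumr; apply: eq_bigr => w _; rewrite mulrA.
    have -> : 2 * `|c| * (K * #|{: cvar (chart_dim ch)}|%:R) * E s =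
      2 * (`|c| * K * #|{: cvar (chart_dim ch)}|%:R * E s) by rewrite !mulrA.
    apply: ler_wpM2l => //; apply: (@quad_bound R _ (fun v => D s _ (Xv v)) (fun v w => c * b (v, w) (q s))); first by rewrite mulr_ge0.
    by move=> v w; rewrite normrM ler_wpM2l //; exact: (bK (v, w)).
  - rewrite /E big1 // => v _; rewrite (Hu u) ?expr0n //; by case/andP: u01 => ->; rewrite lexx.
have Xv0 v : D t _ (Xv v) = 0.
  apply/eqP; rewrite -sqrf_eq0.
  have : E t == 0 by rewrite eq_le Et sumr_ge0 // => w _; exact: sqr_ge0.
  by rewrite /E psumr_eq0 => [/allP/(_ v (mem_index_enum _))//|w _]; exact: sqr_ge0.
have [t01 te'] := sin t (introT andP (conj (ltW ut) (lexx t))).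
move=> i f; have [_ Nt] := He t te'.
by rewrite (Dc _ _ Nt (pD t t01)) big1 // => v _; rewrite Xv0 mulr0.
Qed.

(** Only the coordinates of degree 0 have to be compared. Their derivatives are smooth functions of
    the point, hence locally Lipschitz, so the sum of squares of the differences satisfies
    Gronwall's inequality just after any time up to which the curves agree. *)
Lemma curve_unique (q q' : R -> M) :
  (forall u : R, 0 <= u <= 1 -> {for u, continuous q}) ->
  (forall u : R, 0 <= u <= 1 -> {for u, continuous q'}) ->
  (forall u : R, 0 <= u <= 1 -> forall i (f : sec (opensT M) i),
     is_derive u 1 (fun u => body f (q u)) (c * body (vapp X erefl f) (q u))) ->
  (forall u : R, 0 <= u <= 1 -> forall i (f : sec (opensT M) i),
     is_derive u 1 (fun u => body f (q' u)) (c * body (vapp X erefl f) (q' u))) ->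
  q 0 = q' 0 -> forall u : R, 0 <= u <= 1 -> q u = q' u.
Proof.
move=> cq cq' dq dq' q0; apply: real_induction => u u01 Hu.
  have [->//|un0] := eqVneq u 0.
  apply: separate_points => f; apply/eqP; rewrite -subr_eq0; apply/eqP.
  apply: (@zero_of_left (fun u => body f (q u) - body f (q' u))).
  - by rewrite lt_def un0; case/andP: u01.
  - apply: continuousB; apply: derivable1_continuous; first by have [] := dq u u01 0 f.
    by have [] := dq' u u01 0 f.
  - by move=> t tu; rewrite Hu ?subrr.
have u01' : 0 <= u <= 1 by case/andP: u01 => -> /ltW.
have quE : q u = q' u by apply: Hu; case/andP: u01 => ->; rewrite lexx.
have [ch [N [Xv [Nz Nc aX _]]]] := point_der_coords (q u).
have cqu := Nc _ Nz; have [dy yE] := chart_pt cqu; set y0 := chart_map ch (q u) in dy yE.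
pose n := gdim0 (chart_dim ch); pose XX (i : 'I_n) := vapp X erefl (Xv (inl i)).
pose g (i : 'I_n) (y : 'rV[R]_n) : R := gbody (ev y (gpull (chart_inv ch) (XX i))).
have lip i : exists dK : R * R, [/\ 0 < dK.1, 0 <= dK.2 & forall y y', ball (y0 : 'rV[R]_n) dK.1 y -> ball (y0 : 'rV[R]_n) dK.1 y' ->
    `|g i y - g i y'| <= dK.2 * \sum_j `|y 0 j - y' 0 j| ].
  have sg : smooth (gpre (chart_inv ch) (opensT M)) (g i) by exact: ev_smooth.
  have [d [K [d0 K0 H]]] := smooth_lipschitz (opensP (gpre (chart_inv ch) (opensT M))) (conj dy I) sg.
  by exists (d, K).
have coordE x (i : 'I_n) : oset N x -> body (Xv (inl i)) x = (chart_map ch x : 'rV[R]_n) 0 i.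
  move=> Nx; have [dx xE] := chart_pt (Nc _ Nx); have dx' := Nc _ Nx.
  have aX' : agree (chart_inv ch (chart_map ch x)) (Xv (inl i)) (gpull (chart_map ch) (xc (opensT _) (inl i))).
    by rewrite xE; exact: aX.
  rewrite -{1}xE -gbody_ev // (agree_ev (agree_pull dx aX')).
  have Wy : oset (gpre (gcomp (chart_map ch) (chart_inv ch)) (opensT _)) (chart_map ch x).
    by split=> //; split=> //=; rewrite xE.
  rewrite -(agree_ev (agree_comp _ Wy)) (agree_ev (meq_pull _ (chart_meq_inv dx) _)) //.
  by rewrite (agree_ev (agree_id _ _)) // ev_xc // gbody_cgen.
have gE x (i : 'I_n) : oset N x -> body (XX i) x = g i (chart_map ch x).
  move=> Nx; have [dx xE] := chart_pt (Nc _ Nx).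
  by rewrite /g gbody_ev // xE.
have nq (r : R -> M) : r u = q u -> {for u, continuous r} -> \forall t \near u,
    oset N (r t) /\ forall i, ball (y0 : 'rV[R]_n) (sval (cid (lip i))).1 (chart_map ch (r t)).
  move=> ru cr; apply: filterI.
    by apply: cr; rewrite ru; apply: open_nbhs_nbhs; split; [exact: opensP|].
  apply: (@filter_forall _ _ (fun i t => ball (y0 : 'rV[R]_n) (sval (cid (lip i))).1 (chart_map ch (r t))) _ (nbhs_filter u)) => i.
  have [d0 _ _] := svalP (cid (lip i)).
  have cc : {for u, continuous (chart_map ch \o r)}.
    by apply: continuous_comp => //; apply: gmap_continuous; rewrite ru.
  apply: (cc (ball (y0 : 'rV[R]_n) (sval (cid (lip i))).1)) => /=; rewrite ru.
  exact: nbhsx_ballx.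
have [e e0 He] := near_right (filterI (nq q erefl (cq u u01')) (nq q' (esym quE) (cq' u u01'))).
exists e => // t /andP[ut te] t1.
have sin s : u <= s <= t -> (0 <= s <= 1) /\ (u <= s <= u + e).
  by move=> /andP[us st]; case/andP: u01 => u0 u1; split; lra.
pose a (i : 'I_n) s := body (Xv (inl i)) (q s) - body (Xv (inl i)) (q' s).
pose a' (i : 'I_n) s := c * (body (XX i) (q s) - body (XX i) (q' s)).
pose K := \sum_i (sval (cid (lip i))).2.
have K0 : 0 <= K by apply: sumr_ge0 => i _; have [_ ? _] := svalP (cid (lip i)).
have KE i : (sval (cid (lip i))).2 <= K.
  rewrite /K (bigD1 i) //= lerDl; apply: sumr_ge0 => j _; by have [_ ? _] := svalP (cid (lip j)).
pose E s := \sum_i a i s ^+ 2; pose E' s := \sum_i 2 * (a i s * a' i s).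
have Et : E t <= 0.
  apply: (@gronwall R E E' (2 * `|c| * (K * #|{: 'I_n}|%:R)) u t (ltW ut)).
  - move=> s us; have [s01 _] := sin s us.
    have da i : is_derive s 1 (a i) (a' i s).
      by rewrite /a' mulrBr; apply: is_deriveB; [exact: dq|exact: dq'].
    exact: is_derive_sqr_sum da.
  - move=> s us; have [s01 se] := sin s us; have [[N1 B1] [N2 B2]] := He s se.
    have le i : `|a i s * a' i s| <= `|a i s| * \sum_j `|c| * K * `|a j s|.
      rewrite normrM; apply: ler_wpM2l => //; rewrite -mulr_sumr /a' normrM -mulrA; apply: ler_wpM2l => //.
      rewrite !gE //; have [_ _ H] := svalP (cid (lip i)).
      apply: le_trans (H _ _ (B1 i) (B2 i)) _; under [X in _ <= _ * X]eq_bigr do rewrite /a !coordE //.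
      by apply: ler_wpM2r (KE i); apply: sumr_ge0.
    apply: (@le_trans _ _ (2 * \sum_i `|a i s| * \sum_j `|c| * K * `|a j s|)).
      rewrite /E' mulr_sumr; apply: ler_sum => i _; apply: ler_wpM2l => //.
      exact: le_trans (ler_norm _) (le i).
    have -> : 2 * `|c| * (K * #|{: 'I_n}|%:R) * E s = 2 * (`|c| * K * #|{: 'I_n}|%:R * E s) by rewrite !mulrA.
    apply: ler_wpM2l => //.
    have -> : E s = \sum_i `|a i s| ^+ 2 by apply: eq_bigr => i _; rewrite real_normK ?num_real.
    apply: (@quad_bound R _ (fun i => `|a i s|) (fun _ _ => `|c| * K)); first by rewrite mulr_ge0.
    by move=> v w; rewrite ger0_norm ?mulr_ge0.
  - by rewrite /E big1 // => v _; rewrite /a quE subrr expr0n.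
have a0 i : a i t = 0.
  apply/eqP; rewrite -sqrf_eq0.
  have : E t == 0 by rewrite eq_le Et sumr_ge0 // => w _; exact: sqr_ge0.
  by rewrite /E psumr_eq0 => [/allP/(_ i (mem_index_enum _))//|w _]; exact: sqr_ge0.
have [_ te'] := sin t (introT andP (conj (ltW ut) (lexx t))).
have [[N1 _] [N2 _]] := He t te'.
have [_ <-] := chart_pt (Nc _ N1); have [_ <-] := chart_pt (Nc _ N2).
congr (chart_inv ch _); apply/rowP => i; rewrite -!coordE //.
by apply/eqP; rewrite -subr_eq0; apply/eqP; exact: a0.
Qed.
End CurveODE.

(** * Uniqueness for differential equations in a time of any degree *)

Section Vanishing.
Variables (R : realType) (e : gdim) (M : gmanifold R) (k : int) (X : gvf (opensT M) k).
Local Notation C := (gdomain R e).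
Local Notation V := 'rV[R]_(gdim0 e).

(* The homothety of ratio [u] in the variable [v]. *)
Definition pscale (v : cvar e) (u : R) (p : C) : C :=
  match v with inl i => (p : V) + ((u - 1) * (p : V) 0 i) *: basis_vec R i | inr _ => p end.

Lemma pscale1 v p : pscale v 1 p = p.
Proof. by case: v => [i|//]; rewrite /= subrr mul0r scale0r addr0. Qed.

Lemma pscale_val v u p : cval (pscale v u p) v = u * cval p v.
Proof.
by case: v => [i|j] /=; rewrite ?mulr0 // !mxE !eqxx mulr1 -[X in X + _]mul1r -mulrDl addrC subrK.
Qed.

Lemma pscale_shift i u h p : pscale (inl i) (u + h) p = (pscale (inl i) u p : V) + (cval p (inl i) * h) *: basis_vec R i.
Proof. by rewrite /= -[RHS]addrA -scalerDl; congr (_ + _ *: _); ring. Qed.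

Lemma pscale_continuous i p u : {for u, continuous (fun t => pscale (inl i) t p : V)}.
Proof.
have E : (fun t => pscale (inl i) t p : V) = (fun t => (pscale (inl i) 0 p : V) + t *: ((cval p (inl i)) *: basis_vec R i)).
  by apply/funext => t; rewrite -{1}[t]add0r pscale_shift scalerA mulrC.
rewrite E; apply: (@continuousD _ _ _ (fun=> (pscale (inl i) 0 p : V))); first exact: cst_continuous.
exact: scalel_continuous.
Qed.

Lemma pscale_derive i (W : opens C) m (s : @sec R C W m) a u p : oset W (pscale (inl i) u p) -> mvalid (@gdeg e) a ->
  is_derive u 1 (fun t => gc (ev (pscale (inl i) t p) s) a)
    (cval p (inl i) * gc (pder_fam (inl i) s (pscale (inl i) u p)) a).
Proof.
move=> Wu va; apply: (@is_derive_rescale R _ _ (fun y : V => gc (ev y s) a) (fun t => pscale (inl i) t p) u 1 (basis_vec R i)).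
  by move=> h; rewrite [_ *: 1]mulr1 pscale_shift.
have -> : gc (pder_fam (inl i) s (pscale (inl i) u p)) a = 'D_(basis_vec R i) (fun y : V => gc (ev y s) a) (pscale (inl i) u p).
  by rewrite /= va.
apply: derivableP; exact: sec_derivable.
Qed.

Section Family.
Variables (s : int) (v : cvar e) (W : opens C) (dd : int -> int).
Variables (Es : forall j, sec (opensT M) j -> @sec R C W (dd j)) (G G' : gmap C M) (c : R) (p : C).
Local Notation y u := (pscale v u p).
Hypotheses (inW : forall u : R, 0 <= u <= 1 -> oset W (y u))
  (inG : forall u : R, 0 <= u <= 1 -> oset (gdom G) (y u))
  (inG' : forall u : R, 0 <= u <= 1 -> oset (gdom G') (y u))
  (GG' : forall u : R, 0 <= u <= 1 -> G (y u) = G' (y u))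
  (Elin : forall (u : R) j (a : R) (f g : sec (opensT M) j), 0 <= u <= 1 ->
    ev (y u) (Es (a *: f + g)) = a *: ev (y u) (Es f) + ev (y u) (Es g))
  (Emul : forall (u : R) i j m (ee : i + j = m) (f : sec (opensT M) i) (g : sec (opensT M) j), 0 <= u <= 1 ->
    ev (y u) (Es (gmul ee f g)) = ev (y u) (Es f) * ev (y u) (gpull G' g) +
      (-1) ^ (s * i) *: (ev (y u) (gpull G f) * ev (y u) (Es g)))
  (Eder : forall (u : R) j (f : sec (opensT M) j), 0 <= u <= 1 ->
    pder_fam v (Es f) (y u) = c *: ev (y u) (Es (vapp X erefl f)))
  (E0 : forall j (f : sec (opensT M) j), kap v (ev (y 0) (Es f)) = 0).

(** For [v] of degree 0, induction on the layer [N]: by [gfilM_top] each coefficient of length [N]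
    is a point derivation along the path, to which [point_der_ode] applies. For a graded [v],
    induction on the exponent of [v]: the equation determines the coefficients of one exponent from
    those of the previous one, and [E0] starts the recursion. Two maps [G] and [G'] occur because
    the difference of two homomorphisms is a derivation along the pair. *)
Lemma vanish j (f : sec (opensT M) j) : ev p (Es f) = 0.
Proof.
have i1 : 0 <= (1 : R) <= 1 by rewrite ler01 lexx.
have i0 : 0 <= (0 : R) <= 1 by rewrite ler01 lexx.
rewrite -{1}(pscale1 v p); case: v Eder E0 inW inG inG' GG' Elin Emul => [i|jv] Ed E00 iW iG iG' GE El Em.
  suff H N (u : R) : 0 <= u <= 1 -> forall m (g : sec (opensT M) m), gfil N (ev (pscale (inl i) u p) (Es g)).
    by apply: gfil_eq0 => N; exact: H.
  elim: N u => [|N IH] u u01 m g //; move=> a; rewrite ltnS leq_eqVlt => /orP[/eqP aN|]; last exact: IH.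
  have [va|/gserP//] := boolP (mvalid (@gdeg e) a).
  pose D t m (g : sec (opensT M) m) : R := gc (ev (pscale (inl i) t p) (Es g)) a.
  (* The extra factor [cval p (inl i)] is the speed at which the homothety moves the point as its
     ratio varies. *)
  apply: (@point_der_ode R M k X (cval p (inl i) * c) (fun t => G (pscale (inl i) t p)) D) => //.
  - move=> t t01; apply: continuous_comp; first exact: pscale_continuous.
    exact: gmap_continuous (iG t t01).
  - move=> t t01; split; first by move=> m' b h h'; rewrite /D El // gcD gcZ.
    move=> i' j' m' ee h h'; rewrite /D Em // gcD gcZ.
    have [-> _] := gfilM_top (ev (pscale (inl i) t p) (gpull G' h')) (IH t t01 _ h) aN.
    have [_ ->] := gfilM_top (ev (pscale (inl i) t p) (gpull G h)) (IH t t01 _ h') aN.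
    rewrite !gbody_ev -?GE //; try exact: iG; try exact: iG'.
    congr (_ + _); have [z|z] := eqVneq i' 0; first by rewrite {1}z mulr0 expr0z mul1r.
    by rewrite /body (gsh_body (@ev_gsh _ _ _ _ _ _) z) !mul0r mulr0.
  - move=> t t01 m' h; rewrite -mulrA /D -gcZ -Ed //; apply: pscale_derive => //; exact: iW.
  - by move=> m' h; have := congr1 (fun F => gc F a) (E00 _ h).
suff H (N : nat) m (g : sec (opensT M) m) (a : {ffun 'I_(gvars e) -> nat}) : (a jv < N)%N -> gc (ev (pscale (inr jv) 1 p) (Es g)) a = 0.
  by apply: gser_eqP => a; rewrite (H (a jv).+1).
elim: N m g a => [|N IH] m g a // aN.
case: (posnP (a jv)) => aj.
  transitivity (gc (kap (inr jv) (ev (pscale (inr jv) 0 p) (Es g))) a); last by rewrite E00.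
  by rewrite [RHS](gc_gkill jv _ a) aj.
have [va|/gserP//] := boolP (mvalid (@gdeg e) a).
pose b := msub a (munit jv).
have ab : a = madd b (munit jv).
  apply/ffunP => i; rewrite !ffunE; case: eqP => [->|_]; last by rewrite subn0 addn0.
  by rewrite subnK.
have bN : (b jv < N)%N by rewrite !ffunE eqxx; move: aN aj; lia.
(* At the multi-index [b] the derivative is the coefficient of [a], up to a sign and the non-zero
   factor [(b jv).+1], while the right side has the lower exponent [b jv]. *)
have := congr1 (fun F => gc F b) (Ed 1 _ g i1); rewrite gcZ (IH _ _ b bN) mulr0.
rewrite -[LHS]/(gder_raw (@gdeg e) jv (gc (ev (pscale (inr jv) 1 p) (Es g))) b) /gder_raw -ab => /eqP.
rewrite !mulf_eq0 signr_eq0 pnatr_eq0 /= => /eqP; exact.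
Qed.
End Family.

Section Uniqueness.
Variables (F G : gmap C M) (v : cvar e) (p : C).
Local Notation y u := (pscale v u p).
Hypotheses (inF : forall u : R, 0 <= u <= 1 -> oset (gdom F) (y u))
  (inG : forall u : R, 0 <= u <= 1 -> oset (gdom G) (y u))
  (dF : forall (u : R) j (f : sec (opensT M) j), 0 <= u <= 1 ->
    pder_fam v (gpull F f) (y u) = ev (y u) (gpull F (vapp X erefl f)))
  (dG : forall (u : R) j (f : sec (opensT M) j), 0 <= u <= 1 ->
    pder_fam v (gpull G f) (y u) = ev (y u) (gpull G (vapp X erefl f)))
  (FG0 : forall j (f : sec (opensT M) j), kap v (ev (y 0) (gpull F f)) = kap v (ev (y 0) (gpull G f))).

(** Homotheties in a graded variable do not move points, and the claim is then the initial
    condition; otherwise both composites are integral curves and [curve_unique] applies. *)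
Lemma flow_unique_pt (u : R) : 0 <= u <= 1 -> F (y u) = G (y u).
Proof.
have i0 : 0 <= (0 : R) <= 1 by rewrite ler01 lexx.
have E0 : F (y 0) = G (y 0).
  apply: separate_points => f; rewrite -(gbody_ev f (inF i0)) // -(gbody_ev f (inG i0)) //.
  by rewrite -(kap_body v) FG0 kap_body.
case: v inF inG dF dG FG0 E0 => [i|jv] iF iG Fd Gd _ E0 //.
have bd (H : gmap C M) : (forall u : R, 0 <= u <= 1 -> oset (gdom H) (pscale (inl i) u p)) ->
  (forall (u : R) j (f : sec (opensT M) j), 0 <= u <= 1 ->
    pder_fam (inl i) (gpull H f) (pscale (inl i) u p) = ev (pscale (inl i) u p) (gpull H (vapp X erefl f))) ->
  forall u : R, 0 <= u <= 1 -> forall m (f : sec (opensT M) m),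
    is_derive u 1 (fun t => body f (H (pscale (inl i) t p)))
       (cval p (inl i) * body (vapp X erefl f) (H (pscale (inl i) u p))).
  move=> iH Hd t t01 m f; rewrite -(gbody_ev (vapp X erefl f) (iH t t01)) // -Hd //.
  have nH : \forall t' \near t, oset (gdom H) (pscale (inl i) t' p).
    apply: (@pscale_continuous i p t (gdom H)); apply: open_nbhs_nbhs; split; first exact: opensP.
    exact: iH.
  have Ht : oset (gpre H (opensT M)) (pscale (inl i) t p) by split=> //; exact: iH.
  apply: is_derive_near_eq (pscale_derive (gpull H f) Ht (mvalid0 _)).
  by apply: filterS nH => t' dt'; rewrite -(gbody_ev f dt').
apply: (@curve_unique R M k X (cval p (inl i)) (fun t => F (pscale (inl i) t p)) (fun t => G (pscale (inl i) t p))) => //.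
- move=> t t01; apply: continuous_comp; first exact: pscale_continuous.
  exact: gmap_continuous (iF t t01).
- move=> t t01; apply: continuous_comp; first exact: pscale_continuous.
  exact: gmap_continuous (iG t t01).
- exact: bd.
- exact: bd.
Qed.

(** The difference of the two pullbacks satisfies the hypotheses of [vanish] with [s = 0] and
    [c = 1]. The points are matched first, as [vanish] needs both maps to send the path to the same
    points. *)
Lemma flow_unique : F p = G p /\ forall j (f : sec (opensT M) j), ev p (gpull F f) = ev p (gpull G f).
Proof.
have i1 : 0 <= (1 : R) <= 1 by rewrite ler01 lexx.
have Fp : oset (gdom F) p by rewrite -(pscale1 v p); exact: inF.
have Gp : oset (gdom G) p by rewrite -(pscale1 v p); exact: inG.
split; first by rewrite -(pscale1 v p) flow_unique_pt.
move=> j f.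
pose W := ocap (gpre F (opensT M)) (gpre G (opensT M)).
pose Es j (f : sec (opensT M) j) : @sec R C W (id j) := res (@ocapl _ _ _ _) (gpull F f) - res (@ocapr _ _ _ _) (gpull G f).
have iW (u : R) : 0 <= u <= 1 -> oset W (y u).
  by move=> u01; do !split=> //; [exact: inF|exact: inG].
have EsE x : oset W x -> forall m (g : sec (opensT M) m), ev x (Es m g) = ev x (gpull F g) - ev x (gpull G g).
  by move=> Wx m g; rewrite /Es -scaleN1r addrC evP !ev_res // scaleN1r addrC.
have Wp : oset W p by rewrite -(pscale1 v p); exact: iW.
suff : ev p (Es j f) = 0 by rewrite EsE // => /eqP; rewrite subr_eq0 => /eqP.
apply: (@vanish 0 v W id Es F G 1 p) => //.
- exact: flow_unique_pt.
- by move=> u m a g h /iW Wu; rewrite !EsE // !gpullP !evP scalerBr opprD addrACA.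
- move=> u i m n ee g h /iW Wu; rewrite !EsE // !gpull_mul !ev_mul mul0r expr0z scale1r.
  by rewrite mulrBl mulrBr [RHS]addrC addrA subrK.
- move=> u m g u01; have Wu := iW u u01; rewrite scale1r EsE // -dF // -dG //.
  rewrite /Es -scaleN1r addrC pder_fam_lin // scaleN1r addrC.
  by congr (_ - _); apply: agree_pder; exact: agree_res.
- move=> m g; rewrite EsE; first by rewrite kapB FG0 subrr.
  by apply: iW; rewrite lexx ler01.
Qed.
End Uniqueness.
End Vanishing.

(** * Comparison of maps through global sections; commutation of partial derivatives *)

Section Tools.
Variable R : realType.

Lemma meq_pull2 (X Y Y' Z : gspace R) (x : X) (g1 : gmap X Y) (f1 : gmap Y Z) (g2 : gmap X Y') (f2 : gmap Y' Z)
  (W : opens Z) k (s : sec W k) : meq x (gcomp f1 g1) (gcomp f2 g2) -> oset W (f1 (g1 x)) ->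
  agree x (gpull g1 (gpull f1 s)) (gpull g2 (gpull f2 s)).
Proof.
move=> H Wx; have d1 : oset (gpre (gcomp f1 g1) W) x by split=> //; exact: meq_doml H.
have d2 : oset (gpre (gcomp f2 g2) W) x.
  split; first exact: meq_domr H.
  by have E : f1 (g1 x) = f2 (g2 x) := meq_pt H; move: Wx; rewrite E.
apply: agree_trans (agree_sym (agree_comp s d1)) _.
exact: agree_trans (meq_pull s H Wx) (agree_comp s d2).
Qed.

Lemma pder_germ_der (e : gdim) (X : gspace R) (phi : gmap (gdomain R e) X) p v : oset (gdom phi) p ->
  germ_der (cdeg v) (phi p) (fun W k f => ev p (gpull phi f) : gser R (@gdeg e))
    (fun W k f => pder_fam v (gpull phi f) p).
Proof.
move=> dp; split.
- by move=> W m a f g Wp; rewrite gpullP pder_fam_lin.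
- by move=> W i j m ee f g Wp; rewrite gpull_mul pder_famM.
- move=> W W' h m f Wp; apply: agree_pder; apply: agree_pull dp _; exact: agree_res.
Qed.

(** Near a given point, a section over a smaller open set is the restriction of a global one, so
    testing on global sections is enough. *)
Lemma meq_of_ev (e : gdim) (M : gmanifold R) (F G : gmap (gdomain R e) M) (N : opens (gdomain R e)) p : oset N p ->
  N `<=` gdom F -> N `<=` gdom G ->
  (forall p', oset N p' -> F p' = G p' /\ forall j (f : sec (opensT M) j), ev p' (gpull F f) = ev p' (gpull G f)) ->
  meq p F G.
Proof.
move=> Np NF NG E; apply: (@meq_of_agree _ _ _ N) => //; first by move=> x /set_mem /E[].
move=> x Nx W j f Wx; pose N' := ocap N (gpre F W).
have [f' [ag _ _]] := @section_extend R M (opensT M) W (fun _ _ => I) _ _ f Wx.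
have Gx : G x = F x by have [->] := E x Nx.
apply: agree_trans (agree_sym (agree_pull (NF x Nx) ag)) _; rewrite -Gx in ag.
apply: agree_trans _ (agree_pull (NG x Nx) ag).
apply: (@ev_agree _ _ x N) => //; first by move=> y Ny; split=> //; exact: NF.
  by move=> y Ny; split=> //; exact: NG.
by move=> y Ny; have [_] := E y Ny.
Qed.

Lemma agree0_all (X : gspace R) j (h : sec (opensT X) j) :
  (forall m, agree m h (0 : sec (opensT X) j)) -> h = 0.
Proof.
move=> H; pose V m := sval (cid (H m)).
have Vm m : oset (V m) m by have [? [? []]] := svalP (cid (H m)).
apply: (@sheaf_sep R X X V (opensT X) (fun _ _ _ => I)); first by move=> m _; exists m.
move=> m; have [h1 [h2 [_ E]]] := svalP (cid (H m)).
by move: E; rewrite -/(V m) res0 res0 => <-; congr (res _ h); exact: Prop_irrelevance.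
Qed.

Lemma evB (e : gdim) (W : opens (gdomain R e)) k p (f g : @sec R (gdomain R e) W k) :
  ev p (f - g) = ev p f - ev p g.
Proof. by rewrite -scaleN1r addrC evP scaleN1r addrC. Qed.

Lemma pder_famB (e : gdim) v (W : opens (gdomain R e)) k p (f g : @sec R (gdomain R e) W k) : oset W p ->
  pder_fam v (f - g) p = pder_fam v f p - pder_fam v g p.
Proof. by move=> Wp; rewrite -scaleN1r addrC pder_fam_lin // scaleN1r addrC. Qed.

Lemma gpullB (X Y : gspace R) (phi : gmap X Y) (W : opens Y) k (a : R) (f g : sec W k) :
  gpull phi (f - a *: g) = gpull phi f - a *: gpull phi g.
Proof. by rewrite -scaleNr addrC gpullP scaleNr addrC. Qed.

Lemma ev_germ_hom (e : gdim) (p : gdomain R e) :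
  @germ_hom R _ _ (gdomain R e) p (fun W m g => ev p g : gser R (@gdeg e)).
Proof.
have H := @gmap_germ R e (gdomain R e) (gid _) p I; split.
- by move=> *; exact: evP.
- by move=> *; exact: ev_one.
- by move=> *; exact: ev_mul.
- by move=> *; exact: ev_res.
- by move=> *; exact: ev_gsh.
- by move=> W' g W'p nf; have := gh_body H W'p nf; rewrite (agree_ev (agree_id _ _)).
Qed.

(** The graded commutator of two partial derivatives is again a derivation and vanishes on
    coordinates, so [germ_der_uniq] applies. Symmetry of ordinary second derivatives is the case of
    two coordinates of degree 0. *)
Lemma pderC (e : gdim) (W : opens (gdomain R e)) k (f : @sec R (gdomain R e) W k) u v p : oset W p ->
  pder_fam u (pder v f) p = (-1) ^ (cdeg u * cdeg v) *: pder_fam v (pder u f) p.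
Proof.
move=> Wp; pose L := gser R (@gdeg e).
pose A (W : opens (gdomain R e)) m (g : @sec R (gdomain R e) W m) : L := ev p g.
have hA : @germ_hom R _ _ (gdomain R e) p A := ev_germ_hom p.
pose D (W : opens (gdomain R e)) m (g : @sec R (gdomain R e) W m) : L :=
  pder_fam u (pder v g) p - (-1) ^ (cdeg u * cdeg v) *: pder_fam v (pder u g) p.
suff hD : @germ_der R _ _ (cdeg u + cdeg v) (gdomain R e) p A D.
  have H := germ_der_uniq hA hD; apply/eqP; rewrite -subr_eq0; apply/eqP.
  apply: (H _ W k f) => // W' w W'p; rewrite /D -!ev_pder // !pder_pder_xc ev0.
  by rewrite ev0 scaler0 subr0.
split.
- move=> W' m a g g' W'p; rewrite /D !pder_lin !pder_fam_lin // scalerBr !scalerDr opprD addrACA.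
  by rewrite !scalerA [a * _]mulrC.
- move=> W' i j m ee g g' W'p.
  have pm (x : cvar e) y : oset W' y ->
    ev y (pder x (gmul ee g g')) = ev y (pder x g) * ev y g' + (-1) ^ (cdeg x * i) *: (ev y g * ev y (pder x g')).
    by move=> Wy; rewrite !ev_pder // pder_famM.
  have second (x y : cvar e) : pder_fam x (pder y (gmul ee g g')) p =
      pder_fam x (pder y g) p * ev p g' + (-1) ^ (cdeg x * (i - cdeg y)) *: (ev p (pder y g) * ev p (pder x g'))
      + (-1) ^ (cdeg y * i) *: (ev p (pder x g) * ev p (pder y g')
      + (-1) ^ (cdeg x * i) *: (ev p g * pder_fam x (pder y g') p)).
    have e1 : i - cdeg y + j = m - cdeg y by rewrite -ee addrAC.
    have e2 : i + (j - cdeg y) = m - cdeg y by rewrite -ee addrA.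
    have E : pder y (gmul ee g g') = (-1) ^ (cdeg y * i) *: gmul e2 g (pder y g') + gmul e1 (pder y g) g'.
      by apply: sec_ev_eq => q Wq; rewrite pm // evP !ev_mul addrC.
    by rewrite E pder_fam_lin // !pder_famM // addrC -!ev_pder.
  rewrite /D (second u v) (second v u) /A -!ev_pder //.
  set a1 := ev p (pder u (pder v g)); set a2 := ev p (pder v (pder u g)).
  set b1 := ev p (pder u (pder v g')); set b2 := ev p (pder v (pder u g')).
  set c1 := ev p (pder v g) * _; set c2 := ev p (pder u g) * _.
  have n1 : (-1 : R) != 0 by rewrite oppr_eq0 oner_neq0.
  pose sg : R := (-1) ^ (cdeg u * cdeg v); pose su : R := (-1) ^ (cdeg u * i); pose sv : R := (-1) ^ (cdeg v * i).
  have E1 : (-1 : R) ^ (cdeg u * (i - cdeg v)) = su * sg.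
    by rewrite mulrBr expfzDr // -/su -mulNr signzN.
  have E2 : (-1 : R) ^ (cdeg v * (i - cdeg u)) = sv * sg.
    by rewrite mulrBr expfzDr // -/sv -mulNr signzN [cdeg v * cdeg u]mulrC.
  have E3 : (-1 : R) ^ ((cdeg u + cdeg v) * i) = su * sv by rewrite mulrDl expfzDr.
  rewrite E1 E2 E3 -/sg -/su -/sv mulrBl mulrBr -gsmulZl -gsmulZr.
  have sgE : (sg == 1) || (sg == -1) by rewrite -sqrf_eq1 expr2 signz_sqr.
  apply: gser_eqP => a; rewrite !(gcD, gcB, gcZ, gcN).
  by case/orP: sgE => /eqP ->; ring.
- move=> W' W'' h m g W''p; rewrite /D; congr (_ - _ *: _); apply: agree_pder.
    by rewrite pder_res; exact: agree_res.
  by rewrite pder_res; exact: agree_res.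
Qed.
End Tools.

Section DerivationDegrees.
Variables (R : realType) (M : gspace R) (U : opens M) (k l : int) (X : gvf U k) (Y : gvf U l).

Lemma vapp_nat T (A : forall j, sec U j -> T) i j j' (e : k + i = j) (e' : k + i = j') (f : sec U i) :
  A j (vapp X e f) = A j' (vapp X e' f).
Proof. by case: j / e; case: j' / e'. Qed.

Lemma vapp2_nat T (A : forall j, sec U j -> T) i m j m' j' (e2 : l + i = m) (e1 : k + m = j)
  (e2' : l + i = m') (e1' : k + m' = j') (f : sec U i) :
  A j (vapp X e1 (vapp Y e2 f)) = A j' (vapp X e1' (vapp Y e2' f)).
Proof. by case: m / e2 e1 => e1; case: m' / e2' e1' => e1'; exact: vapp_nat. Qed.
End DerivationDegrees.

(** * The two composites of flows in coordinates *)

Section Square.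
Variables (R : realType) (M : gmanifold R) (k l : int) (PX : gproduct M (gline R k)) (PY : gproduct M (gline R l)).
Variables (X : gvf (opensT M) k) (Y : gvf (opensT M) l) (thX : gmap PX M) (thY : gmap PY M).
Hypotheses (genX : forall w, oset (gdom thX) w -> gen_at X thX w) (genY : forall w, oset (gdom thY) w -> gen_at Y thY w)
  (staX : forall w, start_at thX w) (staY : forall w, start_at thY w).
Variables (e : gdim) (vs vt : cvar e).
Local Notation C := (gdomain R e).
(** In coordinates [(m, s, t)] one has [a = (m, s)], [b = (m, t)], [A = (thX (m, s), t)] and
    [B = (thY (m, t), s)], so that [F] and [G] are the two composites. The hypotheses below record
    just this, up to germs. *)
Variables (a B : gmap C PX) (b A : gmap C PY) (O : opens C).
Hypotheses (vst : vs != vt) (ds : cdeg vs = - k) (dt : cdeg vt = - l).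
Local Notation F := (gcomp thY A).
Local Notation G := (gcomp thX B).
Hypotheses (inF : O `<=` gdom F) (inG : O `<=` gdom G)
  (mab : forall p, oset O p -> meq p (gcomp (pfst PX) a) (gcomp (pfst PY) b))
  (mA1 : forall p, oset O p -> meq p (gcomp (pfst PY) A) (gcomp thX a))
  (mA2 : forall p, oset O p -> meq p (gcomp (psnd PY) A) (gcomp (psnd PY) b))
  (mB1 : forall p, oset O p -> meq p (gcomp (pfst PX) B) (gcomp thY b))
  (mB2 : forall p, oset O p -> meq p (gcomp (psnd PX) B) (gcomp (psnd PX) a))
  (mus : forall p (W : opens M) j (f : sec W j), oset O p -> oset W (pfst PX (a p)) ->
     pder_fam vs (gpull a (gpull (pfst PX) f)) p = 0)
  (mut : forall p (W : opens M) j (f : sec W j), oset O p -> oset W (pfst PX (a p)) ->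
     pder_fam vt (gpull a (gpull (pfst PX) f)) p = 0)
  (cs : forall p, oset O p -> ev p (gpull a (gpull (psnd PX) (line_coord R k))) = cgen p vs)
  (ct : forall p, oset O p -> ev p (gpull b (gpull (psnd PY) (line_coord R l))) = cgen p vt).

Let pX (w : PX) : oset (gdom (pfst PX)) w. Proof. exact: (@pfst_total _ _ _ PX _ I). Qed.
Let pY (w : PY) : oset (gdom (pfst PY)) w. Proof. exact: (@pfst_total _ _ _ PY _ I). Qed.
Let sX (w : PX) : oset (gdom (psnd PX)) w. Proof. exact: (@psnd_total _ _ _ PX _ I). Qed.
Let sY (w : PY) : oset (gdom (psnd PY)) w. Proof. exact: (@psnd_total _ _ _ PY _ I). Qed.

Lemma sq_dom p : oset O p -> [/\ oset (gdom a) p, oset (gdom b) p, oset (gdom A) p & oset (gdom B) p].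
Proof.
move=> Op; have [da _] := meq_doml (mab Op); have [db _] := meq_domr (mab Op).
by have [dA _] := inF Op; have [dB _] := inG Op.
Qed.

Lemma pder_snd (k' : int) (P : gmap C (gline R k')) v w p : oset O p -> O `<=` gdom P -> cdeg w = - k' ->
  (forall y, oset O y -> ev y (gpull P (line_coord R k')) = cgen y w) ->
  pder_fam v (gpull P (line_coord R k')) p = ((v == w)%:R)%:A.
Proof.
move=> Op OP dw E; have E' : agree p (gpull P (line_coord R k')) (scast dw (xc (opensT C) w)).
  apply: (@ev_agree _ _ p O) => //; first by move=> y /OP.
  by move=> y Oy; rewrite E // (scast_nat (fun W m f => ev y f)) ev_xc.
rewrite (agree_pder v E') (scast_nat (fun W m f => pder_fam v f p)) -ev_pder // pder_xc //.
Qed.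

Lemma sq_dera v : (forall p (W : opens M) j (f : sec W j), oset O p -> oset W (pfst PX (a p)) ->
     pder_fam v (gpull a (gpull (pfst PX) f)) p = 0) -> v != vs ->
  forall p (W : opens PX) j (f : sec W j), oset O p -> oset W (a p) -> pder_fam v (gpull a f) p = 0.
Proof.
move=> mu vvs p W j f Op Wp; have [da _ _ _] := sq_dom Op.
apply: (line_der_uniq (gmap_germ da) (pder_germ_der v da)) Wp => [W' j' f' W'p|]; first exact: mu.
have H := @pder_snd k (gcomp (psnd PX) a) v vs p Op _ ds.
have sub : O `<=` gdom (gcomp (psnd PX) a) by move=> y /sq_dom[]; split=> //; exact: sX.
have ag y : oset O y -> agree y (gpull (gcomp (psnd PX) a) (line_coord R k)) (gpull a (gpull (psnd PX) (line_coord R k))).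
  by move=> Oy; apply: agree_comp; split=> //; exact: sub.
rewrite -(agree_pder v (ag p Op)) H ?(negbTE vvs) ?mulr0n ?scale0r //.
by move=> y Oy; rewrite (agree_ev (ag y Oy)) cs.
Qed.

Lemma sq_derb v : (forall p (W : opens M) j (f : sec W j), oset O p -> oset W (pfst PX (a p)) ->
     pder_fam v (gpull a (gpull (pfst PX) f)) p = 0) ->
  forall p, oset O p -> (forall (W : opens M) j (f : sec W j), oset W (pfst PY (b p)) ->
     pder_fam v (gpull b (gpull (pfst PY) f)) p = 0) /\
  pder_fam v (gpull b (gpull (psnd PY) (line_coord R l))) p = ((v == vt)%:R)%:A.
Proof.
move=> mu p Op; split.
  move=> W j f Wp; rewrite -(mu p W j f Op); last by rewrite (meq_pt (mab Op) : pfst PX (a p) = _).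
  by apply: agree_pder; apply: agree_sym; apply: meq_pull2 (mab Op) _; rewrite (meq_pt (mab Op) : pfst PX (a p) = _).
have sub : O `<=` gdom (gcomp (psnd PY) b) by move=> y /sq_dom[]; split=> //; exact: sY.
have ag y : oset O y -> agree y (gpull (gcomp (psnd PY) b) (line_coord R l)) (gpull b (gpull (psnd PY) (line_coord R l))).
  by move=> Oy; apply: agree_comp; split=> //; exact: sub.
rewrite -(agree_pder v (ag p Op)) (@pder_snd l _ v vt p Op sub dt) //.
by move=> y Oy; rewrite (agree_ev (ag y Oy)) ct.
Qed.

Lemma sq_derb0 p (W : opens PY) j (f : sec W j) : oset O p -> oset W (b p) -> pder_fam vs (gpull b f) p = 0.
Proof.
move=> Op Wp; have [_ db _ _] := sq_dom Op; have [H1 H2] := sq_derb mus Op.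
apply: (line_der_uniq (gmap_germ db) (pder_germ_der vs db)) Wp => //.
by rewrite H2 (negbTE vst) mulr0n scale0r.
Qed.

(** [A] depends on [t] through its line component only, so the generator property of [thY] applies
    directly. For [G] the same holds with respect to [s]; its relation to [Y] in [t] is the point at
    issue. *)
Lemma sq_dFt p j (f : sec (opensT M) j) : oset O p ->
  pder_fam vt (gpull F f) p = ev p (gpull F (vapp Y erefl f)).
Proof.
move=> Op; have [dA dth] := inF Op.
have Wp : oset (gpre F (opensT M)) p by split=> //; exact: inF.
rewrite (agree_pder vt (agree_comp f Wp)) (agree_ev (agree_comp _ Wp)).
have [H1 H2] := sq_derb mut Op.
apply: (genY dth); split=> // [W i g Wg|].
  have pE : pfst PY (A p) = thX (a p) := meq_pt (mA1 Op).
  rewrite (agree_pder vt (meq_pull2 g (mA1 Op) Wg)); apply: (sq_dera mut) => //; first by rewrite eq_sym.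
  by have [] := meq_domr (mA1 Op); split=> //=; rewrite -pE.
by rewrite (agree_pder vt (meq_pull2 (line_coord R l) (mA2 Op) I)) H2 eqxx scale1r.
Qed.

Lemma sq_dGs p j (f : sec (opensT M) j) : oset O p ->
  pder_fam vs (gpull G f) p = ev p (gpull G (vapp X erefl f)).
Proof.
move=> Op; have [dB dth] := inG Op.
have Wp : oset (gpre G (opensT M)) p by split=> //; exact: inG.
rewrite (agree_pder vs (agree_comp f Wp)) (agree_ev (agree_comp _ Wp)).
apply: (genX dth); split=> // [W i g Wg|].
  have pE : pfst PX (B p) = thY (b p) := meq_pt (mB1 Op).
  rewrite (agree_pder vs (meq_pull2 g (mB1 Op) Wg)); apply: sq_derb0 => //.
  by have [] := meq_domr (mB1 Op); split=> //=; rewrite -pE.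
rewrite (agree_pder vs (meq_pull2 (line_coord R k) (mB2 Op) I)).
have sub : O `<=` gdom (gcomp (psnd PX) a) by move=> y /sq_dom[]; split=> //; exact: sX.
have ag y : oset O y -> agree y (gpull (gcomp (psnd PX) a) (line_coord R k)) (gpull a (gpull (psnd PX) (line_coord R k))).
  by move=> Oy; apply: agree_comp; split=> //; exact: sub.
rewrite -(agree_pder vs (ag p Op)) (@pder_snd k _ vs vs p Op sub ds) ?eqxx ?scale1r //.
by move=> y Oy; rewrite (agree_ev (ag y Oy)) cs.
Qed.

Lemma kap_cgen p v : cval p v = 0 -> kap v (cgen p v) = (0 : gser R (@gdeg e)).
Proof.
case: v => [i|j] /= H; first by rewrite H scale0r.
apply: gser_eqP => c; rewrite (gc_gkill j _ c) gc0; case: eqP => // cj.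
rewrite -[gc _ _]/((c == munit j)%:R : R); case: eqP => // E.
by move: cj; rewrite E ffunE eqxx.
Qed.

(* On the locus [t = 0], pulling back along [B] is pulling back along [a]. *)
Lemma sq_Ba q (deg : 'I_q -> int) p (H : forall (W : opens C) j, @sec R C W j -> gser R deg) :
  oset O p -> @germ_hom R q deg C p H ->
  H _ _ (gpull b (gpull (psnd PY) (line_coord R l))) = 0 ->
  B p = a p /\ forall (W : opens PX) j (f : sec W j), oset W (a p) -> H _ _ (gpull B f) = H _ _ (gpull a f).
Proof.
move=> Op hH Hb; have [da db dA dB] := sq_dom Op.
have ag (U V : opens C) m (s1 : @sec R C U m) (s2 : @sec R C V m) : agree p s1 s2 -> H _ _ s1 = H _ _ s2.
  exact: (germ_agree (gh_res hH)).
have [dthb thb thbE] := staY (germ_hom_pull db hH) Hb.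
have E1 : pfst PX (B p) = pfst PX (a p).
  rewrite (meq_pt (mB1 Op) : pfst PX (B p) = thY (b p)) thb.
  by rewrite (meq_pt (mab Op) : pfst PX (a p) = _).
have Bp : B p = a p.
  by apply: prod_point_eq => //; exact: (meq_pt (mB2 Op)).
split=> // W j f Wp; have hB := germ_hom_pull dB hH; have ha := germ_hom_pull da hH.
rewrite Bp in hB.
apply: (line_hom_uniq hB ha) Wp => [W' j' f' W'p|]; last first.
  exact: (ag _ _ _ _ _ (meq_pull2 (line_coord R k) (mB2 Op) I)).
rewrite (ag _ _ _ _ _ (meq_pull2 f' (mB1 Op) _)); last by rewrite E1.
have ab : pfst PX (a p) = pfst PY (b p) := meq_pt (mab Op).
rewrite thbE; last by rewrite -ab.
by apply: ag; apply: agree_sym; apply: meq_pull2 (mab Op) _.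
Qed.

(** At [t = 0] both composites reduce to [thX] after [a]. *)
Lemma sq_FG0 p j (f : sec (opensT M) j) : oset O p -> cval p vt = 0 ->
  kap vt (ev p (gpull F f)) = kap vt (ev p (gpull G f)).
Proof.
move=> Op p0; have [da db dA dB] := sq_dom Op; have [_ dthA] := inF Op; have [_ dthB] := inG Op.
have hid : @germ_hom R _ _ C p (fun W m (g : @sec R C W m) => kap vt (ev p g)).
  by apply: kap_germ_hom; exact: ev_germ_hom.
have Wp : oset (gpre F (opensT M)) p by split=> //; exact: inF.
have Wp' : oset (gpre G (opensT M)) p by split=> //; exact: inG.
rewrite (agree_ev (agree_comp f Wp)) (agree_ev (agree_comp f Wp')).
have t0 : kap vt (ev p (gpull b (gpull (psnd PY) (line_coord R l)))) = 0 by rewrite ct // kap_cgen.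
have [BE Ba] := sq_Ba Op hid t0; rewrite Ba; last by split=> //=; rewrite -BE.
have [|_ _ ->] := staY (germ_hom_pull dA hid) _; last by [].
  by rewrite /= (agree_ev (meq_pull2 (line_coord R l) (mA2 Op) I)).
by rewrite /= (agree_ev (meq_pull2 f (mA1 Op) I)).
Qed.

Lemma kl_deg j : l + j = j - cdeg vt. Proof. by rewrite dt opprK addrC. Qed.
Lemma kl_deg' j : k + j = j - cdeg vs. Proof. by rewrite ds opprK addrC. Qed.
Local Notation W0 := (gpre G (opensT M)).
Local Notation sgn := ((-1 : R) ^ (k * l)).

(* The failure of [Y] to be related to [d/dt] along the second composite. *)
Definition sq_defect j (f : sec (opensT M) j) : @sec R C W0 (j - cdeg vt) :=
  pder vt (gpull G f) - gpull G (vapp Y (kl_deg j) f).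

Lemma sq_W0 p : oset O p -> oset W0 p. Proof. by move=> Op; split=> //; exact: inG. Qed.

Lemma ev_defect p j (f : sec (opensT M) j) : oset O p ->
  ev p (sq_defect f) = pder_fam vt (gpull G f) p - ev p (gpull G (vapp Y erefl f)).
Proof.
move=> Op; rewrite /sq_defect evB ev_pder; last exact: sq_W0.
by rewrite (vapp_nat Y (fun m g => ev p (gpull G g)) (kl_deg j) erefl).
Qed.

(** Exchanging the two partial derivatives and using that [d/ds] is related to [X] along [G] turns
    the derivative of the defect of [f] into the defect of [X f], up to the order in which [X] and
    [Y] act. This is where the bracket enters. *)
Lemma sq_defect_der p j (f : sec (opensT M) j) m (em : k + l + j = m) : oset O p ->
  pder_fam vs (sq_defect f) p = sgn *: ev p (sq_defect (vapp X erefl f)) - ev p (gpull G (gbracket X Y em f)).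
Proof.
move=> Op; have Wp := sq_W0 Op.
have kl : cdeg vs * cdeg vt = k * l by rewrite ds dt mulrNN.
rewrite [in LHS]/sq_defect pder_famB // pderC // kl.
have ag : agree p (pder vs (gpull G f)) (gpull G (vapp X (kl_deg' j) f)).
  apply: (@ev_agree _ _ p O) => //; [exact: sq_W0|exact: sq_W0|].
  move=> y Oy; rewrite ev_pder ?sq_dGs //; last exact: sq_W0.
  exact: (vapp_nat X (fun m g => ev y (gpull G g))).
rewrite (agree_pder vt ag) (vapp_nat X (fun m g => pder_fam vt (gpull G g) p) (kl_deg' j) erefl) sq_dGs //.
rewrite ev_defect // /gbracket gpullB evB evZ.
rewrite (vapp2_nat Y X (fun m g => ev p (gpull G g)) erefl (bracket_degr em) erefl erefl).
rewrite (vapp2_nat X Y (fun m g => ev p (gpull G g)) erefl (bracket_degl em) (kl_deg j) erefl).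
rewrite scalerBr opprB; set u1 := sgn *: pder_fam _ _ _; set u2 := sgn *: ev _ _; set u3 := ev _ _.
by rewrite addrA subrK.
Qed.

Lemma sq_slice p j (f : sec (opensT M) j) : oset O p -> cval p vs = 0 ->
  kap vs (ev p (gpull G f)) = kap vs (ev p (gpull b (gpull thY f))).
Proof.
move=> Op p0; have [da db dA dB] := sq_dom Op.
have hid : @germ_hom R _ _ C p (fun W m (g : @sec R C W m) => kap vs (ev p g)).
  by apply: kap_germ_hom; exact: ev_germ_hom.
rewrite (agree_ev (agree_comp f (sq_W0 Op))).
have [|_ _ ->] := staX (germ_hom_pull dB hid) _; last by [].
  by rewrite /= (agree_ev (meq_pull2 (line_coord R k) (mB2 Op) I)) cs // kap_cgen.
by rewrite /= (agree_ev (meq_pull2 f (mB1 Op) I)).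
Qed.

(** On the locus [s = 0], [G] is [thY] after [b], for which the relation with [Y] holds; the
    derivative in [t] is tangent to that locus, so [kap_pder] compares the two. *)
Lemma sq_slice_defect p j (f : sec (opensT M) j) : oset O p -> cval p vs = 0 ->
  kap vs (ev p (sq_defect f)) = 0.
Proof.
move=> Op p0; rewrite ev_defect // kapB sq_slice //.
have bW y : oset O y -> oset (gpre b (gpre thY (opensT M))) y.
  by move=> Oy; have [db dth] := meq_domr (mB1 Oy); do !split.
have [H1 H2] := sq_derb mut Op.
have <- : pder_fam vt (gpull b (gpull thY f)) p = ev p (gpull b (gpull thY (vapp Y erefl f))).
  have [db dth] := meq_domr (mB1 Op).
  by apply: (genY dth); split=> //; rewrite H2 eqxx scale1r.
apply/eqP; rewrite subr_eq0; apply/eqP.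
rewrite -(agree_pder vt (agree_res (fun y Oy => sq_W0 Oy) (gpull G f) Op)).
rewrite -(agree_pder vt (agree_res bW (gpull b (gpull thY f)) Op)).
apply: (kap_pder (N := O)) => //.
by move=> y Oy y0; rewrite (@ev_res R e _ _ _ _ y (gpull G f)) // (@ev_res R e _ _ _ _ y (gpull b (gpull thY f))) // sq_slice.
Qed.

(** With zero bracket, [sq_defect_der] is the homogeneous linear equation of [vanish] in the
    variable [s], for a derivation of degree [l] and the factor [sgn]; the initial value is
    [sq_slice_defect]. *)
Lemma sq_dGt p j (f : sec (opensT M) j) : gbracket_eq0 X Y ->
  (forall u : R, 0 <= u <= 1 -> oset O (pscale vs u p)) ->
  pder_fam vt (gpull G f) p = ev p (gpull G (vapp Y erefl f)).
Proof.
move=> XY st; have Op : oset O p by rewrite -(pscale1 vs p); apply: st; rewrite ler01 lexx.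
apply/eqP; rewrite -subr_eq0 -ev_defect //; apply/eqP.
apply: (@vanish R e M k X l vs W0 (fun j => j - cdeg vt) sq_defect G G sgn p) => //.
- by move=> u /st/sq_W0.
- by move=> u /st/inG.
- by move=> u /st/inG.
- move=> u m a' g h /st Ou; rewrite !ev_defect // vappP !gpullP pder_fam_lin ?evP; last exact: sq_W0.
  by rewrite scalerBr opprD addrACA.
- move=> u i j' m ee g h /st Ou; rewrite !ev_defect //.
  have e1 : l + i + j' = l + m by rewrite -ee addrA.
  have e2 : i + (l + j') = l + m by rewrite -ee addrCA.
  rewrite (vapp_mul Y ee erefl erefl erefl e1 e2) gpull_mul pder_famM; last exact: sq_W0.
  rewrite [gmul e1 _ _ + _]addrC gpullP evP !gpull_mul !ev_mul dt signzN mulrBl mulrBr scalerBr.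
  by rewrite opprD [- _ - _]addrC addrACA.
- move=> u m g /st Ou.
  rewrite (sq_defect_der g (erefl (k + l + m)) Ou) XY gpull0 ev0 subr0.
  by [].
- move=> m g; apply: sq_slice_defect; last by rewrite pscale_val mul0r.
  by apply: st; rewrite lexx ler01.
Qed.

(** If [F] and [G] coincide, then [G] inherits from [F] the relation with [Y]; the defect vanishes
    identically and [sq_defect_der] leaves only the bracket. *)
Lemma sq_bracket0 : (forall p, oset O p -> meq p F G) ->
  forall p j (f : sec (opensT M) j) m (em : k + l + j = m), oset O p -> ev p (gpull G (gbracket X Y em f)) = 0.
Proof.
move=> FG p j f m em Op.
have z y j' (g : sec (opensT M) j') : oset O y -> ev y (sq_defect g) = 0.
  move=> Oy; rewrite ev_defect //; have ag j'' (h : sec (opensT M) j'') := meq_pull h (FG y Oy) I.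
  by rewrite -(agree_pder vt (ag _ g)) -(agree_ev (ag _ _)) sq_dFt // subrr.
have := sq_defect_der f em Op; rewrite z // scaler0 sub0r.
have -> : pder_fam vs (sq_defect f) p = 0.
  have ag : agree p (sq_defect f) (0 : @sec R C O _).
    by apply: (@ev_agree _ _ p O) => //; [exact: sq_W0|move=> y Oy; rewrite z // ev0].
  by rewrite (agree_pder vs ag) -ev_pder // pder0 ev0.
by move=> /eqP; rewrite eq_sym oppr_eq0 => /eqP.
Qed.

(** At [s = t = 0] the composite [G] becomes the projection to [M], so a section killed by the
    pullback along [G] is itself killed there. The map [i] stands for the inclusion of that
    locus. *)
Lemma sq_zero (d : gdim) (i : gmap (gdomain R d) C) y j (h : sec (opensT M) j) :
  oset (gdom i) y -> oset O (i y) ->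
  ev y (gpull i (gpull a (gpull (psnd PX) (line_coord R k)))) = 0 ->
  ev y (gpull i (gpull b (gpull (psnd PY) (line_coord R l)))) = 0 ->
  (forall p, oset O p -> ev p (gpull G h) = 0) ->
  ev y (gpull i (gpull a (gpull (pfst PX) h))) = 0.
Proof.
move=> dy Oy s0 t0 h0; have hH := gmap_germ dy; have [da db dA dB] := sq_dom Oy.
have [Ba BaE] := sq_Ba Oy hH t0.
have [dth th0 thE] := staX (germ_hom_pull da hH) s0.
apply: etrans (esym (thE (opensT M) j h I)) _.
have Wa : oset (gpre thX (opensT M)) (a (i y)) by split.
apply: etrans (esym (BaE _ _ (gpull thX h) Wa)) _.
have ag : agree (i y) (gpull B (gpull thX h)) (0 : @sec R C O j).
  apply: agree_trans (agree_sym (agree_comp h (sq_W0 Oy))) _.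
  by apply: (@ev_agree _ _ (i y) O) => //; [exact: sq_W0|move=> p Op; rewrite h0 // ev0].
by rewrite (agree_ev (agree_pull dy ag)) gpull0 ev0.
Qed.
End Square.

(** * Pairings, product maps and the flip, up to germs *)

Section ProductMaps.
Variables (R : realType).

Lemma ppair_meq (A B T : gmanifold R) (P : gproduct A B) (f : smap T A) (g : smap T B) z :
  oset (gdom f) z -> oset (gdom g) z ->
  [/\ oset (gdom (ppair P f g)) z, meq z (gcomp (pfst P) (ppair P f g)) f
    & meq z (gcomp (psnd P) (ppair P f g)) g].
Proof.
move=> df dg; have dz : oset (ocap (gdom f) (gdom g)) z by [].
split.
- have E := ppair_dom P f g.
  by suff : (gdom (ppair P f g) : set T) z by []; rewrite [X in X z]E.
- exact: geq_meq dz (ppair_fst P f g).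
- exact: geq_meq dz (ppair_snd P f g).
Qed.

Lemma pfst_dom (A B : gmanifold R) (P : gproduct A B) z : oset (gdom (pfst P)) z.
Proof. exact: (@pfst_total _ _ _ P _ I). Qed.
Lemma psnd_dom (A B : gmanifold R) (P : gproduct A B) z : oset (gdom (psnd P)) z.
Proof. exact: (@psnd_total _ _ _ P _ I). Qed.

Lemma line_agree k (v : cvar (line_dim k)) (dv : cdeg v = - k) (y : gline R k) :
  agree (X := gdomain R (line_dim k)) y (line_coord R k) (scast dv (xc (opensT _) v)).
Proof.
have [u [uP du eu _]] := line_var R k.
apply: (@ev_agree R (line_dim k) _ (opensT _)) => // x _.
by rewrite (scast_nat (fun W m f => ev x f)) ev_xc // eu (uP v).
Qed.

Lemma pscale_other (e : gdim) (v w : cvar e) u (p : gdomain R e) : v != w -> cval (pscale v u p) w = cval p w.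
Proof.
case: v w => [i|i] [j|j] //= ij; rewrite !mxE.
have -> : (j == i) = false by apply/negbTE; apply: contraNneq ij => ->.
by rewrite andbF mulr0 addr0.
Qed.

Variable prd : forall A B : gmanifold R, gproduct A B.

Lemma prodmap_meq (A A' B B' : gmanifold R) (f : smap A A') (g : smap B B') w :
  oset (gdom f) (pfst (prd A B) w) -> oset (gdom g) (psnd (prd A B) w) ->
  [/\ oset (gdom (prodmap prd f g)) w,
    meq w (gcomp (pfst (prd A' B')) (prodmap prd f g)) (gcomp f (pfst (prd A B)))
  & meq w (gcomp (psnd (prd A' B')) (prodmap prd f g)) (gcomp g (psnd (prd A B)))].
Proof.
by move=> df dg; apply: ppair_meq; split=> //; [exact: pfst_dom|exact: psnd_dom].
Qed.

Lemma prodmap_domP (A A' B B' : gmanifold R) (f : smap A A') (g : smap B B') w :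
  oset (gdom (prodmap prd f g)) w -> oset (gdom f) (pfst (prd A B) w).
Proof.
have E := ppair_dom (prd A' B') (scomp f (pfst (prd A B))) (scomp g (psnd (prd A B))).
move=> dw; have : (gdom (prodmap prd f g) : set _) w by [].
by rewrite [X in X w]E => -[[]].
Qed.

Lemma pflip_meq (A B C : gmanifold R) z (pAC := prd A C) :
  [/\ oset (gdom (pflip prd A B C)) z,
     meq z (gcomp (psnd (prd pAC B)) (pflip prd A B C)) (gcomp (psnd (prd A B)) (pfst (prd (prd A B) C))),
     meq z (gcomp (pfst pAC) (gcomp (pfst (prd pAC B)) (pflip prd A B C)))
           (gcomp (pfst (prd A B)) (pfst (prd (prd A B) C)))
   & meq z (gcomp (psnd pAC) (gcomp (pfst (prd pAC B)) (pflip prd A B C))) (psnd (prd (prd A B) C))].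
Proof.
set p := pfst (prd (prd A B) C).
have d1 : oset (gdom (scomp (pfst (prd A B)) p)) z by split; exact: pfst_dom.
have d2 : oset (gdom (scomp (psnd (prd A B)) p)) z by split; [exact: pfst_dom|exact: psnd_dom].
have [e1 e2 e3] := ppair_meq pAC d1 (psnd_dom (P := prd (prd A B) C) z).
have [f1 f2 f3] := ppair_meq (prd pAC B) e1 d2; split=> //.
  by apply: meq_trans (meq_compl f2 _) e2; exact: pfst_dom.
by apply: meq_trans (meq_compl f2 _) e3; exact: psnd_dom.
Qed.
End ProductMaps.

Lemma gh_body_any (R : realType) (d : gdim) (q : nat) (deg : 'I_q -> int) (x : gdomain R d)
  (A : forall (W : opens (gdomain R d)) m, @sec R (gdomain R d) W m -> gser R deg) (W : opens (gdomain R d)) m (f : @sec R (gdomain R d) W m) :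
  @germ_hom R q deg (gdomain R d) x A -> oset W x -> gbody (A W m f) = gbody (ev x f).
Proof.
move=> hA Wx; have [m0|m0] := eqVneq m 0.
  by case: _ / (esym m0) f => f; exact: gh_body_eq.
by rewrite (gsh_body (gh_gsh hA f Wx) m0) (gsh_body (@ev_gsh _ _ _ _ _ _) m0).
Qed.

(** * The commutation statement in iterated product charts *)

Section Concrete.
Variables (R : realType) (prd : forall A B : gmanifold R, gproduct A B) (M : gmanifold R) (k l : int).
Local Notation PX := (prd M (gline R k)).
Local Notation PY := (prd M (gline R l)).
Local Notation QX := (prd PX (gline R l)).
Local Notation QY := (prd PY (gline R k)).
Variables (X : gvf (opensT M) k) (Y : gvf (opensT M) l) (thX : smap PX M) (thY : smap PY M) (D : opens QX).
Local Notation flip := (pflip prd M (gline R k) (gline R l)).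
Local Notation pmX := (prodmap prd thX (sid (gline R l))).
Local Notation pmY := (prodmap prd thY (sid (gline R k))).
Local Notation Fz := (scomp thY pmX).
Local Notation Gz := (scomp (scomp thX pmY) flip).
Hypotheses (genX : forall w, oset (gdom thX) w -> gen_at X thX w) (genY : forall w, oset (gdom thY) w -> gen_at Y thY w)
  (staX : forall w, start_at thX w) (staY : forall w, start_at thY w).
Hypotheses (HF : D `<=` gdom Fz) (HG : D `<=` gdom Gz).

Section Chart.
Variable c : chart M.
Local Notation db := (chart_dim c).
Local Notation S1 := (gsumd db (line_dim k)).
Local Notation S2 := (gsumd S1 (line_dim l)).
Local Notation C2 := (gdomain R S2).
Local Notation g1 := (gfst R db (line_dim k)).
Local Notation g2 := (gfst R S1 (line_dim l)).
Local Notation h1 := (gsnd R db (line_dim k)).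
Local Notation h2 := (gsnd R S1 (line_dim l)).
Local Notation vk := (sval (cid (line_var R k))).
Local Notation vl := (sval (cid (line_var R l))).

(** [J2] supplies the coordinates [(m, s, t)] on the iterated product, and [ma], [mb], [mA], [mB]
    are the maps [a], [b], [A], [B] of the square in them. *)
Definition J1 : gmap (gdomain R S1) PX := pchart_inv PX (chart_inv c).
Definition J2 : gmap C2 QX := pchart_inv QX J1.
Definition gg : gmap C2 (gdomain R db) := gcomp g1 g2.
Definition vs : cvar S2 := cinl (line_dim l) (cinr db vk).
Definition vt : cvar S2 := cinr S1 vl.
Definition ma : gmap C2 PX := gcomp (pfst QX) J2.
Definition mf : gmap C2 QY := gcomp flip J2.
Definition mb : gmap C2 PY := gcomp (pfst QY) mf.
Definition mA : gmap C2 PY := gcomp pmX J2.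
Definition mB : gmap C2 PX := gcomp pmY mf.
Definition O2 : opens C2 := gpre J2 D.

Lemma vk_deg : cdeg vk = - k. Proof. by have [] := svalP (cid (line_var R k)). Qed.
Lemma vl_deg : cdeg vl = - l. Proof. by have [] := svalP (cid (line_var R l)). Qed.
Lemma vs_deg : cdeg vs = - k. Proof. by rewrite /vs cdeg_cinl cdeg_cinr vk_deg. Qed.
Lemma vt_deg : cdeg vt = - l. Proof. by rewrite /vt cdeg_cinr vl_deg. Qed.
Lemma vst : vs != vt. Proof. exact: cinlr. Qed.

Lemma J2_dom p : oset (gdom J2) p <-> oset (gdom (chart_inv c)) (gg p).
Proof. by rewrite (pchart_dom QX J1 p) (pchart_dom PX (chart_inv c) (g2 p)). Qed.

Lemma J2_meq p : oset (gdom J2) p ->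
  [/\ meq p (gcomp (pfst PX) ma) (gcomp (chart_inv c) gg), meq p (gcomp (psnd PX) ma) (gcomp h1 g2)
    & meq p (gcomp (psnd QX) J2) h2].
Proof.
move=> dp; have d0 : oset (gdom (chart_inv c)) (gg p) by apply/J2_dom.
have d1 : oset (gdom J1) (g2 p) by apply/(pchart_dom PX).
have m1 := pchart_fst QX d1; have m2 := pchart_snd QX d1.
have n1 := pchart_fst PX d0; have n2 := pchart_snd PX d0.
have dg2 : oset (gdom g2) p by [].
have dg1 : oset (gdom g1) (g2 p) by [].
split=> //.
- apply: meq_trans (meq_compl m1 (pfst_dom _)) _.
  apply: meq_trans (meq_sym (meq_assoc dg2 d1 (pfst_dom _))) _.
  apply: meq_trans (meq_compr dg2 n1) _.
  exact: (meq_assoc dg2 dg1 d0).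
- apply: meq_trans (meq_compl m1 (psnd_dom _)) _.
  apply: meq_trans (meq_sym (meq_assoc dg2 d1 (psnd_dom _))) _.
  exact: (meq_compr dg2 n2).
Qed.

Lemma mb_meq p : oset (gdom J2) p ->
  [/\ oset (gdom mb) p, meq p (gcomp (pfst PX) ma) (gcomp (pfst PY) mb), meq p (gcomp (psnd PY) mb) h2
    & meq p (gcomp (psnd QY) mf) (gcomp (psnd PX) ma)].
Proof.
move=> dp; have [f1 f2 f3 f4] := pflip_meq (prd := prd) (J2 p).
have [_ _ m3] := J2_meq dp.
have dmf : oset (gdom mf) p by split.
have db_ : oset (gdom mb) p by split=> //; exact: pfst_dom.
split=> //.
- apply: meq_sym.
  apply: meq_trans (meq_compl (meq_sym (meq_assoc dp f1 (pfst_dom _))) _) _; first exact: pfst_dom.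
  apply: meq_trans (meq_sym (meq_assoc (psi := gcomp (pfst QY) flip) dp _ (pfst_dom _))) _; first by split=> //; exact: pfst_dom.
  apply: meq_trans (meq_compr dp f3) _.
  exact: (meq_assoc dp (pfst_dom _) (pfst_dom _)).
- apply: meq_trans (meq_compl (meq_sym (meq_assoc dp f1 (pfst_dom _))) _) _; first exact: psnd_dom.
  apply: meq_trans (meq_sym (meq_assoc (psi := gcomp (pfst QY) flip) dp _ (psnd_dom _))) _; first by split=> //; exact: pfst_dom.
  by apply: meq_trans (meq_compr dp f4) _.
- apply: meq_trans (meq_sym (meq_assoc dp f1 (psnd_dom _))) _.
  apply: meq_trans (meq_compr dp f2) _.
  exact: (meq_assoc dp (pfst_dom _) (psnd_dom _)).
Qed.

Lemma mA_meq p : oset (gdom J2) p -> oset (gdom thX) (ma p) ->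
  [/\ oset (gdom mA) p, meq p (gcomp (pfst PY) mA) (gcomp thX ma) & meq p (gcomp (psnd PY) mA) h2].
Proof.
move=> dp dth; have [_ _ m3] := J2_meq dp.
have [e1 e2 e3] := prodmap_meq (prd := prd) (g := sid (gline R l)) (w := J2 p) dth I.
split; first by split.
- apply: meq_trans (meq_sym (meq_assoc dp e1 (pfst_dom _))) _.
  apply: meq_trans (meq_compr dp e2) _.
  exact: (meq_assoc dp (pfst_dom _) dth).
- apply: meq_trans (meq_sym (meq_assoc dp e1 (psnd_dom _))) _.
  apply: meq_trans (meq_compr dp e3) _.
  apply: meq_trans (meq_compr dp (meq_idl (psnd_dom _))) _.
  exact: m3.
Qed.

Lemma mB_meq p : oset (gdom J2) p -> oset (gdom thY) (mb p) ->
  [/\ oset (gdom mB) p, meq p (gcomp (pfst PX) mB) (gcomp thY mb) & meq p (gcomp (psnd PX) mB) (gcomp (psnd PX) ma)].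
Proof.
move=> dp dth; have [db_ m1 m2 m3] := mb_meq dp; have [dmf _] := db_.
have [e1 e2 e3] := prodmap_meq (prd := prd) (g := sid (gline R k)) (w := mf p) dth I.
split; first by split.
- apply: meq_trans (meq_sym (meq_assoc dmf e1 (pfst_dom _))) _.
  apply: meq_trans (meq_compr dmf e2) _.
  exact: (meq_assoc dmf (pfst_dom _) dth).
- apply: meq_trans (meq_sym (meq_assoc dmf e1 (psnd_dom _))) _.
  apply: meq_trans (meq_compr dmf e3) _.
  apply: meq_trans (meq_compr dmf (meq_idl (psnd_dom _))) _.
  exact: m3.
Qed.

Lemma O2_dom p : oset O2 p -> [/\ oset (gdom J2) p, oset (gdom thX) (ma p), oset (gdom thY) (mb p),
  oset (gdom (gcomp thY mA)) p & oset (gdom (gcomp thX mB)) p].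
Proof.
move=> [dp Dp]; have [FA FB] := HF Dp; have [GA [GB GC]] := HG Dp.
by split=> //; [exact: prodmap_domP FA|exact: prodmap_domP GB].
Qed.

Lemma ggS v : cdeg (cinl (line_dim l) (cinl (line_dim k) v)) = cdeg (v : cvar db).
Proof. by rewrite !cdeg_cinl. Qed.

Lemma gg_agree v (W : opens (gdomain R db)) p : oset W (gg p) ->
  agree p (gpull gg (xc W v)) (scast (ggS v) (xc (opensT C2) (cinl (line_dim l) (cinl (line_dim k) v)))).
Proof.
move=> Wp; apply: (@ev_agree _ _ p (gpre gg W)) => //.
move=> y Wy; rewrite (scast_nat (fun W m f => ev y f)) ev_xc // (agree_ev (agree_comp _ Wy)).
have [_ Wgy] := Wy; have Wy' : oset (gpre g1 W) (g2 y) := conj I Wgy.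
rewrite (agree_ev (agree_pull (I : oset (gdom g2) y) (agree_gfst v Wy'))).
by rewrite (scast_nat (fun W m f => ev y (gpull g2 f))) ev_gfst.
Qed.

Lemma gg_pder u p (W : opens (gdomain R db)) j (f : @sec R (gdomain R db) W j) : oset W (gg p) ->
  (forall v, u != cinl (line_dim l) (cinl (line_dim k) v)) -> pder_fam u (gpull gg f) p = 0.
Proof.
move=> Wp hu; have dg : oset (gdom gg) p by split.
apply: (germ_der_uniq (gmap_germ dg) (pder_germ_der u dg)) Wp => W' v W'p.
rewrite (agree_pder u (gg_agree v W'p)) (scast_nat (fun W m f => pder_fam u f p)) -ev_pder // pder_xc //.
by rewrite (negbTE (hu v)) mulr0n scale0r.
Qed.

Lemma ma_pder u p (W : opens M) j (f : sec W j) : oset O2 p -> oset W (pfst PX (ma p)) ->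
  (forall v, u != cinl (line_dim l) (cinl (line_dim k) v)) -> pder_fam u (gpull ma (gpull (pfst PX) f)) p = 0.
Proof.
move=> [dp _] Wp hu; have [m1 _ _] := J2_meq dp.
rewrite (agree_pder u (meq_pull2 f m1 Wp)); apply: gg_pder => //.
have [d1 d2] := meq_domr m1; split=> //.
by have E : pfst PX (ma p) = chart_inv c (gg p) := meq_pt m1; move: Wp; rewrite E.
Qed.

Lemma vs_other v : vs != cinl (line_dim l) (cinl (line_dim k) v).
Proof. by rewrite (inj_eq (@cinl_inj _ _)) eq_sym cinlr. Qed.
Lemma vt_other v : vt != cinl (line_dim l) (cinl (line_dim k) v).
Proof. by rewrite eq_sym cinlr. Qed.

Lemma cs2 p : oset (gdom J2) p -> agree p (gpull ma (gpull (psnd PX) (line_coord R k))) (scast vs_deg (xc (opensT C2) vs)).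
Proof.
move=> dp; have [_ m2 _] := J2_meq dp.
apply: agree_trans (meq_pull2 (line_coord R k) m2 I) _.
apply: (@ev_agree _ _ p (opensT _)) => // y _.
rewrite (scast_nat (fun W m f => ev y f)) ev_xc //.
have ag := agree_pull (I : oset (gdom h1) (g2 y)) (line_agree vk_deg (h1 (g2 y))).
rewrite (agree_ev (agree_pull (I : oset (gdom g2) y) ag)).
rewrite (scast_nat (fun W m f => ev y (gpull g2 (gpull h1 f)))).
have Wy : oset (gpre h1 (opensT _)) (g2 y) by [].
rewrite (agree_ev (agree_pull (I : oset (gdom g2) y) (agree_gsnd vk Wy))).
by rewrite (scast_nat (fun W m f => ev y (gpull g2 f))) ev_gfst.
Qed.

Lemma ct2 p : oset (gdom J2) p -> agree p (gpull mb (gpull (psnd PY) (line_coord R l))) (scast vt_deg (xc (opensT C2) vt)).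
Proof.
move=> dp; have [db_ _ m2 _] := mb_meq dp.
have Wp : oset (gpre (gcomp (psnd PY) mb) (opensT _)) p by split=> //; split=> //; exact: psnd_dom.
apply: agree_trans (agree_sym (agree_comp (line_coord R l) Wp)) _.
apply: agree_trans (meq_pull (line_coord R l) m2 I) _.
apply: (@ev_agree _ _ p (opensT _)) => // y _.
rewrite (scast_nat (fun W m f => ev y f)) ev_xc //.
rewrite (agree_ev (agree_pull (I : oset (gdom h2) y) (line_agree vl_deg (h2 y)))).
by rewrite (scast_nat (fun W m f => ev y (gpull h2 f))) ev_gsnd.
Qed.

Lemma J2_point p : oset (gdom J2) p ->
  [/\ pfst PX (pfst QX (J2 p)) = chart_inv c (gg p), line_val (psnd PX (pfst QX (J2 p))) = cval p vs
    & line_val (psnd QX (J2 p)) = cval p vt].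
Proof.
move=> dp; have [m1 _ m3] := J2_meq dp; split; first exact: (meq_pt m1).
- have hA := germ_hom_pull (psnd_dom (P := PX) (ma p)) (gmap_germ (meq_doml m1).1).
  rewrite -(line_val_germ hA) (agree_ev (cs2 dp)) (scast_nat (fun W m f => ev p f)) ev_xc //.
  by rewrite gbody_cgen.
- have hA := germ_hom_pull (psnd_dom (P := QX) (J2 p)) (gmap_germ dp).
  rewrite -(line_val_germ hA).
  have Wp : oset (gpre (gcomp (psnd QX) J2) (opensT _)) p by split=> //; split=> //; exact: psnd_dom.
  rewrite -(agree_ev (agree_comp (line_coord R l) Wp)) (agree_ev (meq_pull (line_coord R l) m3 I)).
  rewrite (agree_ev (agree_pull (I : oset (gdom h2) p) (line_agree vl_deg (h2 p)))).
  by rewrite (scast_nat (fun W m f => ev p (gpull h2 f))) ev_gsnd // gbody_cgen.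
Qed.
Let F2 := gcomp thY mA.
Let G2 := gcomp thX mB.
Let inF2 : O2 `<=` gdom F2. Proof. by move=> p /O2_dom[]. Qed.
Let inG2 : O2 `<=` gdom G2. Proof. by move=> p /O2_dom[]. Qed.
Let mab2 p : oset O2 p -> meq p (gcomp (pfst PX) ma) (gcomp (pfst PY) mb).
Proof. by move=> /O2_dom[/mb_meq[]]. Qed.
Let mA12 p : oset O2 p -> meq p (gcomp (pfst PY) mA) (gcomp thX ma).
Proof. by move=> /O2_dom[dp dth _ _ _]; have [] := mA_meq dp dth. Qed.
Let mA22 p : oset O2 p -> meq p (gcomp (psnd PY) mA) (gcomp (psnd PY) mb).
Proof.
move=> /O2_dom[dp dth _ _ _]; have [_ _ m] := mA_meq dp dth; have [_ _ m' _] := mb_meq dp.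
exact: meq_trans m (meq_sym m').
Qed.
Let mB12 p : oset O2 p -> meq p (gcomp (pfst PX) mB) (gcomp thY mb).
Proof. by move=> /O2_dom[dp _ dth _ _]; have [] := mB_meq dp dth. Qed.
Let mB22 p : oset O2 p -> meq p (gcomp (psnd PX) mB) (gcomp (psnd PX) ma).
Proof. by move=> /O2_dom[dp _ dth _ _]; have [] := mB_meq dp dth. Qed.
Let mus2 p (W : opens M) j (f : sec W j) : oset O2 p -> oset W (pfst PX (ma p)) ->
  pder_fam vs (gpull ma (gpull (pfst PX) f)) p = 0.
Proof. by move=> Op Wp; apply: ma_pder => //; exact: vs_other. Qed.
Let mut2 p (W : opens M) j (f : sec W j) : oset O2 p -> oset W (pfst PX (ma p)) ->
  pder_fam vt (gpull ma (gpull (pfst PX) f)) p = 0.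
Proof. by move=> Op Wp; apply: ma_pder => //; exact: vt_other. Qed.
Let cs2' p : oset O2 p -> ev p (gpull ma (gpull (psnd PX) (line_coord R k))) = cgen p vs.
Proof. by move=> [dp _]; rewrite (agree_ev (cs2 dp)) (scast_nat (fun W m f => ev p f)) ev_xc. Qed.
Let ct2' p : oset O2 p -> ev p (gpull mb (gpull (psnd PY) (line_coord R l))) = cgen p vt.
Proof. by move=> [dp _]; rewrite (agree_ev (ct2 dp)) (scast_nat (fun W m f => ev p f)) ev_xc. Qed.

Lemma FG2_meq p : oset O2 p -> meq p (gcomp Fz J2) F2 /\ meq p (gcomp Gz J2) G2.
Proof.
move=> [dp Dp]; have [FA FB] := HF Dp; have [GA [GB GC]] := HG Dp.
split; first exact: (meq_assoc (psi := pmX) dp FA FB).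
apply: meq_trans (meq_compr dp (meq_assoc (chi := thX) GA GB GC)) _.
apply: meq_trans (meq_assoc (psi := gcomp pmY flip) dp (conj GA GB) GC) _.
by apply: meq_compl (meq_assoc (psi := flip) dp GA GB) _.
Qed.

(** Stability under shrinking both times towards 0: the uniqueness argument runs along [t] and, for
    each [t], along [s]. *)
Definition star_shaped := forall (z z' : QX), oset D z ->
  pfst PX (pfst QX z') = pfst PX (pfst QX z) ->
  between0 (line_val (psnd PX (pfst QX z))) (line_val (psnd PX (pfst QX z'))) ->
  between0 (line_val (psnd QX z)) (line_val (psnd QX z')) -> oset D z'.

Lemma between0_scale (x u : R) : 0 <= u <= 1 -> between0 x (u * x).
Proof.
move=> /andP[u0 u1]; rewrite /between0 ge_min le_max.
have [x0|x0] := leP 0 x.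
  by rewrite mulr_ge0 //= ler_piMl // orbT.
by rewrite mulr_ge0_le0 ?(ltW x0) //= andbT ler_niMl ?orbT // ltW.
Qed.

Lemma gg_scale v u p : (forall w, v != cinl (line_dim l) (cinl (line_dim k) w)) -> gg (pscale v u p) = gg p.
Proof.
move=> hv; apply/rowP => i.
have E q : (gg q : 'rV[R]_(gdim0 db)) 0 i = cval q (cinl (line_dim l) (cinl (line_dim k) (inl i : cvar db))).
  have -> : gg q = g1 (g2 q) by [].
  by rewrite (gfst_pt (g2 q) i) (gfst_pt q (lshift _ i)).
exact: etrans (E (pscale v u p)) (etrans (pscale_other u p (hv (inl i))) (esym (E p))).
Qed.

Lemma O2_scale p u v : star_shaped -> oset O2 p -> 0 <= u <= 1 -> 0 <= v <= 1 ->
  oset O2 (pscale vs u (pscale vt v p)).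
Proof.
move=> st [dp Dp] u01 v01.
have gE : gg (pscale vs u (pscale vt v p)) = gg p.
  have E1 := gg_scale u (pscale vt v p) vs_other.
  have E2 := gg_scale v p vt_other.
  exact (eq_trans E1 E2).
have vts : vt != vs by rewrite eq_sym vst.
have e1 : cval (pscale vs u (pscale vt v p)) vs = u * cval p vs.
  exact: etrans (pscale_val vs u (pscale vt v p)) (congr1 ( *%R u) (pscale_other v p vts)).
have e2 : cval (pscale vs u (pscale vt v p)) vt = v * cval p vt.
  exact: etrans (pscale_other u (pscale vt v p) vst) (pscale_val vt v p).
move: gE e1 e2; move: (pscale vs u (pscale vt v p)) => p' gE e1 e2.
have dp' : oset (gdom J2) p' by apply/J2_dom; rewrite gE; apply/J2_dom.
have [a1 a2 a3] := J2_point dp; have [b1 b2 b3] := J2_point dp'.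
have tr (x y x' y' : R) : x = x' -> y = y' -> between0 x' y' -> between0 x y by move=> -> ->.
suff Dp' : oset D (J2 p') by exact: (conj dp' Dp').
apply: (st (J2 p) (J2 p') Dp).
- exact (eq_trans b1 (eq_trans (congr1 (chart_inv c) gE) (esym a1))).
- exact (tr _ _ _ _ a2 (eq_trans b2 e1) (between0_scale _ u01)).
- exact (tr _ _ _ _ a3 (eq_trans b3 e2) (between0_scale _ v01)).
Qed.

Lemma FG2_unique p : star_shaped -> gbracket_eq0 X Y -> oset O2 p ->
  F2 p = G2 p /\ forall j (f : sec (opensT M) j), ev p (gpull F2 f) = ev p (gpull G2 f).
Proof.
move=> st XY Op.
have Ov (v : R) : 0 <= v <= 1 -> oset O2 (pscale vt v p).
  move=> v01; rewrite -(pscale1 vs (pscale vt v p)); apply: O2_scale => //.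
  by rewrite ler01 lexx.
have i0 : 0 <= (0 : R) <= 1 by rewrite lexx ler01.
apply: (@flow_unique R S2 M l Y F2 G2 vt p).
- by move=> v /Ov/inF2.
- by move=> v /Ov/inG2.
- move=> v j f /Ov Oy.
  exact: (sq_dFt genY vst vs_deg vt_deg inF2 inG2 mab2 mA12 mA22 mut2 cs2' ct2' f Oy).
- move=> v j f v01; have Oy := Ov v v01.
  apply: (sq_dGt genX genY staX vst vs_deg vt_deg inF2 inG2 mab2 mB12 mB22 mus2 mut2 cs2' ct2' f XY).
  by move=> u u01; exact: O2_scale.
- move=> j f; apply: (sq_FG0 staY inF2 inG2 mab2 mA12 mA22 mB12 mB22 ct2' f (Ov 0 i0)).
  by rewrite pscale_val mul0r.
Qed.

(** The zero section [i] of the chart is the pairing of the identity with coordinates equal to 0, so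
    both times pull back to 0 along it and [sq_zero] applies to the bracket. *)
Lemma bracket_chart y : geq_on D Fz Gz ->
  (forall z : QX, line_val (psnd PX (pfst QX z)) = 0 -> line_val (psnd QX z) = 0 -> oset D z) ->
  oset (gdom (chart_inv c)) y -> forall j (f : sec (opensT M) j) m (em : k + l + j = m),
  ev y (gpull (chart_inv c) (gbracket X Y em f)) = 0.
Proof.
move=> com zer dy j f m em.
pose z1 : gmap (gdomain R db) (gdomain R (line_dim k)) := gt_map (U := opensT _) (fun v => 0).
pose z2 : gmap (gdomain R db) (gdomain R (line_dim l)) := gt_map (U := opensT _) (fun v => 0).
pose i1 := gpair (gid (gdomain R db)) z1; pose i := gpair i1 z2.
have di1 : oset (gdom i1) y by [].
have di : oset (gdom i) y by [].
have q1 : meq y (gcomp g2 i) i1 := gfst_gpair (phi1 := i1) (phi2 := z2) (conj di1 I).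
have q2 : meq y (gcomp h2 i) z2 := gsnd_gpair (phi1 := i1) (phi2 := z2) (conj di1 I).
have q3 : meq y (gcomp g1 i1) (gid _) := gfst_gpair (phi1 := gid _) (phi2 := z1) (conj I I).
have q4 : meq y (gcomp h1 i1) z1 := gsnd_gpair (phi1 := gid _) (phi2 := z1) (conj I I).
have gi : meq y (gcomp gg i) (gid _).
  have dg2 : oset (gdom g2) (i y) by [].
  have dg1 : oset (gdom g1) (g2 (i y)) by [].
  have dg1' : oset (gdom g1) (gcomp g2 i y) by [].
  apply: meq_trans (meq_assoc di dg2 dg1) _; exact: meq_trans (meq_compl q1 dg1') q3.
have giE : gg (i y) = y := meq_pt gi.
have dJ : oset (gdom J2) (i y) by apply/J2_dom; rewrite giE.
have i_s : ev y (gpull i (xc (opensT C2) vs)) = 0.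
  have ag := agree_gfst (cinr db vk) (conj I I : oset (gpre g2 (opensT _)) (i y)).
  rewrite -(scast_nat (fun W m f => ev y (gpull i f)) (cdeg_cinl (line_dim l) (cinr db vk))).
  rewrite -(agree_ev (agree_pull di ag)).
  have cW : oset (gpre (gcomp g2 i) (opensT _)) y by [].
  rewrite -(agree_ev (agree_comp (xc (opensT _) (cinr db vk)) cW)) (agree_ev (meq_pull (xc (opensT _) (cinr db vk)) q1 I)).
  rewrite -(scast_nat (fun W m f => ev y (gpull i1 f)) (cdeg_cinr db vk)).
  have ag' := agree_gsnd vk (conj I I : oset (gpre h1 (opensT _)) (i1 y)).
  rewrite -(agree_ev (agree_pull di1 ag')).
  have cW' : oset (gpre (gcomp h1 i1) (opensT _)) y by [].
  rewrite -(agree_ev (agree_comp (xc (opensT _) vk) cW')) (agree_ev (meq_pull (xc (opensT _) vk) q4 I)).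
  by rewrite gt_map_xc // ev0.
have i_t : ev y (gpull i (xc (opensT C2) vt)) = 0.
  have ag := agree_gsnd vl (conj I I : oset (gpre h2 (opensT _)) (i y)).
  rewrite -(scast_nat (fun W m f => ev y (gpull i f)) (cdeg_cinr S1 vl)).
  rewrite -(agree_ev (agree_pull di ag)).
  have cW : oset (gpre (gcomp h2 i) (opensT _)) y by [].
  rewrite -(agree_ev (agree_comp (xc (opensT _) vl) cW)) (agree_ev (meq_pull (xc (opensT _) vl) q2 I)).
  by rewrite gt_map_xc // ev0.
have gi0 v : ev y (gpull i (xc (opensT C2) v)) = 0 -> cval (i y) v = 0.
  by move=> E; rewrite -(gbody_cgen (i y) v) -(ev_xc (W := opensT _)) // -(gh_body_any (xc (opensT C2) v) (gmap_germ di) I) E.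
have [p1 p2 p3] := J2_point dJ.
have Oy : oset O2 (i y) by split=> //; apply: zer; [rewrite p2|rewrite p3]; exact: gi0.
have FG p : oset O2 p -> meq p F2 G2.
  move=> Op; have [m1 m2] := FG2_meq Op; have [dp Dp] := Op.
  exact: meq_trans (meq_sym m1) (meq_trans (meq_compr dp (geq_meq Dp com)) m2).
have br p : oset O2 p -> ev p (gpull G2 (gbracket X Y em f)) = 0.
  move=> Op; exact: (sq_bracket0 genX genY vst vs_deg vt_deg inF2 inG2 mab2 mA12 mA22 mB12 mB22 mus2 mut2 cs2' ct2' FG f em Op).
have := sq_zero staX staY inF2 inG2 mab2 mB12 mB22 (h := gbracket X Y em f) di Oy.
rewrite (agree_ev (agree_pull di (cs2 dJ))) (scast_nat (fun W m f => ev y (gpull i f))) i_s.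
rewrite (agree_ev (agree_pull di (ct2 dJ))) (scast_nat (fun W m f => ev y (gpull i f))) i_t.
move=> /(_ erefl erefl br).
have [m1 _ _] := J2_meq dJ.
rewrite (agree_ev (agree_pull di (meq_pull2 (gbracket X Y em f) m1 I))).
have Wy : oset (gpre (gcomp gg i) (gpre (chart_inv c) (opensT M))) y.
  have Wy : oset (gpre (chart_inv c) (opensT M)) (gg (i y)) by rewrite giE; split.
  exact: (conj (conj di (conj I I : oset (gdom gg) (i y))) Wy).
rewrite -(agree_ev (agree_comp (gpull (chart_inv c) (gbracket X Y em f)) Wy)).
rewrite (agree_ev (meq_pull (gpull (chart_inv c) (gbracket X Y em f)) gi (proj2 Wy))).
by rewrite (agree_ev (agree_id _ _)) //; split.
Qed.
End Chart.

(** Near each point of [D] the iterated product chart has a one-sided inverse, through which the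
    equality of germs in coordinates descends to the product. *)
Lemma commute_of_bracket : star_shaped -> gbracket_eq0 X Y -> geq_on D Fz Gz.
Proof.
move=> st XY; apply: geq_of_meq => z Dz.
have [c cz] := gman_charts (pfst PX (pfst QX z)).
have [Phi1 [r1 _ _]] := product_retract (chart_retract cz).
have [Phi2 [r2 _ _]] := product_retract (P := QX) r1.
have [dPhi dJ] := meq_doml r2; have zE : J2 c (Phi2 z) = z := meq_pt r2.
have Op : oset (O2 c) (Phi2 z) by split=> //=; rewrite zE.
have H : meq (Phi2 z) (gcomp Fz (J2 c)) (gcomp Gz (J2 c)).
  have [m1 m2] := FG2_meq Op; apply: meq_trans m1 (meq_trans _ (meq_sym m2)).
  apply: (meq_of_ev Op); [by move=> p /O2_dom[]|by move=> p /O2_dom[]|].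
  by move=> p Op'; exact: FG2_unique.
have go (H' : smap QX M) : oset (gdom H') z -> meq z (gcomp (gcomp H' (J2 c)) Phi2) H'.
  move=> dz; apply: meq_trans (meq_assoc dPhi dJ _) _; first by rewrite zE.
  by apply: meq_trans (meq_compl r2 _) (meq_idr dz) => /=; rewrite zE.
apply: meq_trans (meq_sym (go Fz (HF Dz))) (meq_trans (meq_compr dPhi H) (go Gz (HG Dz))).
Qed.

Lemma bracket_of_commute : geq_on D Fz Gz ->
  (forall z : QX, line_val (psnd PX (pfst QX z)) = 0 -> line_val (psnd QX z) = 0 -> oset D z) ->
  gbracket_eq0 X Y.
Proof.
move=> com zer j m em f; apply: agree0_all => x; have [c cx] := gman_charts x.
apply: agree_trans (agree_sym (retract_agree (gbracket X Y em f) (chart_retract cx) (I : oset (opensT M) x))) _.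
have [dy yE] := chart_pt cx.
have ag : agree (chart_map c x) (gpull (chart_inv c) (gbracket X Y em f)) (0 : @sec R (gdomain R (chart_dim c)) (gdom (chart_inv c)) m).
  apply: (@ev_agree _ _ _ (gdom (chart_inv c))) => // y dy'.
  by rewrite ev0; exact: bracket_chart.
apply: agree_trans (agree_pull cx ag) _; rewrite gpull0.
exists (gpre (chart_map c) (gdom (chart_inv c))), (fun _ H => H), (fun _ _ => I).
by rewrite !res0.
Qed.
End Concrete.

(** * Uniqueness of integral maps on products with a line *)

Section IntegralMaps.
Variables (R : realType) (M : gmanifold R) (k : int) (X : gvf (opensT M) k).

Lemma gen_meq (N : gmanifold R) (P : gproduct N (gline R k)) (th th' : gmap P M) w :
  meq w th th' -> gen_at X th w -> gen_at X th' w.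
Proof.
move=> m H e Phi v p al i j ee f; have [dp Ew _ _ _] := al.
have m' : meq (Phi p) th' th by rewrite Ew; exact: meq_sym.
have ag i' (g : sec (opensT M) i') := agree_pull dp (meq_pull g m' I).
rewrite (agree_pder v (ag _ f)) (agree_ev (ag _ (vapp X ee f))); exact: (H _ _ _ _ al).
Qed.

Lemma gen_comp (N N' : gmanifold R) (P : gproduct N (gline R k)) (P' : gproduct N' (gline R k))
  (A : gmap P P') (th : gmap P' M) w : oset (gdom A) w -> oset (gdom th) (A w) ->
  (forall e (Phi : gmap (gdomain R e) P) v p, along w Phi v p -> along (A w) (gcomp A Phi) v p) ->
  gen_at X th (A w) -> gen_at X (gcomp th A) w.
Proof.
move=> dA dth H G e Phi v p al i j ee f; have [dp Ew _ _ _] := al.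
have ag i' (g : sec (opensT M) i') : agree p (gpull Phi (gpull (gcomp th A) g)) (gpull (gcomp A Phi) (gpull th g)).
  have W1 : oset (gpre (gcomp th A) (opensT M)) (Phi p) by rewrite Ew; split=> //; split.
  have W2 : oset (gpre (gcomp A Phi) (gpre th (opensT M))) p.
    by split; [split=> //; rewrite /preimage /= Ew|rewrite /preimage /= Ew; split].
  apply: agree_trans (agree_pull dp (agree_comp g W1)) _.
  exact: agree_sym (agree_comp (gpull th g) W2).
rewrite (agree_pder v (ag _ f)) (agree_ev (ag _ (vapp X ee f))); exact: (G _ _ _ _ (H _ _ _ _ al)).
Qed.

(* Coordinates near [w0] in which the line coordinate is [v], the line through
   each point being an orbit of the homotheties in [v]. *)
Lemma line_chart (N : gmanifold R) (P : gproduct N (gline R k)) (w0 : P) :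
  exists (e : gdim) (J : gmap (gdomain R e) P) (v : cvar e) (Phi : gmap P (gdomain R e)),
  [/\ local_retract Phi J w0,
      forall p, oset (gdom J) p -> along (J p) J v p,
      forall p, oset (gdom J) p -> ev p (gpull J (gpull (psnd P) (line_coord R k))) = cgen p v,
      forall p, oset (gdom J) p -> line_val (psnd P (J p)) = cval p v
    & forall u p, oset (gdom J) p -> oset (gdom J) (pscale v u p) /\ pfst P (J (pscale v u p)) = pfst P (J p)].
Proof.
have [c cz] := gman_charts (pfst P w0).
have [Phi [r2 _ _]] := product_retract (chart_retract cz).
pose J := pchart_inv P (chart_inv c).
pose vk := sval (cid (line_var R k)).
have [_ dvk ev_lc lv_] := svalP (cid (line_var R k)); rewrite -/vk in dvk ev_lc lv_.
pose v : cvar (gsumd (chart_dim c) (line_dim k)) := cinr (chart_dim c) vk.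
have dv : cdeg v = - k by rewrite /v cdeg_cinr.
pose g := gfst R (chart_dim c) (line_dim k); pose h := gsnd R (chart_dim c) (line_dim k).
have Jdom p : oset (gdom J) p <-> oset (gdom (chart_inv c)) (g p) by exact: pchart_dom.
have m1 p : oset (gdom J) p -> meq p (gcomp (pfst P) J) (gcomp (chart_inv c) g).
  by move=> /Jdom dp; exact: (pchart_fst P dp).
have m2 p : oset (gdom J) p -> meq p (gcomp (psnd P) J) h.
  by move=> /Jdom dp; exact: (pchart_snd P dp).
have lcE p : oset (gdom J) p -> agree p (gpull J (gpull (psnd P) (line_coord R k))) (scast dv (xc (opensT _) v)).
  move=> dp; have Wp : oset (gpre (gcomp (psnd P) J) (opensT _)) p.
    by split=> //; split=> //; exact: psnd_dom.
  apply: agree_trans (agree_sym (agree_comp (line_coord R k) Wp)) _.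
  apply: agree_trans (meq_pull (line_coord R k) (m2 p dp) I) _.
  apply: (@ev_agree _ _ p (opensT _)) => // y _.
  rewrite (scast_nat (fun W m f => ev y f)) ev_xc //.
  rewrite (agree_ev (agree_pull (I : oset (gdom h) y) (line_agree dvk (h y)))).
  by rewrite (scast_nat (fun W m f => ev y (gpull h f))) ev_gsnd.
have alJ p : oset (gdom J) p -> along (J p) J v p.
  move=> dp; split=> //.
    move=> W i f Wp; rewrite (agree_pder v (meq_pull2 f (m1 p dp) Wp)).
    have Wg : oset (gpre (chart_inv c) W) (g p).
      have E : pfst P (J p) = chart_inv c (g p) := meq_pt (m1 p dp).
      by split; [apply/Jdom|move: Wp; rewrite E].
    have dg : oset (gdom g) p by [].
    apply: (germ_der_uniq (gmap_germ dg) (pder_germ_der v dg)) Wg => W' u W'p.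
    have Wu : oset (gpre g W') p := conj I W'p.
    rewrite (agree_pder v (agree_gfst u Wu)) (scast_nat (fun W m f => pder_fam v f p)) -ev_pder // pder_xc //.
    by rewrite eq_sym (negbTE (cinlr _ _)) mulr0n scale0r.
  by rewrite (agree_pder v (lcE p dp)) (scast_nat (fun W m f => pder_fam v f p)) -ev_pder // pder_xc // eqxx scale1r.
have lvJ p : oset (gdom J) p -> line_val (psnd P (J p)) = cval p v.
  move=> dp; have hA := germ_hom_pull (psnd_dom (P := P) (J p)) (gmap_germ dp).
  rewrite -(line_val_germ hA) (agree_ev (lcE p dp)) (scast_nat (fun W m f => ev p f)) ev_xc //.
  by rewrite gbody_cgen.
have ptJ p : oset (gdom J) p -> pfst P (J p) = chart_inv c (g p) by move=> dp; exact: (meq_pt (m1 p dp)).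
have gsc u p : g (pscale v u p) = g p.
  apply/rowP => i; have E q : (g q : 'rV[R]__) 0 i = cval q (cinl (line_dim k) (inl i : cvar (chart_dim c))).
    exact: (gfst_pt q i).
  have vi : v != cinl (line_dim k) (inl i : cvar (chart_dim c)) by rewrite eq_sym cinlr.
  exact: (eq_trans (E (pscale v u p)) (eq_trans (pscale_other u p vi) (esym (E p)))).
exists _, J, v, Phi; split=> //.
  by move=> p dp; rewrite (agree_ev (lcE p dp)) (scast_nat (fun W m f => ev p f)) ev_xc.
move=> u p dp; have e1 := gsc u p; move: (pscale v u p) e1 => p' e1.
have dp' : oset (gdom J) p' by apply/Jdom; rewrite e1; apply/Jdom.
split=> //; exact (eq_trans (ptJ p' dp') (eq_trans (congr1 (chart_inv c) e1) (esym (ptJ p dp)))).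
Qed.

(** Integral curves with parameters: along the lines of [line_chart], [flow_unique] applies to both
    maps. The manifold [N] of initial data is general because the group law takes it to be a product
    with the line, and the extension of a flow takes it to be [M]. *)
Lemma int_unique (N : gmanifold R) (P : gproduct N (gline R k)) (H H' : gmap P M) (S : opens P) w0 :
  oset S w0 -> S `<=` gdom H -> S `<=` gdom H' ->
  (forall w, oset S w -> gen_at X H w) -> (forall w, oset S w -> gen_at X H' w) ->
  (forall w w', oset S w -> pfst P w' = pfst P w -> between0 (line_val (psnd P w)) (line_val (psnd P w')) -> oset S w') ->
  (forall w q (deg : 'I_q -> int) (A : forall (W : opens P) j, sec W j -> gser R deg), oset S w ->
     germ_hom w A -> A _ _ (gpull (psnd P) (line_coord R k)) = 0 ->
     forall j (f : sec (opensT M) j), A _ _ (gpull H f) = A _ _ (gpull H' f)) ->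
  meq w0 H H'.
Proof.
move=> S0 SH SH' gH gH' st E0.
have [e [J [v [Phi [r2 alJ lcE lvJ scJ]]]]] := line_chart w0.
have osc u p : oset (gpre J S) p -> 0 <= u <= 1 -> oset (gpre J S) (pscale v u p).
  move=> [dp Sp] u01; have [dp' e1] := scJ u p dp; have e2 := pscale_val v u p.
  move: (pscale v u p) dp' e1 e2 => p' dp' e1 e2.
  suff Sp' : oset S (J p') by exact: (conj dp' Sp').
  apply: (st (J p) (J p') Sp e1).
  have tr (x y x' y' : R) : x = x' -> y = y' -> between0 x' y' -> between0 x y by move=> -> ->.
  exact: (tr _ _ _ _ (lvJ p dp) (eq_trans (lvJ p' dp') e2) (between0_scale _ u01)).
have derH (K : gmap P M) : S `<=` gdom K -> (forall w, oset S w -> gen_at X K w) ->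
    forall p, oset (gpre J S) p -> forall j (f : sec (opensT M) j),
    pder_fam v (gpull (gcomp K J) f) p = ev p (gpull (gcomp K J) (vapp X erefl f)).
  move=> SK gK p [dp Sp] j f; have Wp : oset (gpre (gcomp K J) (opensT M)) p.
    by split=> //; split=> //; exact: SK.
  rewrite (agree_pder v (agree_comp f Wp)) (agree_ev (agree_comp (vapp X erefl f) Wp)).
  exact: (gK (J p) Sp _ _ _ _ (alJ p dp)).
have inK (K : gmap P M) : S `<=` gdom K -> gpre J S `<=` gdom (gcomp K J).
  by move=> SK p [dp Sp]; split=> //; exact: SK.
have [dPhi dJ] := meq_doml r2; have zE : J (Phi w0) = w0 := meq_pt r2.
have Op : oset (gpre J S) (Phi w0) by split=> //; rewrite /preimage /= zE.
have m : meq (Phi w0) (gcomp H J) (gcomp H' J).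
  apply: (meq_of_ev Op (inK H SH) (inK H' SH')) => p Sp.
  apply: (@flow_unique R _ M k X (gcomp H J) (gcomp H' J) v p).
  - by move=> u /(osc u p Sp)/(inK H SH).
  - by move=> u /(osc u p Sp)/(inK H' SH').
  - by move=> u j f /(osc u p Sp) Su; exact: derH.
  - by move=> u j f /(osc u p Sp) Su; exact: derH.
  move=> j f; have S1 : oset (gpre J S) (pscale v 0 p) by apply: osc => //; rewrite lexx ler01.
  have z0 : cval (pscale v 0 p) v = 0 by rewrite pscale_val mul0r.
  move: (pscale v 0 p) S1 z0 => p0 [d0 S1] z0.
  have Wp (K : gmap P M) : S `<=` gdom K -> oset (gpre (gcomp K J) (opensT M)) p0.
    by move=> SK; split=> //; split=> //; exact: SK.
  rewrite (agree_ev (agree_comp f (Wp H SH))) (agree_ev (agree_comp f (Wp H' SH'))).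
  have hA := kap_germ_hom v (gmap_germ d0); apply: (E0 (J p0) _ _ _ S1 hA).
  rewrite /= lcE //; exact (kap_cgen z0).
have go (K : gmap P M) : S `<=` gdom K -> meq w0 (gcomp (gcomp K J) Phi) K.
  move=> SK; have dK := SK w0 S0.
  apply: meq_trans (meq_assoc dPhi dJ _) _; first by rewrite zE.
  by apply: meq_trans (meq_compl r2 _) (meq_idr dK); rewrite /= zE.
exact: meq_trans (meq_sym (go H SH)) (meq_trans (meq_compr dPhi m) (go H' SH')).
Qed.
End IntegralMaps.

(** * Affine changes of the time variable *)

Section Affine.
Variables (R : realType) (N : gmanifold R) (P : gproduct N (gline R 0)).
Local Notation lc := (line_coord R 0).

Lemma point_germ (M : gmanifold R) (w : M) : exists (q : nat) (deg : 'I_q -> int)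
  (A : forall (W : opens M) j, sec W j -> gser R deg), germ_hom w A.
Proof.
have [c cw] := gman_charts w; have [dy yE] := chart_pt cw.
have := gmap_germ dy; rewrite yE => hA.
by exists (gvars (chart_dim c)), (@gdeg (chart_dim c)); eexists; exact: hA.
Qed.

Lemma gpullZ1 (X Y : gspace R) (phi : gmap X Y) (W : opens Y) b : gpull phi (b *: gone W) = b *: gone (gpre phi W).
Proof. by rewrite -[b *: _]addr0 gpullP gpull0 addr0 gpull_one. Qed.

Definition line_affine (a b : R) : gmap (gdomain R (line_dim 0)) (gdomain R (line_dim 0)) :=
  gt_map (U := opensT _) (fun v => a *: xc (opensT _) v + cst_sec (opensT _) (cdeg v) b).

Lemma line_affine_lc a b y : agree (X := gdomain R (line_dim 0)) y
  (gpull (line_affine a b) lc) (a *: lc + b *: gone (opensT (gline R 0))).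
Proof.
have [v [_ dv elc _]] := line_var R 0.
apply: (@ev_agree R (line_dim 0) _ (opensT _)) => // x _.
rewrite (agree_ev (agree_pull (I : oset (gdom (line_affine a b)) x) (line_agree dv (line_affine a b x)))).
rewrite (scast_nat (fun W m f => ev x (gpull (line_affine a b) f))) gt_map_xc //.
rewrite !evP !evZ ev_xc // elc ev_one //; congr (_ + _).
by rewrite ev_fsec // dv oppr0 eqxx.
Qed.

(** The map [(m, t) |-> (m, a t + b)], used with [a = 1] to shift time and with [a = 0] to freeze it
    at [b]. *)
Definition prod_affine (a b : R) : smap P P :=
  ppair P (pfst P) (scomp (mk_smap (X := gline R 0) (Y := gline R 0) (line_affine a b)) (psnd P)).

Lemma prod_affineP a b w : [/\ oset (gdom (prod_affine a b)) w, meq w (gcomp (pfst P) (prod_affine a b)) (pfst P)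
  & agree w (gpull (prod_affine a b) (gpull (psnd P) lc)) (a *: gpull (psnd P) lc + b *: gone (gpre (psnd P) (opensT _)))].
Proof.
pose s := scomp (mk_smap (X := gline R 0) (Y := gline R 0) (line_affine a b)) (psnd P).
have ds : oset (gdom s) w by split=> //; exact: psnd_dom.
have [e1 e2 e3] := ppair_meq P (f := pfst P) (g := s) (pfst_dom w) ds; split=> //.
apply: agree_trans (meq_pull2 (g2 := psnd P) (f2 := line_affine a b) lc e3 I) _.
apply: agree_trans (agree_pull (psnd_dom w) (line_affine_lc a b (psnd P w))) _.
by rewrite gpullP gpullZ1; apply: agree_refl; split=> //; exact: psnd_dom.
Qed.

Lemma prod_affine_hom a b w q (deg : 'I_q -> int) (A : forall (W : opens P) j, sec W j -> gser R deg) : germ_hom w A ->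
  A _ _ (gpull (prod_affine a b) (gpull (psnd P) lc)) = a *: A _ _ (gpull (psnd P) lc) + b%:A.
Proof.
move=> hA; have [_ _ ag] := prod_affineP a b w.
have Ww : oset (gpre (psnd P) (opensT (gline R 0))) w by split=> //; exact: psnd_dom.
rewrite (germ_agree (gh_res hA) ag) (gh_lin hA) //; congr (_ + _).
by rewrite (ghZ Ww _ _ hA) (gh_one hA).
Qed.

Lemma prod_affine_val a b w : pfst P (prod_affine a b w) = pfst P w /\
  line_val (psnd P (prod_affine a b w)) = a * line_val (psnd P w) + b.
Proof.
have [da m _] := prod_affineP a b w; split; first exact: (meq_pt m).
have [q [deg [A hA]]] := point_germ w.
rewrite -(line_val_germ (germ_hom_pull (psnd_dom (P := P) _) (germ_hom_pull da hA))) (prod_affine_hom a b hA).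
by rewrite /gbody gcD !gcZ gc1 eqxx mulr1 -/(gbody _) (line_val_germ (germ_hom_pull (psnd_dom (P := P) w) hA)).
Qed.
End Affine.

(** * The group law of an integral map *)

Section GroupLaw.
Variables (R : realType) (prd : forall A B : gmanifold R, gproduct A B) (M : gmanifold R).
Local Notation L := (gline R 0).
Local Notation P := (prd M L).
Local Notation PP := (prd P L).
Local Notation lc := (line_coord R 0).
Variables (X : gvf (opensT M) 0) (th : smap P M) (add : smap (prd L L) L).
Hypotheses (genT : forall w, oset (gdom th) w -> gen_at X th w) (staT : forall w, start_at th w).
Hypothesis itv : forall w1 w2 w, oset (gdom th) w1 -> oset (gdom th) w2 -> pfst P w1 = pfst P w2 ->
  pfst P w = pfst P w1 -> line_val (psnd P w1) <= line_val (psnd P w) <= line_val (psnd P w2) -> oset (gdom th) w.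
Hypothesis zdom : forall w, line_val (psnd P w) = 0 -> oset (gdom th) w.
Hypothesis addP : is_line_add add.
Local Notation pm := (prodmap prd th (sid L)).
Local Notation sm := (scomp (prodmap prd (sid M) add) (passoc prd M L L)).

Lemma between_dom w w' : oset (gdom th) w -> pfst P w' = pfst P w ->
  between0 (line_val (psnd P w)) (line_val (psnd P w')) -> oset (gdom th) w'.
Proof.
move=> dw E B; have [z1 z2] := prod_affine_val 0 0 w; rewrite mul0r addr0 in z2.
have dz := zdom z2; move: B; rewrite /between0.
have [w0|w0] := leP 0 (line_val (psnd P w)) => B.
  by apply: (itv dz dw) => //; [rewrite E z1|rewrite z2].
by apply: (itv dw dz) => //; rewrite z2.
Qed.

(** Addition on the line is known only through the pullback of the line coordinate, so the time
    component is described by a sum of germs; the form [1 *: s1 + s2] fits the linearity clauses. *)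
Lemma smP z : [/\ oset (gdom sm) z, meq z (gcomp (pfst P) sm) (gcomp (pfst P) (pfst PP))
  & exists (W : opens PP) (s1 s2 : sec W (- 0)), [/\ oset W z, agree z (gpull sm (gpull (psnd P) lc)) (1 *: s1 + s2),
      agree z s1 (gpull (pfst PP) (gpull (psnd P) lc)) & agree z s2 (gpull (psnd PP) lc)]].
Proof.
have [addT addE] := addP.
pose p := pfst PP.
have d1 : oset (gdom (scomp (psnd P) p)) z by split; [exact: pfst_dom|exact: psnd_dom].
have [q1 q2 q3] := ppair_meq (prd L L) d1 (psnd_dom (P := PP) z).
set q := ppair (prd L L) _ _ in q1 q2 q3.
have d2 : oset (gdom (scomp (pfst P) p)) z by split; exact: pfst_dom.
have [a1 a2 a3] := ppair_meq (prd M (prd L L)) d2 q1.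
set as_ := ppair (prd M (prd L L)) _ _ in a1 a2 a3.
have [b1 b2 b3] := prodmap_meq (prd := prd) (f := sid M) (g := add) (w := as_ z) I (addT _ I).
have dz : oset (gdom sm) z by [].
have dq : oset (gdom add) (q z) by exact: addT.
split=> //.
- apply: meq_trans (meq_sym (meq_assoc a1 b1 (pfst_dom _))) _.
  apply: meq_trans (meq_compr a1 (meq_trans b2 (meq_idl (pfst_dom _)))) _.
  exact: a2.
have m : meq z (gcomp (psnd P) sm) (gcomp add q).
  apply: meq_trans (meq_sym (meq_assoc a1 b1 (psnd_dom _))) _.
  apply: meq_trans (meq_compr a1 b3) _.
  apply: meq_trans (meq_assoc a1 (psnd_dom _) _) _; first exact: addT.
  by apply: meq_compl a3 _; exact: addT.
pose h : opensT (prd L L) `<=` gdom add := addT.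
pose h1 : opensT (prd L L) `<=` gdom (pfst (prd L L)) := fun y _ => pfst_dom y.
pose h2 : opensT (prd L L) `<=` gdom (psnd (prd L L)) := fun y _ => psnd_dom y.
have E := addE h h1 h2.
have g0 := agree_res (gdom_gpreT h) (gpull add lc) (I : oset (opensT (prd L L)) (q z)).
have g1 := agree_res (gdom_gpreT h1) (gpull (pfst (prd L L)) lc) (I : oset (opensT (prd L L)) (q z)).
have g2 := agree_res (gdom_gpreT h2) (gpull (psnd (prd L L)) lc) (I : oset (opensT (prd L L)) (q z)).
have e1 : agree z (gpull q (gpull_on h1 lc)) (gpull (pfst PP) (gpull (psnd P) lc)).
  apply: agree_trans (agree_pull q1 g1) _.
  exact: (meq_pull2 (g2 := pfst PP) (f2 := psnd P) lc q2 I).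
have e2 : agree z (gpull q (gpull_on h2 lc)) (gpull (psnd PP) lc).
  apply: agree_trans (agree_pull q1 g2) _.
  have Wq : oset (gpre (gcomp (psnd (prd L L)) q) (opensT L)) z by split=> //; exact: meq_doml q3.
  exact: agree_trans (agree_sym (agree_comp lc Wq)) (meq_pull lc q3 I).
exists (gpre q (opensT _)), (gpull q (gpull_on h1 lc)), (gpull q (gpull_on h2 lc)); split=> //.
apply: agree_trans (meq_pull2 lc m I) _.
apply: agree_trans (agree_pull q1 (agree_sym g0)) _.
rewrite -gpullP (_ : res (gdom_gpreT h) (gpull add lc) = 1 *: gpull_on h1 lc + gpull_on h2 lc).
  by apply: agree_refl; split.
by rewrite scale1r; exact: E.
Qed.

(** As functions of the last time, both sides are integral maps of [X] with the same start, so
    [int_unique] applies. The hypotheses on [th] are only those needed for this, since the lemma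
    will serve an extension not yet known to be a flow. *)
Lemma group_law : geq_on (flow_dom2 (gdom th) th add) (scomp th pm) (scomp th sm).
Proof.
apply: geq_of_meq => z [dz1 dz2 dz3].
have pmP w : oset (gdom th) (pfst PP w) -> [/\ oset (gdom pm) w, meq w (gcomp (pfst P) pm) (gcomp th (pfst PP))
   & meq w (gcomp (psnd P) pm) (psnd PP)].
  move=> dw; have [e1 e2 e3] := prodmap_meq (prd := prd) (f := th) (g := sid L) (w := w) dw I.
  by split=> //; exact: meq_trans e3 (meq_idl (psnd_dom _)).
have pmD w : oset (gdom pm) w -> oset (gdom th) (pfst PP w) by exact: prodmap_domP.
pose S := ocap (gpre pm (gdom th)) (gpre sm (gdom th)).
have smv w : line_val (psnd P (sm w)) = line_val (psnd P (pfst PP w)) + line_val (psnd PP w).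
  have [d1 _ [W [s1 [s2 [Ww ag ag1 ag2]]]]] := smP w; have [q [deg [A hA]]] := point_germ w.
  rewrite -(line_val_germ (germ_hom_pull (psnd_dom (P := P) _) (germ_hom_pull d1 hA))).
  rewrite (germ_agree (gh_res hA) ag) (gh_lin hA) // scale1r (germ_agree (gh_res hA) ag1) (germ_agree (gh_res hA) ag2).
  rewrite /gbody gcD -!/(gbody _).
  by rewrite (line_val_germ (germ_hom_pull (psnd_dom (P := P) _) (germ_hom_pull (pfst_dom (P := PP) w) hA)))
    (line_val_germ (germ_hom_pull (psnd_dom (P := PP) w) hA)).
have smp w : pfst P (sm w) = pfst P (pfst PP w) by have [_ m _] := smP w; exact: (meq_pt m).
have pmv w : oset (gdom th) (pfst PP w) -> psnd P (pm w) = psnd PP w by move=> /pmP[_ _ m]; exact: (meq_pt m).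
have pmp w : oset (gdom th) (pfst PP w) -> pfst P (pm w) = th (pfst PP w) by move=> /pmP[_ m _]; exact: (meq_pt m).
apply: (@int_unique R M 0 X P PP (scomp th pm) (scomp th sm) S z).
- have [d1 _ _] := pmP z dz1; have [d2 _ _] := smP z; exact (conj (conj d1 dz2) (conj d2 dz3)).
- by move=> w [[x1 x2] _]; exact (conj x1 x2).
- by move=> w [_ [x1 x2]]; exact (conj x1 x2).
- move=> w [[d1 d2] _]; apply: gen_comp => //; last exact: genT.
  move=> e Phi v p al; have [dp Ew dv H1 H2] := al; have dw := pmD w d1; have [_ m1 m2] := pmP w dw.
  split=> //; [by split=> //; rewrite /preimage /= Ew|by rewrite /= Ew| |].
    move=> W i f Wp.
    have m1' : meq (Phi p) (gcomp (pfst P) pm) (gcomp th (pfst PP)) by rewrite Ew.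
    have c1 : oset (gpre (gcomp pm Phi) (gpre (pfst P) W)) p.
      by split; [split=> //; rewrite /preimage /= Ew|rewrite /preimage /= Ew; split=> //; exact: pfst_dom].
    rewrite (agree_pder v (agree_comp (gpull (pfst P) f) c1)).
    have Wp' : oset W (pfst P (pm (Phi p))) by rewrite Ew.
    rewrite (agree_pder v (agree_pull dp (meq_pull2 f m1' Wp'))); apply: H1.
    by split=> //; rewrite /preimage /= -(pmp w dw).
  have c1 : oset (gpre (gcomp pm Phi) (gpre (psnd P) (opensT L))) p.
    by split; [split=> //; rewrite /preimage /= Ew|split=> //; exact: psnd_dom].
  rewrite (agree_pder v (agree_comp (gpull (psnd P) lc) c1)).
  have m2' : meq (Phi p) (gcomp (psnd P) pm) (psnd PP) by rewrite Ew.
  have c2 : oset (gpre (gcomp (psnd P) pm) (opensT L)) (Phi p) by split=> //; exact: meq_doml m2'.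
  by rewrite -(agree_pder v (agree_pull dp (agree_comp lc c2))) (agree_pder v (agree_pull dp (meq_pull lc m2' I))).
- move=> w [_ [d1 d2]]; apply: gen_comp => //; last exact: genT.
  move=> e Phi v p al; have [dp Ew dv H1 H2] := al; have [_ m1 [W0 [s1 [s2 [Ww ag ag1 ag2]]]]] := smP w.
  split=> //; [by split=> //; rewrite /preimage /= Ew|by rewrite /= Ew| |].
    move=> W i f Wp.
    have m1' : meq (Phi p) (gcomp (pfst P) sm) (gcomp (pfst P) (pfst PP)) by rewrite Ew.
    have c1 : oset (gpre (gcomp sm Phi) (gpre (pfst P) W)) p.
      by split; [split=> //; rewrite /preimage /= Ew|rewrite /preimage /= Ew; split=> //; exact: pfst_dom].
    rewrite (agree_pder v (agree_comp (gpull (pfst P) f) c1)).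
    have Wp' : oset W (pfst P (sm (Phi p))) by rewrite Ew.
    rewrite (agree_pder v (agree_pull dp (meq_pull2 f m1' Wp'))); apply: H1.
    by split; [exact: pfst_dom|rewrite /preimage /= -smp].
  have c1 : oset (gpre (gcomp sm Phi) (gpre (psnd P) (opensT L))) p.
    by split; [split=> //; rewrite /preimage /= Ew|split=> //; exact: psnd_dom].
  rewrite (agree_pder v (agree_comp (gpull (psnd P) lc) c1)).
  rewrite -Ew in Ww ag ag1 ag2.
  rewrite (agree_pder v (agree_pull dp ag)) gpullP pder_fam_lin; last by split.
  rewrite (agree_pder v (agree_pull dp ag1)) (agree_pder v (agree_pull dp ag2)) H2 H1 ?scaler0 ?add0r //.
  by split=> //; exact: psnd_dom.
- move=> w w' [[d1 d2] [d3 d4]] E B; have dw := pmD w d1.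
  have dw' : oset (gdom th) (pfst PP w') by rewrite E.
  have [d1' _ _] := pmP w' dw'; have [d3' _ _] := smP w'.
  suff [u1 u2] : oset (gdom th) (pm w') /\ oset (gdom th) (sm w') by exact (conj (conj d1' u1) (conj d3' u2)).
  split.
    by apply: (between_dom d2); rewrite ?pmp ?pmv ?E.
  move: B; rewrite /between0; have [r0|r0] := leP 0 (line_val (psnd PP w)) => B.
    by apply: (itv dw d4); rewrite ?smp ?smv ?E ?lerD2l ?lerDl.
  by apply: (itv d4 dw); rewrite ?smp ?smv ?E ?lerD2l ?gerDl.
- move=> w q deg A [[d1 d2] [d3 d4]] hA A0 j f; have dw := pmD w d1; have [_ m1 m2] := pmP w dw; have [_ n1 [W0 [s1 [s2 [Ww ag ag1 ag2]]]]] := smP w.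
  have gA := germ_agree (gh_res hA).
  have c1 : oset (gpre (gcomp th pm) (opensT M)) w by split=> //; split.
  have c2 : oset (gpre (gcomp th sm) (opensT M)) w by split=> //; split.
  apply: etrans (gA _ _ _ _ _ (agree_comp f c1)) _; apply: etrans _ (esym (gA _ _ _ _ _ (agree_comp f c2))).
  have hpm := germ_hom_pull d1 hA; have hsm := germ_hom_pull d3 hA; have hp := germ_hom_pull (pfst_dom (P := PP) w) hA.
  have c3 : oset (gpre (gcomp (psnd P) pm) (opensT L)) w by split=> //; exact: meq_doml m2.
  have A1 : A _ _ (gpull pm (gpull (psnd P) lc)) = 0.
    by rewrite -(gA _ _ _ _ _ (agree_comp lc c3)) (gA _ _ _ _ _ (meq_pull lc m2 I)).
  have [_ _ sE] := staT hpm A1; apply: etrans (sE _ _ f I) _.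
  apply: etrans (gA _ _ _ _ _ (meq_pull2 f m1 I)) _.
  have w0 : line_val (psnd PP w) = 0.
    by rewrite -(line_val_germ (germ_hom_pull (psnd_dom (P := PP) w) hA)) A0.
  have sw : sm w = pfst PP w.
    by apply: prod_point_eq => //; apply: line_val_inj; rewrite smv w0 addr0.
  rewrite sw in hsm; have dW : oset (gpre th (opensT M)) (pfst PP w) by [].
  symmetry; have U := line_hom_uniq hsm hp; apply: (U _ _ (gpre th (opensT M)) _ (gpull th f) dW).
    by move=> W' j' f' W'p; apply: gA; apply: meq_pull2 n1 _; rewrite smp.
  apply: etrans (gA _ _ _ _ _ ag) _.
  by rewrite (gh_lin hA) // (gA _ _ _ _ _ ag2) A0 addr0 scale1r (gA _ _ _ _ _ ag1).
Qed.
End GroupLaw.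

(** * Inequalities on shifted times, and derivatives along affine changes of time *)

Section RealShift.
Variables (R : realType) (b : R).

Lemma shift_le (l0 l1 l2 r r' : R) : l0 = b -> l1 = r + b -> l2 = r' + b -> 0 <= r' <= r -> l0 <= l2 <= l1.
Proof. by move=> -> -> -> ?; lra. Qed.
Lemma shift_ge (l0 l1 l2 r r' : R) : l0 = b -> l1 = r + b -> l2 = r' + b -> r <= r' <= 0 -> l1 <= l2 <= l0.
Proof. by move=> -> -> -> ?; lra. Qed.
Lemma between_lt (r r' eps : R) : `|r| < eps -> between0 r r' -> `|r'| < eps.
Proof. by rewrite /between0 !ltr_norml => ?; have [r0|r0] := leP 0 r => ?; lra. Qed.
Lemma near_between (x y eps : R) : (b <= x /\ x <= y) \/ (y <= x /\ x <= b) -> `|y - b| < eps -> `|x - b| < eps.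
Proof. by rewrite !ltr_norml => -[[h1 h2]|[h1 h2]] ?; lra. Qed.
Lemma near_ball (x y eps : R) : `|x - y| < eps - `|x - b| -> `|y - b| < eps.
Proof.
move=> h; have := ler_normD (y - x) (x - b); rewrite addrA subrK => h'.
by apply: le_lt_trans h' _; rewrite -ltrBrDr distrC.
Qed.
End RealShift.

Section AlongMaps.
Variables (R : realType).
Local Notation L := (gline R 0).
Local Notation lc := (line_coord R 0).

Lemma along_comp (N N' : gmanifold R) (P : gproduct N L) (P' : gproduct N' L) (A : gmap P P') w e
  (Phi : gmap (gdomain R e) P) v p : oset (gdom A) w -> along w Phi v p ->
  (forall (W : opens N') i (f : sec W i), oset W (pfst P' (A w)) ->
     pder_fam v (gpull Phi (gpull A (gpull (pfst P') f))) p = 0) ->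
  pder_fam v (gpull Phi (gpull A (gpull (psnd P') lc))) p = 1 -> along (A w) (gcomp A Phi) v p.
Proof.
move=> dA [dp Ew dv _ _] H1 H2; have dAp : oset (gdom (gcomp A Phi)) p.
  by split=> //; rewrite /preimage /= Ew.
have AE : gcomp A Phi p = A w by rewrite -Ew.
split=> // [W i f Wp|].
  have c1 : oset (gpre (gcomp A Phi) (gpre (pfst P') W)) p.
    have Wq : oset (gpre (pfst P') W) (gcomp A Phi p) by rewrite AE; exact (conj (pfst_dom _) Wp).
    exact (conj dAp Wq).
  by rewrite (agree_pder v (agree_comp (gpull (pfst P') f) c1)) H1.
have c1 : oset (gpre (gcomp A Phi) (gpre (psnd P') (opensT L))) p.
  by split=> //; split=> //; exact: psnd_dom.
by rewrite (agree_pder v (agree_comp (gpull (psnd P') lc) c1)).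
Qed.

Lemma pder_scone (e : gdim) (W : opens (gdomain R e)) v b p : oset W p ->
  pder_fam v (b *: gone W : @sec R (gdomain R e) W 0) p = 0.
Proof.
move=> Wp; rewrite -[b *: _]addr0 pder_fam_lin // -!ev_pder // pder_one pder0.
by rewrite !ev0 scaler0 addr0.
Qed.

Variables (N : gmanifold R) (P : gproduct N L).

Lemma affine_pder a b w e (Phi : gmap (gdomain R e) P) v p : along w Phi v p ->
  (forall (W : opens N) i (f : sec W i), oset W (pfst P w) ->
    pder_fam v (gpull Phi (gpull (prod_affine P a b) (gpull (pfst P) f))) p = 0) /\
  pder_fam v (gpull Phi (gpull (prod_affine P a b) (gpull (psnd P) lc))) p = a%:A.
Proof.
move=> [dp Ew dv H1 H2]; have [d m ag] := prod_affineP a b w; split.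
  move=> W i f Wp; have Wp' : oset W (pfst P (prod_affine P a b w)).
    by rewrite (meq_pt m : pfst P (prod_affine P a b w) = _).
  have cW : oset (gpre (gcomp (pfst P) (prod_affine P a b)) W) w by split=> //; exact: meq_doml m.
  have ag' := agree_trans (agree_sym (agree_comp f cW)) (meq_pull f m Wp').
  rewrite -Ew in ag'; rewrite (agree_pder v (agree_pull dp ag')); exact: H1.
have Ww : oset (gpre (psnd P) (opensT L)) w by split=> //; exact: psnd_dom.
rewrite -Ew in ag Ww; rewrite (agree_pder v (agree_pull dp ag)) gpullP gpullZ1.
have Wp : oset (gpre Phi (gpre (psnd P) (opensT L))) p by split.
by rewrite pder_fam_lin // H2 (@pder_scone e _ v b p Wp) addr0.
Qed.

Lemma affine_flat b w e (Phi : gmap (gdomain R e) P) v p (W : opens P) j (g : sec W j) : along w Phi v p ->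
  oset W (prod_affine P 0 b w) -> pder_fam v (gpull Phi (gpull (prod_affine P 0 b) g)) p = 0.
Proof.
move=> al Wp; have [dp Ew _ _ _] := al; have [d m _] := prod_affineP 0 b w.
have [A1 A2] := affine_pder 0 b al; have [pE _] := prod_affine_val 0 b w.
have hA := gmap_germ dp; have hD := pder_germ_der v dp; rewrite Ew in hA hD.
have hA' := germ_hom_pull d hA; have hD' := germ_der_pull d hD.
have U := line_der_uniq hA' hD'; apply: (U _ _ W _ g Wp); last by rewrite A2 scale0r.
by move=> W' j' f' W'p; apply: A1; rewrite -pE.
Qed.

Lemma prod_affine_dom a b w : oset (gdom (prod_affine P a b)) w.
Proof. by have [] := prod_affineP a b w. Qed.

Lemma line_val_open b eps : open [set y : L | `|line_val y - b| < eps].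
Proof.
have c : continuous (fun y : L => line_val y).
  move=> y; have [c _] := @Cr_sum R (gdim0 (line_dim 0)) 0 setT _ (index_enum _) (fun i x => x 0 i) openT (fun i => Cr_coord 0 i openT).
  exact: c.
have -> : [set y : L | `|line_val y - b| < eps] = (fun y : L => line_val y) @^-1` ball b eps.
  by apply/seteqP; split=> y; rewrite /ball /= distrC.
by apply: open_comp => [y _|]; [exact: c|exact: ball_open].
Qed.
End AlongMaps.

(** * Extension of a flow by a time shift *)

Section Extend.
Variables (R : realType) (prd : forall A B : gmanifold R, gproduct A B) (M : gmanifold R).
Local Notation L := (gline R 0).
Local Notation P := (prd M L).
Local Notation lc := (line_coord R 0).
Variables (X : gvf (opensT M) 0) (th : smap P M).
Hypotheses (mx : is_maximal_flow th) (genT : forall w, oset (gdom th) w -> gen_at X th w).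
Variables (N : opens M) (b eps : R).
Hypotheses (eps0 : 0 < eps) (box : forall w, oset N (pfst P w) -> `|line_val (psnd P w)| < eps -> oset (gdom th) w).

Let fl : is_flow th. Proof. by case: mx. Qed.
Let sta w : start_at th w. Proof. exact: flow_start_at. Qed.

Definition dom_itv (D : set P) := forall w1 w2 w, D w1 -> D w2 -> pfst P w1 = pfst P w2 ->
  pfst P w = pfst P w1 -> line_val (psnd P w1) <= line_val (psnd P w) <= line_val (psnd P w2) -> D w.

Lemma itv_dom : dom_itv (gdom th).
Proof.
move=> w1 w2 w d1 d2 e e' B; have [] := fl; rewrite /is_flow_domain eqxx => /(_ (pfst P w1))[_ itv _] _ _.
have S1 : slice (gdom th) (pfst P w1) (line_val (psnd P w1)) by exists w1.
have S2 : slice (gdom th) (pfst P w1) (line_val (psnd P w2)) by exists w2.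
have [w3 [d3 e3] l3] := itv _ _ S1 S2 _ B.
suff <- : w3 = w by [].
by apply: prod_point_eq; [rewrite e3 e'|exact: line_val_inj l3].
Qed.

Local Notation C := (prod_affine P 0 b).
Local Notation T := (prod_affine P 1 b).
Local Notation T' := (prod_affine P 1 (- b)).
(** [K] is [(m, t) |-> (th (m, b), t)], so that [ext_map] is [(m, t) |-> th (th (m, b), t - b)]. The
    pair [N], [eps] provides a common existence time for the points of [N], which are possible
    values of [th (m, b)]. *)
Definition shiftK : smap P P := ppair P (scomp th C) (psnd P).
Local Notation K := shiftK.
Definition ext_map : gmap P M := gcomp (gcomp th K) T'.
Definition ext_dom : opens P := ocap (gpre (gcomp th C) N) (gpre (psnd P) (Opens (@line_val_open R b eps))).

Lemma C_val w : pfst P (C w) = pfst P w /\ line_val (psnd P (C w)) = b.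
Proof. by have [e1 e2] := prod_affine_val 0 b w; rewrite e1 e2 mul0r add0r. Qed.
Lemma T_val w : pfst P (T w) = pfst P w /\ line_val (psnd P (T w)) = line_val (psnd P w) + b.
Proof. by have [e1 e2] := prod_affine_val 1 b w; rewrite e1 e2 mul1r. Qed.
Lemma T'_val w : pfst P (T' w) = pfst P w /\ line_val (psnd P (T' w)) = line_val (psnd P w) - b.
Proof. by have [e1 e2] := prod_affine_val 1 (- b) w; rewrite e1 e2 mul1r. Qed.
Lemma C_eq w w' : pfst P w = pfst P w' -> C w = C w'.
Proof.
move=> E; have [e1 e2] := C_val w; have [e3 e4] := C_val w'.
by apply: prod_point_eq; [rewrite e1 e3|apply: line_val_inj; rewrite e2 e4].
Qed.

Lemma K_meq w : oset (gdom th) (C w) -> [/\ oset (gdom K) w, meq w (gcomp (pfst P) K) (gcomp th C)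
  & meq w (gcomp (psnd P) K) (psnd P)].
Proof.
move=> d; apply: (ppair_meq P (f := scomp th C) (g := psnd P)); last exact: psnd_dom.
exact (conj (prod_affine_dom 0 b w) d).
Qed.

Lemma K_dom w : oset (gdom th) (C w) -> oset N (th (C w)) -> `|line_val (psnd P w)| < eps ->
  oset (gdom K) w /\ oset (gdom th) (K w).
Proof.
move=> d Nw lw; have [dK m1 m2] := K_meq d; split=> //; apply: box.
  by rewrite (meq_pt m1 : pfst P (K w) = th (C w)).
by rewrite (meq_pt m2 : psnd P (K w) = psnd P w).
Qed.

Lemma gen_K w : oset (gdom th) (C w) -> oset N (th (C w)) -> `|line_val (psnd P w)| < eps -> gen_at X (gcomp th K) w.
Proof.
move=> d Nw lw; have [dK dth] := K_dom d Nw lw; have [_ m1 m2] := K_meq d.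
apply: gen_comp => //; last exact: genT.
move=> e Phi v p al; have [dp Ew dv H1 H2] := al; apply: along_comp => //.
  move=> W i f Wp; have ag := meq_pull2 f m1 Wp; rewrite -Ew in ag.
  rewrite (agree_pder v (agree_pull dp ag)); apply: (affine_flat _ al).
  by split=> //; rewrite /preimage /= -(meq_pt m1 : pfst P (K w) = th (C w)).
have cW : oset (gpre (gcomp (psnd P) K) (opensT L)) w by split=> //; exact: meq_doml m2.
have ag := agree_trans (agree_sym (agree_comp lc cW)) (meq_pull lc m2 I).
by rewrite -Ew in ag; rewrite (agree_pder v (agree_pull dp ag)).
Qed.

Lemma gen_affine1 a (f : gmap P M) w : oset (gdom f) (prod_affine P 1 a w) -> gen_at X f (prod_affine P 1 a w) ->
  gen_at X (gcomp f (prod_affine P 1 a)) w.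
Proof.
move=> df g; apply: gen_comp => //; first exact: prod_affine_dom.
move=> e Phi v p al; have [A1 A2] := affine_pder 1 a al.
apply: along_comp => //; first exact: prod_affine_dom.
  by move=> W i g' Wp; apply: A1; have [<- _] := prod_affine_val 1 a w.
by rewrite A2 scale1r.
Qed.

Lemma ext_domP w : oset ext_dom w -> [/\ oset (gdom th) (C (T' w)), oset N (th (C (T' w))),
  `|line_val (psnd P (T' w))| < eps & oset (gdom ext_map) w].
Proof.
move=> [[[dC dth] Nw] [_ lw]]; have [e1 e2] := T'_val w.
have CE : C (T' w) = C w by exact: C_eq.
have Nw' : oset N (th (C w)) := Nw.
have a1 : oset (gdom th) (C (T' w)) by rewrite CE; exact dth.
have a2 : oset N (th (C (T' w))) by rewrite CE; exact Nw'.
have a3 : `|line_val (psnd P (T' w))| < eps by rewrite e2; exact lw.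
split; [exact a1|exact a2|exact a3|]; have [k1 k2] := K_dom a1 a2 a3.
exact (conj (prod_affine_dom 1 (- b) w) (conj k1 k2)).
Qed.

Lemma T_T' z : meq z (gcomp T T') (gid P).
Proof.
have [d1 m1 ag1] := prod_affineP 1 (- b) z; have [d2 m2 ag2] := prod_affineP 1 b (T' z).
have dd : oset (gdom (gcomp T T')) z by [].
apply: (prod_meq (P := P) (T := P)) => //.
  apply: meq_trans (meq_sym (meq_assoc d1 d2 (pfst_dom _))) _.
  apply: meq_trans (meq_compr d1 m2) _.
  exact: meq_trans m1 (meq_sym (meq_idr (pfst_dom z))).
apply: meq_trans _ (meq_sym (meq_idr (psnd_dom z))).
have sd a w : oset (gdom (scomp (mk_smap (X := L) (Y := L) (line_affine 1 a)) (psnd P))) w.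
  by split=> //; exact: psnd_dom.
have [_ _ n2] := ppair_meq P (f := pfst P) (pfst_dom (T' z)) (sd b (T' z)).
have [_ _ n1] := ppair_meq P (f := pfst P) (pfst_dom z) (sd (- b) z).
apply: meq_trans (meq_sym (meq_assoc d1 d2 (psnd_dom _))) _.
apply: meq_trans (meq_compr d1 n2) _.
apply: meq_trans (meq_assoc (phi := T') (psi := psnd P) (chi := line_affine 1 b) d1 (psnd_dom _) I) _.
apply: meq_trans (meq_compl (psi := line_affine 1 b) n1 I) _.
apply: meq_trans (meq_sym (meq_assoc (phi := psnd P) (psi := line_affine 1 (- b)) (chi := line_affine 1 b) (psnd_dom _) I I)) _.
apply: meq_trans (meq_compr (psnd_dom z) _) (meq_idl (psnd_dom z)).
apply: (@gd_meq R _ _ _ _ (opensT _)) => // x v _.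
have [v0 [vP dv elc _]] := line_var R 0; rewrite (vP v).
have cW : oset (gpre (gcomp (line_affine 1 b) (line_affine 1 (- b))) (opensT (gdomain R (line_dim 0)))) x by [].
rewrite (agree_ev (agree_comp _ cW)) (agree_ev (agree_id (xc (opensT _) v0) (I : oset (opensT (gdomain R (line_dim 0))) x))) ev_xc //.
rewrite -(scast_nat (fun W m f => ev x (gpull (line_affine 1 (- b)) (gpull (line_affine 1 b) f))) dv).
have l1 := agree_pull (I : oset (gdom (line_affine 1 b)) (line_affine 1 (- b) x)) (line_agree dv (line_affine 1 b (line_affine 1 (- b) x))).
rewrite -(agree_ev (agree_pull (I : oset (gdom (line_affine 1 (- b))) x) l1)).
rewrite (agree_ev (agree_pull (I : oset (gdom (line_affine 1 (- b))) x) (line_affine_lc 1 b (line_affine 1 (- b) x)))).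
rewrite gpullP gpullZ1 evP evZ ev_one // (agree_ev (line_affine_lc 1 (- b) x)) evP evZ ev_one // elc.
by rewrite !scale1r scaleNr subrK.
Qed.

(** After a shift by [b], both maps are integral maps of [X] starting at [th (m, b)], so
    [int_unique] applies; the inverse shift [T'] brings the equality back. *)
Lemma ext_compat z : oset (gdom th) z -> oset ext_dom z -> meq z th ext_map.
Proof.
move=> dz Uz; have [c1 c2 c3 c4] := ext_domP Uz.
have TT := meq_pt (T_T' z); rewrite /= in TT.
pose S : opens P := ocap (gpre T (gdom th)) (ocap (gpre (gcomp th C) N) (gpre (psnd P) (Opens (@line_val_open R 0 eps)))).
have SP w : oset S w -> [/\ oset (gdom th) (T w), oset (gdom th) (C w), oset N (th (C w)) & `|line_val (psnd P w)| < eps].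
  move=> [[_ s1] [[[_ s2] s3] [_ s4]]]; have s4' : `|line_val (psnd P w) - 0| < eps := s4.
  by rewrite subr0 in s4'; split; [exact s1|exact s2|exact s3|exact s4'].
have PS w : oset (gdom th) (T w) -> oset (gdom th) (C w) -> oset N (th (C w)) -> `|line_val (psnd P w)| < eps -> oset S w.
  move=> s1 s2 s3 s4; have s4' : `|line_val (psnd P w) - 0| < eps by rewrite subr0.
  exact (conj (conj (prod_affine_dom 1 b w) s1) (conj (conj (conj (prod_affine_dom 0 b w) s2) s3) (conj (psnd_dom w) s4'))).
have m : meq (T' z) (gcomp th T) (gcomp th K).
  apply: (@int_unique R M 0 X M P (gcomp th T) (gcomp th K) S (T' z)).
  - by apply: PS; [rewrite TT; exact dz|exact c1|exact c2|exact c3].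
  - by move=> w /SP[s1 _ _ _]; exact (conj (prod_affine_dom 1 b w) s1).
  - by move=> w /SP[_ s2 s3 s4]; have [k1 k2] := K_dom s2 s3 s4; exact (conj k1 k2).
  - by move=> w /SP[s1 _ _ _]; apply: gen_affine1 => //; exact: genT.
  - by move=> w /SP[_ s2 s3 s4]; exact: gen_K.
  - move=> w w' /SP[s1 s2 s3 s4] E B; have CE : C w' = C w by exact: C_eq.
    have [x1 x2] := T_val w; have [y1 y2] := T_val w'; have [z1 z2] := C_val w.
    apply: PS; [|rewrite CE; exact s2|rewrite CE; exact s3|exact: (between_lt s4 B)].
    have E1 : pfst P (C w) = pfst P (T w) := eq_trans z1 (esym x1).
    have E2 : pfst P (T w') = pfst P (C w) := eq_trans y1 (eq_trans E (esym z1)).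
    have E3 : pfst P (T w') = pfst P (T w) := eq_trans E2 E1.
    move: B; rewrite /between0; have [w0|w0] := leP 0 (line_val (psnd P w)) => B.
      exact (itv_dom s2 s1 E1 E2 (shift_le z2 x2 y2 B)).
    exact (itv_dom s1 s2 (esym E1) E3 (shift_ge z2 x2 y2 B)).
  - move=> w q deg A /SP[s1 s2 s3 s4] hA A0 j f; have [k1 k2] := K_dom s2 s3 s4; have [_ m1 m2] := K_meq s2.
    have gA := germ_agree (gh_res hA).
    have dT := prod_affine_dom 1 b w; have dC := prod_affine_dom 0 b w.
    have cT : oset (gpre (gcomp th T) (opensT M)) w := conj (conj dT s1) I.
    have cK : oset (gpre (gcomp th K) (opensT M)) w := conj (conj k1 k2) I.
    apply: etrans (gA _ _ _ _ _ (agree_comp f cT)) _; apply: etrans _ (esym (gA _ _ _ _ _ (agree_comp f cK))).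
    have hK := germ_hom_pull k1 hA; have hT := germ_hom_pull dT hA; have hC := germ_hom_pull dC hA.
    have cW : oset (gpre (gcomp (psnd P) K) (opensT L)) w by split=> //; exact: meq_doml m2.
    have A1 : A _ _ (gpull K (gpull (psnd P) lc)) = 0.
      by rewrite -(gA _ _ _ _ _ (agree_comp lc cW)) (gA _ _ _ _ _ (meq_pull lc m2 I)).
    have [_ _ sE] := sta hK A1; apply: etrans _ (esym (sE _ _ f I)).
    apply: etrans _ (esym (gA _ _ _ _ _ (meq_pull2 f m1 I))).
    have w0 : line_val (psnd P w) = 0 by rewrite -(line_val_germ (germ_hom_pull (psnd_dom (P := P) w) hA)) A0.
    have [x1 x2] := T_val w; have [z1 z2] := C_val w.
    have TC : T w = C w.
      apply: prod_point_eq; first exact (eq_trans x1 (esym z1)).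
      by apply: line_val_inj; apply: (eq_trans x2); rewrite w0 add0r; exact (esym z2).
    rewrite TC in hT; have dW : oset (gpre th (opensT M)) (C w) := conj s2 I.
    have U := line_hom_uniq hT hC; apply: (U _ _ (gpre th (opensT M)) _ (gpull th f) dW); last first.
      have e1 := prod_affine_hom 1 b hA; have e2 := prod_affine_hom 0 b hA.
      have m0 : 1 *: (0 : gser R deg) + b%:A = 0 *: 0 + b%:A by rewrite !scaler0.
      exact (eq_trans e1 (eq_trans (congr1 (fun x => 1 *: x + b%:A) A0)
        (eq_trans m0 (esym (eq_trans e2 (congr1 (fun x => 0 *: x + b%:A) A0)))))).
    move=> W' j' f' W'p; apply: gA; have [_ t1 _] := prod_affineP 1 b w; have [_ t2 _] := prod_affineP 0 b w.
    by apply: (meq_pull2 (g1 := T) (f1 := pfst P) (g2 := C) (f2 := pfst P)); [exact: meq_trans t1 (meq_sym t2)|rewrite TC; exact W'p].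
have [d1 _ _] := prod_affineP 1 (- b) z; have d2 := prod_affine_dom 1 b (T' z).
have dz' : oset (gdom th) (T (T' z)) by rewrite TT.
apply: meq_sym; apply: meq_trans (meq_sym (meq_compr d1 m)) _.
apply: meq_trans (meq_assoc d1 d2 dz') _.
by apply: meq_trans (meq_compl (T_T' z) _) (meq_idr dz).
Qed.
Lemma ext_compat' z : oset (gdom th) z -> oset (gdom (grestr ext_map ext_dom)) z -> meq z th (grestr ext_map ext_dom).
Proof. by move=> dz [d1 d2]; exact: meq_trans (ext_compat dz d2) (meq_sym (grestr_meq d1 d2)). Qed.

Definition ext_flow : smap P M := mk_smap (gglue ext_compat').
Local Notation th' := ext_flow.

Lemma ext_flow_meq w : oset (gdom th) w -> meq w th' th.
Proof. exact: gglue_meql. Qed.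

Lemma ext_flow_dom w : oset (gdom th') w <-> (oset (gdom th) w \/ oset ext_dom w).
Proof.
split=> [[d|[_ d]]|[d|d]]; [by left|by right|by left|right].
by have [_ _ _ d'] := ext_domP d; exact (conj d' d).
Qed.

Lemma ext_flow_gen w : oset (gdom th') w -> gen_at X th' w.
Proof.
move=> /ext_flow_dom[d|d]; first exact: gen_meq (meq_sym (ext_flow_meq d)) (genT d).
have [c1 c2 c3 c4] := ext_domP d.
have m : meq w th' (grestr ext_map ext_dom) by apply: gglue_meqr; exact (conj c4 d).
apply: gen_meq (meq_sym (meq_trans m (grestr_meq c4 d))) _.
have [k1 k2] := K_dom c1 c2 c3.
by apply: gen_affine1; [exact (conj k1 k2)|exact: gen_K].
Qed.

Lemma ext_flow_sta w : start_at th' w.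
Proof.
move=> q deg A hA A0; have [dT tw E] := sta hA A0; have m := ext_flow_meq dT.
split; [by apply/ext_flow_dom; left|by rewrite (meq_pt m : th' w = th w)|].
move=> W i f Wz; rewrite -(E _ _ f Wz); apply: (germ_agree (gh_res hA)).
have pm : th' w = th w := meq_pt m.
by apply: (meq_pull f m); rewrite pm tw.
Qed.

Lemma ext_zdom w : line_val (psnd P w) = 0 -> oset (gdom th) w.
Proof.
move=> w0; have [] := fl; rewrite /is_flow_domain eqxx => /(_ (pfst P w))[_ _ [w' [d e'] l']] _ _.
suff <- : w' = w by [].
by apply: prod_point_eq => //; apply: line_val_inj; rewrite l' w0.
Qed.

Lemma ext_domI w w' : oset ext_dom w -> pfst P w' = pfst P w -> `|line_val (psnd P w') - b| < eps -> oset ext_dom w'.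
Proof.
move=> [[[d1 d2] d3] _] E l; have CE : C w' = C w by exact: C_eq.
have d2' : oset (gdom th) (C w') by rewrite CE; exact d2.
have d3' : oset N (th (C w')) by rewrite CE; exact d3.
exact (conj (conj (conj (prod_affine_dom 0 b w') d2') d3') (conj (psnd_dom w') l)).
Qed.

Lemma ext_dom_lv w : oset ext_dom w -> `|line_val (psnd P w) - b| < eps.
Proof. by move=> [_ [_ l]]. Qed.
Lemma ext_dom_C w : oset ext_dom w -> oset (gdom th) (C w).
Proof. by move=> [[[_ d] _] _]; exact d. Qed.

(** Whenever a slice of [ext_dom] is not empty, the time [b] belongs to the corresponding slice of
    [th], so the two intervals that are joined both contain [b]. *)
Lemma ext_itv : dom_itv (gdom th').
Proof.
move=> w1 w2 w /ext_flow_dom d1 /ext_flow_dom d2 e e' /andP[l1 l2]; apply/ext_flow_dom.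
have [c1 c2] := C_val w.
have e2 : pfst P w = pfst P w2 by rewrite e' e.
have le2 (x y z : R) : x <= y -> y <= z -> x <= y <= z by move=> -> ->.
have lC (x : R) : x <= line_val (psnd P (C w)) -> x <= b by rewrite c2.
case: d1 d2 => d1 [d2|d2].
- by left; exact (itv_dom d1 d2 e e' (le2 _ _ _ l1 l2)).
- have CE : C w = C w2 by exact: C_eq.
  have dC : oset (gdom th) (C w) by rewrite CE; exact: ext_dom_C.
  have [lb|lb] := leP (line_val (psnd P w)) b.
    left; apply: (itv_dom d1 dC); [by rewrite c1 e'|exact: e'|by apply: le2; rewrite ?c2].
  right; apply: (ext_domI d2 e2); exact: (near_between (or_introl (conj (ltW lb) l2)) (ext_dom_lv d2)).
- have CE : C w = C w1 by exact: C_eq.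
  have dC : oset (gdom th) (C w) by rewrite CE; exact: ext_dom_C.
  have [lb|lb] := leP b (line_val (psnd P w)).
    left; apply: (itv_dom dC d2); [by rewrite c1 e2|by rewrite c1|by apply: le2; rewrite ?c2].
  right; apply: (ext_domI d1 e'); exact: (near_between (or_intror (conj l1 (ltW lb))) (ext_dom_lv d1)).
- right; have [lb|lb] := leP b (line_val (psnd P w)).
    by apply: (ext_domI d2 e2); exact: (near_between (or_introl (conj lb l2)) (ext_dom_lv d2)).
  by apply: (ext_domI d1 e'); exact: (near_between (or_intror (conj l1 (ltW lb))) (ext_dom_lv d1)).
Qed.

Lemma ext_flow_is_flow : is_flow th'.
Proof.
have [fd [bang [z [bT zP H]]] [add [addP _]]] := fl; split.
- rewrite /is_flow_domain eqxx in fd *; move=> m; have [o _ [w0 [d0 e0] l0]] := fd m.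
  have at_ t : exists2 w, pfst P w = m & line_val (psnd P w) = t.
    exists (prod_affine P 0 t w0); have [e1 e2] := prod_affine_val 0 t w0; first by rewrite e1 e0.
    by rewrite e2 mul0r add0r.
  split.
  + rewrite openE => t [w [/ext_flow_dom[d|d] e] l].
      have : nbhs t (slice (gdom th) m) by apply: open_nbhs_nbhs; split=> //; exists w.
      by apply: filterS => t' [w' [d' e'] l']; exists w' => //; split=> //; apply/ext_flow_dom; left.
    have lt := ext_dom_lv d; rewrite l in lt.
    apply/nbhs_ballP; exists (eps - `|t - b|); rewrite /= ?subr_gt0 // => t'; rewrite /ball /= => bt.
    have [w' e' l'] := at_ t'; exists w' => //; split=> //; apply/ext_flow_dom; right.
    by apply: (ext_domI d); [rewrite e' e|rewrite l'; exact: near_ball bt].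
  + move=> x y [w1 [d1 e1] l1] [w2 [d2 e2] l2] t B; have [w e l] := at_ t.
    by exists w => //; split=> //; apply: (ext_itv d1 d2); rewrite ?e ?e1 ?e2 ?l ?l1 ?l2.
  + by exists w0 => //; split=> //; apply/ext_flow_dom; left.
- exists bang, z; split=> //; apply: geq_of_meq => m _.
  have mm : meq m (scomp th (ppair P (sid M) (scomp z bang))) (sid M) := geq_meq (U := opensT M) I H.
  have [dc dth] := meq_doml mm.
  exact: meq_trans (meq_compr dc (ext_flow_meq dth)) mm.
exists add; split=> //.
apply: (group_law ext_flow_gen ext_flow_sta ext_itv _ addP).
by move=> w w0; apply/ext_flow_dom; left; exact: ext_zdom.
Qed.

(** The glued map is a flow extending [th], so maximality of [th] puts [ext_dom] inside its
    domain. *)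
Lemma extend_dom w : oset (gdom th) (C w) -> oset N (th (C w)) -> `|line_val (psnd P w) - b| < eps -> oset (gdom th) w.
Proof.
move=> d1 d2 d3; have [_ maxi] := mx; apply: (maxi _ ext_flow_is_flow).
  by apply: geq_of_meq => z; exact: ext_flow_meq.
apply/ext_flow_dom; right.
exact (conj (conj (conj (prod_affine_dom 0 b w) d1) d2) (conj (psnd_dom w) d3)).
Qed.
End Extend.

(** * Domains of flows *)

Section FlowDomains.
Variables (R : realType) (prd : forall A B : gmanifold R, gproduct A B) (M : gmanifold R) (k : int).
Local Notation P := (prd M (gline R k)).
Variables (theta : smap P M).
Hypothesis fth : is_flow theta.

Lemma flow_zero_dom w : line_val (psnd P w) = 0 -> oset (gdom theta) w /\ theta w = pfst P w.
Proof.
move=> w0; have [c cw] := gman_charts w; have [dy yE] := chart_pt cw.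
have hA := gmap_germ dy; rewrite yE in hA; have hS := scalar_germ_hom hA.
have [|dw E _] := flow_start_at fth hS; last by [].
have := line_val_germ (germ_hom_pull (psnd_dom (P := P) w) hA); rewrite w0 => ->.
by rewrite scale0r.
Qed.

Lemma flow_dom_neq0 w : k != 0 -> oset (gdom theta) w.
Proof. by case: fth; rewrite /is_flow_domain; case: ifP => // _ -> _ _. Qed.

Lemma flow_dom_between w w' : oset (gdom theta) w -> pfst P w' = pfst P w ->
  between0 (line_val (psnd P w)) (line_val (psnd P w')) -> oset (gdom theta) w'.
Proof.
move=> dw E B; have [k0|k0] := eqVneq k 0; last exact: flow_dom_neq0.
case: fth; rewrite /is_flow_domain ifT => [/(_ (pfst P w))[_ itv S0] _ _|]; last exact/eqP.
have Sw : slice (gdom theta) (pfst P w) (line_val (psnd P w)) by exists w.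
have [w2 [dw2 e2] l2] : slice (gdom theta) (pfst P w) (line_val (psnd P w')).
  move: B; rewrite /between0; have [w0|w0] := leP 0 (line_val (psnd P w)) => B.
    by apply: (itv _ _ S0 Sw).
  by apply: (itv _ _ Sw S0).
suff <- : w2 = w' by [].
by apply: prod_point_eq; [rewrite e2 E|exact: line_val_inj l2].
Qed.
End FlowDomains.

(** * The maximal commuting domain of classical vector fields *)

Section CommutingDomains.
Variables (R : realType) (M : gmanifold R).
Local Open Scope ring_scope.

Lemma flow0_box (D : set (M * R)) (th : M * R -> M) m : is_flow0 D th -> D (m, 0).
Proof. by move=> [[_ /(_ m)[]]]. Qed.

Lemma prod_box (T : topologicalType) (A : set (T * R)) x y : open A -> A (x, y) ->
  exists (N : set T) (d : R), [/\ open N, N x, 0 < d & forall n r, N n -> `|y - r| < d -> A (n, r)].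
Proof.
move=> oA Ax; have [[U V] [/= nU nV] sub] : nbhs (x, y) A by exact: open_nbhs_nbhs.
have /nbhs_ballP[d d0 dV] := nV; exists U°, d; split=> //; first exact: open_interior.
by move=> n r /interior_subset Un yr; apply: (sub (n, r)); split=> //=; exact: dV.
Qed.

(** A box with small time radius around [((m, 0), 0)] is itself a commuting domain, hence is
    contained in the maximal one. *)
Lemma max_commuting_zero (X0 Y0 : (M -> R) -> M -> R) E m : is_max_commuting_domain0 X0 Y0 E -> E ((m, 0), 0).
Proof.
move=> [D1 [th1 [D2 [th2 [[f1 _ _] [f2 _ _] _ Emax]]]]].
have [[[oD1 _] c1 z1 _] [[oD2 _] c2 z2 _]] := (f1, f2).
have [N1 [d1 [oN1 N1m d1p B1]]] := prod_box oD1 (flow0_box m f1).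
have [N2 [d2 [oN2 N2m d2p B2]]] := prod_box oD2 (flow0_box m f2).
have [o1 _] := c1 (Opens oN2); have [o2 _] := c2 (Opens oN1).
have i1 : (D1 `&` th1 @^-1` N2) (m, 0) by split; [exact: flow0_box f1|rewrite /preimage /= z1].
have i2 : (D2 `&` th2 @^-1` N1) (m, 0) by split; [exact: flow0_box f2|rewrite /preimage /= z2].
have [N3 [d3 [oN3 N3m d3p B3]]] := prod_box o1 i1.
have [N4 [d4 [oN4 N4m d4p B4]]] := prod_box o2 i2.
(* [d1] and [d2] keep the times inside the domains for base points in [N1] and [N2]; [d3] and [d4]
   keep each flow inside the base on which the other one is defined. *)
pose d := Num.min (Num.min d1 d2) (Num.min d3 d4).
have dp : 0 < d by rewrite /d !lt_min d1p d2p d3p d4p.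
pose E' : set ((M * R) * R) := [set x | [/\ (N3 `&` N4) x.1.1, `|x.1.2| < d & `|x.2| < d]].
suff cE : is_commuting_domain0 D1 th1 D2 th2 E'.
  by apply: (Emax _ cE); split=> //=; rewrite normr0.
have lt r : `|r| < d -> [/\ `|0 - r| < d1, `|0 - r| < d2, `|0 - r| < d3 & `|0 - r| < d4].
  by rewrite sub0r normrN /d !lt_min => /andP[/andP[-> ->] /andP[-> ->]].
split.
- rewrite openE => -[[n s] t] [/= N34 sd td].
  have nn : nbhs n (N3 `&` N4) by apply: open_nbhs_nbhs; split=> //; exact: openI.
  have nb (r : R) : `|r| < d -> nbhs r [set r : R | `|r| < d].
    move=> rd; apply: open_nbhs_nbhs; split=> //.
    have -> : [set r : R | `|r| < d] = ball (0 : R) d by apply/seteqP; split=> x; rewrite /ball /= sub0r normrN.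
    exact: ball_open.
  have H1 : nbhs (n, s) [set x : M * R | (N3 `&` N4) x.1 /\ `|x.2| < d].
    exists (N3 `&` N4, [set r : R | `|r| < d]); first by split=> //; exact: nb.
    by move=> x [].
  exists ([set x : M * R | (N3 `&` N4) x.1 /\ `|x.2| < d], [set r : R | `|r| < d]); first by split=> //; exact: nb.
  by move=> x [/= [? ?] ?]; split.
- move=> n s t [/= [n3 n4] /lt[s1 s2 s3 s4] /lt[t1 t2 t3 t4]].
  have [D1s th1N] := B3 n s n3 s3; have [D2t th2N] := B4 n t n4 t4.
  by split=> //; [exact: B2|exact: B1].
- move=> n s t [/= N34 sd td] s' t' bs bt.
  have bl (x x' : R) : `|x| < d -> between0 x x' -> `|x'| < d.
    rewrite /between0 !ltr_norml ge_min le_max => /andP[h1 h2] /andP[/orP h3 /orP h4].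
    by apply/andP; split; case: h3 => h3; case: h4 => h4; lra.
  by split=> //=; [exact: bl bs|exact: bl bt].
Qed.
End CommutingDomains.

(** * The maximal commuting domain for all pairs of degrees *)

Section Cases.
Variables (R : realType) (prd : forall A B : gmanifold R, gproduct A B) (M : gmanifold R) (k l : int).
Local Notation PX := (prd M (gline R k)).
Local Notation PY := (prd M (gline R l)).
Local Notation QX := (prd PX (gline R l)).
Local Notation QY := (prd PY (gline R k)).
Variables (X : gvf (opensT M) k) (Y : gvf (opensT M) l) (thX : smap PX M) (thY : smap PY M) (D : opens QX).
Local Notation flip := (pflip prd M (gline R k) (gline R l)).
Local Notation pmX := (prodmap prd thX (sid (gline R l))).
Local Notation pmY := (prodmap prd thY (sid (gline R k))).
Local Notation Fz := (scomp thY pmX).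
Local Notation Gz := (scomp (scomp thX pmY) flip).
Hypotheses (fX : is_flow_of X thX) (fY : is_flow_of Y thY) (maxD : is_max_commuting_domain X Y thX thY D).

Lemma flip_pts z : [/\ pfst PY (pfst QY (flip z)) = pfst PX (pfst QX z), psnd PY (pfst QY (flip z)) = psnd QX z
  & psnd QY (flip z) = psnd PX (pfst QX z)].
Proof.
have [_ m1 m2 m3] := pflip_meq (prd := prd) z.
by split; [exact: (meq_pt m2)|exact: (meq_pt m3)|exact: (meq_pt m1)].
Qed.

Lemma domD_zero z : line_val (psnd PX (pfst QX z)) = 0 -> line_val (psnd QX z) = 0 -> oset D z.
Proof.
move=> s0 t0; have [[flX _] _] := fX; have [[flY _] _] := fY; have [p1 p2 p3] := flip_pts z.
move: maxD; rewrite /is_max_commuting_domain; case: (k == 0); case: (l == 0); last by move=> ->.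
- move=> [X0 [Y0 [E [_ _ mE ->]]]]; rewrite /preimage /= /QX_point s0 t0.
  exact: max_commuting_zero mE.
- by move=> ->; have [] := flow_zero_dom flX s0.
- by move=> ->; have [] := flow_zero_dom flY (w := pfst QY (flip z)) (etrans (congr1 _ p2) t0).
Qed.

Lemma domD_star : @star_shaped R prd M k l D.
Proof.
move=> z z' Dz Em Es Et; have [[flX _] _] := fX; have [[flY _] _] := fY.
have [p1 p2 p3] := flip_pts z; have [q1 q2 q3] := flip_pts z'.
move: maxD Dz; rewrite /is_max_commuting_domain; case: (k == 0); case: (l == 0); last by move=> ->.
- move=> [X0 [Y0 [E [_ _ mE ->]]]]; rewrite /preimage /= /QX_point Em.
  by case: mE => D1 [th1 [D2 [th2 [_ _ [_ _ st] _]]]] H; exact: st H _ _ Es Et.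
- by move=> -> dz; exact: (flow_dom_between flX dz Em Es).
- move=> -> dz; apply: (flow_dom_between flY dz); first exact: (eq_trans q1 (eq_trans Em (esym p1))).
  by rewrite p2 q2.
Qed.

Hypotheses (extX : forall X0 D1 th1, k = 0 -> is_underlying_vf X X0 -> is_maximal_flow0 X0 D1 th1 -> forall w,
    D1 (pfst PX w, line_val (psnd PX w)) -> oset (gdom thX) w /\ thX w = th1 (pfst PX w, line_val (psnd PX w)))
  (extY : forall X0 D1 th1, l = 0 -> is_underlying_vf Y X0 -> is_maximal_flow0 X0 D1 th1 -> forall w,
    D1 (pfst PY w, line_val (psnd PY w)) -> oset (gdom thY) w /\ thY w = th1 (pfst PY w, line_val (psnd PY w))).

(** For [k = l = 0] the set [D] is described by classical flows, and [extX], [extY] carry its points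
    into the domains of the graded flows. In the mixed cases the flow of non-zero degree does not
    move points, so the condition defining [D] is already the one on the other flow. *)
Lemma domD_dom z : oset D z -> oset (gdom Fz) z /\ oset (gdom Gz) z.
Proof.
move=> Dz; have [[flX _] _] := fX; have [[flY _] _] := fY; have [p1 p2 p3] := flip_pts z.
have [fl _ _ _] := pflip_meq (prd := prd) z.
have goF : oset (gdom thX) (pfst QX z) ->
    (forall w, pfst PY w = thX (pfst QX z) -> psnd PY w = psnd QX z -> oset (gdom thY) w) -> oset (gdom Fz) z.
  move=> dX H; have [e1 e2 e3] := prodmap_meq (prd := prd) (g := sid (gline R l)) dX I.
  by split=> //; apply: H; [exact: (meq_pt e2)|exact: (meq_pt e3)].
have goG : oset (gdom thY) (pfst QY (flip z)) ->
    (forall w, pfst PX w = thY (pfst QY (flip z)) -> psnd PX w = psnd PX (pfst QX z) -> oset (gdom thX) w) -> oset (gdom Gz) z.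
  move=> dY H; have [e1 e2 e3] := prodmap_meq (prd := prd) (g := sid (gline R k)) dY I.
  split=> //; split=> //; apply: H; first exact: (meq_pt e2).
  exact: (eq_trans (meq_pt e3 : psnd PX (pmY _) = psnd QY (flip z)) p3).
have triv k' (w : prd M (gline R k')) : k' != 0 -> line_val (psnd _ w) = 0.
  move=> k0; have [v [_ dv _ ->]] := line_var R k'.
  by case: v dv => //= i dv; case/eqP: k0; apply: oppr_inj; rewrite -dv oppr0.
move: maxD Dz; rewrite /is_max_commuting_domain; case: (eqVneq k 0) => k0; case: (eqVneq l 0) => l0.
- move=> [X0 [Y0 [E [uX uY mE ->]]]]; rewrite /preimage /= /QX_point => Ez.
  case: mE => D1 [th1 [D2 [th2 [m1 m2 [_ C _] _]]]]; have [c1 c2 c3 c4] := C _ _ _ Ez.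
  have [dX EX] := extX k0 uX m1 c1.
  have c3' : D2 (pfst PY (pfst QY (flip z)), line_val (psnd PY (pfst QY (flip z)))) by rewrite p1 p2.
  have [dY EY] := extY l0 uY m2 c3'.
  split.
    by apply: goF => // w w1 w2; have [] := extY l0 uY m2 (w := w); rewrite ?w1 ?w2 ?EX.
  by apply: goG => // w w1 w2; have [] := extX k0 uX m1 (w := w); rewrite ?w1 ?w2 ?EY ?p1 ?p2.
- move=> -> dX; split; first by apply: goF => // w _ _; exact: flow_dom_neq0.
  have lv := triv l (pfst QY (flip z)) l0; have [dY EY] := flow_zero_dom flY lv.
  apply: goG => // w w1 w2; suff -> : w = pfst QX z by [].
  by apply: prod_point_eq w2; rewrite w1 EY p1.
- move=> -> dY; split; last by apply: goG => // w _ _; exact: flow_dom_neq0.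
  have lv := triv k (pfst QX z) k0; have [dX EX] := flow_zero_dom flX lv.
  apply: goF => // w w1 w2; suff -> : w = pfst QY (flip z) by [].
  by apply: prod_point_eq; [rewrite w1 EX p1|rewrite w2 p2].
- by move=> _ _; split; [apply: goF|apply: goG]=> // *; exact: flow_dom_neq0.
Qed.

Lemma commute_iff : flows_commute_on thX thY D <-> gbracket_eq0 X Y.
Proof.
have [[flX _] gX] := fX; have [[flY _] gY] := fY.
have genX w : oset (gdom thX) w -> gen_at X thX w by move=> dw; exact: generator_gen_at.
have genY w : oset (gdom thY) w -> gen_at Y thY w by move=> dw; exact: generator_gen_at.
have staX w : start_at thX w by exact: flow_start_at.
have staY w : start_at thY w by exact: flow_start_at.
split=> H.
  have [HF HG _ _] := H.
  exact: (bracket_of_commute genX genY staX staY HF HG H domD_zero).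
have HF : D `<=` gdom Fz by move=> z Dz; have [] := domD_dom Dz.
have HG : D `<=` gdom Gz by move=> z Dz; have [] := domD_dom Dz.
exact: (commute_of_bracket genX genY staX staY HF HG domD_star H).
Qed.
End Cases.

(** * Comparison of the graded flow with the classical one *)

Section ClassicalComparison.
Variables (R : realType) (prd : forall A B : gmanifold R, gproduct A B) (M : gmanifold R).
Local Notation L := (gline R 0).
Local Notation P := (prd M L).
Variables (X : gvf (opensT M) 0) (th : smap P M) (X0 : (M -> R) -> M -> R) (D1 : set (M * R)) (th1 : M * R -> M).
Hypotheses (mx : is_maximal_flow th) (genT : forall w, oset (gdom th) w -> gen_at X th w).
Hypotheses (und : is_underlying_vf X X0) (fl0 : is_flow0 D1 th1) (gen0 : is_generator0 D1 th1 X0).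

Let fl : is_flow th. Proof. by case: mx. Qed.

Lemma body_neq0 (U : opens M) i (f : sec U i) (m : M) : i != 0 -> body f m = 0.
Proof. by move=> i0; rewrite /body (gsh_body (@ev_gsh _ _ _ _ _ _) i0). Qed.

Lemma gen0_body i (f : sec (opensT M) i) m t : D1 (m, t) ->
  is_derive t 1 (fun u => body f (th1 (m, u))) (body (vapp X erefl f) (th1 (m, t))).
Proof.
move=> d; have [i0|i0] := eqVneq i 0; last first.
  rewrite body_neq0 ?add0r // (_ : (fun u => _) = cst (0 : R^o)); first exact: is_derive_cst.
  by apply/funext => u; rewrite body_neq0.
case: _ / (esym i0) f => f; have [_ E] := und.
have <- : X0 (body f) = body (vapp X erefl f).
  rewrite (vapp_nat X (fun j g => body g) erefl (addr0 0)).
  by apply: (E (addr0 0) f); exact: body_is_body.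
by apply: gen0 d; exact: body_smooth.
Qed.

Lemma flow0_segment m s u : D1 (m, s) -> 0 <= u <= 1 -> D1 (m, u * s).
Proof.
move=> d u01; have [[_ /(_ m)[_ itv z]] _ _ _] := fl0; have := between0_scale s u01; rewrite /between0.
by have [s0|s0] := leP 0 s => B; [exact: (itv _ _ z d)|exact: (itv _ _ d z)].
Qed.

Lemma flow0_continuous m (s u : R) : D1 (m, s) -> 0 <= u <= 1 ->
  {for u, continuous (fun t : R => th1 (m, t * s))}.
Proof.
move=> d u01 W /=; rewrite nbhsE => -[W' [oW' W'u] sub].
have [_ /(_ (Opens oW'))[o _] _ _] := fl0.
have i : (D1 `&` th1 @^-1` W') (m, u * s) by split=> //; exact: flow0_segment.
have [N [e [_ Nm e0 B]]] := prod_box o i.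
have c : {for u, continuous (fun t : R => t * s)} by exact: mulrr_continuous.
have nb : nbhs (u * s) (ball (u * s) e) by exact: nbhsx_ballx.
have nt : nbhs u (fun t : R => ball (u * s) e (t * s)) by exact: (c _ nb).
suff : nbhs u (fun t : R => W (th1 (m, t * s))) by [].
apply: (filterS _ nt) => t bt; apply: sub.
by have [] := B m (t * s) Nm bt.
Qed.

(** Both sides are integral curves of [X] from [m], parametrised by the fraction [u] of the time
    [s], and [curve_unique] applies. *)
Lemma flow_agree w : oset (gdom th) w -> D1 (pfst P w, line_val (psnd P w)) ->
  th w = th1 (pfst P w, line_val (psnd P w)).
Proof.
move=> dw d; set m := pfst P w; set s := line_val _.
have [e [J [v [Phi [r2 alJ lcE lvJ scJ]]]]] := line_chart w.
have [dPhi dJ] := meq_doml r2; have zE : J (Phi w) = w := meq_pt r2.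
have lp : cval (Phi w) v = s by rewrite -lvJ // zE.
have ex u : 0 <= u <= 1 -> [/\ oset (gdom J) (pscale v u (Phi w)), oset (gdom th) (J (pscale v u (Phi w))),
    pfst P (J (pscale v u (Phi w))) = m & line_val (psnd P (J (pscale v u (Phi w)))) = u * s].
  move=> u01; have [dJu pE] := scJ u (Phi w) dJ; have lE := lvJ _ dJu.
  rewrite pscale_val lp in lE; rewrite zE in pE; split=> //.
  by apply: (flow_dom_between fl dw pE); rewrite lE; exact: between0_scale.
have vinl : exists i, v = inl i.
  have [_ _ dv _ _] := alJ _ dJ; case: v dv {alJ lcE lvJ scJ lp ex} => [i _|j /= dv]; first by exists i.
  by have := @gdeg_neq0 e j; rewrite dv oppr0 eqxx.
have [i vE] := vinl; rewrite {}vE in alJ lcE lvJ scJ lp ex *.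
have i1 : 0 <= (1 : R) <= 1 by rewrite lexx ler01.
have i0 : 0 <= (0 : R) <= 1 by rewrite lexx ler01.
have H : forall u : R, 0 <= u <= 1 -> th (J (pscale (inl i) u (Phi w))) = th1 (m, u * s).
  apply: (@curve_unique R M 0 X s (fun u => th (J (pscale (inl i) u (Phi w)))) (fun u => th1 (m, u * s))).
  - move=> u u01; have [d1 d2 _ _] := ex u u01.
    apply: (@continuous_comp _ _ _ (fun u => J (pscale (inl i) u (Phi w))) th); last exact: gmap_continuous.
    apply: (@continuous_comp _ _ _ (fun u => pscale (inl i) u (Phi w)) J); last exact: gmap_continuous.
    exact: pscale_continuous.
  - by move=> u u01; exact: flow0_continuous.
  - move=> u u01 j f; have [d1 d2 _ _] := ex u u01.
    have dG : oset (gdom (gcomp th J)) (pscale (inl i) u (Phi w)) by [].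
    have WG : oset (gpre (gcomp th J) (opensT M)) (pscale (inl i) u (Phi w)) by [].
    have -> : s * body (vapp X erefl f) (th (J (pscale (inl i) u (Phi w)))) =
      cval (Phi w) (inl i) * gc (pder_fam (inl i) (gpull (gcomp th J) f) (pscale (inl i) u (Phi w))) (mzero _).
      rewrite lp; congr (_ * _); rewrite (agree_pder (inl i) (agree_comp f WG)).
      rewrite (genT d2 (alJ _ d1) erefl f) -/(gbody _) -(agree_ev (agree_comp _ WG)).
      by rewrite (gbody_ev (vapp X erefl f) dG).
    apply: is_derive_near_eq (pscale_derive (gpull (gcomp th J) f) WG (mvalid0 _)).
    have nG : \forall t \near u, oset (gdom (gcomp th J)) (pscale (inl i) t (Phi w)).
      apply: (@pscale_continuous R e i (Phi w) u (gdom (gcomp th J))).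
      by apply: open_nbhs_nbhs; split; [exact: opensP|exact: dG].
    by apply: filterS nG => t dt; rewrite -/(gbody _) (gbody_ev f dt).
  - move=> u u01 j f; have dus := flow0_segment d u01.
    apply: (@is_derive_rescale R _ _ (fun t : R => body f (th1 (m, t))) (fun t : R => t * s) u 1 1).
      by move=> h; rewrite /GRing.scale /= !mulr1 mulrDl [h * s]mulrC.
    exact: gen0_body.
  - have [_ _ pE lE] := ex 0 i0; rewrite mul0r in lE *.
    have [_ ->] := flow_zero_dom fl lE; rewrite pE.
    by have [_ _ -> _] := fl0.
by have := H 1 i1; rewrite pscale1 zE mul1r.
Qed.

(** In a product chart the domain contains a cube around the point; one side of the cube is a common
    existence time for the points of the opposite face. *)
Lemma flow_box (w : P) : oset (gdom th) w -> line_val (psnd P w) = 0 ->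
  exists (N : opens M) (eps : R), [/\ oset N (pfst P w), 0 < eps &
    forall w', oset N (pfst P w') -> `|line_val (psnd P w')| < eps -> oset (gdom th) w'].
Proof.
move=> dw w0; have [c cz] := gman_charts (pfst P w).
pose J := pchart_inv P (chart_inv c).
have [Phi [r _ n2]] := product_retract (P := P) (chart_retract cz).
have [Phi' [r' m1 m2]] := product_retract (P := P) (chart_retract cz).
have [dPhi dJ] := meq_doml r'; have zE : J (Phi' w) = w := meq_pt r'.
have Op : oset (gpre J (gdom th)) (Phi' w) by split=> //; rewrite /preimage /= zE.
have [d d0 B] := open_ball_sub (opensP (gpre J (gdom th))) Op.
pose n := gdim0 (chart_dim c).
have oB : open (ball (chart_map c (pfst P w) : 'rV[R]_n) d) by exact: ball_open.
pose BB : opens (gdomain R (chart_dim c)) := Opens oB.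
exists (gpre (chart_map c) BB), d; split=> //.
  by split=> //; exact: ballxx.
move=> w' [cz' bz'] lw'; have [Ph [q q1 q2]] := product_retract (P := P) (chart_retract cz').
have zE' : J (Ph w') = w' := meq_pt q.
suff : oset (gpre J (gdom th)) (Ph w') by move=> [_ H]; rewrite -zE'; exact H.
apply: B.
have e1 : gfst R (chart_dim c) (line_dim 0) (Ph w') = chart_map c (pfst P w') := meq_pt q1.
have e2 : gsnd R (chart_dim c) (line_dim 0) (Ph w') = psnd P w' := meq_pt q2.
have f1 : gfst R (chart_dim c) (line_dim 0) (Phi' w) = chart_map c (pfst P w) := meq_pt m1.
have f2 : gsnd R (chart_dim c) (line_dim 0) (Phi' w) = psnd P w := meq_pt m2.
have lvE (y : L) (j : 'I_(gdim0 (line_dim 0))) : line_val y = (y : 'rV[R]_(gdim0 (line_dim 0))) 0 j.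
  have [v [vP _ _ ->]] := line_var R 0.
  by rewrite -(vP (inl j)).
have [_ bij] : ball (chart_map c (pfst P w) : 'rV[R]_n) d (chart_map c (pfst P w') : 'rV[R]_n) by exact bz'.
split=> // a j; rewrite (ord1 a); case: (splitP j) => j' jj.
  have -> : j = lshift _ j' by exact/val_inj.
  by rewrite -2!gfst_pt e1 f1; exact: bij.
have -> : j = rshift _ j' by exact/val_inj.
rewrite -2!gsnd_pt e2 f2 -2!lvE w0.
by rewrite /ball /= sub0r normrN.
Qed.

(** Real induction along the times [u * s]. To reach [u], take a box around the point where the
    classical flow is at time [u * s]: slightly earlier the graded flow is already in its base, and
    [extend_dom] covers the remaining time. To pass beyond [u], slices of the domain are open. *)
Lemma flow_extends w : D1 (pfst P w, line_val (psnd P w)) ->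
  oset (gdom th) w /\ th w = th1 (pfst P w, line_val (psnd P w)).
Proof.
move=> d; suff dw : oset (gdom th) w by split=> //; exact: flow_agree.
set m := pfst P w in d; set s := line_val (psnd P w) in d.
pose W u := prod_affine P 0 (u * s) w.
have Wv u : pfst P (W u) = m /\ line_val (psnd P (W u)) = u * s.
  by have [e1 e2] := prod_affine_val 0 (u * s) w; rewrite /W e1 e2 mul0r add0r.
have WE u w' : pfst P w' = m -> line_val (psnd P w') = u * s -> w' = W u.
  move=> e1 e2; have [e3 e4] := Wv u.
  by apply: prod_point_eq; [rewrite e3|apply: line_val_inj; rewrite e4].
have w1 : w = W 1 by apply: WE => //; rewrite mul1r.
suff H : forall u : R, 0 <= u <= 1 -> oset (gdom th) (W u) by rewrite w1; apply: H; rewrite lexx ler01.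
have agW u : 0 <= u <= 1 -> oset (gdom th) (W u) -> th (W u) = th1 (m, u * s).
  move=> u01 du; have [e1 e2] := Wv u; rewrite flow_agree ?e1 ?e2 //; exact: flow0_segment.
apply: real_induction => u u01 Hu.
  have [e1 e2] := Wv u; have [u0|un0] := eqVneq u 0.
    by have [] := flow_zero_dom fl (w := W u); rewrite // e2 u0 mul0r.
  have up : 0 < u by rewrite lt_def un0; case/andP: u01.
  (* The point at time 0 over the position that the classical flow reaches at [u * s]; the graded
     flow is defined in a box around it. *)
  have [w0 p0 l0] : exists2 w0, pfst P w0 = th1 (m, u * s) & line_val (psnd P w0) = 0.
    have [fd _ _] := fl; rewrite /is_flow_domain eqxx in fd.
    by have [_ _ [w0 [_ x1] x2]] := fd (th1 (m, u * s)); exists w0.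
  have [d0 _] := flow_zero_dom fl l0.
  have [N [eps [Nw0 eps0 box]]] := flow_box d0 l0; rewrite p0 in Nw0.
  have nN : \forall t \near u, oset N (th1 (m, t * s)).
    by apply: (flow0_continuous d u01); apply: open_nbhs_nbhs; split; [exact: opensP|].
  have ne : \forall t \near u, `|u * s - t * s| < eps.
    have c : {for u, continuous (fun t : R => t * s)} by exact: mulrr_continuous.
    by have /cvgrPdist_lt := c; apply.
  have nI : nbhs u (fun t : R => oset N (th1 (m, t * s)) /\ `|u * s - t * s| < eps).
    exact: (filterI nN ne).
  have /nbhs_ballP[r r0 rP] := nI.
  (* A time before [u], close enough to it for the box and still non-negative, so that the induction
     hypothesis covers it. *)
  pose t := Num.max 0 (u - r / 2).
  have tu : t < u by rewrite /t gt_max up ltrBlDr ltrDl divr_gt0.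
  have t0 : 0 <= t by rewrite /t le_max lexx.
  have [Nt lt] : oset N (th1 (m, t * s)) /\ `|u * s - t * s| < eps.
    apply: rP; rewrite /ball /= ger0_norm ?subr_ge0; last exact: ltW.
    have h1 : u - r / 2 <= t by rewrite /t le_max lexx orbT.
    have h2 : r / 2 < r by rewrite ltr_pdivrMr // ltr_pMr // ltr1n.
    by apply: le_lt_trans h2; rewrite lerBlDl -lerBlDr.
  have t01 : 0 <= t <= 1 by rewrite t0 /=; apply: le_trans (ltW tu) _; case/andP: u01.
  have dt : oset (gdom th) (W t) by apply: Hu; rewrite t0 tu.
  have CE : prod_affine P 0 (t * s) (W u) = W t.
    have [x1 x2] := prod_affine_val 0 (t * s) (W u).
    by apply: WE; [rewrite x1 e1|rewrite x2 mul0r add0r].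
  apply: (extend_dom mx genT box (b := t * s)); first by rewrite CE.
    by rewrite CE agW.
  by rewrite e2.
have u01' : 0 <= u <= 1 by case/andP: u01 => -> /ltW.
have du : oset (gdom th) (W u) by apply: Hu; case/andP: u01 => ->; rewrite lexx.
have [e1 e2] := Wv u; have [fd _ _] := fl; rewrite /is_flow_domain eqxx in fd.
have [oS _ _] := fd m.
have nS : nbhs (u * s) (slice (gdom th) m) by apply: open_nbhs_nbhs; split=> //; exists (W u).
have c : {for u, continuous (fun t : R => t * s)} by exact: mulrr_continuous.
have nR : nbhs u (fun t : R => slice (gdom th) m (t * s)) by exact: (c _ nS).
have [e e0 He] := near_right nR.
exists e; first exact: e0.
move=> t /andP[ut te] _.
have ute : u <= t <= u + e by rewrite (ltW ut).
have [w' [d' p'] l'] := He t ute.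
by have <- := WE t w' p' l'; exact: d'.
Qed.
End ClassicalComparison.

(** The commuting domain is defined by testing [k] in types where [k] stays a variable, while the
    comparison is made in degree 0; the equality is substituted here. *)
Lemma flow_of_extends (R : realType) (prd : forall A B : gmanifold R, gproduct A B)
    (M : gmanifold R) (k : int) (X : gvf (opensT M) k) (th : smap (prd M (gline R k)) M)
    X0 D1 th1 :
  is_flow_of X th -> k = 0 -> is_underlying_vf X X0 -> is_maximal_flow0 X0 D1 th1 ->
  forall w, D1 (pfst (prd M (gline R k)) w, line_val (psnd (prd M (gline R k)) w)) ->
  oset (gdom th) w /\ th w = th1 (pfst (prd M (gline R k)) w, line_val (psnd (prd M (gline R k)) w)).
Proof.
move=> fX k0; subst k; have [mx gX] := fX => und [f0 g0 _].
have genT w : oset (gdom th) w -> gen_at X th w.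
  by move=> dw; exact: generator_gen_at.
exact: (flow_extends mx genT und f0 g0).
Qed.

Theorem theorem5p6 (R : realType)
    (prd : forall A B : gmanifold R, gproduct A B)
    (M : gmanifold R) (k l : int)
    (X : gvf (opensT M) k) (Y : gvf (opensT M) l)
    (thX : smap (prd M (gline R k)) M) (thY : smap (prd M (gline R l)) M)
    (D : opens (prd (prd M (gline R k)) (gline R l))) :
  gbracket_eq0 X X -> gbracket_eq0 Y Y ->
  is_flow_of X thX -> is_flow_of Y thY ->
  is_max_commuting_domain X Y thX thY D ->
  (flows_commute_on thX thY D <-> gbracket_eq0 X Y).
Proof.
move=> _ _ fX fY mD.
apply: (commute_iff fX fY mD).
- by move=> X0 D1 th1; exact: flow_of_extends.
- by move=> X0 D1 th1; exact: flow_of_extends.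
Qed.
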